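(* Let $\tau\in\mathbb{C}$ with $\mathrm{Im}(\tau)>0$, $q=e^{2\pi i\tau}$, $u,v\in\mathbb{C}$, $x=e^{2\pi iu}$, $y=e^{2\pi iv}$. (i) Assume that neither $x^2$ nor $y^2$ is an integer power of $q$, and that neither of $\pm x$, $\pm y$ is an integer power of $q$. Then the Weierstrass function $\wp(u)=\wp(u,\tau)$ for the lattice $\mathbb{Z}+\mathbb{Z}\tau$ satisfies $$ \wp(u)-\wp(v)=-\frac{4\pi^2x}{q}\frac{q+x}{q-x}\frac{(q)_\infty^2}{\theta(x^2/q^2)}\,{}_2\psi_6\!\left(\begin{matrix}-x,x/q\\ -x/q,x,0,0,0,0\end{matrix};q,\frac{x^4}{q^2}\right)+\frac{4\pi^2y}{q}\frac{q+y}{q-y}\frac{(q)_\infty^2}{\theta(y^2/q^2)}\,{}_2\psi_6\!\left(\begin{matrix}-y,y/q\\ -y/q,y,0,0,0,0\end{matrix};q,\frac{y^4}{q^2}\right) $$ $$ =-4\pi^2(q)_\infty^2\sum_{n\in\mathbb{Z}}\left\{\frac{1+xq^n}{1-xq^n}\frac{x^{4n+1}q^{2n^2}}{\theta(x^2)}-\frac{1+yq^n}{1-yq^n}\frac{y^{4n+1}q^{2n^2}}{\theta(y^2)}\right\} $$ $$ =-\frac{4\pi^2x(q)_\infty^2}{\theta(x^2)}\sum_{n\in\mathbb{Z}}\left\{\frac{x^{4n}q^{2n^2}}{(1-xq^n)^2}-\frac{x^{-4n}q^{2n^2}}{(1-x^{-1}q^n)^2}\right\}+\frac{4\pi^2y(q)_\infty^2}{\theta(y^2)}\sum_{n\in\mathbb{Z}}\left\{\frac{y^{4n}q^{2n^2}}{(1-yq^n)^2}-\frac{y^{-4n}q^{2n^2}}{(1-y^{-1}q^n)^2}\right\}.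 $$ (ii) Assume that none of $x$, $-x$, $-x^2$ is an integer power of $q$. Then the Jacobi elliptic function $$\frac{1}{\mathrm{sn}(2Ku,k)\,\mathrm{sn}\big(2K(u+\tfrac12),k\big)}=\frac{\mathrm{dn}(2Ku,k)}{\mathrm{sn}(2Ku,k)\,\mathrm{cn}(2Ku,k)}$$ satisfies $$ \frac{1}{2\pi i}\frac{2K}{\vartheta_{11}(\frac12)}\frac{\mathrm{dn}(2Ku,k)}{\mathrm{sn}(2Ku,k)\,\mathrm{cn}(2Ku,k)} =q^{-\frac98}\frac{q^2+x^2}{q^2-x^2}\frac{x}{(q)_\infty\theta(-x^2/q^2)}\,{}_4\psi_8\!\left(\begin{matrix}ix,-ix,x/q,-x/q\\ ix/q,-ix/q,x,-x,0,0,0,0\end{matrix};q,\frac{x^4}{q^2}\right) $$ $$ =q^{-\frac18}\frac{x}{(q)_\infty\theta(-x^2)}\sum_{n\in\mathbb{Z}}\frac{1+x^2q^{2n}}{1-x^2q^{2n}}x^{4n}q^{2n^2} $$ $$ =q^{-\frac18}\frac{x}{(q)_\infty\theta(-x^2)}\sum_{n\in\mathbb{Z}}\left\{\frac{x^{4n}q^{2n^2}}{1-x^2q^{2n}}-\frac{x^{-4n}q^{2n^2}}{1-x^{-2}q^{2n}}\right\}. $$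
   Context: Notation. $q=e^{2\pi i\tau}$ with $\mathrm{Im}(\tau)>0$, and $q^{s}:=e^{2\pi i\tau s}$ for complex $s$. $(z)_\infty=(z;q)_\infty:=\prod_{j\ge0}(1-zq^{j})$; $(z)_n:=(z)_\infty/(q^{n}z)_\infty$ for $n\in\mathbb{Z}$; $(z_1,\dots,z_r)_n:=(z_1)_n\cdots(z_r)_n$ for $n\in\mathbb{Z}\cup\{\infty\}$. $\theta(z):=(z,q/z)_\infty$. The bilateral basic hypergeometric series is $${}_r\psi_s\!\left(\begin{matrix}a_1,\dots,a_r\\ b_1,\dots,b_s\end{matrix};q,z\right):=\sum_{n\in\mathbb{Z}}\frac{(a_1,\dots,a_r)_n}{(b_1,\dots,b_s)_n}\left((-1)^nq^{\frac{n(n-1)}{2}}\right)^{s-r}z^n .$$ The theta function is $\vartheta_{11}(u):=\sum_{n\in\mathbb{Z}}e^{2\pi i(n+\frac12)(u+\frac12)+\pi i(n+\frac12)^2\tau}=-iq^{\frac18}e^{-\pi iu}(q,e^{2\pi iu},qe^{-2\pi iu})_\infty$. The Weierstrass function is $\wp(u)=\wp(u,\tau):=\frac1{u^2}+\sum_{\omega\in\mathbb{Z}+\mathbb{Z}\tau,\ \omega\ne0}\left\{\frac{1}{(u-\omega)^2}-\frac{1}{\omega^2}\right\}$. $\mathrm{sn},\mathrm{cn},\mathrm{dn}$ are the Jacobi elliptic functions with modulus $k=k(\tau)$, the elliptic modulus attached to $\tau$ (nome $e^{\pi i\tau}=q^{1/2}$, i.e. $k=4q^{\frac14}(-q)_\infty^4/(-q^{\frac12})_\infty^4$),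 and $K=K(\tau):=\frac{\pi}{2}(q)_\infty^2(-q^{\frac12})_\infty^4=\int_0^1\frac{dt}{\sqrt{(1-t^2)(1-k^2t^2)}}$. *)

(* Defs.v *)
(* Stdlib reals with Coquelicot's complex numbers. *)
From Stdlib Require Import Reals ZArith List.
From Coquelicot Require Export Coquelicot.
Import ListNotations.

Local Open Scope C_scope.

Definition Cexp (z : C) : C :=
  (exp (Re z) * cos (Im z), exp (Re z) * sin (Im z))%R.

Definition Cpowz (z : C) (n : Z) : C :=
  match n with
  | Z0 => 1
  | Zpos p => z ^ Pos.to_nat p
  | Zneg p => / z ^ Pos.to_nat p
  end.

Notation "z ^^ n" := (Cpowz z n%Z) (at level 30, right associativity) : C_scope.

(* [qpow tau s] is q^s := exp (2 i pi tau s), so [qpow tau 1] is q (the nome is q^(1/2)). *)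
Definition qpow (tau s : C) : C := Cexp (2 * PI * Ci * tau * s).

Definition is_int_power (q z : C) : Prop := exists n : Z, z = q ^^ n.

(* Unordered (equivalently, absolutely convergent) summation over the elements
   of a set [A]: the limit along the finite subsets of [A]. *)
Definition is_usum {I : Type} (A : I -> Prop) (f : I -> C) (s : C) : Prop :=
  forall eps : posreal, exists F : list I, List.Forall A F /\
    forall G : list I, NoDup G -> List.Forall A G -> incl F G ->
      (Cmod (fold_right Cplus (RtoC 0) (map f G) - s) < eps)%R.

Definition usum {I : Type} (A : I -> Prop) (f : I -> C) : C :=
  iota (T := C_CompleteNormedModule) (is_usum A f).

Definition sumZ (f : Z -> C) : C := usum (fun _ : Z => True) f.

Fixpoint poch_nat (q z : C) (n : nat) : C :=
  match n with
  | O => 1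
  | S m => poch_nat q z m * (1 - z * q ^ m)
  end.

(* (z; q)_oo *)
Definition poch_inf (q z : C) : C :=
  iota (T := C_CompleteNormedModule)
    (fun l : C => filterlim (poch_nat q z) eventually (locally l)).

(* (z; q)_n for n in Z *)
Definition poch (q z : C) (n : Z) : C :=
  poch_inf q z / poch_inf q (q ^^ n * z).

(* (z_1, ..., z_r; q)_n *)
Definition pochs (q : C) (zs : list C) (n : Z) : C :=
  fold_right Cmult (RtoC 1) (map (fun z => poch q z n) zs).

Definition theta (q z : C) : C := poch_inf q z * poch_inf q (q / z).

(* The bilateral series r_psi_s, with r and s the lengths of the lists. *)
Definition psi (q : C) (a b : list C) (z : C) : C :=
  sumZ (fun n =>
    pochs q a n / pochs q b n
    * ((-1) ^^ n * q ^^ (n * (n - 1) / 2))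
        ^^ (Z.of_nat (length b) - Z.of_nat (length a))
    * z ^^ n).

Definition theta11 (tau u : C) : C :=
  sumZ (fun n =>
    let h := RtoC (IZR n) + 1 / 2 in
    Cexp (2 * PI * Ci * h * (u + 1 / 2) + PI * Ci * h ^ 2 * tau)).

Definition lattice (tau w : C) : Prop :=
  exists m n : Z, w = RtoC (IZR m) + RtoC (IZR n) * tau.

Definition weierstrass_p (tau u : C) : C :=
  1 / u ^ 2
  + usum (fun w => lattice tau w /\ w <> 0)
      (fun w => 1 / (u - w) ^ 2 - 1 / w ^ 2).

Definition elliptic_modulus (tau : C) : C :=
  let q := qpow tau 1 in
  4 * qpow tau (1 / 4) * poch_inf q (- q) ^ 4
  / poch_inf q (- qpow tau (1 / 2)) ^ 4.

Definition elliptic_K (tau : C) : C :=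
  let q := qpow tau 1 in
  PI / 2 * poch_inf q q ^ 2 * poch_inf q (- qpow tau (1 / 2)) ^ 4.

Definition jacobi_ode (k : C) (sn cn dn : C -> C) (z : C) : Prop :=
  is_derive sn z (cn z * dn z) /\
  is_derive cn z (- (sn z * dn z)) /\
  is_derive dn z (- (k ^ 2 * (sn z * cn z))).

(* The triple of meromorphic functions on C solving Jacobi's differential
   system with modulus [k] and initial values (0, 1, 1).  Each point is either
   regular or a pole; as the functions are total, they are given the value 0
   at their poles, which makes the triple unique. *)
Definition is_jacobi (k : C) (sn cn dn : C -> C) : Prop :=
  sn 0 = 0 /\ cn 0 = 1 /\ dn 0 = 1 /\
  forall z : C,
    jacobi_ode k sn cn dn z \/
    ((sn z = 0 /\ cn z = 0 /\ dn z = 0) /\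
     locally' z (jacobi_ode k sn cn dn) /\
     filterlim (fun w => Cmod (sn w)) (locally' z) (Rbar_locally p_infty)).

Definition jacobi_sn (k z : C) : C :=
  iota (T := C_CompleteNormedModule)
    (fun s : C => exists sn cn dn, is_jacobi k sn cn dn /\ s = sn z).

Definition jacobi_cn (k z : C) : C :=
  iota (T := C_CompleteNormedModule)
    (fun c : C => exists sn cn dn, is_jacobi k sn cn dn /\ c = cn z).

Definition jacobi_dn (k z : C) : C :=
  iota (T := C_CompleteNormedModule)
    (fun d : C => exists sn cn dn, is_jacobi k sn cn dn /\ d = dn z).

(* The value at [z] of a meromorphic function given by an expression [f] that
   may be singular at [z] itself: dn / (sn cn), for instance, is regular at the
   common poles of sn, cn and dn. *)
Definition mero_value (f : C -> C) (z : C) : C :=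
  iota (T := C_CompleteNormedModule)
    (fun l : C => filterlim f (locally' z) (locally l)).

(* Main.v *)
(* (i) Summing the lattice by rows, with sum_m 1/(u-m)^2 = (pi / sin pi u)^2,
   gives wp(u) - wp(v) = -4 pi^2 (P(x) - P(y)) for P(x) = sum_n x q^n/(1-x q^n)^2.
   By the triple product and Jacobi's formula for (q)_oo^3, the function
   (theta(z^2) - (q)_oo^2 (1-z^2)) / (1-z)^2 is a series of Laurent polynomials
   antisymmetric under z -> 1/z. Put z = x q^n and sum over n with weights
   x^(4n) q^(2n^2): each z^i - z^-i yields a constant multiple of theta(x^2)/x, so
   theta(x^2) P(x) - (q)_oo^2 x sum_n (1+x q^n)/(1-x q^n) x^(4n) q^(2n^2) is a
   constant multiple of theta(x^2), and the constant cancels in P(x) - P(y).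

   (ii) The theta quotients solve Jacobi's system by three Wronskian identities
   between theta functions, and the solution is unique. Hence dn/(sn cn) is a
   multiple of theta_3 theta_4 / (theta_1 theta_2), that is, a constant
   times x theta(q X; q^2) / theta(X; q^2) with X = x^2. The partial fractions
   sum_n q^n/(1-X q^(2n)) of the latter quotient become, by the same antisymmetry
   argument, the stated series divided by theta(-X; q). *)
Require Import Defs.
From Stdlib Require Import Reals ZArith List Lra Lia.
From Stdlib Require Import Classical ClassicalEpsilon FunctionalExtensionality.
From Coquelicot Require Import Coquelicot.
Import ListNotations.
Local Open Scope C_scope.

(** * Unordered sums *)

(** Identities between theta functions come from rearranging absolutely convergent double series; a
    leftover factor is fixed at one point where both sides are known. Hence the explicit bounds.

    The weights x^(4n) q^(2n^2) are forced. With p = q^(1/8) and s(N) = x^N p^(N^2), the weight is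
    s(4n), and its product with (x q^n)^i is p^(-i^2) s(4n+i). Periodizing z^i - z^-i thus compares
    the residue classes of i and -i modulo 4, which differ only for odd i, always by the same amount
    up to sign. In (ii) the modulus is 2, the classes coincide, and no constant survives. The growth
    of p^(-i^2) is beaten by the Gaussian coefficients of the triple product.

    The Jacobi functions are known only through their differential system and the value 0 at poles.
    Uniqueness must therefore be carried across poles, where the equations say nothing: near a
    common pole one goes around it in the punctured disc. Since 1 / 0 = 0, the theta quotients have
    the prescribed value at their poles without any case distinction. *)

Definition lsum {I : Type} (f : I -> C) (G : list I) : C :=
  fold_right Cplus (RtoC 0) (map f G).

Definition rsum {I : Type} (f : I -> R) (G : list I) : R :=
  fold_right Rplus 0%R (map f G).

(** The bound is kept explicit because it also bounds the sum ([tsum_bound]), and because double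
    series are controlled by a bound for each row. *)
Definition summable_by {I : Type} (f : I -> C) (M : R) : Prop :=
  forall G : list I, NoDup G -> (rsum (fun i => Cmod (f i)) G <= M)%R.

Definition summable {I : Type} (f : I -> C) : Prop := exists M, summable_by f M.

Definition tsum {I : Type} (f : I -> C) : C := usum (fun _ : I => True) f.

Notation has_sum := (is_usum (fun _ => True)).

Lemma eq_dec_classic {I : Type} (x y : I) : {x = y} + {x <> y}.
Proof. apply excluded_middle_informative. Qed.

Lemma Forall_True {I : Type} (G : list I) : List.Forall (fun _ => True) G.
Proof. apply Forall_forall; auto. Qed.

Lemma Cmod_sym (x y : C) : Cmod (x - y) = Cmod (y - x).
Proof. rewrite <- Cmod_opp. f_equal. ring. Qed.

Lemma Cmod_triangle_sub (x y : C) : (Cmod (x - y) <= Cmod x + Cmod y)%R.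
Proof. unfold Cminus. rewrite <- (Cmod_opp y). apply Cmod_triangle. Qed.

Lemma Cmod_triangle_rev (x y : C) : (Cmod x - Cmod y <= Cmod (x - y))%R.
Proof.
  assert (H := Cmod_triangle (x - y) y).
  replace (x - y + y) with x in H by ring. lra.
Qed.

Lemma Ceq_small (a b : C) :
  (forall eps : R, (0 < eps)%R -> (Cmod (a - b) < eps)%R) -> a = b.
Proof.
  intros H. apply NNPP. intros Hn.
  assert (Hp : (0 < Cmod (a - b))%R).
  { apply Cmod_gt_0. intro E. apply Hn.
    replace a with (a - b + b) by ring. rewrite E. ring. }
  specialize (H _ Hp). lra.
Qed.

Lemma rsum_nonneg {I : Type} (f : I -> R) (G : list I) :
  (forall i, 0 <= f i)%R -> (0 <= rsum f G)%R.
Proof.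
  intros H. induction G as [|a G IH]; unfold rsum; simpl; [lra|].
  specialize (H a). unfold rsum in IH. lra.
Qed.

Lemma rsum_cons {I : Type} (f : I -> R) (a : I) (G : list I) :
  rsum f (a :: G) = (f a + rsum f G)%R.
Proof. reflexivity. Qed.

Lemma lsum_cons {I : Type} (f : I -> C) (a : I) (G : list I) :
  lsum f (a :: G) = f a + lsum f G.
Proof. reflexivity. Qed.

Lemma rsum_app {I : Type} (f : I -> R) (G H : list I) :
  rsum f (G ++ H) = (rsum f G + rsum f H)%R.
Proof.
  unfold rsum. rewrite map_app.
  induction G as [|a G IH]; simpl; [lra|]. rewrite IH. lra.
Qed.

Lemma rsum_le {I : Type} (f g : I -> R) (G : list I) :
  (forall i, List.In i G -> f i <= g i)%R -> (rsum f G <= rsum g G)%R.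
Proof.
  intros H. induction G as [|a G IH]; unfold rsum; simpl; [lra|].
  assert (f a <= g a)%R by (apply H; simpl; auto).
  assert (rsum f G <= rsum g G)%R by (apply IH; intros; apply H; simpl; auto).
  unfold rsum in *. lra.
Qed.

Lemma rsum_scal {I : Type} (c : R) (f : I -> R) (G : list I) :
  rsum (fun i => c * f i)%R G = (c * rsum f G)%R.
Proof.
  unfold rsum. induction G as [|a G IH]; simpl; [lra|]. rewrite IH. lra.
Qed.

Lemma rsum_plus {I : Type} (f g : I -> R) (G : list I) :
  rsum (fun i => f i + g i)%R G = (rsum f G + rsum g G)%R.
Proof.
  unfold rsum. induction G as [|a G IH]; simpl; [lra|]. rewrite IH. lra.
Qed.

Lemma rsum_incl {I : Type} (f : I -> R) (G H : list I) :
  (forall i, 0 <= f i)%R -> NoDup G -> incl G H -> (rsum f G <= rsum f H)%R.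
Proof.
  intros Hf HG. revert H. induction HG as [|a G Ha HG IH]; intros H Hi.
  - apply rsum_nonneg, Hf.
  - destruct (in_split a H (Hi a (or_introl eq_refl))) as [H1 [H2 E]].
    subst H. assert (K : (rsum f G <= rsum f (H1 ++ H2))%R).
    { apply IH. intros b Hb. assert (Hb' := Hi b (or_intror Hb)).
      apply in_app_or in Hb'. apply in_or_app.
      destruct Hb' as [|[|]]; subst; tauto. }
    rewrite rsum_app in *. unfold rsum in *. simpl. lra.
Qed.

Lemma lsum_app {I : Type} (f : I -> C) (G H : list I) :
  lsum f (G ++ H) = lsum f G + lsum f H.
Proof.
  unfold lsum. rewrite map_app.
  induction G as [|a G IH]; simpl; [ring|]. rewrite IH. ring.
Qed.

Lemma lsum_plus {I : Type} (f g : I -> C) (G : list I) :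
  lsum (fun i => f i + g i) G = lsum f G + lsum g G.
Proof.
  unfold lsum. induction G as [|a G IH]; simpl; [ring|]. rewrite IH. ring.
Qed.

Lemma lsum_scal {I : Type} (c : C) (f : I -> C) (G : list I) :
  lsum (fun i => c * f i) G = c * lsum f G.
Proof.
  unfold lsum. induction G as [|a G IH]; simpl; [ring|]. rewrite IH. ring.
Qed.

Lemma lsum_ext {I : Type} (f g : I -> C) (G : list I) :
  (forall i, List.In i G -> f i = g i) -> lsum f G = lsum g G.
Proof.
  intros H. unfold lsum. f_equal. apply map_ext_in, H.
Qed.

Lemma lsum_RtoC {I : Type} (f : I -> R) (G : list I) :
  lsum (fun i => RtoC (f i)) G = RtoC (rsum f G).
Proof.
  unfold lsum, rsum. induction G as [|a G IH]; simpl; [reflexivity|].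
  rewrite IH, RtoC_plus. reflexivity.
Qed.

Lemma lsum_map {I J : Type} (e : I -> J) (f : J -> C) (G : list I) :
  lsum f (map e G) = lsum (fun i => f (e i)) G.
Proof. unfold lsum. rewrite map_map. reflexivity. Qed.

Lemma rsum_map {I J : Type} (e : I -> J) (f : J -> R) (G : list I) :
  rsum f (map e G) = rsum (fun i => f (e i)) G.
Proof. unfold rsum. rewrite map_map. reflexivity. Qed.

Lemma Cmod_lsum {I : Type} (f : I -> C) (G : list I) :
  (Cmod (lsum f G) <= rsum (fun i => Cmod (f i)) G)%R.
Proof.
  induction G as [|a G IH]; unfold lsum, rsum; simpl.
  - rewrite Cmod_0. lra.
  - eapply Rle_trans; [apply Cmod_triangle|]. unfold lsum, rsum in IH. lra.
Qed.

Lemma is_usum_unique {I : Type} (A : I -> Prop) (f : I -> C) (s t : C) :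
  is_usum A f s -> is_usum A f t -> s = t.
Proof.
  intros Hs Ht. apply Ceq_small. intros eps He.
  assert (He2 : (0 < eps / 2)%R) by lra.
  destruct (Hs (mkposreal _ He2)) as [F [HF KF]].
  destruct (Ht (mkposreal _ He2)) as [F' [HF' KF']].
  set (G := nodup eq_dec_classic (F ++ F')).
  assert (NG : NoDup G) by apply NoDup_nodup.
  assert (AG : List.Forall A G).
  { apply Forall_forall. intros x Hx. apply nodup_In, in_app_or in Hx.
    rewrite Forall_forall in HF, HF'. destruct Hx; auto. }
  assert (I1 : incl F G) by (intros x Hx; apply nodup_In, in_or_app; auto).
  assert (I2 : incl F' G) by (intros x Hx; apply nodup_In, in_or_app; auto).
  specialize (KF G NG AG I1). specialize (KF' G NG AG I2). simpl in *.
  fold (lsum f G) in *. rewrite Cmod_sym in KF.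
  replace (s - t) with ((s - lsum f G) + (lsum f G - t)) by ring.
  eapply Rle_lt_trans; [apply Cmod_triangle|]. lra.
Qed.

Lemma usum_eq {I : Type} (A : I -> Prop) (f : I -> C) (s : C) :
  is_usum A f s -> usum A f = s.
Proof.
  intros H. unfold usum. apply (iota_unique (V := C_CompleteNormedModule)); [|exact H].
  intros y Hy. exact (is_usum_unique A f y s Hy H).
Qed.

Lemma is_usum_plus {I : Type} (A : I -> Prop) (f g : I -> C) (s t : C) :
  is_usum A f s -> is_usum A g t -> is_usum A (fun i => f i + g i) (s + t).
Proof.
  intros Hs Ht eps.
  assert (He2 : (0 < eps / 2)%R) by (destruct eps; simpl; lra).
  destruct (Hs (mkposreal _ He2)) as [F [HF KF]].
  destruct (Ht (mkposreal _ He2)) as [F' [HF' KF']].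
  exists (F ++ F'). split; [apply Forall_app; auto|].
  intros G NG AG Hi.
  specialize (KF G NG AG (fun x Hx => Hi x (in_or_app _ _ _ (or_introl Hx)))).
  specialize (KF' G NG AG (fun x Hx => Hi x (in_or_app _ _ _ (or_intror Hx)))).
  simpl in *. fold (lsum f G) in *. fold (lsum g G) in *.
  fold (lsum (fun i => f i + g i) G). rewrite lsum_plus.
  replace (lsum f G + lsum g G - (s + t))
    with ((lsum f G - s) + (lsum g G - t)) by ring.
  eapply Rle_lt_trans; [apply Cmod_triangle|]. lra.
Qed.

Lemma is_usum_scal {I : Type} (A : I -> Prop) (c : C) (f : I -> C) (s : C) :
  is_usum A f s -> is_usum A (fun i => c * f i) (c * s).
Proof.
  intros Hs eps. destruct eps as [eps He].
  assert (Hc := Cmod_ge_0 c).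
  assert (He2 : (0 < eps / (Cmod c + 1))%R) by (apply Rdiv_lt_0_compat; lra).
  destruct (Hs (mkposreal _ He2)) as [F [HF KF]].
  exists F. split; [exact HF|]. intros G NG AG Hi.
  specialize (KF G NG AG Hi). simpl in *.
  fold (lsum f G) in *. fold (lsum (fun i => c * f i) G). rewrite lsum_scal.
  replace (c * lsum f G - c * s) with (c * (lsum f G - s)) by ring.
  rewrite Cmod_mult. assert (Hn := Cmod_ge_0 (lsum f G - s)).
  apply Rle_lt_trans with ((Cmod c) * (eps / (Cmod c + 1)))%R.
  - apply Rmult_le_compat_l; lra.
  - apply Rmult_lt_reg_r with (Cmod c + 1)%R; [lra|].
    field_simplify; [|lra]. nra.
Qed.

(** The sum is the supremum of the finite partial sums; a finite set that comes within epsilon of it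
    works, by monotonicity. *)
Lemma has_sum_nonneg {I : Type} (f : I -> R) (M : R) :
  (forall i, 0 <= f i)%R -> (forall G, NoDup G -> rsum f G <= M)%R ->
  exists s, has_sum (fun i : I => RtoC (f i)) (RtoC s).
Proof.
  intros Hf HM.
  destruct (completeness (fun x => exists G, NoDup G /\ x = rsum f G)) as [s [U L]].
  - exists M. intros x [G [NG ->]]. auto.
  - exists 0%R, nil. split; [constructor|reflexivity].
  - exists s. intros [eps He].
    destruct (classic (exists F, NoDup F /\ (s - eps < rsum f F)%R)) as [[F [NF KF]]|Hn].
    + exists F. split; [apply Forall_True|]. intros G NG _ Hi. simpl.
      fold (lsum (fun i => RtoC (f i)) G). rewrite lsum_RtoC, <- RtoC_minus, Cmod_R.
      assert (rsum f F <= rsum f G)%R by (apply rsum_incl; auto).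
      assert (rsum f G <= s)%R by (apply U; exists G; auto).
      apply Rabs_def1; lra.
    + exfalso. assert (s <= s - eps)%R; [|lra].
      apply L. intros x [G [NG ->]]. apply Rnot_lt_le. intro. apply Hn. exists G; auto.
Qed.

(** A complex family is a combination of four nonnegative ones, the positive and negative parts of
    its real and imaginary parts, each dominated by the modulus. *)
Lemma summable_has_sum {I : Type} (f : I -> C) :
  summable f -> has_sum f (tsum f).
Proof.
  intros [M HM].
  assert (P : forall r : C -> R, (forall z, Rabs (r z) <= Cmod z)%R ->
     exists s, has_sum (fun i => RtoC (Rmax (r (f i)) 0)) (RtoC s)).
  { intros r Hr. apply has_sum_nonneg with M.
    - intros; apply Rmax_r.
    - intros G NG. eapply Rle_trans; [|exact (HM G NG)].
      apply rsum_le. intros i _. apply Rle_trans with (Rabs (r (f i))); [|apply Hr].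
      apply Rmax_lub; [apply Rle_abs|apply Rabs_pos]. }
  assert (Him : forall z, (Rabs (Im z) <= Cmod z)%R).
  { intros z. eapply Rle_trans; [|apply Rmax_Cmod]. apply Rmax_r. }
  destruct (P Re re_le_Cmod) as [s1 H1].
  destruct (P Im Him) as [s2 H2].
  destruct (P (fun z => - Re z)%R) as [s3 H3].
  { intros; rewrite Rabs_Ropp; apply re_le_Cmod. }
  destruct (P (fun z => - Im z)%R) as [s4 H4].
  { intros; rewrite Rabs_Ropp; apply Him. }
  assert (H : has_sum f (s1 + Ci * s2 + (-1) * s3 + (- Ci) * s4)).
  { replace f with (fun i => RtoC (Rmax (Re (f i)) 0) + Ci * RtoC (Rmax (Im (f i)) 0)
       + (-1) * RtoC (Rmax (- Re (f i)) 0) + (- Ci) * RtoC (Rmax (- Im (f i)) 0)).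
    - repeat apply is_usum_plus; try apply is_usum_scal; assumption.
    - apply functional_extensionality. intros i.
      destruct (f i) as [a b]. unfold Re, Im; simpl.
      apply injective_projections; simpl; unfold Rmax;
      repeat destruct Rle_dec; lra. }
  unfold tsum. rewrite (usum_eq _ _ _ H). exact H.
Qed.

Lemma tsum_eq {I : Type} (f : I -> C) (s : C) : has_sum f s -> tsum f = s.
Proof. apply usum_eq. Qed.

Lemma tsum_ext {I : Type} (f g : I -> C) : (forall i, f i = g i) -> tsum f = tsum g.
Proof. intros H. apply functional_extensionality in H. subst. reflexivity. Qed.

Lemma summable_ext {I : Type} (f g : I -> C) :
  (forall i, f i = g i) -> summable f -> summable g.
Proof. intros H. apply functional_extensionality in H. subst. auto. Qed.

Lemma tsum_plus {I : Type} (f g : I -> C) :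
  summable f -> summable g -> tsum (fun i => f i + g i) = tsum f + tsum g.
Proof. intros. apply tsum_eq, is_usum_plus; apply summable_has_sum; auto. Qed.

Lemma tsum_scal {I : Type} (c : C) (f : I -> C) :
  summable f -> tsum (fun i => c * f i) = c * tsum f.
Proof. intros. apply tsum_eq, is_usum_scal; apply summable_has_sum; auto. Qed.

Lemma summable_le {I : Type} (f g : I -> C) :
  (forall i, Cmod (f i) <= Cmod (g i))%R -> summable g -> summable f.
Proof.
  intros H [M HM]. exists M. intros G NG.
  eapply Rle_trans; [|exact (HM G NG)]. apply rsum_le; auto.
Qed.

Lemma summable_by_scal {I : Type} (c : C) (f : I -> C) (M : R) :
  summable_by f M -> summable_by (fun i => c * f i) (Cmod c * M).
Proof.
  intros HM G NG.
  replace (fun i => Cmod (c * f i)) with (fun i => Cmod c * Cmod (f i))%R.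
  - rewrite rsum_scal. apply Rmult_le_compat_l; [apply Cmod_ge_0|auto].
  - apply functional_extensionality. intros; now rewrite Cmod_mult.
Qed.

Lemma summable_scal {I : Type} (c : C) (f : I -> C) :
  summable f -> summable (fun i => c * f i).
Proof. intros [M HM]. eexists. apply summable_by_scal, HM. Qed.

Lemma summable_by_plus {I : Type} (f g : I -> C) (M N : R) :
  summable_by f M -> summable_by g N -> summable_by (fun i => f i + g i) (M + N).
Proof.
  intros HM HN G NG. eapply Rle_trans; [apply rsum_le; intros; apply Cmod_triangle|].
  rewrite rsum_plus. specialize (HM G NG). specialize (HN G NG). lra.
Qed.

Lemma summable_plus {I : Type} (f g : I -> C) :
  summable f -> summable g -> summable (fun i => f i + g i).
Proof. intros [M HM] [N HN]. eexists. apply summable_by_plus; eauto. Qed.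

Lemma tsum_minus {I : Type} (f g : I -> C) :
  summable f -> summable g -> tsum (fun i => f i - g i) = tsum f - tsum g.
Proof.
  intros Hf Hg. transitivity (tsum (fun i => f i + (-1) * g i)).
  - apply tsum_ext. intros; ring.
  - rewrite tsum_plus, tsum_scal; auto using summable_scal. ring.
Qed.

Lemma summable_minus {I : Type} (f g : I -> C) :
  summable f -> summable g -> summable (fun i => f i - g i).
Proof.
  intros Hf Hg. apply summable_ext with (fun i => f i + (-1) * g i).
  - intros; ring.
  - apply summable_plus; auto using summable_scal.
Qed.

Lemma is_usum_bound {I : Type} (A : I -> Prop) (f : I -> C) (s c : C) (M : R) :
  is_usum A f s ->
  (forall G, NoDup G -> List.Forall A G -> (Cmod (lsum f G - c) <= M)%R) ->
  (Cmod (s - c) <= M)%R.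
Proof.
  intros Hs HM. apply le_epsilon. intros eps He.
  destruct (Hs (mkposreal _ He)) as [F [HF KF]].
  set (G := nodup eq_dec_classic F).
  assert (NG : NoDup G) by apply NoDup_nodup.
  assert (AG : List.Forall A G).
  { apply Forall_forall. intros x Hx. apply nodup_In in Hx.
    rewrite Forall_forall in HF. auto. }
  specialize (KF G NG AG (fun x Hx => proj2 (nodup_In eq_dec_classic F x) Hx)).
  simpl in KF. fold (lsum f G) in KF. specialize (HM G NG AG).
  replace (s - c) with ((s - lsum f G) + (lsum f G - c)) by ring.
  eapply Rle_trans; [apply Cmod_triangle|]. rewrite Cmod_sym. lra.
Qed.

Lemma tsum_bound {I : Type} (f : I -> C) (M : R) :
  summable_by f M -> (Cmod (tsum f) <= M)%R.
Proof.
  intros HM. replace (tsum f) with (tsum f - 0) by ring.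
  apply is_usum_bound with (fun _ => True) f.
  - apply summable_has_sum. exists M; auto.
  - intros G NG _. replace (lsum f G - 0) with (lsum f G) by ring.
    eapply Rle_trans; [apply Cmod_lsum|auto].
Qed.

Lemma NoDup_map_inj {I J : Type} (e : I -> J) (G : list I) :
  (forall a b, e a = e b -> a = b) -> NoDup G -> NoDup (map e G).
Proof.
  intros He NG. induction NG as [|a G Ha NG IH]; simpl; constructor; auto.
  intros Hin. apply in_map_iff in Hin. destruct Hin as [b [E Hb]].
  apply He in E. subst; auto.
Qed.

Lemma summable_inj {I J : Type} (e : I -> J) (f : J -> C) :
  (forall a b, e a = e b -> a = b) -> summable f -> summable (fun i => f (e i)).
Proof.
  intros He [M HM]. exists M. intros G NG.
  specialize (HM (map e G) (NoDup_map_inj e G He NG)).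
  rewrite rsum_map in HM. exact HM.
Qed.

Lemma is_usum_reindex {I J : Type} (e : I -> J) (A : I -> Prop) (B : J -> Prop)
    (f : J -> C) (s : C) :
  (forall a b, e a = e b -> a = b) -> (forall j, B j <-> exists i, A i /\ j = e i) ->
  is_usum A (fun i => f (e i)) s -> is_usum B f s.
Proof.
  intros He HB Hs eps. destruct (Hs eps) as [F [HF KF]].
  exists (map e F). split.
  - apply Forall_forall. intros j Hj. apply in_map_iff in Hj.
    destruct Hj as [i [E Hi]]. apply HB. exists i. split; auto.
    rewrite Forall_forall in HF; auto.
  - intros G NG AG Hi.
    assert (X : exists G', map e G' = G /\ List.Forall A G').
    { clear -AG HB. induction G as [|j G IH].
      - exists nil; split; auto.
      - inversion AG; subst. destruct (IH H2) as [G' [E K]].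
        apply HB in H1. destruct H1 as [i [Ai Ei]]. subst.
        exists (i :: G'). split; [reflexivity|constructor; auto]. }
    destruct X as [G' [E AG']]. subst G.
    apply NoDup_map_inv in NG. rewrite map_map. apply KF; auto.
    intros x Hx. assert (Hx' := Hi (e x) (in_map e _ _ Hx)).
    apply in_map_iff in Hx'. destruct Hx' as [y [Ey Hy]]. apply He in Ey. subst; auto.
Qed.

Lemma tsum_reindex {I J : Type} (e : I -> J) (e' : J -> I) (f : J -> C) :
  (forall i, e' (e i) = i) -> (forall j, e (e' j) = j) ->
  summable f -> tsum (fun i => f (e i)) = tsum f.
Proof.
  intros H1 H2 Hs. symmetry. apply tsum_eq.
  assert (inj : forall a b, e a = e b -> a = b).
  { intros a b E. rewrite <- (H1 a), <- (H1 b), E. reflexivity. }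
  apply is_usum_reindex with (e := e) (A := fun _ => True); auto.
  - intros j; split; auto. intros _. exists (e' j). auto.
  - apply summable_has_sum, summable_inj; auto.
Qed.

(** A finite set inside [A] may be enlarged by the part of [F] outside [A] without changing its sum,
    since the added terms vanish. *)
Lemma is_usum_support {I : Type} (A : I -> Prop) (f : I -> C) (s : C) :
  (forall i, A i \/ f i = 0) -> has_sum f s -> is_usum A f s.
Proof.
  intros HA Hs eps. destruct (Hs eps) as [F [_ KF]].
  set (a := fun i => if excluded_middle_informative (A i) then true else false).
  assert (Ha : forall i, a i = true <-> A i).
  { intros i. unfold a. destruct excluded_middle_informative; split; auto; discriminate. }
  exists (filter a F). split.
  - apply Forall_forall. intros i Hi. apply filter_In in Hi. apply Ha, Hi.
  - intros G NG AG Hi. rewrite Forall_forall in AG.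
    set (H := nodup eq_dec_classic (filter (fun i => negb (a i)) F)).
    assert (EH : forall i, List.In i H -> ~ A i).
    { intros i Hin. apply nodup_In, filter_In in Hin. destruct Hin as [_ K].
      rewrite <- Ha. destruct (a i); discriminate. }
    specialize (KF (G ++ H)). simpl in KF.
    fold (lsum f (G ++ H)) in KF. fold (lsum f G). rewrite lsum_app in KF.
    assert (Z : lsum f H = 0).
    { rewrite (lsum_ext f (fun _ => 0 * 0)).
      - rewrite lsum_scal. ring.
      - intros i Hin. destruct (HA i) as [K|K]; [destruct (EH i Hin K)|]. rewrite K; ring. }
    rewrite Z, Cplus_0_r in KF. apply KF.
    + apply NoDup_app; auto. apply NoDup_nodup. intros i K1 K2. apply (EH i K2). auto.
    + apply Forall_True.
    + intros i Hin. apply in_or_app. destruct (classic (A i)) as [K|K].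
      * left. apply Hi, filter_In. split; auto. apply Ha, K.
      * right. apply nodup_In, filter_In. split; auto. rewrite <- Ha in K.
        destruct (a i); auto.
Qed.

Lemma rsum_list_prod {I J : Type} (f : I * J -> R) (G : list I) (H : list J) :
  rsum f (list_prod G H) = rsum (fun i => rsum (fun j => f (i, j)) H) G.
Proof.
  induction G as [|a G IH]; [reflexivity|]. simpl.
  rewrite rsum_app, IH, rsum_map. unfold rsum at 3. simpl. reflexivity.
Qed.

Lemma lsum_list_prod {I J : Type} (f : I * J -> C) (G : list I) (H : list J) :
  lsum f (list_prod G H) = lsum (fun i => lsum (fun j => f (i, j)) H) G.
Proof.
  induction G as [|a G IH]; [reflexivity|]. simpl.
  rewrite lsum_app, IH, lsum_map. unfold lsum at 3. simpl. reflexivity.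
Qed.

(** A finite set of pairs lies in the rectangle spanned by its two projections, and a rectangle is
    summed row by row. *)
Lemma summable_pair {I J : Type} (f : I * J -> C) (B : I -> R) (M : R) :
  (forall i, summable_by (fun j => f (i, j)) (B i)) ->
  summable_by (fun i => RtoC (B i)) M -> summable_by f M.
Proof.
  intros HB HM G NG.
  set (G1 := nodup eq_dec_classic (map fst G)).
  set (G2 := nodup eq_dec_classic (map snd G)).
  apply Rle_trans with (rsum (fun i => Cmod (f i)) (list_prod G1 G2)).
  - apply rsum_incl; auto; [intros; apply Cmod_ge_0|].
    intros [i j] Hin. apply in_prod.
    + apply nodup_In, (in_map fst _ _ Hin).
    + apply nodup_In, (in_map snd _ _ Hin).
  - rewrite rsum_list_prod.
    eapply Rle_trans; [|apply (HM G1), NoDup_nodup].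
    apply rsum_le. intros i _. rewrite Cmod_R.
    apply Rle_trans with (B i); [|apply Rle_abs].
    apply HB, NoDup_nodup.
Qed.

Lemma summable_row {I J : Type} (f : I * J -> C) (i : I) :
  summable f -> summable (fun j => f (i, j)).
Proof.
  intros H. apply (summable_inj (fun j : J => (i, j)) f); auto.
  intros a b E. congruence.
Qed.

Lemma NoDup_list_prod {I J : Type} (G : list I) (H : list J) :
  NoDup G -> NoDup H -> NoDup (list_prod G H).
Proof.
  intros NG NH. induction NG as [|a G Ha NG IH]; simpl; [constructor|].
  apply NoDup_app; auto.
  - apply NoDup_map_inj; auto. intros; congruence.
  - intros [i j] K1 K2. apply in_map_iff in K1. destruct K1 as [b [E _]].
    inversion E; subst. apply in_prod_iff in K2. tauto.
Qed.

(** Finitely many row sums are approximated simultaneously by partial sums over one common set of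
    columns, so the bound for finite rectangles passes to them up to epsilon. *)
Lemma summable_rows {I J : Type} (f : I * J -> C) :
  summable f -> summable (fun i => tsum (fun j => f (i, j))).
Proof.
  intros Hs. destruct (Hs) as [M HM]. exists M. intros G NG.
  assert (X : forall eps : R, (0 < eps)%R -> exists H : list J, NoDup H /\
     (rsum (fun i => Cmod (tsum (fun j => f (i, j)))) G
        <= rsum (fun i => rsum (fun j => Cmod (f (i, j))) H) G + eps)%R).
  { clear NG. induction G as [|a G IH]; intros eps He.
    - exists nil. split; [constructor|]. unfold rsum; simpl; lra.
    - destruct (IH (eps / 2)%R) as [H [NH KH]]; [lra|].
      assert (He2 : (0 < eps / 2)%R) by lra.
      destruct (summable_has_sum _ (summable_row f a Hs) (mkposreal _ He2)) as [F [_ KF]].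
      set (H' := nodup eq_dec_classic (F ++ H)).
      assert (NH' : NoDup H') by apply NoDup_nodup.
      exists H'. split; auto.
      specialize (KF H' NH' (Forall_True _)
        (fun x Hx => proj2 (nodup_In _ _ _) (in_or_app _ _ _ (or_introl Hx)))).
      simpl in KF. fold (lsum (fun j => f (a, j)) H') in KF.
      assert (K1 := Cmod_lsum (fun j => f (a, j)) H').
      assert (K2 := Cmod_triangle_rev (tsum (fun j => f (a, j))) (lsum (fun j => f (a, j)) H')).
      rewrite Cmod_sym in K2.
      assert (K3 : (rsum (fun i => rsum (fun j => Cmod (f (i, j))) H) G <=
               rsum (fun i => rsum (fun j => Cmod (f (i, j))) H') G)%R).
      { apply rsum_le. intros i _. apply rsum_incl; auto; [intros; apply Cmod_ge_0|].
        intros x Hx. apply nodup_In, in_or_app; auto. }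
      rewrite !rsum_cons. simpl in K1. lra. }
  apply le_epsilon. intros eps He. destruct (X eps He) as [H [NH KH]].
  eapply Rle_trans; [exact KH|]. apply Rplus_le_compat_r.
  rewrite <- (rsum_list_prod (fun p => Cmod (f p))). apply HM, NoDup_list_prod; auto.
Qed.

(** Once [G] contains the rows met by [F], a large enough set of columns [H] makes the sum over the
    rectangle of [G] and [H] close both to the total and to the sum of the rows in [G]. *)
Lemma tsum_fubini {I J : Type} (f : I * J -> C) :
  summable f -> tsum f = tsum (fun i => tsum (fun j => f (i, j))).
Proof.
  intros Hs. symmetry. apply tsum_eq. intros [eps He].
  assert (He3 : (0 < eps / 3)%R) by lra.
  destruct (summable_has_sum f Hs (mkposreal _ He3)) as [F [_ KF]]. simpl in KF.
  exists (map fst F). split; [apply Forall_True|].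
  intros G NG _ Hi. simpl. fold (lsum (fun i => tsum (fun j => f (i, j))) G).
  assert (X : forall e : R, (0 < e)%R -> exists H0 : list J,
     forall H, NoDup H -> incl H0 H ->
     (Cmod (lsum (fun i => tsum (fun j => f (i, j))) G
        - lsum (fun i => lsum (fun j => f (i, j)) H) G) < e)%R).
  { clear -Hs. induction G as [|a G IH]; intros e He.
    - exists nil. intros. unfold lsum; simpl.
      replace (0 - 0) with (RtoC 0) by ring. rewrite Cmod_0; auto.
    - assert (He2 : (0 < e / 2)%R) by lra.
      destruct (IH _ He2) as [H0 K0].
      destruct (summable_has_sum _ (summable_row f a Hs) (mkposreal _ He2)) as [F [_ KF]].
      exists (F ++ H0). intros H NH Hi.
      specialize (K0 H NH (fun x Hx => Hi x (in_or_app _ _ _ (or_intror Hx)))).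
      specialize (KF H NH (Forall_True _) (fun x Hx => Hi x (in_or_app _ _ _ (or_introl Hx)))).
      simpl in KF. fold (lsum (fun j => f (a, j)) H) in KF.
      rewrite !lsum_cons.
      match goal with |- (Cmod (?a + ?b - (?c + ?d)) < _)%R =>
        replace (a + b - (c + d)) with ((a - c) + (b - d)) by ring end.
      eapply Rle_lt_trans; [apply Cmod_triangle|]. rewrite Cmod_sym in KF. lra. }
  destruct (X _ He3) as [H0 KH0].
  set (H := nodup eq_dec_classic (H0 ++ map snd F)).
  assert (NH : NoDup H) by apply NoDup_nodup.
  specialize (KH0 H NH (fun x Hx => proj2 (nodup_In _ _ _) (in_or_app _ _ _ (or_introl Hx)))).
  specialize (KF (list_prod G H) (NoDup_list_prod _ _ NG NH) (Forall_True _)).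
  fold (lsum f (list_prod G H)) in KF. rewrite lsum_list_prod in KF.
  match type of KH0 with (Cmod (?a - ?b) < _)%R =>
    replace (a - tsum f) with ((a - b) + (b - tsum f)) by ring end.
  eapply Rle_lt_trans; [apply Cmod_triangle|].
  assert (K : (Cmod (lsum (fun i => lsum (fun j => f (i, j)) H) G - tsum f) < eps / 3)%R);
    [|lra].
  apply KF. intros [i j] Hin. apply in_prod.
  - apply Hi. apply (in_map fst _ _ Hin).
  - apply nodup_In, in_or_app. right. apply (in_map snd _ _ Hin).
Qed.

Lemma tsum_swap {I J : Type} (f : I * J -> C) : summable f ->
  tsum (fun i => tsum (fun j => f (i, j))) = tsum (fun j => tsum (fun i => f (i, j))).
Proof.
  intros Hs. rewrite <- tsum_fubini by auto.
  set (e := fun p : J * I => (snd p, fst p)).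
  rewrite <- (tsum_reindex e (fun p => (snd p, fst p)) f);
    [|intros []; reflexivity|intros []; reflexivity|exact Hs].
  rewrite (tsum_fubini (fun p => f (e p))); [reflexivity|].
  apply (summable_inj e f); auto. intros [] [] E; unfold e in E; simpl in E; congruence.
Qed.

Lemma summable_mult {I J : Type} (f : I -> C) (g : J -> C) :
  summable f -> summable g -> summable (fun p => f (fst p) * g (snd p)).
Proof.
  intros [M HM] [N HN].
  exists (N * M)%R. apply summable_pair with (fun i => N * Cmod (f i))%R.
  - intros i. simpl. rewrite Rmult_comm. apply summable_by_scal, HN.
  - assert (HN0 : (0 <= N)%R) by (apply (HN nil); constructor).
    intros G NG. replace (fun i => Cmod (RtoC (N * Cmod (f i))))
      with (fun i => N * Cmod (f i))%R.
    + rewrite rsum_scal. apply Rmult_le_compat_l; auto.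
    + apply functional_extensionality. intros i. rewrite Cmod_R, Rabs_pos_eq; auto.
      apply Rmult_le_pos; auto. apply Cmod_ge_0.
Qed.

Lemma tsum_mult {I J : Type} (f : I -> C) (g : J -> C) :
  summable f -> summable g ->
  tsum (fun p => f (fst p) * g (snd p)) = tsum f * tsum g.
Proof.
  intros Hf Hg. rewrite tsum_fubini by (apply summable_mult; auto). simpl.
  rewrite Cmult_comm, <- tsum_scal by auto. apply tsum_ext. intros i.
  rewrite tsum_scal by auto. ring.
Qed.

Lemma summable_by_0 {I : Type} : summable_by (fun _ : I => RtoC 0) 0.
Proof.
  intros G _. rewrite Cmod_0. induction G; [unfold rsum; simpl; lra|].
  rewrite rsum_cons. lra.
Qed.

Lemma summable_0 {I : Type} : summable (fun _ : I => RtoC 0).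
Proof. exists 0%R. apply summable_by_0. Qed.

Lemma tsum_0 {I : Type} : tsum (fun _ : I => RtoC 0) = 0.
Proof.
  apply Cmod_eq_0, Rle_antisym; [|apply Cmod_ge_0].
  apply tsum_bound, summable_by_0.
Qed.

Lemma tsum_lsum {I J : Type} (f : J -> I -> C) (l : list J) :
  (forall j, summable (f j)) ->
  summable (fun i => lsum (fun j => f j i) l) /\
  tsum (fun i => lsum (fun j => f j i) l) = lsum (fun j => tsum (f j)) l.
Proof.
  intros Hf. induction l as [|a l [S E]].
  - split; [apply summable_0|apply tsum_0].
  - split; [apply (summable_plus (f a)); auto|].
    rewrite lsum_cons, <- E. apply (tsum_plus (f a)); auto.
Qed.

(** * Exponentials and powers *)

Lemma Cexp_plus (a b : C) : Cexp (a + b) = Cexp a * Cexp b.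
Proof.
  destruct a as [a1 a2], b as [b1 b2]. unfold Cexp, Re, Im. simpl.
  rewrite exp_plus, cos_plus, sin_plus.
  apply injective_projections; simpl; ring.
Qed.

Lemma Cexp_0 : Cexp 0 = 1.
Proof.
  unfold Cexp. simpl. rewrite exp_0, cos_0, sin_0.
  apply injective_projections; simpl; ring.
Qed.

Lemma Cmod_Cexp (z : C) : Cmod (Cexp z) = exp (Re z).
Proof.
  unfold Cmod, Cexp. simpl.
  replace (exp (Re z) * cos (Im z) * (exp (Re z) * cos (Im z) * 1)
    + exp (Re z) * sin (Im z) * (exp (Re z) * sin (Im z) * 1))%R
    with (Rsqr (exp (Re z)) * ((sin (Im z))² + (cos (Im z))²))%R
    by (unfold Rsqr; ring).
  rewrite sin2_cos2, Rmult_1_r, sqrt_Rsqr; [reflexivity|]. left; apply exp_pos.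
Qed.

Lemma Cexp_nz (z : C) : Cexp z <> 0.
Proof. apply Cmod_gt_0. rewrite Cmod_Cexp. apply exp_pos. Qed.

Lemma Cexp_opp (z : C) : Cexp (- z) = / Cexp z.
Proof.
  assert (H : Cexp (- z) * Cexp z = 1).
  { rewrite <- Cexp_plus. replace (- z + z) with (RtoC 0) by ring. apply Cexp_0. }
  assert (Hz := Cexp_nz z).
  replace (Cexp (- z)) with (Cexp (- z) * Cexp z / Cexp z) by (field; auto).
  rewrite H. field. auto.
Qed.

Lemma Cexp_2PI : Cexp (2 * PI * Ci) = 1.
Proof.
  unfold Cexp. simpl.
  replace ((2 * PI - 0 * 0) * 0 - (2 * 0 + 0 * PI) * 1)%R with 0%R by ring.
  replace ((2 * PI - 0 * 0) * 1 + (2 * 0 + 0 * PI) * 0)%R with (2 * PI)%R by ring.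
  rewrite exp_0, cos_2PI, sin_2PI.
  apply injective_projections; simpl; ring.
Qed.

Lemma Cexp_PI : Cexp (PI * Ci) = -1.
Proof.
  unfold Cexp. simpl.
  replace (PI * 0 - 0 * 1)%R with 0%R by ring.
  replace (PI * 1 + 0 * 0)%R with PI by ring.
  rewrite exp_0, cos_PI, sin_PI.
  apply injective_projections; simpl; ring.
Qed.

Lemma Cexp_PI2 : Cexp (PI * Ci / 2) = Ci.
Proof.
  replace (PI * Ci / 2) with (0%R, (PI / 2)%R).
  - unfold Cexp. simpl. rewrite exp_0, cos_PI2, sin_PI2.
    apply injective_projections; simpl; ring.
  - apply injective_projections; simpl; field.
Qed.

Lemma Cexp_eq_1 (z : C) : Cexp z = 1 -> exists n : Z, z = 2 * PI * Ci * IZR n.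
Proof.
  intros H. assert (Hm : exp (Re z) = 1%R).
  { rewrite <- Cmod_Cexp, H. apply Cmod_1. }
  assert (Hr : Re z = 0%R).
  { apply exp_inv. rewrite exp_0. exact Hm. }
  unfold Cexp in H. rewrite Hm in H.
  assert (H1 := f_equal fst H). assert (H2 := f_equal snd H). simpl in H1, H2.
  rewrite Rmult_1_l in H1, H2.
  destruct (sin_eq_0_0 _ H2) as [k Hk].
  assert (Hev : Z.even k = true).
  { destruct (Z.even k) eqn:E; [reflexivity|exfalso].
    assert (Ho : Z.odd k = true) by (rewrite <- Z.negb_even, E; reflexivity).
    apply Z.odd_spec in Ho. destruct Ho as [m ->].
    rewrite Hk, plus_IZR, mult_IZR in H1.
    replace ((2 * IZR m + 1) * PI)%R with (2 * IZR m * PI + PI)%R in H1 by ring.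
    rewrite neg_cos in H1.
    assert (K : cos (2 * IZR m * PI) = 1%R); [|lra].
    replace (2 * IZR m * PI)%R with (2 * (IZR m * PI))%R by ring.
    rewrite cos_2a_sin. rewrite (sin_eq_0_1 (IZR m * PI)); [ring|].
    exists m; reflexivity. }
  apply Z.even_spec in Hev. destruct Hev as [m ->].
  exists m. rewrite mult_IZR in Hk.
  apply injective_projections; unfold Re, Im in *; simpl.
  - rewrite Hr. ring.
  - rewrite Hk. ring.
Qed.

Lemma Cpowz_nat (z : C) (n : nat) : z ^^ (Z.of_nat n) = z ^ n.
Proof. destruct n; [reflexivity|]. simpl. rewrite SuccNat2Pos.id_succ. reflexivity. Qed.

Lemma Cpowz_opp (z : C) (n : Z) : z <> 0 -> z ^^ (- n) = / z ^^ n.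
Proof.
  intros Hz. destruct n; simpl; auto.
  - field.
  - field. apply Cpow_nz; auto.
Qed.

Lemma Cpowz_nz (z : C) (n : Z) : z <> 0 -> z ^^ n <> 0.
Proof.
  intros Hz. destruct n; simpl.
  - intro E. apply RtoC_inj in E. lra.
  - apply Cpow_nz; auto.
  - assert (H := Cpow_nz z (Pos.to_nat p) Hz). intros E.
    assert (K : z ^ Pos.to_nat p * / z ^ Pos.to_nat p = 1) by (field; auto).
    rewrite E, Cmult_0_r in K. apply RtoC_inj in K. lra.
Qed.

Lemma Cpowz_succ (z : C) (n : Z) : z <> 0 -> z ^^ (n + 1) = z * z ^^ n.
Proof.
  intros Hz. destruct (Z_le_gt_dec 0 n) as [H|H].
  - rewrite <- (Z2Nat.id n H) at 1 2.
    replace (Z.of_nat (Z.to_nat n) + 1)%Z with (Z.of_nat (S (Z.to_nat n))) by lia.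
    rewrite !Cpowz_nat. reflexivity.
  - set (m := Z.to_nat (- n - 1)).
    replace (n + 1)%Z with (- Z.of_nat m)%Z by lia.
    replace n with (- Z.of_nat (S m))%Z by lia.
    rewrite !Cpowz_opp, !Cpowz_nat, Cpow_S by auto.
    assert (K := Cpow_nz z m Hz). field. auto.
Qed.

Lemma Cpowz_add (z : C) (n m : Z) : z <> 0 -> z ^^ (n + m) = z ^^ n * z ^^ m.
Proof.
  intros Hz. revert m. apply Z.peano_ind.
  - rewrite Z.add_0_r. simpl. ring.
  - intros m IH. rewrite <- Z.add_1_r, Z.add_assoc, !Cpowz_succ, IH by auto. ring.
  - intros m IH. assert (K := Cpowz_succ z (Z.pred m) Hz).
    assert (K' := Cpowz_succ z (n + Z.pred m) Hz).
    replace (Z.pred m + 1)%Z with m in K by lia.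
    replace (n + Z.pred m + 1)%Z with (n + m)%Z in K' by lia.
    rewrite IH, K in K'.
    replace (z ^^ (n + Z.pred m)) with (z * z ^^ (n + Z.pred m) / z) by (field; auto).
    rewrite <- K'. field. auto.
Qed.

Lemma Cpowz_1 (z : C) : z ^^ 1 = z.
Proof. simpl. ring. Qed.

Lemma Cpowz_mul (z : C) (n m : Z) : z <> 0 -> z ^^ (n * m) = (z ^^ n) ^^ m.
Proof.
  intros Hz. assert (Hn := Cpowz_nz z n Hz). revert m. apply Z.peano_ind.
  - rewrite Z.mul_0_r. reflexivity.
  - intros m IH. rewrite <- Z.add_1_r, Cpowz_succ, <- IH by auto.
    replace (n * (m + 1))%Z with (n + n * m)%Z by ring. apply Cpowz_add; auto.
  - intros m IH. assert (K := Cpowz_succ (z ^^ n) (Z.pred m) Hn).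
    replace (Z.pred m + 1)%Z with m in K by lia.
    replace (n * m)%Z with (n + n * Z.pred m)%Z in IH by lia.
    rewrite Cpowz_add, K in IH by auto.
    replace (z ^^ (n * Z.pred m)) with (z ^^ n * z ^^ (n * Z.pred m) / z ^^ n) by (field; auto).
    rewrite IH. field. auto.
Qed.

Lemma Cpowz_mult_l (a b : C) (n : Z) :
  a <> 0 -> b <> 0 -> (a * b) ^^ n = a ^^ n * b ^^ n.
Proof.
  intros Ha Hb. assert (Hab : a * b <> 0) by (apply Cmult_neq_0; auto).
  destruct n; simpl; [ring|apply Cpow_mult_l|].
  rewrite Cpow_mult_l. field. split; apply Cpow_nz; auto.
Qed.

Lemma Cpowz_2 (z : C) : z ^^ 2 = z ^ 2.
Proof. reflexivity. Qed.

Lemma Cmod_powz (z : C) (n : Z) : z <> 0 -> Cmod (z ^^ n) = exp (IZR n * ln (Cmod z)).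
Proof.
  intros Hz. assert (Hm : (0 < Cmod z)%R) by (apply Cmod_gt_0; auto).
  assert (P : forall m : nat, Cmod (z ^ m) = exp (INR m * ln (Cmod z))).
  { induction m.
    - simpl. rewrite Rmult_0_l, exp_0. apply Cmod_1.
    - rewrite Cpow_S, Cmod_mult, IHm, S_INR, Rmult_plus_distr_r, exp_plus, Rmult_1_l,
        exp_ln by auto. ring. }
  destruct n; simpl.
  - rewrite Rmult_0_l, exp_0. apply Cmod_1.
  - rewrite P, INR_IZR_INZ, positive_nat_Z. reflexivity.
  - rewrite Cmod_inv, P, INR_IZR_INZ, positive_nat_Z by (apply Cpow_nz; auto).
    rewrite <- exp_Ropp. f_equal. rewrite <- Pos2Z.opp_pos, opp_IZR. ring.
Qed.

Lemma Cexp_Zmult (z : C) (n : Z) : Cexp (IZR n * z) = Cexp z ^^ n.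
Proof.
  assert (Hz := Cexp_nz z). revert n. apply Z.peano_ind.
  - rewrite Cmult_0_l. apply Cexp_0.
  - intros n IH. rewrite <- Z.add_1_r, Cpowz_succ, <- IH, <- Cexp_plus by auto.
    f_equal. rewrite plus_IZR, RtoC_plus. ring.
  - intros n IH. assert (K := Cpowz_succ (Cexp z) (Z.pred n) Hz).
    replace (Z.pred n + 1)%Z with n in K by lia. rewrite <- IH in K.
    replace (Cexp z ^^ Z.pred n) with (Cexp z * Cexp z ^^ Z.pred n / Cexp z)
      by (field; auto).
    rewrite <- K. unfold Cdiv. rewrite <- Cexp_opp, <- Cexp_plus.
    f_equal. rewrite <- Z.sub_1_r, minus_IZR, RtoC_minus. ring.
Qed.

Lemma Cpowz_1_l (n : Z) : 1 ^^ n = 1.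
Proof. destruct n; simpl; rewrite ?Cpow_1_l; auto. field. Qed.

Lemma C1_nz : RtoC 1 <> 0.
Proof. intros E. apply RtoC_inj in E. lra. Qed.

Lemma Cm1_nz : RtoC (-1) <> 0.
Proof. intros E. apply RtoC_inj in E. lra. Qed.

Lemma Cpowz_m1_even (n : Z) : (-1) ^^ (2 * n) = 1.
Proof.
  rewrite Cpowz_mul by apply Cm1_nz. replace ((-1) ^^ 2) with (RtoC 1).
  - apply Cpowz_1_l.
  - simpl. rewrite <- !RtoC_mult. f_equal. ring.
Qed.

Lemma Cpowz_m1_opp (n : Z) : (-1) ^^ (- n) = (-1) ^^ n.
Proof.
  replace n with (2 * n + - n)%Z at 2 by ring.
  rewrite Cpowz_add, Cpowz_m1_even by apply Cm1_nz. ring.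
Qed.

Lemma Cmod_m1_powz (n : Z) : Cmod ((-1) ^^ n) = 1%R.
Proof.
  rewrite Cmod_powz by apply Cm1_nz. rewrite Cmod_R, Rabs_m1, ln_1, Rmult_0_r.
  apply exp_0.
Qed.

(** The division is exact, as [tri_double] records; equalities of exponents are then settled by
    integer arithmetic from that lemma. *)
Definition tri (n : Z) : Z := (n * (n - 1) / 2)%Z.

Lemma tri_double (n : Z) : (2 * tri n = n * (n - 1))%Z.
Proof.
  unfold tri. symmetry. apply Z_div_exact_2; [lia|].
  rewrite Zmod_even. replace (Z.even (n * (n - 1))) with true; auto.
  rewrite Z.even_mul, Z.even_sub. simpl. destruct (Z.even n); reflexivity.
Qed.

Lemma IZR_tri (n : Z) : IZR (tri n) = (IZR n * (IZR n - 1) / 2)%R.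
Proof.
  assert (H := f_equal IZR (tri_double n)). rewrite !mult_IZR, minus_IZR in H. lra.
Qed.

(** * Summability on the integers *)

Lemma geom_rsum (r : R) (N : nat) : (0 <= r < 1)%R ->
  (rsum (fun k : nat => r ^ k) (seq 0 N) <= / (1 - r))%R.
Proof.
  intros Hr.
  assert (H : rsum (fun k : nat => r ^ k)%R (seq 0 N) = ((1 - r ^ N) / (1 - r))%R).
  { induction N as [|N IH].
    - unfold rsum; simpl. field. lra.
    - rewrite seq_S, rsum_app, IH. unfold rsum; simpl. field. lra. }
  rewrite H. unfold Rdiv. rewrite <- (Rmult_1_l (/ (1 - r))) at 2.
  apply Rmult_le_compat_r.
  - left. apply Rinv_0_lt_compat. lra.
  - assert (0 <= r ^ N)%R by (apply pow_le; lra). lra.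
Qed.

Lemma geom_summable_by (f : Z -> C) (M r : R) : (0 <= M)%R -> (0 <= r < 1)%R ->
  (forall n, Cmod (f n) <= M * r ^ (Z.abs_nat n))%R ->
  summable_by f (M * (2 * / (1 - r))).
Proof.
  intros HM Hr Hf G NG.
  eapply Rle_trans; [apply rsum_le; intros i _; apply Hf|].
  rewrite rsum_scal. apply Rmult_le_compat_l; auto.
  assert (X : exists N : nat, forall n, List.In n G -> (Z.abs_nat n < N)%nat).
  { clear. induction G as [|a G [N IH]].
    - exists O. intros n [].
    - exists (Nat.max N (S (Z.abs_nat a))). intros n [E|E].
      + subst. lia.
      + specialize (IH n E). lia. }
  destruct X as [N HN].
  (* Two copies of 0, ..., N-1, one negated, cover [G]. Zero is counted twice, which is harmless for
     an upper bound and explains the factor 2. *)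
  apply Rle_trans with (rsum (fun i : Z => r ^ Z.abs_nat i)%R
    (map Z.of_nat (seq 0 N) ++ map (fun k => - Z.of_nat k)%Z (seq 0 N))).
  - apply rsum_incl; auto.
    + intros; apply pow_le; lra.
    + intros n Hn. specialize (HN n Hn). apply in_or_app.
      destruct (Z_le_gt_dec 0 n).
      * left. apply in_map_iff. exists (Z.abs_nat n). split; [lia|]. apply in_seq. lia.
      * right. apply in_map_iff. exists (Z.abs_nat n). split; [lia|]. apply in_seq. lia.
  - rewrite rsum_app, !rsum_map.
    replace (fun i : nat => r ^ Z.abs_nat (Z.of_nat i))%R with (fun i : nat => r ^ i)%R.
    2:{ apply functional_extensionality. intros; f_equal; lia. }
    replace (fun i : nat => r ^ Z.abs_nat (- Z.of_nat i))%R with (fun i : nat => r ^ i)%R.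
    2:{ apply functional_extensionality. intros; f_equal; lia. }
    assert (H := geom_rsum r N Hr). lra.
Qed.

Lemma summable_geom (f : Z -> C) (M r : R) : (0 <= r < 1)%R ->
  (forall n, Cmod (f n) <= M * r ^ (Z.abs_nat n))%R -> summable f.
Proof.
  intros Hr Hf. exists (Rmax M 0 * (2 * / (1 - r)))%R. apply geom_summable_by; auto.
  - apply Rmax_r.
  - intros n. eapply Rle_trans; [apply Hf|]. apply Rmult_le_compat_r.
    + apply pow_le; lra.
    + apply Rmax_l.
Qed.

Lemma geom_summable_nat (f : nat -> C) (M r : R) : (0 <= r < 1)%R ->
  (forall n, Cmod (f n) <= M * r ^ n)%R -> summable f.
Proof.
  intros Hr Hf.
  apply summable_ext with (fun n => (fun z => f (Z.abs_nat z)) (Z.of_nat n)).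
  - intros n. f_equal. lia.
  - apply (summable_inj Z.of_nat (fun z => f (Z.abs_nat z))); [intros; lia|].
    apply summable_geom with M r; auto.
Qed.

Lemma exp_nat_pow (a : R) (n : nat) : (exp a ^ n)%R = exp (INR n * a).
Proof.
  induction n.
  - simpl. rewrite Rmult_0_l, exp_0. reflexivity.
  - rewrite S_INR. simpl. rewrite IHn, <- exp_plus. f_equal. ring.
Qed.

Lemma abs_nat_IZR (n : Z) : INR (Z.abs_nat n) = Rabs (IZR n).
Proof. rewrite INR_IZR_INZ, Nat2Z.inj_abs_nat, abs_IZR. reflexivity. Qed.

Lemma exp_le_compat (a b : R) : (a <= b)%R -> (exp a <= exp b)%R.
Proof. intros [H|H]; [left; apply exp_increasing; auto|right; subst; auto]. Qed.

(** Completing the square: c2 t^2 + B t is at most B^2 / (4 (-c2)). Taking B one larger than the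
    linear growth leaves a factor exp(-|n|), hence a geometric majorant. The term in [A] makes room
    for polynomial or exponential factors in |n|. *)
Lemma summable_gauss (f : Z -> C) (M A c2 c1 c0 : R) : (c2 < 0)%R ->
  (forall n, Cmod (f n) <=
     M * exp (c2 * (IZR n * IZR n) + c1 * IZR n + c0 + A * Rabs (IZR n)))%R ->
  summable f.
Proof.
  intros Hc Hf.
  set (B := (Rabs c1 + Rabs A + 1)%R).
  apply summable_geom with (Rabs M * exp (B * B / (4 * - c2) + c0))%R (exp (-1)).
  - split; [left; apply exp_pos|]. rewrite <- exp_0. apply exp_increasing. lra.
  - intros n. eapply Rle_trans; [apply Hf|]. rewrite Rmult_assoc.
    apply Rle_trans with (Rabs M *
      exp (c2 * (IZR n * IZR n) + c1 * IZR n + c0 + A * Rabs (IZR n)))%R.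
    + apply Rmult_le_compat_r; [left; apply exp_pos|apply Rle_abs].
    + apply Rmult_le_compat_l; [apply Rabs_pos|].
      rewrite exp_nat_pow, <- exp_plus, abs_nat_IZR. apply exp_le_compat.
      assert (H1 : (c1 * IZR n <= Rabs c1 * Rabs (IZR n))%R)
        by (rewrite <- Rabs_mult; apply Rle_abs).
      assert (H2 : (A * Rabs (IZR n) <= Rabs A * Rabs (IZR n))%R)
        by (apply Rmult_le_compat_r; [apply Rabs_pos|apply Rle_abs]).
      set (t := Rabs (IZR n)) in *.
      replace (IZR n * IZR n)%R with (t * t)%R
        by (unfold t; rewrite <- Rabs_mult; apply Rabs_pos_eq, Rle_0_sqr).
      assert (H3 : (c2 * (t * t) + B * t <= B * B / (4 * - c2))%R).
      { apply Rmult_le_reg_r with (4 * - c2)%R; [lra|].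
        unfold Rdiv. rewrite Rmult_assoc, Rinv_l, Rmult_1_r by lra.
        assert (0 <= (2 * - c2 * t - B) * (2 * - c2 * t - B))%R by apply Rle_0_sqr. nra. }
      unfold B in *. lra.
Qed.

(** * Complex derivatives *)

(** The difference quotient with its denominator cleared, so that h = 0 is no exception. It agrees
    with the derivative used in the differential system by [is_derive_cder]. *)
Definition cder (f : C -> C) (z l : C) : Prop :=
  forall eps : R, (0 < eps)%R -> exists delta : R, (0 < delta)%R /\
    forall h : C, (Cmod h < delta)%R ->
      (Cmod (f (z + h)%C - f z - l * h) <= eps * Cmod h)%R.

Lemma locally_Cmod (z : C) (P : C -> Prop) :
  locally (T := AbsRing_UniformSpace C_AbsRing) z P <->
  exists delta : R, (0 < delta)%R /\ forall w : C, (Cmod (w - z) < delta)%R -> P w.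
Proof.
  split.
  - intros [d Hd]. exists d. split; [apply cond_pos|]. intros w Hw. apply Hd. exact Hw.
  - intros [d [Hd H]]. exists (mkposreal d Hd). intros w Hw. apply H. exact Hw.
Qed.

Lemma locally_Cmod' (z : C) (P : C -> Prop) :
  locally (T := C_UniformSpace) z P <->
  exists delta : R, (0 < delta)%R /\ forall w : C, (Cmod (w - z) < delta)%R -> P w.
Proof. rewrite <- locally_Cmod. apply locally_C. Qed.

Lemma is_derive_cder (f : C -> C) (z l : C) :
  @is_derive C_AbsRing C_NormedModule f z l <-> cder f z l.
Proof.
  split.
  - intros [_ H] eps He. specialize (H z (fun P HP => HP) (mkposreal eps He)).
    apply locally_Cmod in H. destruct H as [d [Hd H]]. exists d. split; auto.
    intros h Hh. specialize (H (z + h)).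
    replace (z + h - z) with h in H by ring. specialize (H Hh).
    change (Cmod (f (z + h)%C - f z - (z + h - z) * l) <= eps * Cmod (z + h - z)%C)%R in H.
    replace (z + h - z) with h in H by ring. rewrite Cmult_comm in H. exact H.
  - intros H. split; [apply is_linear_scal_l|].
    intros x Hx.
    assert (E : z = x) by exact (is_filter_lim_locally_unique (V := AbsRing_NormedModule C_AbsRing) z x Hx).
    subst x. intros [eps He]. destruct (H eps He) as [d [Hd K]].
    apply locally_Cmod. exists d. split; auto. intros w Hw.
    specialize (K (w - z) Hw). replace (z + (w - z)) with w in K by ring.
    change (Cmod (f w - f z - (w - z) * l) <= eps * Cmod (w - z))%R.
    rewrite (Cmult_comm (w - z)). exact K.
Qed.

Lemma cder_lip (f : C -> C) (z l : C) : cder f z l ->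
  exists delta : R, (0 < delta)%R /\ forall h, (Cmod h < delta)%R ->
    (Cmod (f (z + h)%C - f z) <= (Cmod l + 1) * Cmod h)%R.
Proof.
  intros H. destruct (H 1%R) as [d [Hd K]]; [lra|]. exists d. split; auto.
  intros h Hh. specialize (K h Hh).
  replace (f (z + h) - f z) with ((f (z + h) - f z - l * h) + l * h) by ring.
  eapply Rle_trans; [apply Cmod_triangle|]. rewrite Cmod_mult. lra.
Qed.

Definition ccont (f : C -> C) (z : C) : Prop :=
  forall eps : R, (0 < eps)%R -> exists delta : R, (0 < delta)%R /\
    forall w : C, (Cmod (w - z) < delta)%R -> (Cmod (f w - f z) < eps)%R.

Lemma cder_ccont (f : C -> C) (z l : C) : cder f z l -> ccont f z.
Proof.
  intros H eps He. destruct (cder_lip f z l H) as [d [Hd K]].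
  assert (Hl := Cmod_ge_0 l).
  exists (Rmin d (eps / (Cmod l + 1))). split.
  - apply Rmin_pos; auto. apply Rdiv_lt_0_compat; lra.
  - intros w Hw. specialize (K (w - z)).
    replace (z + (w - z)) with w in K by ring.
    eapply Rle_lt_trans; [apply K|].
    + eapply Rlt_le_trans; [exact Hw|apply Rmin_l].
    + assert (Hw2 : (Cmod (w - z) < eps / (Cmod l + 1))%R)
        by (eapply Rlt_le_trans; [exact Hw|apply Rmin_r]).
      apply Rmult_lt_compat_l with (r := (Cmod l + 1)%R) in Hw2; [|lra].
      replace ((Cmod l + 1) * (eps / (Cmod l + 1)))%R with eps in Hw2 by (field; lra).
      exact Hw2.
Qed.

Lemma ccont_bound (f : C -> C) (z : C) : ccont f z ->
  exists delta M : R, (0 < delta)%R /\ (0 < M)%R /\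
    forall w, (Cmod (w - z) < delta)%R -> (Cmod (f w) < M)%R.
Proof.
  intros H. destruct (H 1%R) as [d [Hd K]]; [lra|].
  exists d, (Cmod (f z) + 1)%R. split; auto. assert (X := Cmod_ge_0 (f z)).
  split; [lra|]. intros w Hw. specialize (K w Hw).
  assert (Y := Cmod_triangle_rev (f w) (f z)). lra.
Qed.

Lemma ccont_nz (f : C -> C) (z : C) : ccont f z -> f z <> 0 ->
  exists delta : R, (0 < delta)%R /\
    forall w, (Cmod (w - z) < delta)%R -> (Cmod (f z) / 2 < Cmod (f w))%R.
Proof.
  intros H Hz. apply Cmod_gt_0 in Hz.
  destruct (H (Cmod (f z) / 2)%R) as [d [Hd K]]; [lra|].
  exists d. split; auto. intros w Hw. specialize (K w Hw).
  assert (Y := Cmod_triangle_rev (f z) (f w)). rewrite Cmod_sym in K. lra.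
Qed.

Lemma ccont_mult (f g : C -> C) (z : C) :
  ccont f z -> ccont g z -> ccont (fun w => f w * g w) z.
Proof.
  intros Hf Hg eps He.
  destruct (ccont_bound f z Hf) as [d1 [M [Hd1 [HM K1]]]].
  assert (Hgz := Cmod_ge_0 (g z)).
  destruct (Hg (eps / (2 * M))%R) as [d2 [Hd2 K2]]; [apply Rdiv_lt_0_compat; lra|].
  destruct (Hf (eps / (2 * (Cmod (g z) + 1)))%R) as [d3 [Hd3 K3]];
    [apply Rdiv_lt_0_compat; lra|].
  exists (Rmin d1 (Rmin d2 d3)). split; [repeat apply Rmin_pos; auto|].
  intros w Hw.
  assert (W1 : (Cmod (w - z) < d1)%R) by (eapply Rlt_le_trans; [exact Hw|apply Rmin_l]).
  assert (W2 : (Cmod (w - z) < d2)%R).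
  { eapply Rlt_le_trans; [exact Hw|]. eapply Rle_trans; [apply Rmin_r|apply Rmin_l]. }
  assert (W3 : (Cmod (w - z) < d3)%R).
  { eapply Rlt_le_trans; [exact Hw|]. eapply Rle_trans; [apply Rmin_r|apply Rmin_r]. }
  specialize (K1 w W1). specialize (K2 w W2). specialize (K3 w W3).
  replace (f w * g w - f z * g z) with (f w * (g w - g z) + g z * (f w - f z)) by ring.
  eapply Rle_lt_trans; [apply Cmod_triangle|]. rewrite !Cmod_mult.
  assert (A1 : (Cmod (f w) * Cmod (g w - g z) <= M * (eps / (2 * M)))%R).
  { apply Rmult_le_compat; try apply Cmod_ge_0; lra. }
  replace (M * (eps / (2 * M)))%R with (eps / 2)%R in A1 by (field; lra).
  assert (A2 : (Cmod (g z) * Cmod (f w - f z)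
      < (Cmod (g z) + 1) * (eps / (2 * (Cmod (g z) + 1))))%R).
  { apply Rle_lt_trans with ((Cmod (g z) + 1) * Cmod (f w - f z))%R.
    - apply Rmult_le_compat_r; [apply Cmod_ge_0|lra].
    - apply Rmult_lt_compat_l; lra. }
  replace ((Cmod (g z) + 1) * (eps / (2 * (Cmod (g z) + 1))))%R
    with (eps / 2)%R in A2 by (field; lra).
  lra.
Qed.

Lemma Cinv_nz (a : C) : a <> 0 -> / a <> 0.
Proof.
  intros Ha E. assert (K : a * / a = 1) by (field; auto).
  rewrite E, Cmult_0_r in K. apply RtoC_inj in K. lra.
Qed.

Lemma ccont_inv (f : C -> C) (z : C) :
  ccont f z -> f z <> 0 -> ccont (fun w => / f w) z.
Proof.
  intros Hf Hz eps He. assert (Hz' := proj1 (Cmod_gt_0 _) Hz).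
  destruct (ccont_nz f z Hf Hz) as [d1 [Hd1 K1]].
  set (m := Cmod (f z)) in *.
  destruct (Hf (eps * (m * m / 2))%R) as [d2 [Hd2 K2]].
  { apply Rmult_lt_0_compat; auto. nra. }
  exists (Rmin d1 d2). split; [apply Rmin_pos; auto|]. intros w Hw.
  assert (W1 : (Cmod (w - z) < d1)%R) by (eapply Rlt_le_trans; [exact Hw|apply Rmin_l]).
  assert (W2 : (Cmod (w - z) < d2)%R) by (eapply Rlt_le_trans; [exact Hw|apply Rmin_r]).
  specialize (K1 w W1). specialize (K2 w W2).
  assert (Hw0 : f w <> 0) by (apply Cmod_gt_0; lra).
  replace (/ f w - / f z) with ((f z - f w) / (f w * f z)) by (field; auto).
  rewrite Cmod_div, Cmod_mult, Cmod_sym by (apply Cmult_neq_0; auto). fold m.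
  apply Rmult_lt_reg_r with (Cmod (f w) * m)%R; [nra|].
  unfold Rdiv. rewrite Rmult_assoc, Rinv_l, Rmult_1_r by nra.
  eapply Rlt_le_trans; [exact K2|]. apply Rmult_le_compat_l; [lra|]. nra.
Qed.

Lemma cder_scal (c : C) (f : C -> C) (z l : C) :
  cder f z l -> cder (fun w => c * f w) z (c * l).
Proof.
  intros H eps He. assert (Hc := Cmod_ge_0 c).
  destruct (H (eps / (Cmod c + 1))%R) as [d [Hd K]]; [apply Rdiv_lt_0_compat; lra|].
  exists d. split; auto. intros h Hh. specialize (K h Hh).
  replace (c * f (z + h) - c * f z - c * l * h)
    with (c * (f (z + h) - f z - l * h)) by ring.
  rewrite Cmod_mult.
  apply Rle_trans with ((Cmod c + 1) * (eps / (Cmod c + 1) * Cmod h))%R.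
  - apply Rmult_le_compat; try lra; apply Cmod_ge_0.
  - right. field. lra.
Qed.

Lemma cder_scal_arg (c : C) (f : C -> C) (z l : C) :
  cder f (c * z) l -> cder (fun w => f (c * w)) z (c * l).
Proof.
  intros H eps He. assert (Hc := Cmod_ge_0 c).
  destruct (H (eps / (Cmod c + 1))%R) as [d [Hd K]]; [apply Rdiv_lt_0_compat; lra|].
  exists (d / (Cmod c + 1))%R. split; [apply Rdiv_lt_0_compat; lra|].
  intros h Hh. assert (Hh0 := Cmod_ge_0 h).
  assert (B : (Cmod (c * h) < d)%R).
  { rewrite Cmod_mult. apply Rle_lt_trans with ((Cmod c + 1) * Cmod h)%R.
    - apply Rmult_le_compat_r; lra.
    - apply Rmult_lt_compat_l with (r := (Cmod c + 1)%R) in Hh; [|lra].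
      replace ((Cmod c + 1) * (d / (Cmod c + 1)))%R with d in Hh by (field; lra). auto. }
  specialize (K (c * h) B).
  replace (c * (z + h)) with (c * z + c * h) by ring.
  replace (c * l * h) with (l * (c * h)) by ring.
  eapply Rle_trans; [exact K|]. rewrite Cmod_mult.
  apply Rle_trans with (eps / (Cmod c + 1) * ((Cmod c + 1) * Cmod h))%R.
  - apply Rmult_le_compat_l; [left; apply Rdiv_lt_0_compat; lra|].
    apply Rmult_le_compat_r; lra.
  - right. field. lra.
Qed.

Lemma cder_quot (f g : C -> C) (z l m : C) : cder f z l -> cder g z m -> g z <> 0 ->
  cder (fun w => f w / g w) z ((l * g z - f z * m) / (g z) ^ 2).
Proof.
  intros Hf Hg Hz eps He. assert (Hz' := proj1 (Cmod_gt_0 _) Hz).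
  assert (Cg := cder_ccont _ _ _ Hg).
  assert (Ci' := ccont_inv g z Cg Hz).
  destruct (ccont_bound _ _ Ci') as [d1 [M [Hd1 [HM K1]]]].
  set (L := (l * g z - f z * m) / (g z) ^ 2).
  set (B := (Cmod (f z / g z))%R). assert (HB : (0 <= B)%R) by apply Cmod_ge_0.
  assert (HL := Cmod_ge_0 L).
  destruct (Hf (eps / (3 * M))%R) as [d2 [Hd2 K2]]; [apply Rdiv_lt_0_compat; lra|].
  destruct (Hg (eps / (3 * M * (B + 1)))%R) as [d3 [Hd3 K3]];
    [apply Rdiv_lt_0_compat; auto; apply Rmult_lt_0_compat; lra|].
  destruct (Cg (eps / (3 * M * (Cmod L + 1)))%R) as [d4 [Hd4 K4]];
    [apply Rdiv_lt_0_compat; auto; apply Rmult_lt_0_compat; lra|].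
  destruct (ccont_nz g z Cg Hz) as [d5 [Hd5 K5]].
  exists (Rmin d1 (Rmin d2 (Rmin d3 (Rmin d4 d5)))).
  split; [repeat apply Rmin_pos; auto|]. intros h Hh.
  repeat match goal with H : (_ < Rmin _ _)%R |- _ =>
    let A := fresh in let B := fresh in
    assert (A := Rlt_le_trans _ _ _ H (Rmin_l _ _));
    assert (B := Rlt_le_trans _ _ _ H (Rmin_r _ _)); clear H end.
  assert (E : z + h - z = h) by ring.
  specialize (K1 (z + h)). specialize (K2 h). specialize (K3 h).
  specialize (K4 (z + h)). specialize (K5 (z + h)).
  rewrite E in *. specialize (K1 ltac:(auto)). specialize (K2 ltac:(auto)).
  specialize (K3 ltac:(auto)). specialize (K4 ltac:(auto)). specialize (K5 ltac:(auto)).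
  assert (Hw0 : g (z + h) <> 0) by (apply Cmod_gt_0; lra).
  set (u := f (z + h) - f z - l * h) in *. set (v := g (z + h) - g z - m * h) in *.
  (* Here [u] and [v] are the remainders of [f] and [g]. The linear terms cancel because L g(z) = l
     - (f(z) / g(z)) m. *)
  replace (f (z + h) / g (z + h) - f z / g z - L * h)
    with (/ g (z + h) * (u - f z / g z * v - L * h * (g (z + h) - g z)))
    by (unfold u, v, L; field; auto).
  rewrite Cmod_mult.
  assert (Hh0 := Cmod_ge_0 h).
  apply Rle_trans with (M * (eps / (3 * M) * Cmod h
      + (B + 1) * (eps / (3 * M * (B + 1)) * Cmod h)
      + (Cmod L + 1) * Cmod h * (eps / (3 * M * (Cmod L + 1)))))%R.
  - apply Rmult_le_compat; try apply Cmod_ge_0; [lra|].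
    eapply Rle_trans; [apply Cmod_triangle_sub|]. apply Rplus_le_compat.
    + eapply Rle_trans; [apply Cmod_triangle_sub|]. rewrite Cmod_mult.
      apply Rplus_le_compat; [exact K2|]. fold B.
      apply Rmult_le_compat; try lra. apply Cmod_ge_0.
    + rewrite !Cmod_mult. apply Rmult_le_compat; try lra.
      * apply Rmult_le_pos; lra.
      * apply Cmod_ge_0.
  - right. field. lra.
Qed.

Lemma cder_ext_loc (f g : C -> C) (z l : C) (d : R) : (0 < d)%R ->
  (forall w, (Cmod (w - z) < d)%R -> f w = g w) -> cder f z l -> cder g z l.
Proof.
  intros Hd E H eps He. destruct (H eps He) as [d' [Hd' K]].
  exists (Rmin d d'). split; [apply Rmin_pos; auto|]. intros h Hh.
  rewrite <- !E.
  - apply K. eapply Rlt_le_trans; [exact Hh|apply Rmin_r].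
  - replace (z - z) with (RtoC 0) by ring. rewrite Cmod_0. auto.
  - replace (z + h - z) with h by ring. eapply Rlt_le_trans; [exact Hh|apply Rmin_l].
Qed.

(** * Taylor bounds and termwise differentiation *)

Definition rder (G : R -> C) (t : R) (d : C) : Prop :=
  is_derive (fun t => Re (G t)) t (Re d) /\ is_derive (fun t => Im (G t)) t (Im d).

Lemma im_le_Cmod (z : C) : (Rabs (Im z) <= Cmod z)%R.
Proof. eapply Rle_trans; [|apply Rmax_Cmod]. apply Rmax_r. Qed.

Lemma Cmod_le_Re_Im (z : C) : (Cmod z <= Rabs (Re z) + Rabs (Im z))%R.
Proof.
  replace z with (RtoC (Re z) + Ci * RtoC (Im z)) at 1.
  - eapply Rle_trans; [apply Cmod_triangle|].
    rewrite Cmod_mult, !Cmod_R, Cmod_Ci. lra.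
  - destruct z; apply injective_projections; simpl; ring.
Qed.

(** The mean value theorem holds for the real and the imaginary part separately, at different
    points; this costs the factor 2. *)
Lemma rder_mvt (G dG : R -> C) (D : R) :
  (forall t, (0 <= t <= 1)%R -> rder G t (dG t) /\ (Cmod (dG t) <= D)%R) ->
  (Cmod (G 1%R - G 0%R) <= 2 * D)%R.
Proof.
  intros H.
  assert (X : forall t, (Rabs (t - 0) <= Rabs (1 - 0))%R -> (0 <= t <= 1)%R \/ (t < 0)%R).
  { intros t. rewrite !Rminus_0_r, Rabs_R1. intros K.
    apply Rabs_le_between in K. lra. }
  destruct (MVT_gen (fun t => Re (G t)) 0 1 (fun t => Re (dG t))) as [c1 [Hc1 E1]].
  - intros t. rewrite Rmin_left, Rmax_right by lra. intros Ht. apply H. lra.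
  - intros t. rewrite Rmin_left, Rmax_right by lra. intros Ht.
    apply continuity_pt_filterlim, (ex_derive_continuous (fun t => Re (G t))).
    exists (Re (dG t)). apply H. lra.
  - destruct (MVT_gen (fun t => Im (G t)) 0 1 (fun t => Im (dG t))) as [c2 [Hc2 E2]].
    + intros t. rewrite Rmin_left, Rmax_right by lra. intros Ht. apply H. lra.
    + intros t. rewrite Rmin_left, Rmax_right by lra. intros Ht.
      apply continuity_pt_filterlim, (ex_derive_continuous (fun t => Im (G t))).
      exists (Im (dG t)). apply H. lra.
    + rewrite Rmin_left, Rmax_right in * by lra.
      eapply Rle_trans; [apply Cmod_le_Re_Im|].
      replace (Re (G 1%R - G 0%R)) with (Re (G 1%R) - Re (G 0%R))%R by reflexivity.
      replace (Im (G 1%R - G 0%R)) with (Im (G 1%R) - Im (G 0%R))%R by reflexivity.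
      rewrite E1, E2, Rminus_0_r, !Rmult_1_r.
      assert (K1 := re_le_Cmod (dG c1)). assert (K2 := im_le_Cmod (dG c2)).
      assert (L1 := proj2 (H c1 Hc1)). assert (L2 := proj2 (H c2 Hc2)). lra.
Qed.

Lemma rder_Cexp (z : C) (t : R) : rder (fun t => Cexp (t * z)) t (z * Cexp (t * z)).
Proof.
  destruct z as [a b]. split; unfold Cexp, Re, Im; simpl;
  auto_derive; auto; unfold Rminus; ring.
Qed.

Lemma Cexp_bound (z : C) (t : R) : (0 <= t <= 1)%R -> (Cmod (Cexp (t * z)) <= exp (Cmod z))%R.
Proof.
  intros Ht. rewrite Cmod_Cexp. apply exp_le_compat.
  eapply Rle_trans; [apply Rle_abs|]. eapply Rle_trans; [apply re_le_Cmod|].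
  rewrite Cmod_mult, Cmod_R, Rabs_pos_eq by lra.
  rewrite <- (Rmult_1_l (Cmod z)) at 2. apply Rmult_le_compat_r; [apply Cmod_ge_0|lra].
Qed.

Lemma Cmod_scal_unit (t : R) (z : C) : (0 <= t <= 1)%R -> (Cmod (t * z) <= Cmod z)%R.
Proof.
  intros Ht. rewrite Cmod_mult, Cmod_R, Rabs_pos_eq by lra.
  rewrite <- (Rmult_1_l (Cmod z)) at 2. apply Rmult_le_compat_r; [apply Cmod_ge_0|lra].
Qed.

Lemma Cexp_taylor1 (z : C) : (Cmod (Cexp z - 1) <= 2 * (Cmod z * exp (Cmod z)))%R.
Proof.
  assert (H := rder_mvt (fun t => Cexp (t * z)) (fun t => z * Cexp (t * z))
                 (Cmod z * exp (Cmod z))).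
  cbv beta in H. rewrite Cmult_1_l, Cmult_0_l, Cexp_0 in H. apply H.
  intros t Ht. split; [apply rder_Cexp|]. rewrite Cmod_mult.
  apply Rmult_le_compat_l; [apply Cmod_ge_0|apply Cexp_bound; auto].
Qed.

(** Along t -> t z, the derivative of each Taylor remainder is z times the preceding remainder. Each
    order thus gains a factor |z| and loses the factor 2 of [rder_mvt], which explains the constants
    2, 4, 8. *)
Lemma Cexp_taylor2 (z : C) :
  (Cmod (Cexp z - 1 - z) <= 4 * (Cmod z ^ 2 * exp (Cmod z)))%R.
Proof.
  assert (H := rder_mvt (fun t => Cexp (t * z) - 1 - t * z)
    (fun t => z * (Cexp (t * z) - 1)) (2 * (Cmod z ^ 2 * exp (Cmod z)))).
  cbv beta in H. rewrite Cmult_1_l, Cmult_0_l, Cexp_0 in H.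
  replace (Cexp z - 1 - z - (1 - 1 - 0)) with (Cexp z - 1 - z) in H by ring.
  eapply Rle_trans; [apply H|right; ring].
  intros t Ht. split.
  - destruct (rder_Cexp z t) as [R1 R2]. destruct z as [a b]. split.
    + apply is_derive_ext with (fun t : R => Re (Cexp (t * (a, b))) - 1 - t * a)%R.
      * intros; unfold Re; simpl; ring.
      * unfold Cexp, Re, Im; simpl. auto_derive; auto; unfold Rminus; ring.
    + apply is_derive_ext with (fun t : R => Im (Cexp (t * (a, b))) - t * b)%R.
      * intros; unfold Im; simpl; ring.
      * unfold Cexp, Re, Im; simpl. auto_derive; auto; unfold Rminus; ring.
  - rewrite Cmod_mult. assert (K := Cexp_taylor1 (t * z)).
    assert (K2 := Cmod_scal_unit t z Ht). assert (K3 := exp_le_compat _ _ K2).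
    assert (Hz := Cmod_ge_0 z).
    replace (2 * (Cmod z ^ 2 * exp (Cmod z)))%R
      with (Cmod z * (2 * (Cmod z * exp (Cmod z))))%R by ring.
    apply Rmult_le_compat_l; auto. eapply Rle_trans; [exact K|].
    apply Rmult_le_compat_l; [lra|].
    apply Rmult_le_compat; auto; try apply Cmod_ge_0. left; apply exp_pos.
Qed.

Lemma Cexp_taylor3 (z : C) :
  (Cmod (Cexp z - 1 - z - z ^ 2 / 2) <= 8 * (Cmod z ^ 3 * exp (Cmod z)))%R.
Proof.
  assert (H := rder_mvt (fun t => Cexp (t * z) - 1 - t * z - (t * t) * z ^ 2 / 2)
    (fun t => z * (Cexp (t * z) - 1 - t * z)) (4 * (Cmod z ^ 3 * exp (Cmod z)))).
  cbv beta in H. rewrite !Cmult_1_l, !Cmult_0_l, Cexp_0 in H.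
  replace (Cexp z - 1 - z - z ^ 2 / 2 - (1 - 1 - 0 - 0 / 2))
    with (Cexp z - 1 - z - z ^ 2 / 2) in H by field.
  eapply Rle_trans; [apply H|right; ring].
  intros t Ht. split.
  - destruct z as [a b]. split.
    + apply is_derive_ext with
        (fun t : R => Re (Cexp (t * (a, b))) - 1 - t * a - t * t * Re ((a, b) ^ 2 / 2))%R.
      * intros; unfold Re; simpl; field.
      * unfold Re, Cexp, Im; simpl. auto_derive; auto; unfold Rminus; field.
    + apply is_derive_ext with
        (fun t : R => Im (Cexp (t * (a, b))) - t * b - t * t * Im ((a, b) ^ 2 / 2))%R.
      * intros; unfold Im; simpl; field.
      * unfold Re, Cexp, Im; simpl. auto_derive; auto; unfold Rminus; field.
  - rewrite Cmod_mult. assert (K := Cexp_taylor2 (t * z)).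
    assert (K2 := Cmod_scal_unit t z Ht). assert (K3 := exp_le_compat _ _ K2).
    assert (Hz := Cmod_ge_0 z).
    replace (4 * (Cmod z ^ 3 * exp (Cmod z)))%R
      with (Cmod z * (4 * (Cmod z ^ 2 * exp (Cmod z))))%R by ring.
    apply Rmult_le_compat_l; auto. eapply Rle_trans; [exact K|].
    apply Rmult_le_compat_l; [lra|].
    apply Rmult_le_compat; auto; try (left; apply exp_pos).
    + apply pow_le, Cmod_ge_0.
    + apply pow_incr. split; [apply Cmod_ge_0|exact K2].
Qed.

(* Exponential sums with coefficients decaying faster than every exponential
   of the frequencies define entire functions of [w]. *)
Definition rapid {I : Type} (c lam : I -> C) : Prop :=
  forall B : R, summable (fun i => c i * RtoC (exp (B * Cmod (lam i)))).

Definition expsum {I : Type} (c lam : I -> C) (w : C) : C :=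
  tsum (fun i => c i * Cexp (lam i * w)).

(** |lam| is at most exp(|lam|), which is absorbed by using the hypothesis at B + 1. *)
Lemma rapid_lam {I : Type} (c lam : I -> C) :
  rapid c lam -> rapid (fun i => c i * lam i) lam.
Proof.
  intros H B. apply summable_le with (2 := H (B + 1)%R). intros i.
  rewrite !Cmod_mult, !Cmod_R, !(Rabs_pos_eq (exp _)) by (left; apply exp_pos).
  rewrite Rmult_assoc. apply Rmult_le_compat_l; [apply Cmod_ge_0|].
  rewrite Rmult_plus_distr_r, exp_plus, Rmult_comm, Rmult_1_l.
  apply Rmult_le_compat_l; [left; apply exp_pos|].
  assert (K := exp_ineq1_le (Cmod (lam i))). lra.
Qed.

Lemma rapid_summable {I : Type} (c lam : I -> C) (w : C) :
  rapid c lam -> summable (fun i => c i * Cexp (lam i * w)).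
Proof.
  intros H. apply summable_le with (2 := H (Cmod w)). intros i.
  rewrite !Cmod_mult, !Cmod_R, !(Rabs_pos_eq (exp _)) by (left; apply exp_pos).
  apply Rmult_le_compat_l; [apply Cmod_ge_0|].
  rewrite Cmod_Cexp. apply exp_le_compat.
  eapply Rle_trans; [apply Rle_abs|]. eapply Rle_trans; [apply re_le_Cmod|].
  rewrite Cmod_mult, Rmult_comm. lra.
Qed.

(** The second order Taylor remainders of the terms sum to O(|h|^2), uniformly for |h| < 1. *)
Lemma cder_expsum {I : Type} (c lam : I -> C) (w : C) : rapid c lam ->
  cder (expsum c lam) w (expsum (fun i => c i * lam i) lam w).
Proof.
  intros H eps He.
  (* Of the two extra units, one pays for exp(|lam h|) and the other for |lam|^2, which is at most 4
     exp(|lam|). *)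
  destruct (H (Cmod w + 2)%R) as [M HM].
  assert (HM0 : (0 <= M)%R) by (apply (HM nil); constructor).
  exists (Rmin 1 (eps / (16 * (M + 1)))). split.
  { apply Rmin_pos; [lra|]. apply Rdiv_lt_0_compat; lra. }
  intros h Hh.
  assert (h1 : (Cmod h < 1)%R) by (eapply Rlt_le_trans; [exact Hh|apply Rmin_l]).
  assert (h2 : (Cmod h < eps / (16 * (M + 1)))%R)
    by (eapply Rlt_le_trans; [exact Hh|apply Rmin_r]).
  assert (h0 := Cmod_ge_0 h).
  unfold expsum.
  assert (S1 := rapid_summable c lam (w + h) H).
  assert (S2 := rapid_summable c lam w H).
  assert (S3 := rapid_summable _ lam w (rapid_lam c lam H)). cbv beta in S3.
  rewrite (Cmult_comm _ h), <- tsum_scal, <- !tsum_minus;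
    auto using summable_minus, summable_scal.
  apply Rle_trans with (16 * Cmod h ^ 2 * M)%R.
  - apply tsum_bound.
    intros G NG. eapply Rle_trans; [|apply Rmult_le_compat_l; [|exact (HM G NG)]];
      [|assert (0 <= Cmod h ^ 2)%R by apply pow2_ge_0; lra].
    rewrite <- rsum_scal. apply rsum_le. intros i _.
    replace (c i * Cexp (lam i * (w + h)) - c i * Cexp (lam i * w)
       - h * (c i * lam i * Cexp (lam i * w)))
      with (c i * (Cexp (lam i * w) * (Cexp (lam i * h) - 1 - lam i * h))).
    2:{ rewrite Cmult_plus_distr_l, Cexp_plus. ring. }
    rewrite !Cmod_mult, !Cmod_R, !(Rabs_pos_eq (exp _)) by (left; apply exp_pos).
    set (l := Cmod (lam i)). assert (Hl : (0 <= l)%R) by apply Cmod_ge_0.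
    replace (16 * Cmod h ^ 2 * (Cmod (c i) * exp ((Cmod w + 2) * l)))%R
      with (Cmod (c i) * (16 * Cmod h ^ 2 * exp ((Cmod w + 2) * l)))%R by ring.
    apply Rmult_le_compat_l; [apply Cmod_ge_0|].
    assert (A1 : (Cmod (Cexp (lam i * w)) <= exp (Cmod w * l))%R).
    { rewrite Cmod_Cexp. apply exp_le_compat.
      eapply Rle_trans; [apply Rle_abs|]. eapply Rle_trans; [apply re_le_Cmod|].
      rewrite Cmod_mult, Rmult_comm. unfold l. lra. }
    assert (A2 := Cexp_taylor2 (lam i * h)). rewrite Cmod_mult in A2. fold l in A2.
    assert (A3 : (l ^ 2 <= 4 * exp l)%R).
    { assert (Y := exp_ineq1_le (l / 2)).
      replace (exp l) with (exp (l / 2) * exp (l / 2))%R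
        by (rewrite <- exp_plus; f_equal; lra).
      assert ((1 + l / 2) * (1 + l / 2) <= exp (l / 2) * exp (l / 2))%R
        by (apply Rmult_le_compat; lra).
      simpl. nra. }
    replace ((Cmod w + 2) * l)%R with (Cmod w * l + (l + l))%R by ring.
    rewrite exp_plus.
    replace (16 * Cmod h ^ 2 * (exp (Cmod w * l) * exp (l + l)))%R
      with (exp (Cmod w * l) * (16 * Cmod h ^ 2 * exp (l + l)))%R by ring.
    apply Rmult_le_compat; try apply Cmod_ge_0; auto.
    eapply Rle_trans; [exact A2|]. rewrite exp_plus, Rpow_mult_distr.
    replace (4 * (l ^ 2 * Cmod h ^ 2 * exp (l * Cmod h)))%R
      with (4 * Cmod h ^ 2 * (l ^ 2 * exp (l * Cmod h)))%R by ring.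
    replace (16 * Cmod h ^ 2 * (exp l * exp l))%R
      with (4 * Cmod h ^ 2 * ((4 * exp l) * exp l))%R by ring.
    apply Rmult_le_compat_l.
    { assert (0 <= Cmod h ^ 2)%R by apply pow2_ge_0. lra. }
    apply Rmult_le_compat; auto.
    + apply pow2_ge_0.
    + left; apply exp_pos.
    + apply exp_le_compat. rewrite <- (Rmult_1_r l) at 2.
      apply Rmult_le_compat_l; lra.
  - replace (16 * Cmod h ^ 2 * M)%R with (16 * M * Cmod h * Cmod h)%R by ring.
    apply Rmult_le_compat_r; auto.
    apply Rle_trans with (16 * (M + 1) * Cmod h)%R; [nra|].
    apply Rmult_lt_compat_l with (r := (16 * (M + 1))%R) in h2; [|lra].
    replace (16 * (M + 1) * (eps / (16 * (M + 1))))%R with eps in h2 by (field; lra). lra.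
Qed.

(** A single exponential is an exponential sum over a one-point index set. *)
Lemma cder_Cexp_scal (a w : C) : cder (fun w => Cexp (a * w)) w (a * Cexp (a * w)).
Proof.
  assert (H : rapid (I := unit) (fun _ => 1) (fun _ => a)).
  { intros B. exists (exp (B * Cmod a)). intros G NG.
    assert (Hi : incl G [tt]) by (intros [] _; left; auto).
    eapply Rle_trans; [apply rsum_incl with (H := [tt]); auto|].
    - intros; apply Cmod_ge_0.
    - unfold rsum; simpl. rewrite Cmult_1_l, Cmod_R, Rabs_pos_eq; [lra|left; apply exp_pos]. }
  assert (K := cder_expsum _ _ w H).
  assert (E : forall (g : unit -> C), tsum g = g tt).
  { intros g. apply tsum_eq. intros eps. exists [tt]. split; [apply Forall_True|].
    intros G NG _ Hi. destruct G as [|[] G]; [destruct (Hi tt); simpl; auto|].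
    destruct G as [|[] G]; [|inversion NG; subst; simpl in *; tauto]. simpl.
    replace (g tt + 0 - g tt) with (RtoC 0) by ring. rewrite Cmod_0. apply cond_pos. }
  intros eps He. destruct (K eps He) as [d [Hd Kd]]. exists d. split; auto.
  intros h Hh. specialize (Kd h Hh). unfold expsum in Kd. rewrite !E in Kd.
  rewrite !Cmult_1_l in Kd. exact Kd.
Qed.

Lemma cder_unique (f : C -> C) (z l m : C) : cder f z l -> cder f z m -> l = m.
Proof.
  intros H1 H2. apply Ceq_small. intros eps He.
  destruct (H1 (eps / 4)%R) as [d1 [Hd1 K1]]; [lra|].
  destruct (H2 (eps / 4)%R) as [d2 [Hd2 K2]]; [lra|].
  set (h := (Rmin d1 d2 / 2)%R).
  assert (Hm : (0 < Rmin d1 d2)%R) by (apply Rmin_pos; auto).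
  assert (E : Cmod (RtoC h) = h) by (rewrite Cmod_R; apply Rabs_pos_eq; unfold h; lra).
  specialize (K1 (RtoC h)). specialize (K2 (RtoC h)). rewrite E in K1, K2.
  specialize (K1 ltac:(assert (X := Rmin_l d1 d2); unfold h; lra)).
  specialize (K2 ltac:(assert (X := Rmin_r d1 d2); unfold h; lra)).
  apply Rmult_lt_reg_r with h; [unfold h; lra|].
  rewrite <- E at 1. rewrite <- Cmod_mult.
  replace ((l - m) * h) with ((f (z + h) - f z - m * h) - (f (z + h) - f z - l * h)) by ring.
  eapply Rle_lt_trans; [apply Cmod_triangle_sub|].
  assert (0 < eps * h)%R by (apply Rmult_lt_0_compat; auto; unfold h; lra). lra.
Qed.

(** * Splitting, folding and shifting of sums; the ratio test *)

Lemma is_usum_split {I : Type} (A B : I -> Prop) (f : I -> C) (s t : C) :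
  (forall i, A i <-> ~ B i) -> is_usum A f s -> is_usum B f t -> has_sum f (s + t).
Proof.
  intros AB Hs Ht [eps He].
  assert (He2 : (0 < eps / 2)%R) by lra.
  destruct (Hs (mkposreal _ He2)) as [F [HF KF]].
  destruct (Ht (mkposreal _ He2)) as [F' [HF' KF']].
  exists (F ++ F'). split; [apply Forall_True|].
  intros G NG _ Hi.
  set (a := fun i => if excluded_middle_informative (A i) then true else false).
  assert (Ha : forall i, a i = true <-> A i).
  { intros i. unfold a. destruct excluded_middle_informative; split; auto; discriminate. }
  assert (Hb : forall i, negb (a i) = true <-> B i).
  { intros i. unfold a. destruct excluded_middle_informative as [K|K]; simpl.
    - split; [discriminate|]. intros K'. exfalso. revert K'. apply AB, K.
    - split; auto. intros _. apply NNPP. intros K'. apply K, AB, K'. }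
  assert (E : lsum f G = lsum f (filter a G) + lsum f (filter (fun i => negb (a i)) G)).
  { clear. induction G as [|x G IH].
    - unfold lsum; simpl; ring.
    - rewrite lsum_cons, IH. simpl. destruct (a x); simpl; rewrite lsum_cons; ring. }
  simpl. fold (lsum f G). rewrite E.
  rewrite Forall_forall in HF, HF'.
  assert (K1 : (Cmod (lsum f (filter a G) - s) < eps / 2)%R).
  { apply KF.
    - apply NoDup_filter; auto.
    - apply Forall_forall. intros x Hx. apply filter_In in Hx. apply Ha, Hx.
    - intros x Hx. apply filter_In. split; [apply Hi, in_or_app; auto|apply Ha; auto]. }
  assert (K2 : (Cmod (lsum f (filter (fun i => negb (a i)) G) - t) < eps / 2)%R).
  { apply KF'.
    - apply NoDup_filter; auto.
    - apply Forall_forall. intros x Hx. apply filter_In in Hx. apply Hb, Hx.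
    - intros x Hx. apply filter_In. split; [apply Hi, in_or_app; auto|apply Hb; auto]. }
  match goal with |- (Cmod (?a + ?b - _) < _)%R =>
    replace (a + b - (s + t)) with ((a - s) + (b - t)) by ring end.
  eapply Rle_lt_trans; [apply Cmod_triangle|]. lra.
Qed.

Lemma tsum_split {I J K : Type} (e1 : I -> K) (e2 : J -> K) (f : K -> C) :
  (forall a b, e1 a = e1 b -> a = b) -> (forall a b, e2 a = e2 b -> a = b) ->
  (forall k, (exists i, k = e1 i) <-> ~ (exists j, k = e2 j)) -> summable f ->
  tsum f = tsum (fun i => f (e1 i)) + tsum (fun j => f (e2 j)).
Proof.
  intros H1 H2 H Hs. apply tsum_eq.
  apply is_usum_split with (A := fun k => exists i, k = e1 i)
    (B := fun k => exists j, k = e2 j); auto.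
  - apply (is_usum_reindex e1 (fun _ => True)); auto.
    + intros j; split; intros [i K0]; exists i; [auto|apply K0].
    + apply summable_has_sum, summable_inj; auto.
  - apply (is_usum_reindex e2 (fun _ => True)); auto.
    + intros j; split; intros [i K0]; exists i; [auto|apply K0].
    + apply summable_has_sum, summable_inj; auto.
Qed.

Lemma tsum_unit (g : unit -> C) : tsum g = g tt.
Proof.
  apply tsum_eq. intros eps. exists [tt]. split; [apply Forall_True|].
  intros G NG _ Hi. destruct G as [|[] G]; [destruct (Hi tt); simpl; auto|].
  destruct G as [|[] G]; [|inversion NG; subst; simpl in *; tauto]. simpl.
  replace (g tt + 0 - g tt) with (RtoC 0) by ring. rewrite Cmod_0. apply cond_pos.
Qed.

Lemma tsum_nat_S (f : nat -> C) : summable f -> tsum f = f O + tsum (fun n => f (S n)).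
Proof.
  intros Hs. rewrite (tsum_split (fun _ : unit => O) S f); auto.
  - rewrite tsum_unit. reflexivity.
  - intros [] [] _; reflexivity.
  - intros [|k]; split; intros H.
    + intros [j E]; discriminate.
    + exists tt; auto.
    + destruct H as [_ E]; discriminate.
    + exfalso. apply H. exists k; auto.
Qed.

(** The indices n + 1 and -n are exchanged by k -> 1 - k, the symmetry of [tri]; triple product
    series are folded along it. *)
Lemma tsum_Z_fold (f : Z -> C) : summable f ->
  tsum f = tsum (fun n : nat => f (Z.of_nat n + 1)%Z + f (- Z.of_nat n)%Z).
Proof.
  intros Hs.
  rewrite (tsum_split (fun n : nat => (Z.of_nat n + 1)%Z) (fun n : nat => (- Z.of_nat n)%Z) f);
    auto; try (intros; lia).
  - rewrite tsum_plus; auto.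
    + apply (summable_inj (fun n : nat => (Z.of_nat n + 1)%Z) f); auto. intros; lia.
    + apply (summable_inj (fun n : nat => (- Z.of_nat n)%Z) f); auto. intros; lia.
  - intros k; split.
    + intros [i E] [j E']. lia.
    + intros H. exists (Z.to_nat (k - 1)). destruct (Z_le_gt_dec k 0); [|lia].
      exfalso. apply H. exists (Z.to_nat (- k)). lia.
Qed.

Lemma tsum_Z_shift (f : Z -> C) (k : Z) :
  summable f -> tsum (fun n => f (n + k)%Z) = tsum f.
Proof.
  intros. apply (tsum_reindex (fun n => n + k)%Z (fun n => n - k)%Z); auto; intros; ring.
Qed.

Lemma tsum_Z_refl (f : Z -> C) (k : Z) :
  summable f -> tsum (fun n => f (k - n)%Z) = tsum f.
Proof.
  intros. apply (tsum_reindex (fun n => k - n)%Z (fun n => k - n)%Z); auto; intros; ring.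
Qed.

Lemma summable_ratio (f : nat -> C) (r : R) (N : nat) : (0 <= r < 1)%R ->
  (forall n, (N <= n)%nat -> Cmod (f (S n)) <= r * Cmod (f n))%R -> summable f.
Proof.
  intros Hr Hf.
  apply summable_ext with (fun n => (fun z => f (Z.abs_nat z)) (Z.of_nat n));
    [intros; f_equal; lia|].
  assert (X : forall n, (Cmod (f (N + n)%nat) <= Cmod (f N) * r ^ n)%R).
  { induction n.
    - rewrite Nat.add_0_r. simpl. lra.
    - rewrite Nat.add_succ_r. eapply Rle_trans; [apply Hf; lia|]. simpl.
      rewrite (Rmult_comm r (r ^ n)), <- Rmult_assoc, Rmult_comm.
      apply Rmult_le_compat_r; lra. }
  assert (S1 : summable (fun n => f (N + n)%nat)).
  { apply geom_summable_nat with (Cmod (f N)) r; auto. }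
  destruct S1 as [M HM].
  assert (S2 : summable f).
  { exists (rsum (fun i => Cmod (f i)) (seq 0 N) + M)%R. intros G NG.
    set (H := map (fun n => n - N)%nat (filter (fun n => N <=? n)%nat G)).
    assert (NH : NoDup H).
    { unfold H. assert (NF := NoDup_filter (fun n => N <=? n)%nat NG).
      apply NoDup_map_NoDup_ForallPairs; auto.
      intros a b Ia Ib E. apply filter_In in Ia, Ib. destruct Ia as [_ Ia], Ib as [_ Ib].
      apply Nat.leb_le in Ia, Ib. lia. }
    specialize (HM H NH).
    apply Rle_trans with (rsum (fun i => Cmod (f i)) (seq 0 N ++ map (fun n => N + n)%nat H)).
    - apply rsum_incl; auto; [intros; apply Cmod_ge_0|].
      intros n Hn. apply in_or_app. destruct (Nat.leb_spec N n) as [K|K].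
      + right. apply in_map_iff. exists (n - N)%nat. split; [lia|].
        apply in_map_iff. exists n. split; auto. apply filter_In. split; auto.
        apply Nat.leb_le; auto.
      + left. apply in_seq. lia.
    - rewrite rsum_app, rsum_map. lra. }
  apply summable_ext with f; auto. intros; f_equal; lia.
Qed.

(** * Infinite products and the triple product identity *)

Definition qdisc (q : C) : Prop := q <> 0 /\ (Cmod q < 1)%R.

Lemma qdisc_pow_lt (q : C) (n : nat) : qdisc q -> (Cmod (q ^ S n) <= Cmod q)%R.
Proof.
  intros [Hq0 Hq]. rewrite Cmod_pow. simpl.
  assert (H := Cmod_ge_0 q).
  assert (Cmod q ^ n <= 1)%R by (rewrite <- (pow1 n); apply pow_incr; lra). nra.
Qed.

Lemma qdisc_1m_nz (q : C) (n : nat) : qdisc q -> 1 - q ^ S n <> 0.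
Proof.
  intros Hq E. assert (H := qdisc_pow_lt q n Hq). destruct Hq as [_ Hq].
  replace (q ^ S n) with (RtoC 1) in H.
  - rewrite Cmod_1 in H. lra.
  - replace (RtoC 1) with (1 - q ^ S n + q ^ S n) by ring. rewrite E. ring.
Qed.

Lemma poch_nat_q_nz (q : C) (n : nat) : qdisc q -> poch_nat q q n <> 0.
Proof.
  intros Hq. induction n; simpl; [apply C1_nz|].
  apply Cmult_neq_0; auto. apply (qdisc_1m_nz q n Hq).
Qed.

Definition pser (a : nat -> C) (z : C) : C := tsum (fun n => a n * z ^ n).

Lemma pser_near_0 (a : nat -> C) (z : C) : z <> 0 -> summable (fun n => a n * z ^ n) ->
  exists M : R, (0 <= M)%R /\ forall w, (Cmod w <= Cmod z)%R ->
    summable (fun n => a n * w ^ n) /\ (Cmod (pser a w - a O) <= M * Cmod w)%R.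
Proof.
  intros Hz Hs. assert (Hz' := proj1 (Cmod_gt_0 z) Hz).
  assert (X : forall w, (Cmod w <= Cmod z)%R -> summable (fun n => a n * w ^ n)).
  { intros w Hw. apply summable_le with (2 := Hs). intros n.
    rewrite !Cmod_mult, !Cmod_pow. apply Rmult_le_compat_l; [apply Cmod_ge_0|].
    apply pow_incr. split; [apply Cmod_ge_0|auto]. }
  assert (Hs' := summable_inj S _ ltac:(intros; lia) Hs). cbv beta in Hs'.
  destruct (summable_scal (/ z) _ Hs') as [M HM].
  exists M. split; [apply (HM nil); constructor|].
  intros w Hw. split; auto. unfold pser. rewrite tsum_nat_S by auto.
  replace (a O * w ^ 0 + tsum (fun n => a (S n) * w ^ S n) - a O)
    with (tsum (fun n => a (S n) * w ^ S n)) by (simpl; ring).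
  rewrite Rmult_comm.
  replace (tsum (fun n => a (S n) * w ^ S n)) with (tsum (fun n => w * (a (S n) * w ^ n)))
    by (apply tsum_ext; intros; simpl; ring).
  apply tsum_bound. intros G NG.
  eapply Rle_trans; [|apply Rmult_le_compat_l; [apply Cmod_ge_0|exact (HM G NG)]].
  rewrite <- rsum_scal. apply rsum_le. intros n _. rewrite Cmod_mult.
  apply Rmult_le_compat_l; [apply Cmod_ge_0|].
  replace (/ z * (a (S n) * z ^ S n)) with (a (S n) * z ^ n) by (simpl; field; auto).
  rewrite !Cmod_mult, !Cmod_pow. apply Rmult_le_compat_l; [apply Cmod_ge_0|].
  apply pow_incr. split; [apply Cmod_ge_0|auto].
Qed.

(** Coefficients of Euler's expansion of (z; q)_oo in powers of z. *)
Definition euler_coef (q : C) (n : nat) : C :=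
  (-1) ^ n * q ^^ tri (Z.of_nat n) / poch_nat q q n.

Lemma tri_succ (n : Z) : tri (n + 1) = (tri n + n)%Z.
Proof. assert (H := tri_double n). assert (H' := tri_double (n + 1)). lia. Qed.

Lemma euler_coef_S (q : C) (n : nat) : qdisc q ->
  euler_coef q (S n) * (1 - q ^ S n) = - (q ^ n * euler_coef q n).
Proof.
  intros Hq. assert (H1 := poch_nat_q_nz q n Hq). assert (H2 := qdisc_1m_nz q n Hq).
  unfold euler_coef. rewrite Nat2Z.inj_succ, <- Z.add_1_r, tri_succ, Cpowz_add, Cpowz_nat
    by apply Hq.
  simpl. field. split; auto.
Qed.

Lemma pow_small (r B : R) : (0 <= r < 1)%R -> (0 < B)%R ->
  exists N : nat, forall n, (N <= n)%nat -> (r ^ n < B)%R.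
Proof.
  intros Hr HB. destruct (pow_lt_1_zero r) with B as [N HN]; auto.
  - rewrite Rabs_pos_eq; lra.
  - exists N. intros n Hn. eapply Rle_lt_trans; [apply Rle_abs|]. apply HN. lia.
Qed.

Lemma Cmod_1m_lower (q : C) (n : nat) : qdisc q -> (1 - Cmod q <= Cmod (1 - q ^ S n))%R.
Proof.
  intros Hq. assert (H := qdisc_pow_lt q n Hq).
  assert (K := Cmod_triangle_rev 1 (q ^ S n)). rewrite Cmod_1 in K. lra.
Qed.

Lemma euler_summable (q z : C) : qdisc q -> summable (fun n => euler_coef q n * z ^ n).
Proof.
  intros Hq. assert (Hq' := Hq). destruct Hq' as [Hq0 Hq1].
  assert (Hz := Cmod_ge_0 z). assert (Hqp := Cmod_ge_0 q).
  destruct (pow_small (Cmod q) ((1 - Cmod q) / (2 * (Cmod z + 1)))) as [N HN]; [lra| |].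
  { apply Rdiv_lt_0_compat; lra. }
  apply summable_ratio with (1 / 2)%R N; [lra|]. intros n Hn. specialize (HN n Hn).
  assert (E := euler_coef_S q n Hq). assert (Hnz := qdisc_1m_nz q n Hq).
  assert (L := Cmod_1m_lower q n Hq).
  replace (euler_coef q (S n) * z ^ S n)
    with ((q ^ n * - z / (1 - q ^ S n)) * (euler_coef q n * z ^ n)).
  2:{ replace (euler_coef q (S n)) with (euler_coef q (S n) * (1 - q ^ S n) / (1 - q ^ S n))
        by (field; auto). rewrite E. simpl. field. auto. }
  rewrite Cmod_mult. apply Rmult_le_compat_r; [apply Cmod_ge_0|].
  rewrite Cmod_div, Cmod_mult, Cmod_opp, Cmod_pow by auto.
  apply Rmult_le_reg_r with (Cmod (1 - q ^ S n)); [lra|].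
  unfold Rdiv at 1. rewrite Rmult_assoc, Rinv_l, Rmult_1_r by lra.
  apply Rle_trans with ((1 - Cmod q) / (2 * (Cmod z + 1)) * (Cmod z + 1))%R.
  - apply Rmult_le_compat; try lra. apply pow_le; lra.
  - replace ((1 - Cmod q) / (2 * (Cmod z + 1)) * (Cmod z + 1))%R
      with ((1 - Cmod q) / 2)%R by (field; lra). lra.
Qed.

Definition euler_fun (q z : C) : C := pser (euler_coef q) z.

Lemma euler_fun_step (q z : C) : qdisc q ->
  euler_fun q z = (1 - z) * euler_fun q (q * z).
Proof.
  intros Hq. unfold euler_fun, pser.
  assert (S1 := euler_summable q z Hq). assert (S2 := euler_summable q (q * z) Hq).
  assert (S3 := summable_scal z _ S2). cbv beta in S3.
  assert (S1' := summable_inj S _ ltac:(intros; lia) S1). cbv beta in S1'.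
  assert (S2' := summable_inj S _ ltac:(intros; lia) S2). cbv beta in S2'.
  replace ((1 - z) * tsum (fun n => euler_coef q n * (q * z) ^ n))
    with (tsum (fun n => euler_coef q n * (q * z) ^ n)
      - z * tsum (fun n => euler_coef q n * (q * z) ^ n)) by ring.
  rewrite <- (tsum_scal z) by auto.
  rewrite (tsum_nat_S _ S1).
  rewrite (tsum_nat_S (fun n => euler_coef q n * (q * z) ^ n) S2).
  simpl (_ ^ 0).
  match goal with |- ?a + ?b = ?a + ?c - ?d => replace b with (c - d); [ring|] end.
  rewrite <- tsum_minus by auto. apply tsum_ext. intros n.
  rewrite !Cpow_mult_l.
  replace (euler_coef q (S n) * z ^ S n)
    with (euler_coef q (S n) * (1 - q ^ S n) * z ^ S n + euler_coef q (S n) * q ^ S n * z ^ S n)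
    by ring.
  rewrite (euler_coef_S q n Hq). simpl. ring.
Qed.

Lemma euler_fun_steps (q z : C) (n : nat) : qdisc q ->
  euler_fun q z = poch_nat q z n * euler_fun q (q ^ n * z).
Proof.
  intros Hq. induction n; simpl.
  - rewrite !Cmult_1_l. reflexivity.
  - rewrite IHn, (euler_fun_step q (q ^ n * z)) by auto.
    rewrite (Cmult_comm z). replace (q * (q ^ n * z)) with (q * q ^ n * z) by ring. ring.
Qed.

Lemma euler_coef_0 (q : C) : euler_coef q 0 = 1.
Proof. unfold euler_coef. simpl. field. Qed.

Lemma geom_to_0 (q z : C) (M eps : R) : qdisc q -> (0 <= M)%R -> (0 < eps)%R ->
  exists N, forall n, (N <= n)%nat -> (M * Cmod (q ^ n * z) < eps)%R.
Proof.
  intros [Hq0 Hq1] HM He. assert (Hz := Cmod_ge_0 z). assert (Hqp := Cmod_ge_0 q).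
  assert (Hp : (0 <= M * Cmod z)%R) by (apply Rmult_le_pos; auto).
  destruct (pow_small (Cmod q) (eps / (M * Cmod z + 1))) as [N HN]; [lra| |].
  { apply Rdiv_lt_0_compat; lra. }
  exists N. intros n Hn. specialize (HN n Hn). rewrite Cmod_mult, Cmod_pow.
  replace (M * (Cmod q ^ n * Cmod z))%R with (Cmod q ^ n * (M * Cmod z))%R by ring.
  assert (0 <= Cmod q ^ n)%R by (apply pow_le; lra).
  apply Rle_lt_trans with (Cmod q ^ n * (M * Cmod z + 1))%R; [nra|].
  apply Rmult_lt_compat_r with (r := (M * Cmod z + 1)%R) in HN; [|lra].
  replace (eps / (M * Cmod z + 1) * (M * Cmod z + 1))%R with eps in HN by (field; lra). auto.
Qed.

Lemma euler_fun_near_1 (q z : C) (eps : R) : qdisc q -> (0 < eps)%R ->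
  exists N, forall n, (N <= n)%nat -> (Cmod (euler_fun q (q ^ n * z) - 1) < eps)%R.
Proof.
  intros Hq He.
  destruct (pser_near_0 (euler_coef q) 1 C1_nz (euler_summable q 1 Hq)) as [M [HM K]].
  destruct (geom_to_0 q z M eps Hq HM He) as [N1 HN1].
  destruct (geom_to_0 q z 1 1 Hq ltac:(lra) ltac:(lra)) as [N2 HN2].
  exists (Nat.max N1 N2). intros n Hn. specialize (HN1 n ltac:(lia)). specialize (HN2 n ltac:(lia)).
  destruct (K (q ^ n * z)) as [_ K2]; [rewrite Cmod_1; lra|].
  rewrite euler_coef_0 in K2. unfold euler_fun. lra.
Qed.

(** The recurrence of the coefficients gives f(z) = (z; q)_n f(q^n z) for Euler's series f, and
    f(q^n z) tends to f(0) = 1. This yields at once the convergence of the product and the value of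
    its limit. *)
Lemma poch_nat_lim (q z : C) : qdisc q ->
  filterlim (poch_nat q z) eventually (locally (euler_fun q z)).
Proof.
  intros Hq P HP. apply locally_Cmod' in HP. destruct HP as [d [Hd HP]].
  set (m := Cmod (euler_fun q z)). assert (Hm : (0 <= m)%R) by apply Cmod_ge_0.
  destruct (euler_fun_near_1 q z (Rmin (1 / 2) (d / (2 * (m + 1)))) Hq) as [N HN].
  { apply Rmin_pos; [lra|apply Rdiv_lt_0_compat; lra]. }
  exists N. intros n Hn. specialize (HN n Hn). apply HP.
  assert (H1 := Rlt_le_trans _ _ _ HN (Rmin_l _ _)).
  assert (H2 := Rlt_le_trans _ _ _ HN (Rmin_r _ _)).
  set (e := euler_fun q (q ^ n * z)) in *.
  assert (K := Cmod_triangle_rev 1 (1 - e)). rewrite Cmod_1 in K.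
  replace (1 - (1 - e)) with e in K by ring. rewrite (Cmod_sym 1 e) in K.
  assert (Hmm : m = (Cmod (poch_nat q z n) * Cmod e)%R).
  { unfold m. rewrite (euler_fun_steps q z n Hq), Cmod_mult. reflexivity. }
  rewrite (euler_fun_steps q z n Hq). fold e.
  replace (poch_nat q z n - poch_nat q z n * e) with (poch_nat q z n * (1 - e)) by ring.
  rewrite Cmod_mult, (Cmod_sym 1 e).
  assert (HP0 := Cmod_ge_0 (poch_nat q z n)).
  (* As f(q^n z) lies within 1/2 of 1, its modulus is at least 1/2. *)
  assert (B : (Cmod (poch_nat q z n) <= 2 * m)%R) by (rewrite Hmm; nra).
  apply Rle_lt_trans with (2 * m * Cmod (e - 1))%R.
  - apply Rmult_le_compat_r; [apply Cmod_ge_0|auto].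
  - apply Rle_lt_trans with (2 * (m + 1) * Cmod (e - 1))%R.
    + apply Rmult_le_compat_r; [apply Cmod_ge_0|lra].
    + apply Rmult_lt_compat_l with (r := (2 * (m + 1))%R) in H2; [|lra].
      replace (2 * (m + 1) * (d / (2 * (m + 1))))%R with d in H2 by (field; lra). auto.
Qed.

Lemma poch_inf_euler (q z : C) : qdisc q -> poch_inf q z = euler_fun q z.
Proof.
  intros Hq. unfold poch_inf. apply (iota_unique (V := C_CompleteNormedModule)).
  - intros l Hl. apply (filterlim_locally_unique (V := C_NormedModule) (poch_nat q z) l _ Hl).
    apply poch_nat_lim, Hq.
  - apply poch_nat_lim, Hq.
Qed.

Lemma poch_inf_lim (q z : C) : qdisc q ->
  filterlim (poch_nat q z) eventually (locally (poch_inf q z)).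
Proof. intros Hq. rewrite poch_inf_euler by auto. apply poch_nat_lim, Hq. Qed.

Lemma poch_inf_step (q z : C) : qdisc q -> poch_inf q z = (1 - z) * poch_inf q (q * z).
Proof. intros Hq. rewrite !poch_inf_euler by auto. apply euler_fun_step, Hq. Qed.

Lemma poch_inf_steps (q z : C) (n : nat) : qdisc q ->
  poch_inf q z = poch_nat q z n * poch_inf q (q ^ n * z).
Proof. intros Hq. rewrite !poch_inf_euler by auto. apply euler_fun_steps, Hq. Qed.

Lemma poch_inf_0 (q : C) : qdisc q -> poch_inf q 0 = 1.
Proof.
  intros Hq. rewrite poch_inf_euler by auto. apply Ceq_small. intros eps He.
  destruct (euler_fun_near_1 q 0 eps Hq He) as [N HN]. specialize (HN N (le_n N)).
  rewrite Cmult_0_r in HN. exact HN.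
Qed.

Lemma poch_nat_eq_0 (q z : C) (n : nat) : poch_nat q z n = 0 ->
  exists k, (k < n)%nat /\ z * q ^ k = 1.
Proof.
  induction n; simpl; intros H.
  - destruct (C1_nz H).
  - destruct (classic (poch_nat q z n = 0)) as [K|K].
    + destruct (IHn K) as [k [Hk E]]. exists k. split; [lia|auto].
    + destruct (classic (1 - z * q ^ n = 0)) as [K'|K'].
      * exists n. split; [lia|]. replace (z * q ^ n) with (1 - (1 - z * q ^ n)) by ring.
        rewrite K'. ring.
      * destruct (Cmult_neq_0 _ _ K K' H).
Qed.

(** A tail of the product is close to 1, hence nonzero, so the zero comes from one of finitely many
    factors. *)
Lemma poch_inf_eq_0 (q z : C) : qdisc q -> poch_inf q z = 0 -> exists n, z * q ^ n = 1.
Proof.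
  intros Hq H. rewrite poch_inf_euler in H by auto.
  destruct (euler_fun_near_1 q z 1 Hq ltac:(lra)) as [N HN]. specialize (HN N (le_n N)).
  rewrite (euler_fun_steps q z N Hq) in H.
  destruct (classic (poch_nat q z N = 0)) as [K|K].
  - destruct (poch_nat_eq_0 q z N K) as [k [_ E]]. exists k; auto.
  - exfalso. apply (Cmult_neq_0 _ _ K) in H; auto. intros E. rewrite E in HN.
    replace (0 - 1) with (- (1)) in HN by ring. rewrite Cmod_m1 in HN. lra.
Qed.

Lemma poch_inf_q_nz (q : C) : qdisc q -> poch_inf q q <> 0.
Proof.
  intros Hq H. destruct (poch_inf_eq_0 q q Hq H) as [n E].
  apply (qdisc_1m_nz q n Hq). simpl. rewrite E. ring.
Qed.

Lemma theta_step (q z : C) : qdisc q -> z <> 0 -> theta q (q * z) = - theta q z / z.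
Proof.
  intros Hq Hz. assert (Hq0 := proj1 Hq). unfold theta.
  replace (q / (q * z)) with (/ z) by (field; auto).
  rewrite (poch_inf_step q z), (poch_inf_step q (/ z)) by auto.
  replace (q * / z) with (q / z) by reflexivity. field. auto.
Qed.

Lemma theta_shift (q z : C) (k : Z) : qdisc q -> z <> 0 ->
  theta q (q ^^ k * z) = (-1) ^^ k * z ^^ (- k) * q ^^ (- tri k) * theta q z.
Proof.
  intros Hq Hz. assert (Hq0 := proj1 Hq).
  assert (Y : forall k, theta q (q ^^ (k + 1) * z) = - theta q (q ^^ k * z) / (q ^^ k * z)).
  { intros m. rewrite Cpowz_succ, <- Cmult_assoc by auto.
    apply theta_step; auto. apply Cmult_neq_0; auto. apply Cpowz_nz; auto. }
  assert (X : forall k, (-1) ^^ (k + 1) * z ^^ (- (k + 1)) * q ^^ (- tri (k + 1))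
     = - ((-1) ^^ k * z ^^ (- k) * q ^^ (- tri k)) / (q ^^ k * z)).
  { intros m. rewrite tri_succ.
    replace (- (m + 1))%Z with (- m + - (1))%Z by ring.
    replace (- (tri m + m))%Z with (- tri m + - m)%Z by ring.
    rewrite !Cpowz_add, !Cpowz_opp, !Cpowz_1 by (auto; apply Cm1_nz).
    assert (A := Cpowz_nz z m Hz). assert (B := Cpowz_nz q m Hq0).
    assert (D := Cpowz_nz q (tri m) Hq0). field. auto. }
  revert k. apply Z.peano_ind.
  - change (tri 0) with 0%Z. simpl. rewrite !Cmult_1_l. reflexivity.
  - intros m IH. rewrite <- Z.add_1_r, Y, X, IH.
    assert (B := Cpowz_nz q m Hq0). field. auto.
  - intros m IH. set (n := Z.pred m) in *. replace m with (n + 1)%Z in IH by (unfold n; lia).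
    rewrite Y, X in IH. assert (B := Cpowz_nz q n Hq0).
    transitivity (- (- theta q (q ^^ n * z) / (q ^^ n * z)) * (q ^^ n * z)); [field; auto|].
    rewrite IH. field. auto.
Qed.

Definition tser (q z : C) : C := tsum (fun n : Z => (-1) ^^ n * q ^^ tri n * z ^^ n).

Lemma ln_qdisc (q : C) : qdisc q -> (ln (Cmod q) < 0)%R.
Proof.
  intros [Hq0 Hq1]. apply Cmod_gt_0 in Hq0. rewrite <- ln_1. apply ln_increasing; auto.
Qed.

Lemma tser_summable (q z : C) : qdisc q -> z <> 0 ->
  summable (fun n : Z => (-1) ^^ n * q ^^ tri n * z ^^ n).
Proof.
  intros Hq Hz. assert (Hl := ln_qdisc q Hq).
  apply summable_gauss with 1%R 0%R (ln (Cmod q) / 2)%R (ln (Cmod z) - ln (Cmod q) / 2)%R 0%R.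
  - lra.
  - intros n. rewrite !Cmod_mult, Cmod_m1_powz, !Cmod_powz by (auto; apply Hq).
    rewrite IZR_tri, !Rmult_1_l, <- exp_plus. right. f_equal. field.
Qed.

Lemma tser_step (q z : C) : qdisc q -> z <> 0 -> tser q (q * z) = - tser q z / z.
Proof.
  intros Hq Hz. assert (Hq0 := proj1 Hq). unfold tser.
  rewrite <- (tsum_Z_shift (fun n : Z => (-1) ^^ n * q ^^ tri n * z ^^ n) 1)
    by (apply tser_summable; auto).
  replace (- tsum (fun n => (-1) ^^ (n + 1) * q ^^ tri (n + 1) * z ^^ (n + 1)) / z)
    with (- / z * tsum (fun n => (-1) ^^ (n + 1) * q ^^ tri (n + 1) * z ^^ (n + 1)))
    by (field; auto).
  rewrite <- tsum_scal.
  - apply tsum_ext. intros n. rewrite tri_succ, !Cpowz_add, Cpowz_mult_l, !Cpowz_1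
      by (auto; apply Cm1_nz). field. auto.
  - apply (summable_inj (fun n => n + 1)%Z (fun n : Z => (-1) ^^ n * q ^^ tri n * z ^^ n));
      [intros; lia|apply tser_summable; auto].
Qed.

(** Coefficients of Euler's companion expansion, that of 1 / (w; q)_oo for |w| < 1. *)
Definition euler2_coef (q : C) (n : nat) : C := / poch_nat q q n.

Lemma euler2_summable (q w : C) : qdisc q -> (Cmod w < 1)%R ->
  summable (fun n => euler2_coef q n * w ^ n).
Proof.
  intros Hq Hw. assert (Hq1 := proj2 Hq). assert (Hw0 := Cmod_ge_0 w).
  assert (Hqp := Cmod_ge_0 q).
  destruct (pow_small (Cmod q) ((1 - Cmod w) / 2)) as [N HN]; [lra|lra|].
  set (r := (2 * Cmod w / (1 + Cmod w))%R).
  assert (Er : (r * (1 + Cmod w) = 2 * Cmod w)%R) by (unfold r; field; lra).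
  assert (Hr : (0 <= r < 1)%R).
  { split; [unfold r; apply Rdiv_le_0_compat; lra|]. apply Rmult_lt_reg_r with (1 + Cmod w)%R; lra. }
  apply summable_ratio with r N; auto.
  intros n Hn. assert (HN' := HN (S n) ltac:(lia)).
  assert (Hnz := qdisc_1m_nz q n Hq). assert (Hp := poch_nat_q_nz q n Hq).
  replace (euler2_coef q (S n) * w ^ S n) with (w / (1 - q ^ S n) * (euler2_coef q n * w ^ n)).
  2:{ unfold euler2_coef. simpl. field. split; auto. }
  rewrite Cmod_mult. apply Rmult_le_compat_r; [apply Cmod_ge_0|].
  assert (K := Cmod_triangle_rev 1 (q ^ S n)). rewrite Cmod_1, Cmod_pow in K.
  rewrite Cmod_div by auto.
  apply Rmult_le_reg_r with (Cmod (1 - q ^ S n)); [lra|].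
  unfold Rdiv. rewrite Rmult_assoc, Rinv_l, Rmult_1_r by lra. nra.
Qed.

(** The product of the two functions is invariant under w -> q w, by their functional equations, and
    tends to 1 along w, q w, q^2 w, ... *)
Lemma euler2_inv (q w : C) : qdisc q -> (Cmod w < 1)%R ->
  pser (euler2_coef q) w * poch_inf q w = 1.
Proof.
  intros Hq Hw.
  assert (step : forall w, (Cmod w < 1)%R ->
     pser (euler2_coef q) w * (1 - w) = pser (euler2_coef q) (q * w)).
  { clear w Hw. intros w Hw. unfold pser.
    assert (S1 := euler2_summable q w Hq Hw).
    assert (Hqw : (Cmod (q * w) < 1)%R).
    { rewrite Cmod_mult. assert (A := Cmod_ge_0 q). assert (B := Cmod_ge_0 w).
      destruct Hq. nra. }
    assert (S2 := euler2_summable q (q * w) Hq Hqw).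
    assert (S1' := summable_inj S _ ltac:(intros; lia) S1). cbv beta in S1'.
    assert (S2' := summable_inj S _ ltac:(intros; lia) S2). cbv beta in S2'.
    replace (tsum (fun n => euler2_coef q n * w ^ n) * (1 - w))
      with (tsum (fun n => euler2_coef q n * w ^ n)
        - w * tsum (fun n => euler2_coef q n * w ^ n)) by ring.
    rewrite <- (tsum_scal w) by auto. rewrite (tsum_nat_S _ S1), (tsum_nat_S _ S2).
    simpl (_ ^ 0).
    match goal with |- ?a + ?b - ?c = ?a + ?d => replace d with (b - c); [ring|] end.
    rewrite <- tsum_minus; auto using summable_scal.
    apply tsum_ext. intros n. rewrite Cpow_mult_l. unfold euler2_coef.
    assert (Hnz := qdisc_1m_nz q n Hq). assert (Hp := poch_nat_q_nz q n Hq).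
    simpl in *. field. split; auto. }
  assert (X : forall n, pser (euler2_coef q) w * poch_inf q w =
    pser (euler2_coef q) (q ^ n * w) * poch_inf q (q ^ n * w)).
  { assert (Hn : forall n, (Cmod (q ^ n * w) < 1)%R).
    { intros n. rewrite Cmod_mult, Cmod_pow. assert (A := Cmod_ge_0 q).
      assert (B := Cmod_ge_0 w). assert (D : (Cmod q ^ n <= 1)%R).
      { rewrite <- (pow1 n). apply pow_incr. destruct Hq; lra. }
      assert (0 <= Cmod q ^ n)%R by (apply pow_le; auto). nra. }
    induction n; simpl; [rewrite Cmult_1_l; reflexivity|].
    rewrite IHn, (poch_inf_step q (q ^ n * w)) by auto.
    rewrite Cmult_assoc, step by auto. rewrite (Cmult_assoc q). reflexivity. }
  assert (E0 : euler2_coef q 0 = 1) by (unfold euler2_coef; simpl; field).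
  apply Ceq_small. intros eps He.
  assert (Hhalf : (Cmod (RtoC (1 / 2)) < 1)%R) by (rewrite Cmod_R, Rabs_pos_eq; lra).
  assert (Hhz : RtoC (1 / 2) <> 0) by (intros E; apply RtoC_inj in E; lra).
  destruct (pser_near_0 _ _ Hhz (euler2_summable q _ Hq Hhalf)) as [M [HM K]].
  set (d := Rmin (1 / 2) (eps / 4)).
  assert (Hd : (0 < d)%R) by (apply Rmin_pos; lra).
  assert (d1 : (d <= 1 / 2)%R) by apply Rmin_l.
  assert (d2 : (d <= eps / 4)%R) by apply Rmin_r.
  destruct (geom_to_0 q w M d Hq HM Hd) as [N1 HN1].
  destruct (geom_to_0 q w 1 (1/2) Hq ltac:(lra) ltac:(lra)) as [N2 HN2].
  destruct (euler_fun_near_1 q w d Hq Hd) as [N3 HN3].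
  set (n := (N1 + N2 + N3)%nat). rewrite (X n).
  specialize (HN1 n ltac:(lia)). specialize (HN2 n ltac:(lia)). specialize (HN3 n ltac:(lia)).
  rewrite poch_inf_euler by auto.
  destruct (K (q ^ n * w)) as [_ K2]; [rewrite Cmod_R, Rabs_pos_eq; lra|].
  rewrite E0 in K2. set (a := pser (euler2_coef q) (q ^ n * w)) in *. set (b := euler_fun q (q ^ n * w)) in *.
  replace (a * b - 1) with ((a - 1) * (b - 1) + (a - 1) + (b - 1)) by ring.
  eapply Rle_lt_trans; [apply Cmod_triangle|].
  eapply Rle_lt_trans; [apply Rplus_le_compat_r, Cmod_triangle|].
  rewrite Cmod_mult. assert (A0 := Cmod_ge_0 (a - 1)). assert (B0 := Cmod_ge_0 (b - 1)).
  nra.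
Qed.

Lemma poch_nat_zero_factor (q z : C) (k n : nat) :
  (k < n)%nat -> z * q ^ k = 1 -> poch_nat q z n = 0.
Proof.
  intros Hk E. induction n; [lia|]. simpl.
  destruct (Nat.eq_dec k n) as [->|].
  - rewrite E. ring.
  - rewrite IHn by lia. ring.
Qed.

(** Multiply the Laurent series by Euler's series for 1 / (q/z; q)_oo, which converges since |q| <
    |z|. Summed along diagonals, the inner sum is Euler's series for (q^(n+1); q)_oo; it vanishes
    for n < 0, and the terms with n >= 0 rebuild (q; q)_oo (z; q)_oo. *)
Lemma tser_theta_near (q z : C) : qdisc q -> z <> 0 -> (Cmod q < Cmod z)%R ->
  tser q z = poch_inf q q * theta q z.
Proof.
  intros Hq Hz Hlt. assert (Hq0 := proj1 Hq).
  assert (Hz' := proj1 (Cmod_gt_0 z) Hz).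
  assert (Hw : (Cmod (q / z) < 1)%R).
  { rewrite Cmod_div by auto. apply Rmult_lt_reg_r with (Cmod z); auto.
    unfold Rdiv. rewrite Rmult_assoc, Rinv_l; lra. }
  assert (S1 := tser_summable q z Hq Hz).
  assert (S2 := euler2_summable q (q / z) Hq Hw).
  assert (SP := summable_mult _ _ S1 S2).
  assert (H : tser q z * pser (euler2_coef q) (q / z) = poch_inf q q * poch_inf q z).
  { unfold tser, pser. rewrite <- tsum_mult by auto.
    set (f := fun p : Z * nat => (-1) ^^ fst p * q ^^ tri (fst p) * z ^^ fst p *
          (euler2_coef q (snd p) * (q / z) ^ snd p)).
    change (tsum f = poch_inf q q * poch_inf q z).
    (* The new first index is the exponent of z in the product. By tri(n + m) = tri(n) + tri(m) + n
       m the dependence on m becomes that of an Euler series at q^(n+1). *)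
    set (e := fun p : Z * nat => (fst p + Z.of_nat (snd p), snd p)%Z).
    rewrite <- (tsum_reindex e (fun p => (fst p - Z.of_nat (snd p), snd p)%Z) f); auto.
    2,3: intros [a b]; unfold e; simpl; f_equal; ring.
    assert (SE : summable (fun p => f (e p))).
    { apply (summable_inj e f); auto. intros [a b] [a' b'] E.
      unfold e in E; simpl in E. inversion E; subst. f_equal; lia. }
    rewrite (tsum_fubini (fun p => f (e p))) by auto.
    assert (P : forall n, tsum (fun m : nat => f (e (n, m))) =
       (-1) ^^ n * q ^^ tri n * z ^^ n * poch_inf q (q ^^ (n + 1))).
    { intros n. rewrite poch_inf_euler by auto. unfold euler_fun, pser.
      rewrite <- tsum_scal by (apply euler_summable; auto).
      apply tsum_ext. intros m. unfold f, e, euler2_coef, euler_coef. simpl fst. simpl snd.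
      assert (Hp := poch_nat_q_nz q m Hq).
      replace (tri (n + Z.of_nat m))
        with (tri n + tri (Z.of_nat m) + n * Z.of_nat m)%Z.
      2:{ assert (A := tri_double n). assert (B := tri_double (Z.of_nat m)).
          assert (D := tri_double (n + Z.of_nat m)). nia. }
      rewrite <- !Cpowz_nat, !Cpowz_add by (auto; apply Cm1_nz).
      unfold Cdiv at 1. rewrite Cpowz_mult_l by (auto using Cinv_nz).
      rewrite Cpowz_1, (Cpowz_mult_l (q ^^ n)), <- Cpowz_mul by (auto using Cpowz_nz).
      replace ((/ z) ^^ Z.of_nat m) with (/ (z ^^ Z.of_nat m)).
      2:{ rewrite !Cpowz_nat, Cpow_inv; auto. }
      assert (Hzm := Cpowz_nz z (Z.of_nat m) Hz).
      field. split; auto. }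
    assert (SR := summable_rows _ SE). cbv beta in SR.
    rewrite (tsum_ext _ _ P). apply (summable_ext _ _ P) in SR.
    rewrite (tsum_split Z.of_nat (fun m : nat => - Z.of_nat m - 1)%Z); auto; try (intros; lia).
    (* For n = -j - 1 the product is (q^(-j); q)_oo, whose factor of index j is zero. *)
    - rewrite (tsum_ext (fun j : nat => _ * poch_inf q (q ^^ (- Z.of_nat j - 1 + 1))) (fun _ => 0)).
      + rewrite tsum_0, Cplus_0_r. rewrite (poch_inf_euler q z) by auto.
        unfold euler_fun, pser. rewrite <- tsum_scal by (apply euler_summable; auto).
        apply tsum_ext. intros n. rewrite (poch_inf_steps q q n) by auto.
        replace (q ^ n * q) with (q ^^ (Z.of_nat n + 1))
          by (rewrite Cpowz_succ, Cpowz_nat by auto; ring).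
        unfold euler_coef. rewrite !Cpowz_nat.
        assert (Hp := poch_nat_q_nz q n Hq). field. auto.
      + intros m. rewrite (poch_inf_steps q _ (S m)), (poch_nat_zero_factor q _ m (S m)) by
          (auto; rewrite <- Cpowz_nat, <- Cpowz_add by auto;
           replace (- Z.of_nat m - 1 + 1 + Z.of_nat m)%Z with 0%Z by ring; reflexivity).
        ring.
    - intros k; split.
      + intros [i E] [j E']. lia.
      + intros K. exists (Z.to_nat k). destruct (Z_le_gt_dec 0 k); [lia|].
        exfalso. apply K. exists (Z.to_nat (- k - 1)). lia. }
  unfold theta. rewrite Cmult_assoc, <- H.
  rewrite <- Cmult_assoc, euler2_inv by auto. ring.
Qed.

(** Both sides have the same transformation under z -> q z, and z / q^N has modulus larger than |q|
    for large N; the identity known there is carried back to z. *)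
Lemma jacobi_triple (q z : C) : qdisc q -> z <> 0 ->
  tser q z = poch_inf q q * theta q z.
Proof.
  intros Hq Hz. assert (Hq0 := proj1 Hq). assert (Hqp := proj1 (Cmod_gt_0 q) Hq0).
  assert (Hzp := proj1 (Cmod_gt_0 z) Hz).
  assert (X : forall n : nat, tser q (z / q ^ n) = poch_inf q q * theta q (z / q ^ n) ->
     tser q z = poch_inf q q * theta q z).
  { induction n; intros H.
    - simpl in H. replace (z / 1) with z in H by field. auto.
    - apply IHn. assert (Hn := Cpow_nz q n Hq0).
      assert (Hw : z / q ^ S n <> 0).
      { apply Cmult_neq_0; auto. apply Cinv_nz, Cpow_nz; auto. }
      replace (z / q ^ n) with (q * (z / q ^ S n)) by (simpl; field; auto).
      rewrite tser_step, theta_step, H by auto. field; repeat split; auto; apply Cpow_nz; auto. }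
  destruct (pow_small (Cmod q) (Cmod z)) as [N HN]; [destruct Hq; lra|auto|].
  assert (HN' := HN (S N) ltac:(lia)). assert (Hn := Cpow_nz q N Hq0).
  apply (X N). apply tser_theta_near; auto.
  - apply Cmult_neq_0; auto. apply Cinv_nz; auto.
  - rewrite Cmod_div, Cmod_pow by auto. assert (0 < Cmod q ^ N)%R by (apply pow_lt; auto).
    apply Rmult_lt_reg_r with (Cmod q ^ N)%R; auto.
    unfold Rdiv. rewrite Rmult_assoc, Rinv_l, Rmult_1_r by lra. exact HN'.
Qed.

Lemma theta_eq_0 (q z : C) : qdisc q -> z <> 0 -> theta q z = 0 -> is_int_power q z.
Proof.
  intros Hq Hz H. assert (Hq0 := proj1 Hq). unfold theta in H.
  destruct (classic (poch_inf q z = 0)) as [K|K].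
  - destruct (poch_inf_eq_0 q z Hq K) as [n E]. exists (- Z.of_nat n)%Z.
    rewrite Cpowz_opp, Cpowz_nat by auto. assert (Hn := Cpow_nz q n Hq0).
    transitivity (z * q ^ n / q ^ n); [field; auto|]. rewrite E. field. auto.
  - destruct (classic (poch_inf q (q / z) = 0)) as [K'|K'];
      [|destruct (Cmult_neq_0 _ _ K K' H)].
    destruct (poch_inf_eq_0 q _ Hq K') as [n E]. exists (Z.of_nat n + 1)%Z.
    rewrite Cpowz_succ, Cpowz_nat by auto.
    transitivity (q / z * q ^ n * z); [rewrite E; ring|]. field. auto.
Qed.

Lemma theta_1 (q : C) : qdisc q -> theta q 1 = 0.
Proof.
  intros Hq. unfold theta. rewrite (poch_inf_step q 1) by auto. ring.
Qed.

Lemma theta_nz (q z : C) : qdisc q -> z <> 0 -> ~ is_int_power q z -> theta q z <> 0.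
Proof. intros Hq Hz H E. apply H, theta_eq_0; auto. Qed.

(** * Products in base q and in base q^2 *)

Lemma poch_inf_square (q z : C) : qdisc q ->
  poch_inf q z * poch_inf q (- z) = poch_inf (q ^ 2) (z ^ 2).
Proof.
  intros Hq. assert (Hq2 : qdisc (q ^ 2)).
  { split; [apply Cpow_nz, Hq|]. rewrite Cmod_pow. destruct Hq.
    assert (H1 := Cmod_ge_0 q). simpl; nra. }
  assert (H1 := poch_inf_lim q z Hq). assert (H2 := poch_inf_lim q (- z) Hq).
  assert (H3 := poch_inf_lim (q ^ 2) (z ^ 2) Hq2).
  apply (filterlim_locally_unique (V := C_NormedModule) (poch_nat (q ^ 2) (z ^ 2))
    (F := eventually)); auto.
  assert (E : forall n, poch_nat (q ^ 2) (z ^ 2) n = poch_nat q z n * poch_nat q (- z) n).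
  { induction n; [simpl; ring|]. cbn [poch_nat].
    rewrite IHn, <- Cpow_mult_r, Nat.mul_comm, Cpow_mult_r. ring. }
  apply filterlim_ext with (fun n => scal (poch_nat q z n) (poch_nat q (- z) n)).
  { intros n. symmetry. apply E. }
  apply (filterlim_comp_2 _ _ _ H1 H2).
  assert (K := filterlim_scal (K := C_AbsRing) (V := C_NormedModule) (poch_inf q z) (poch_inf q (- z))).
  intros P HP. specialize (K P HP). destruct K as [Q R HQ HR K].
  exists Q R; auto. apply locally_C. exact HQ.
Qed.

Lemma poch_nat_dissect (q z : C) (n : nat) :
  poch_nat q z (2 * n) = poch_nat (q ^ 2) z n * poch_nat (q ^ 2) (z * q) n.
Proof.
  induction n; [simpl; ring|].
  replace (2 * S n)%nat with (S (S (2 * n))) by lia. cbn [poch_nat].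
  rewrite IHn, <- !Cpow_mult_r. replace (q ^ S (2 * n)) with (q * q ^ (2 * n)) by reflexivity.
  ring.
Qed.

Lemma qdisc_sq (q : C) : qdisc q -> qdisc (q ^ 2).
Proof.
  intros Hq. split; [apply Cpow_nz, Hq|]. rewrite Cmod_pow. destruct Hq.
  assert (H1 := Cmod_ge_0 q). simpl; nra.
Qed.

Lemma poch_inf_dissect (q z : C) : qdisc q ->
  poch_inf (q ^ 2) z * poch_inf (q ^ 2) (z * q) = poch_inf q z.
Proof.
  intros Hq. assert (Hq2 := qdisc_sq q Hq).
  assert (H1 := poch_inf_lim (q ^ 2) z Hq2). assert (H2 := poch_inf_lim (q ^ 2) (z * q) Hq2).
  assert (H3 := poch_inf_lim q z Hq).
  apply (filterlim_locally_unique (V := C_NormedModule) (fun n => poch_nat q z (2 * n))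
    (F := eventually)).
  - apply filterlim_ext with
      (fun n => scal (poch_nat (q ^ 2) z n) (poch_nat (q ^ 2) (z * q) n)).
    { intros n. symmetry. apply poch_nat_dissect. }
    apply (filterlim_comp_2 _ _ _ H1 H2).
    assert (K := filterlim_scal (K := C_AbsRing) (V := C_NormedModule)
      (poch_inf (q ^ 2) z) (poch_inf (q ^ 2) (z * q))).
    intros P HP. specialize (K P HP). destruct K as [Q R HQ HR K].
    exists Q R; auto. apply locally_C. exact HQ.
  - apply filterlim_comp with (2 := H3). intros P [N HN]. exists N. intros n Hn.
    apply HN. lia.
Qed.

(** Euler's theorem on partitions into odd and into distinct parts, as an identity of products:
    (q)_oo (-q)_oo and (q)_oo / (q; q^2)_oo are both (q^2; q^2)_oo. *)
Lemma poch_euler_odd (q : C) : qdisc q -> poch_inf q (- q) * poch_inf (q ^ 2) q = 1.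
Proof.
  intros Hq. assert (H1 := poch_inf_square q q Hq). assert (H2 := poch_inf_dissect q q Hq).
  assert (Hnz := poch_inf_q_nz q Hq).
  replace (q * q) with (q ^ 2) in H2 by (simpl; ring).
  rewrite <- H1 in H2.
  transitivity (poch_inf (q ^ 2) q * (poch_inf q q * poch_inf q (- q)) / poch_inf q q).
  - field. auto.
  - rewrite H2. field. auto.
Qed.

(** [theta] with its zero at 1 divided out; its value at 1 is (q)_oo^2. *)
Definition phi (q z : C) : C := poch_inf q (q * z) * poch_inf q (q / z).

Lemma theta_phi (q z : C) : qdisc q -> theta q z = (1 - z) * phi q z.
Proof. intros Hq. unfold theta, phi. rewrite (poch_inf_step q z) by auto. ring. Qed.

(** Along z = a exp(b w), Euler's power series is an exponential sum in w, so [cder_expsum]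
    applies. *)
Lemma ccont_poch (q a b w : C) : qdisc q ->
  ccont (fun w => poch_inf q (a * Cexp (b * w))) w.
Proof.
  intros Hq.
  assert (R : rapid (fun n : nat => euler_coef q n * a ^ n) (fun n => RtoC (INR n) * b)).
  { intros B.
    assert (S := euler_summable q (a * RtoC (exp (B * Cmod b))) Hq).
    apply summable_ext with (2 := S). intros n.
    rewrite Cpow_mult_l, Cmult_assoc. f_equal. rewrite <- RtoC_pow. f_equal.
    rewrite exp_nat_pow. f_equal. rewrite Cmod_mult, Cmod_R, Rabs_pos_eq by apply pos_INR. ring. }
  assert (K := cder_ccont _ _ _ (cder_expsum _ _ w R)).
  intros eps He. destruct (K eps He) as [d [Hd Kd]]. exists d. split; auto.
  intros v Hv. specialize (Kd v Hv).
  assert (E : forall v, poch_inf q (a * Cexp (b * v)) =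
     expsum (fun n : nat => euler_coef q n * a ^ n) (fun n => RtoC (INR n) * b) v).
  { intros u. rewrite poch_inf_euler by auto. unfold euler_fun, pser, expsum.
    apply tsum_ext. intros n. rewrite Cpow_mult_l, <- Cmult_assoc. do 2 f_equal.
    rewrite <- Cpowz_nat, <- Cexp_Zmult, <- INR_IZR_INZ. f_equal. ring. }
  rewrite !E. exact Kd.
Qed.

(** At a zero of [g] the product rule requires only continuity of [f]. It serves to differentiate (1
    - z) times a product at z = 1. *)
Lemma cder_mult_zero (g f : C -> C) (z l : C) :
  cder g z l -> g z = 0 -> ccont f z -> cder (fun w => g w * f w) z (l * f z).
Proof.
  intros Hg Hgz Hf eps He.
  destruct (ccont_bound f z Hf) as [d1 [M [Hd1 [HM K1]]]].
  destruct (Hg (eps / (2 * M))%R) as [d2 [Hd2 K2]]; [apply Rdiv_lt_0_compat; lra|].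
  assert (Hl := Cmod_ge_0 l).
  destruct (Hf (eps / (2 * (Cmod l + 1)))%R) as [d3 [Hd3 K3]];
    [apply Rdiv_lt_0_compat; lra|].
  exists (Rmin d1 (Rmin d2 d3)). split; [repeat apply Rmin_pos; auto|].
  intros h Hh. assert (h0 := Cmod_ge_0 h).
  assert (W1 : (Cmod h < d1)%R) by (eapply Rlt_le_trans; [exact Hh|apply Rmin_l]).
  assert (W2 : (Cmod h < d2)%R).
  { eapply Rlt_le_trans; [exact Hh|]. eapply Rle_trans; [apply Rmin_r|apply Rmin_l]. }
  assert (W3 : (Cmod h < d3)%R).
  { eapply Rlt_le_trans; [exact Hh|]. eapply Rle_trans; [apply Rmin_r|apply Rmin_r]. }
  assert (E : z + h - z = h) by ring.
  specialize (K1 (z + h)). specialize (K2 h W2). specialize (K3 (z + h)).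
  rewrite E in K1, K3. specialize (K1 W1). specialize (K3 W3).
  rewrite Hgz in *.
  replace (g (z + h) * f (z + h) - 0 * f z - l * f z * h)
    with ((g (z + h) - 0 - l * h) * f (z + h) + l * h * (f (z + h) - f z)) by ring.
  eapply Rle_trans; [apply Cmod_triangle|]. rewrite !Cmod_mult.
  apply Rle_trans with (eps / (2 * M) * Cmod h * M
     + (Cmod l + 1) * Cmod h * (eps / (2 * (Cmod l + 1))))%R.
  - apply Rplus_le_compat; apply Rmult_le_compat; try apply Cmod_ge_0; try lra.
    + apply Rmult_le_pos; auto.
  - right. field. lra.
Qed.

Lemma Rabs_2n1 (n : Z) : (Rabs (IZR (2 * n + 1)) <= 2 * Rabs (IZR n) + 1)%R.
Proof.
  rewrite plus_IZR, mult_IZR. eapply Rle_trans; [apply Rabs_triang|].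
  rewrite Rabs_mult, (Rabs_pos_eq 2), Rabs_R1; lra.
Qed.

Lemma rapid_gauss (c lam : Z -> C) (c2 c1 c0 L : R) : (c2 < 0)%R -> (0 <= L)%R ->
  (forall n, Cmod (c n) <= exp (c2 * (IZR n * IZR n) + c1 * IZR n + c0))%R ->
  (forall n, Cmod (lam n) <= L * (2 * Rabs (IZR n) + 1))%R -> rapid c lam.
Proof.
  intros Hc2 HL Hc Hlam B.
  apply summable_gauss with 1%R (2 * (Rabs B * L))%R c2 c1 (c0 + Rabs B * L)%R; auto.
  intros n. rewrite Cmod_mult, Cmod_R, (Rabs_pos_eq (exp _)) by (left; apply exp_pos).
  rewrite Rmult_1_l.
  apply Rle_trans with (exp (c2 * (IZR n * IZR n) + c1 * IZR n + c0)
     * exp (Rabs B * (L * (2 * Rabs (IZR n) + 1))))%R.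
  - apply Rmult_le_compat; auto; [apply Cmod_ge_0|left; apply exp_pos|].
    apply exp_le_compat. eapply Rle_trans; [apply Rle_abs|]. rewrite Rabs_mult.
    apply Rmult_le_compat_l; [apply Rabs_pos|].
    rewrite Rabs_pos_eq by apply Cmod_ge_0. auto.
  - rewrite <- exp_plus. right. f_equal. ring.
Qed.

Lemma Cmod_Cmult_PI : Cmod (PI * Ci) = PI.
Proof.
  rewrite Cmod_mult, Cmod_Ci, Cmod_R, Rabs_pos_eq by (left; apply PI_RGT_0). ring.
Qed.

Lemma two_pi_i_nz : 2 * PI * Ci <> 0.
Proof.
  apply Cmod_gt_0. rewrite <- Cmult_assoc, Cmod_mult, Cmod_Cmult_PI, Cmod_R, Rabs_pos_eq by lra.
  assert (H := PI_RGT_0). lra.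
Qed.

(** The triple product with z = exp(2 pi i w), differentiated at w = 0: the series gives 2 pi i
    times the sum, and the factor 1 - z leaves -2 pi i (q)_oo^3 on the product side. *)
Lemma jacobi_cube (q : C) : qdisc q ->
  tsum (fun n : Z => (-1) ^^ n * q ^^ tri n * IZR n) = - poch_inf q q ^ 3.
Proof.
  intros Hq. assert (Hl := ln_qdisc q Hq).
  set (c := fun n : Z => (-1) ^^ n * q ^^ tri n). set (lam := fun n : Z => 2 * PI * Ci * IZR n).
  assert (R : rapid c lam).
  { apply rapid_gauss with (ln (Cmod q) / 2)%R (- ln (Cmod q) / 2)%R 0%R (PI)%R.
    - lra.
    - left; apply PI_RGT_0.
    - intros n. unfold c. rewrite Cmod_mult, Cmod_m1_powz, Cmod_powz by apply Hq.
      rewrite IZR_tri, Rmult_1_l. right. f_equal. field.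
    - intros n. assert (H := PI_RGT_0). unfold lam. rewrite !Cmod_mult, Cmod_Ci, !Cmod_R.
      rewrite (Rabs_pos_eq 2), (Rabs_pos_eq PI) by lra. assert (K := Rabs_pos (IZR n)). nra. }
  assert (D1 := cder_expsum c lam 0 R).
  assert (E : forall w, expsum c lam w
     = (1 - Cexp (2 * PI * Ci * w)) * (poch_inf q q * phi q (Cexp (2 * PI * Ci * w)))).
  { intros w. assert (Hx := Cexp_nz (2 * PI * Ci * w)).
    transitivity (tser q (Cexp (2 * PI * Ci * w))).
    - unfold expsum, tser. apply tsum_ext. intros n. unfold c, lam. f_equal.
      rewrite <- Cexp_Zmult. f_equal. ring.
    - rewrite jacobi_triple, theta_phi by auto. ring. }
  assert (D2 : cder (expsum c lam) 0 (- (2 * PI * Ci) * poch_inf q q ^ 3)).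
  { assert (D3 : cder (fun w => 1 - Cexp (2 * PI * Ci * w)) 0 (- (2 * PI * Ci))).
    { assert (K := cder_scal (-1) _ _ _ (cder_Cexp_scal (2 * PI * Ci) 0)).
      rewrite Cmult_0_r, Cexp_0 in K.
      intros eps He. destruct (K eps He) as [d [Hd Kd]]. exists d. split; auto.
      intros h Hh. specialize (Kd h Hh). rewrite Cmult_0_r, Cexp_0 in *.
      match goal with |- (Cmod ?a <= _)%R => match type of Kd with (Cmod ?b <= _)%R =>
        replace a with b by ring end end. exact Kd. }
    assert (D4 : ccont (fun w => poch_inf q q * phi q (Cexp (2 * PI * Ci * w))) 0).
    { apply (ccont_mult (fun _ => poch_inf q q)).
      - intros eps He. exists 1%R. split; [lra|]. intros.
        replace (poch_inf q q - poch_inf q q) with (RtoC 0) by ring. rewrite Cmod_0; auto.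
      - unfold phi. apply ccont_mult.
        + apply ccont_poch; auto.
        + assert (K := ccont_poch q q (- (2 * PI * Ci)) 0 Hq).
          intros eps He. destruct (K eps He) as [d [Hd Kd]]. exists d. split; auto.
          intros w Hw. specialize (Kd w Hw). unfold Cdiv. rewrite <- !Cexp_opp.
          replace (- (2 * PI * Ci * w)) with (- (2 * PI * Ci) * w) by ring.
          replace (- (2 * PI * Ci * 0)) with (- (2 * PI * Ci) * 0) by ring. exact Kd. }
    assert (G0 : 1 - Cexp (2 * PI * Ci * 0) = 0) by (rewrite Cmult_0_r, Cexp_0; ring).
    assert (D5 := cder_mult_zero _ _ 0 _ D3 G0 D4).
    cbv beta in D5. rewrite Cmult_0_r, Cexp_0 in D5.
    replace (phi q 1) with (poch_inf q q ^ 2) in D5.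
    2:{ unfold phi. rewrite Cmult_1_r. replace (q / 1) with q by field. ring. }
    replace (- (2 * PI * Ci) * poch_inf q q ^ 3)
      with (- (2 * PI * Ci) * (poch_inf q q * poch_inf q q ^ 2)) by ring.
    apply cder_ext_loc with (d := 1%R) (3 := D5); [lra|]. intros w _. symmetry. apply E. }
  assert (U := cder_unique _ _ _ _ D1 D2).
  assert (S := rapid_summable _ _ 0 (rapid_lam _ _ R)). cbv beta in S.
  unfold expsum in U.
  assert (X : tsum (fun n => c n * lam n * Cexp (lam n * 0))
     = 2 * PI * Ci * tsum (fun n : Z => (-1) ^^ n * q ^^ tri n * IZR n)).
  { rewrite <- tsum_scal.
    - apply tsum_ext. intros n. rewrite Cmult_0_r, Cexp_0. unfold c, lam. ring.
    - apply (summable_scal (/ (2 * PI * Ci))) in S. apply summable_ext with (2 := S).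
      intros n. rewrite Cmult_0_r, Cexp_0. unfold c, lam.
      assert (H := two_pi_i_nz). field. repeat split; intros K; apply H; rewrite K; ring. }
  rewrite X in U. assert (H := two_pi_i_nz).
  match goal with |- ?a = _ => transitivity ((2 * PI * Ci) * a / (2 * PI * Ci)) end.
  - field. repeat split; intros K; apply H; rewrite K; ring.
  - rewrite U. field. repeat split; intros K; apply H; rewrite K; ring.
Qed.

(** * The four theta functions *)

Definition odd_freq (n : Z) : C := PI * Ci * IZR (2 * n + 1).
Definition even_freq (n : Z) : C := PI * Ci * IZR (2 * n).
(** With q = p^8 this is q^((n + 1/2)^2 / 2); in powers of p, all exponents of the four theta series
    are integers. *)
Definition odd_coef (p : C) (n : Z) : C := p ^^ ((2 * n + 1) ^ 2).
Definition even_coef (p : C) (n : Z) : C := p ^^ ((2 * n) ^ 2).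

(* [p] is the eighth root of [q]; [th1] is [i] times the usual theta_1. *)
Definition th1 (p w : C) : C := expsum (fun n => (-1) ^^ n * odd_coef p n) odd_freq w.
Definition th2 (p w : C) : C := expsum (odd_coef p) odd_freq w.
Definition th3 (p w : C) : C := expsum (even_coef p) even_freq w.
Definition th4 (p w : C) : C := expsum (fun n => (-1) ^^ n * even_coef p n) even_freq w.

Lemma Cmod_odd_freq (n : Z) : (Cmod (odd_freq n) <= PI * (2 * Rabs (IZR n) + 1))%R.
Proof.
  unfold odd_freq. rewrite Cmod_mult, Cmod_Cmult_PI, Cmod_R.
  apply Rmult_le_compat_l; [left; apply PI_RGT_0|apply Rabs_2n1].
Qed.

Lemma Cmod_even_freq (n : Z) : (Cmod (even_freq n) <= PI * (2 * Rabs (IZR n) + 1))%R.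
Proof.
  unfold even_freq. rewrite Cmod_mult, Cmod_Cmult_PI, Cmod_R.
  apply Rmult_le_compat_l; [left; apply PI_RGT_0|].
  rewrite mult_IZR, Rabs_mult, (Rabs_pos_eq 2); lra.
Qed.

Lemma Cmod_odd_coef (p : C) (n : Z) : qdisc p ->
  Cmod (odd_coef p n) = exp (4 * ln (Cmod p) * (IZR n * IZR n)
    + 4 * ln (Cmod p) * IZR n + ln (Cmod p)).
Proof.
  intros Hp. unfold odd_coef. rewrite Cmod_powz by apply Hp. f_equal.
  replace ((2 * n + 1) ^ 2)%Z with (4 * (n * n) + 4 * n + 1)%Z by ring.
  rewrite !plus_IZR, !mult_IZR. ring.
Qed.

Lemma Cmod_even_coef (p : C) (n : Z) : qdisc p ->
  Cmod (even_coef p n) = exp (4 * ln (Cmod p) * (IZR n * IZR n) + 0 * IZR n + 0).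
Proof.
  intros Hp. unfold even_coef. rewrite Cmod_powz by apply Hp. f_equal.
  replace ((2 * n) ^ 2)%Z with (4 * (n * n))%Z by ring.
  rewrite !mult_IZR. ring.
Qed.

Lemma Cmod_sign_mult (n : Z) (a : C) : Cmod ((-1) ^^ n * a) = Cmod a.
Proof. rewrite Cmod_mult, Cmod_m1_powz. ring. Qed.

Lemma rapid_th1 (p : C) : qdisc p -> rapid (fun n => (-1) ^^ n * odd_coef p n) odd_freq.
Proof.
  intros Hp. assert (H := ln_qdisc p Hp).
  eapply rapid_gauss; [| |intros n; rewrite Cmod_sign_mult, Cmod_odd_coef by auto; right; reflexivity|
    apply Cmod_odd_freq]; [lra|left; apply PI_RGT_0].
Qed.

Lemma rapid_th2 (p : C) : qdisc p -> rapid (odd_coef p) odd_freq.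
Proof.
  intros Hp. assert (H := ln_qdisc p Hp).
  eapply rapid_gauss; [| |intros n; rewrite Cmod_odd_coef by auto; right; reflexivity|
    apply Cmod_odd_freq]; [lra|left; apply PI_RGT_0].
Qed.

Lemma rapid_th3 (p : C) : qdisc p -> rapid (even_coef p) even_freq.
Proof.
  intros Hp. assert (H := ln_qdisc p Hp).
  eapply rapid_gauss; [| |intros n; rewrite Cmod_even_coef by auto; right; reflexivity|
    apply Cmod_even_freq]; [lra|left; apply PI_RGT_0].
Qed.

Lemma rapid_th4 (p : C) : qdisc p -> rapid (fun n => (-1) ^^ n * even_coef p n) even_freq.
Proof.
  intros Hp. assert (H := ln_qdisc p Hp).
  eapply rapid_gauss; [| |intros n; rewrite Cmod_sign_mult, Cmod_even_coef by auto; right; reflexivity|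
    apply Cmod_even_freq]; [lra|left; apply PI_RGT_0].
Qed.

Lemma qdisc_pow8 (p : C) : qdisc p -> qdisc (p ^ 8).
Proof.
  intros Hp. replace (p ^ 8) with (((p ^ 2) ^ 2) ^ 2) by ring.
  apply qdisc_sq, qdisc_sq, qdisc_sq, Hp.
Qed.

Lemma Cpowz_pow (p : C) (k : nat) (n : Z) : p <> 0 ->
  (p ^ k) ^^ n = p ^^ (Z.of_nat k * n).
Proof. intros Hp. rewrite Cpowz_mul, Cpowz_nat by auto. reflexivity. Qed.

Lemma Cexp_even_freq (n : Z) (w : C) : Cexp (even_freq n * w) = Cexp (2 * PI * Ci * w) ^^ n.
Proof.
  rewrite <- Cexp_Zmult. f_equal. unfold even_freq. rewrite mult_IZR, RtoC_mult. ring.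
Qed.

Lemma Cexp_odd_freq (n : Z) (w : C) :
  Cexp (odd_freq n * w) = Cexp (PI * Ci * w) * Cexp (2 * PI * Ci * w) ^^ n.
Proof.
  rewrite <- Cexp_Zmult, <- Cexp_plus. f_equal. unfold odd_freq.
  rewrite plus_IZR, mult_IZR, RtoC_plus, RtoC_mult. ring.
Qed.

Lemma m1_mult_powz (z : C) (n : Z) : z <> 0 -> (- z) ^^ n = (-1) ^^ n * z ^^ n.
Proof.
  intros Hz. replace (- z) with ((-1) * z) by ring. apply Cpowz_mult_l; auto. apply Cm1_nz.
Qed.

Lemma m1_powz_sq (n : Z) : (-1) ^^ n * (-1) ^^ n = 1.
Proof.
  rewrite <- Cpowz_add by apply Cm1_nz. replace (n + n)%Z with (2 * n)%Z by ring.
  apply Cpowz_m1_even.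
Qed.

Lemma Copp_nz (z : C) : z <> 0 -> - z <> 0.
Proof. intros Hz E. apply Hz. replace z with (- - z) by ring. rewrite E. ring. Qed.

Lemma th4_prod (p w : C) : qdisc p ->
  th4 p w = poch_inf (p ^ 8) (p ^ 8) * theta (p ^ 8) (p ^ 4 * Cexp (2 * PI * Ci * w)).
Proof.
  intros Hp. assert (Hq := qdisc_pow8 p Hp). assert (Hp0 := proj1 Hp).
  assert (Hx := Cexp_nz (2 * PI * Ci * w)). assert (Hp4 := Cpow_nz p 4 Hp0).
  rewrite <- jacobi_triple by (auto; apply Cmult_neq_0; auto).
  unfold th4, expsum, tser. apply tsum_ext. intros n.
  rewrite Cexp_even_freq, Cpowz_mult_l, !Cpowz_pow by auto.
  rewrite !Cmult_assoc. f_equal. rewrite <- Cmult_assoc. f_equal.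
  unfold even_coef. rewrite <- Cpowz_add by auto. f_equal.
  assert (H := tri_double n). lia.
Qed.

Lemma th3_prod (p w : C) : qdisc p ->
  th3 p w = poch_inf (p ^ 8) (p ^ 8) * theta (p ^ 8) (- (p ^ 4 * Cexp (2 * PI * Ci * w))).
Proof.
  intros Hp. assert (Hq := qdisc_pow8 p Hp). assert (Hp0 := proj1 Hp).
  assert (Hx := Cexp_nz (2 * PI * Ci * w)). assert (Hp4 := Cpow_nz p 4 Hp0).
  assert (Hpx : p ^ 4 * Cexp (2 * PI * Ci * w) <> 0) by (apply Cmult_neq_0; auto).
  rewrite <- jacobi_triple by (auto using Copp_nz).
  unfold th3, expsum, tser. apply tsum_ext. intros n.
  rewrite Cexp_even_freq, m1_mult_powz, Cpowz_mult_l, !Cpowz_pow by auto.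
  unfold even_coef.
  replace ((2 * n) ^ 2)%Z with (Z.of_nat 8 * tri n + Z.of_nat 4 * n)%Z
    by (assert (H := tri_double n); lia).
  rewrite Cpowz_add by auto.
  match goal with |- ?a * ?b * ?c = ?s * ?d * (?s * ?e) =>
    transitivity ((s * s) * (a * b * c)); [rewrite m1_powz_sq; ring|ring] end.
Qed.

Lemma th1_prod (p w : C) : qdisc p ->
  th1 p w = - (p / Cexp (PI * Ci * w)) * poch_inf (p ^ 8) (p ^ 8)
    * theta (p ^ 8) (Cexp (2 * PI * Ci * w)).
Proof.
  intros Hp. assert (Hq := qdisc_pow8 p Hp). assert (Hp0 := proj1 Hp).
  assert (Hx := Cexp_nz (2 * PI * Ci * w)). assert (Hxi := Cexp_nz (PI * Ci * w)).
  assert (Hq0 := proj1 Hq).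
  assert (E : Cexp (2 * PI * Ci * w) = Cexp (PI * Ci * w) * Cexp (PI * Ci * w)).
  { rewrite <- Cexp_plus. f_equal. ring. }
  (* Since (2n+1)^2 = 8 tri(n) + 8n + 1, the series is a triple product at q exp(2 pi i w), moved
     back by one step of the functional equation. *)
  transitivity (p * Cexp (PI * Ci * w) * tser (p ^ 8) (p ^ 8 * Cexp (2 * PI * Ci * w))).
  - unfold th1, expsum, tser. rewrite <- tsum_scal by (apply tser_summable; auto; apply Cmult_neq_0; auto).
    apply tsum_ext. intros n.
    rewrite Cexp_odd_freq, Cpowz_mult_l, !Cpowz_pow by auto.
    unfold odd_coef.
    replace ((2 * n + 1) ^ 2)%Z with (Z.of_nat 8 * tri n + Z.of_nat 8 * n + 1)%Z
      by (assert (H := tri_double n); lia).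
    rewrite !Cpowz_add, Cpowz_1 by auto. ring.
  - rewrite tser_step, jacobi_triple by auto. rewrite E. field. auto.
Qed.

Lemma th2_prod (p w : C) : qdisc p ->
  th2 p w = p / Cexp (PI * Ci * w) * poch_inf (p ^ 8) (p ^ 8)
    * theta (p ^ 8) (- Cexp (2 * PI * Ci * w)).
Proof.
  intros Hp. assert (Hq := qdisc_pow8 p Hp). assert (Hp0 := proj1 Hp).
  assert (Hx := Cexp_nz (2 * PI * Ci * w)). assert (Hxi := Cexp_nz (PI * Ci * w)).
  assert (Hq0 := proj1 Hq). assert (Hmx := Copp_nz _ Hx).
  assert (E : Cexp (2 * PI * Ci * w) = Cexp (PI * Ci * w) * Cexp (PI * Ci * w)).
  { rewrite <- Cexp_plus. f_equal. ring. }
  transitivity (p * Cexp (PI * Ci * w) * tser (p ^ 8) (p ^ 8 * - Cexp (2 * PI * Ci * w))).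
  - unfold th2, expsum, tser. rewrite <- tsum_scal by (apply tser_summable; auto; apply Cmult_neq_0; auto).
    apply tsum_ext. intros n.
    rewrite Cexp_odd_freq, Cpowz_mult_l, m1_mult_powz, !Cpowz_pow by auto.
    unfold odd_coef.
    replace ((2 * n + 1) ^ 2)%Z with (Z.of_nat 8 * tri n + Z.of_nat 8 * n + 1)%Z
      by (assert (H := tri_double n); lia).
    rewrite !Cpowz_add, Cpowz_1 by auto.
    match goal with |- ?a = ?b => transitivity (((-1) ^^ n * (-1) ^^ n) * a);
      [rewrite m1_powz_sq; ring|ring] end.
  - rewrite tser_step, jacobi_triple by auto. rewrite E. field. auto.
Qed.

(** * Products and Wronskians of exponential sums as convolutions *)

Lemma rapid_coef_summable {I : Type} (c lam : I -> C) : rapid c lam -> summable c.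
Proof.
  intros H. apply summable_ext with (2 := rapid_summable c lam 0 H).
  intros i. rewrite Cmult_0_r, Cexp_0. ring.
Qed.

Lemma conv_summable (c d : Z -> C) :
  summable c -> summable d -> summable (fun p : Z * Z => c (snd p) * d (fst p - snd p)%Z).
Proof.
  intros Hc Hd.
  apply (summable_inj (fun p : Z * Z => (snd p, fst p - snd p)%Z)
    (fun p => c (fst p) * d (snd p))).
  - intros [a b] [a' b'] E. simpl in E. inversion E. f_equal; lia.
  - apply (summable_mult c d); auto.
Qed.

Lemma conv_row (c d : Z -> C) (N : Z) :
  summable c -> summable d -> summable (fun n => c n * d (N - n)%Z).
Proof.
  intros Hc Hd. apply (summable_row _ N (conv_summable c d Hc Hd)).
Qed.

Lemma conv_mult (c d : Z -> C) : summable c -> summable d ->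
  tsum c * tsum d = tsum (fun N => tsum (fun n => c n * d (N - n)%Z)).
Proof.
  intros Hc Hd. rewrite <- tsum_mult by auto.
  set (e := fun p : Z * Z => (snd p, fst p - snd p)%Z).
  rewrite <- (tsum_reindex e (fun p => (fst p + snd p, fst p)%Z)
    (fun p => c (fst p) * d (snd p))).
  - apply (tsum_fubini (fun p => c (snd p) * d (fst p - snd p)%Z)), conv_summable; auto.
  - intros [a b]. unfold e. simpl. f_equal; ring.
  - intros [a b]. unfold e. simpl. f_equal; ring.
  - apply (summable_mult c d); auto.
Qed.

Lemma conv_outer (c d : Z -> C) : summable c -> summable d ->
  summable (fun N => tsum (fun n => c n * d (N - n)%Z)).
Proof.
  intros Hc Hd. apply (summable_rows _ (conv_summable c d Hc Hd)).
Qed.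

Definition wron (c lam d mu : Z -> C) (w : C) : C :=
  expsum (fun n => c n * lam n) lam w * expsum d mu w
  - expsum c lam w * expsum (fun n => d n * mu n) mu w.

Lemma expsum_conv (c d lam mu Lam : Z -> C) (w : C) : rapid c lam -> rapid d mu ->
  (forall n N, lam n + mu (N - n)%Z = Lam N) ->
  summable (fun N => Cexp (Lam N * w) * tsum (fun n => c n * d (N - n)%Z)) /\
  expsum c lam w * expsum d mu w
    = tsum (fun N => Cexp (Lam N * w) * tsum (fun n => c n * d (N - n)%Z)).
Proof.
  intros Hc Hd HL.
  assert (S1 := rapid_summable c lam w Hc). assert (S2 := rapid_summable d mu w Hd).
  assert (E : forall N, tsum (fun n => c n * Cexp (lam n * w)
      * (d (N - n)%Z * Cexp (mu (N - n)%Z * w)))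
      = Cexp (Lam N * w) * tsum (fun n => c n * d (N - n)%Z)).
  { intros N. rewrite <- tsum_scal by (apply conv_row; eapply rapid_coef_summable; eauto).
    apply tsum_ext. intros n. rewrite <- (HL n N), Cmult_plus_distr_r, Cexp_plus. ring. }
  split.
  - apply (summable_ext _ _ E). apply (conv_outer _ _ S1 S2).
  - rewrite <- (tsum_ext _ _ E). apply (conv_mult _ _ S1 S2).
Qed.

(** Both sides are series in exp(Lam(N) w), and comparing coefficients suffices. The hypothesis on
    [a] and [b] says that the two coefficient sequences are proportional, with a ratio independent
    of [N]. *)
Lemma wron_eq (c lam d mu c' lam' d' mu' Lam : Z -> C) (a b w : C) :
  rapid c lam -> rapid d mu -> rapid c' lam' -> rapid d' mu' ->
  (forall n N, lam n + mu (N - n)%Z = Lam N) ->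
  (forall n N, lam' n + mu' (N - n)%Z = Lam N) ->
  (forall N, b * tsum (fun n => c n * d (N - n)%Z * (lam n - mu (N - n)%Z))
     = a * tsum (fun n => c' n * d' (N - n)%Z)) ->
  b * wron c lam d mu w = a * (expsum c' lam' w * expsum d' mu' w).
Proof.
  intros Hc Hd Hc' Hd' HL HL' H. unfold wron.
  destruct (expsum_conv _ _ lam mu Lam w (rapid_lam c lam Hc) Hd HL) as [S1 E1].
  destruct (expsum_conv _ _ lam mu Lam w Hc (rapid_lam d mu Hd) HL) as [S2 E2].
  destruct (expsum_conv c' d' lam' mu' Lam w Hc' Hd' HL') as [S3 E3].
  rewrite E1, E2, E3, <- tsum_minus, <- !tsum_scal by auto using summable_minus.
  apply tsum_ext. intros N.
  match goal with |- b * (?x * ?y - ?x * ?z) = _ =>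
    replace (b * (x * y - x * z)) with (b * (x * (y - z))) by ring end.
  rewrite <- tsum_minus.
  - rewrite (tsum_ext _ (fun n => c n * d (N - n)%Z * (lam n - mu (N - n)%Z))).
    + transitivity (Cexp (Lam N * w)
        * (b * tsum (fun n => c n * d (N - n)%Z * (lam n - mu (N - n)%Z)))); [ring|].
      rewrite H. ring.
    + intros n. ring.
  - apply (conv_row (fun n => c n * lam n) d); eapply rapid_coef_summable; eauto using rapid_lam.
  - apply (conv_row c (fun n => d n * mu n)); eapply rapid_coef_summable; eauto using rapid_lam.
Qed.

(* The constant relating the two sides is found by evaluating at one point. *)
Lemma wron_const (c lam d mu c' lam' d' mu' Lam : Z -> C) (a b g w0 : C) :
  rapid c lam -> rapid d mu -> rapid c' lam' -> rapid d' mu' ->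
  (forall n N, lam n + mu (N - n)%Z = Lam N) ->
  (forall n N, lam' n + mu' (N - n)%Z = Lam N) ->
  (forall N, b * tsum (fun n => c n * d (N - n)%Z * (lam n - mu (N - n)%Z))
     = a * tsum (fun n => c' n * d' (N - n)%Z)) ->
  (b = 0 -> forall N, tsum (fun n => c' n * d' (N - n)%Z) = 0) ->
  expsum c' lam' w0 * expsum d' mu' w0 <> 0 ->
  wron c lam d mu w0 = g * (expsum c' lam' w0 * expsum d' mu' w0) ->
  forall w, wron c lam d mu w = g * (expsum c' lam' w * expsum d' mu' w).
Proof.
  intros Hc Hd Hc' Hd' HL HL' H H0 Hnz E w.
  (* If [b] were 0, every coefficient of the product on the right would vanish, although the product
     is nonzero at [w0]. *)
  assert (Hb : b <> 0).
  { intros Eb. apply Hnz.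
    destruct (expsum_conv c' d' lam' mu' Lam w0 Hc' Hd' HL') as [_ E3]. rewrite E3.
    rewrite (tsum_ext _ (fun _ => 0)); [apply tsum_0|].
    intros N. rewrite H0 by auto. ring. }
  assert (K := fun w => wron_eq c lam d mu c' lam' d' mu' Lam a b w Hc Hd Hc' Hd' HL HL' H).
  assert (K0 := K w0). rewrite E in K0.
  assert (Ea : b * g = a).
  { set (V := expsum c' lam' w0 * expsum d' mu' w0) in *.
    transitivity (b * (g * V) / V); [field; auto|]. rewrite K0. field. auto. }
  specialize (K w). rewrite <- Ea in K.
  match goal with |- ?x = _ => transitivity (b * x / b); [field; auto|] end.
  rewrite K. field. auto.
Qed.

Lemma summable_sign {I : Type} (e : I -> Z) (f : I -> C) :
  summable f -> summable (fun i => (-1) ^^ e i * f i).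
Proof.
  intros H. apply summable_le with (2 := H). intros i. rewrite Cmod_sign_mult. lra.
Qed.

Lemma m1_powz_parity (N : Z) : (-1) ^^ N = if Z.even N then 1 else -1.
Proof.
  destruct (Z.even N) eqn:E.
  - apply Z.even_spec in E. destruct E as [k ->]. apply Cpowz_m1_even.
  - assert (Ho : Z.odd N = true) by (rewrite <- Z.negb_even, E; reflexivity).
    apply Z.odd_spec in Ho. destruct Ho as [k ->].
    rewrite Cpowz_add, Cpowz_m1_even, Cpowz_1 by apply Cm1_nz. ring.
Qed.

Lemma summable_affine (F : Z -> C) (N : Z) : summable F -> summable (fun n => F (2 * n - N)%Z).
Proof. intros H. apply (summable_inj (fun n => 2 * n - N)%Z F); auto. intros; lia. Qed.

Lemma summable_double (F : Z -> C) : summable F -> summable (fun n => F (2 * n)%Z).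
Proof. intros H. apply (summable_inj (fun n => 2 * n)%Z F); auto. intros; lia. Qed.

(** D = 2n - N runs over the integers with the parity of [N]. The reflection D -> -1 - D exchanges
    the parities, so odd [N] reduces to even [N] at the cost of [eps]. *)
Lemma parity_sum (F : Z -> C) (eps K : C) (N : Z) : summable F ->
  (forall D, F (- 1 - D)%Z = eps * F D) ->
  tsum (fun n => K * F (2 * n - N)%Z)
    = K * (if Z.even N then 1 else eps) * tsum (fun n => F (2 * n)%Z).
Proof.
  intros HF He. rewrite tsum_scal by (apply summable_affine; auto).
  rewrite <- Cmult_assoc. f_equal. apply summable_double in HF.
  destruct (Z.even N) eqn:EN.
  - apply Z.even_spec in EN. destruct EN as [k ->]. rewrite Cmult_1_l.
    rewrite <- (tsum_Z_shift (fun n => F (2 * n)%Z) (- k)) by auto. apply tsum_ext. intros n.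
    replace (2 * (n + - k))%Z with (2 * n - 2 * k)%Z by ring. reflexivity.
  - assert (Ho : Z.odd N = true) by (rewrite <- Z.negb_even, EN; reflexivity).
    apply Z.odd_spec in Ho. destruct Ho as [k ->].
    rewrite <- (tsum_Z_refl (fun n => F (2 * n)%Z) k), <- tsum_scal by
      (auto; apply (summable_inj (fun n => k - n)%Z (fun n => F (2 * n)%Z)); auto; intros; lia).
    apply tsum_ext. intros n. rewrite <- He.
    replace (- 1 - 2 * (k - n))%Z with (2 * n - (2 * k + 1))%Z by ring. reflexivity.
Qed.

(** The same reduction with the sign (-1)^n: recentring the index at N / 2 produces the sign (-1)^(N
    / 2), with the quotient rounded down. *)
Lemma parity_sum_alt (F : Z -> C) (eps K : C) (N : Z) : summable F ->
  (forall D, F (- 1 - D)%Z = eps * F D) ->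
  tsum (fun n => K * ((-1) ^^ n * F (2 * n - N)%Z))
    = K * ((-1) ^^ (N / 2) * (if Z.even N then 1 else eps))
      * tsum (fun n => (-1) ^^ n * F (2 * n)%Z).
Proof.
  intros HF He. rewrite tsum_scal by (apply summable_sign, summable_affine; auto).
  rewrite <- Cmult_assoc. f_equal.
  apply summable_double, (summable_sign (fun n => n)) in HF.
  destruct (Z.even N) eqn:EN.
  - apply Z.even_spec in EN. destruct EN as [k ->].
    replace (2 * k / 2)%Z with k by (rewrite Z.mul_comm, Z.div_mul; lia).
    rewrite Cmult_1_r, <- (tsum_Z_shift (fun n => (-1) ^^ n * F (2 * n)%Z) (- k)), <- tsum_scal by
      (auto; apply (summable_inj (fun n => n + - k)%Z (fun n => (-1) ^^ n * F (2 * n)%Z)); auto; intros; lia).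
    apply tsum_ext. intros n.
    rewrite Cmult_assoc, <- Cpowz_add by apply Cm1_nz.
    replace (k + (n + - k))%Z with n by ring.
    replace (2 * (n + - k))%Z with (2 * n - 2 * k)%Z by ring. reflexivity.
  - assert (Ho : Z.odd N = true) by (rewrite <- Z.negb_even, EN; reflexivity).
    apply Z.odd_spec in Ho. destruct Ho as [k ->].
    replace ((2 * k + 1) / 2)%Z with k.
    2:{ rewrite Z.mul_comm, Z.div_add_l by lia. replace (1 / 2)%Z with 0%Z by reflexivity. ring. }
    rewrite <- (tsum_Z_refl (fun n => (-1) ^^ n * F (2 * n)%Z) k), <- tsum_scal by
      (auto; apply (summable_inj (fun n => k - n)%Z (fun n => (-1) ^^ n * F (2 * n)%Z)); auto; intros; lia).
    apply tsum_ext. intros n.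
    replace (2 * n - (2 * k + 1))%Z with (- 1 - (2 * (k - n)))%Z by ring.
    rewrite He. replace (k - n)%Z with (k + - n)%Z at 2 by ring.
    rewrite Cpowz_add, Cpowz_m1_opp by apply Cm1_nz.
    match goal with |- ?a * (?e * ?x) = ?s * ?e * (?s * ?a * ?y) =>
      transitivity ((s * s) * (a * (e * x))); [rewrite m1_powz_sq; ring|ring] end.
Qed.

Definition dth1 (p w : C) : C :=
  expsum (fun n => (-1) ^^ n * odd_coef p n * odd_freq n) odd_freq w.
Definition dth2 (p w : C) : C := expsum (fun n => odd_coef p n * odd_freq n) odd_freq w.
Definition dth3 (p w : C) : C := expsum (fun n => even_coef p n * even_freq n) even_freq w.
Definition dth4 (p w : C) : C :=
  expsum (fun n => (-1) ^^ n * even_coef p n * even_freq n) even_freq w.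

Lemma cder_th1 (p w : C) : qdisc p -> cder (th1 p) w (dth1 p w).
Proof. intros Hp. apply (cder_expsum _ _ w (rapid_th1 p Hp)). Qed.
Lemma cder_th2 (p w : C) : qdisc p -> cder (th2 p) w (dth2 p w).
Proof. intros Hp. apply (cder_expsum _ _ w (rapid_th2 p Hp)). Qed.
Lemma cder_th3 (p w : C) : qdisc p -> cder (th3 p) w (dth3 p w).
Proof. intros Hp. apply (cder_expsum _ _ w (rapid_th3 p Hp)). Qed.
Lemma cder_th4 (p w : C) : qdisc p -> cder (th4 p) w (dth4 p w).
Proof. intros Hp. apply (cder_expsum _ _ w (rapid_th4 p Hp)). Qed.

Lemma th1_0 (p : C) : qdisc p -> th1 p 0 = 0.
Proof.
  intros Hp. rewrite th1_prod, !Cmult_0_r, !Cexp_0, theta_1 by auto using qdisc_pow8. ring.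
Qed.

Lemma even_freq_eq (n : Z) : even_freq n = PI * Ci * (2 * IZR n).
Proof. unfold even_freq. rewrite mult_IZR, RtoC_mult. reflexivity. Qed.

Lemma odd_freq_eq (n : Z) : odd_freq n = PI * Ci * (2 * IZR n + 1).
Proof. unfold odd_freq. rewrite plus_IZR, mult_IZR, RtoC_plus, RtoC_mult. reflexivity. Qed.

Lemma tsum_antisym (f : Z -> C) (k : Z) : summable f ->
  (forall n, f (k - n)%Z = - f n) -> tsum f = 0.
Proof.
  intros Hf H. assert (E := tsum_Z_refl f k Hf).
  rewrite (tsum_ext _ (fun n => (-1) * f n)) in E by (intros; rewrite H; ring).
  rewrite tsum_scal in E by auto.
  replace (tsum f) with ((tsum f - (-1) * tsum f) / 2) by field.
  rewrite E. field.
Qed.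

Lemma dth1_0 (p : C) : qdisc p -> dth1 p 0 = 2 * PI * Ci * p * poch_inf (p ^ 8) (p ^ 8) ^ 3.
Proof.
  intros Hp. assert (Hq := qdisc_pow8 p Hp). assert (Hp0 := proj1 Hp).
  assert (J := jacobi_cube (p ^ 8) Hq).
  assert (S := rapid_summable _ _ 0 (rapid_lam _ _ (rapid_th1 p Hp))). cbv beta in S.
  unfold dth1, expsum. rewrite <- (tsum_Z_shift _ (-1)) by auto.
  assert (S1 := tser_summable (p ^ 8) 1 Hq C1_nz).
  assert (T : tser (p ^ 8) 1 = 0) by (rewrite jacobi_triple, theta_1 by (auto; apply C1_nz); ring).
  unfold tser in T.
  assert (S2 : summable (fun n : Z => (-1) ^^ n * (p ^ 8) ^^ tri n * IZR n)).
  { assert (Hl := ln_qdisc _ Hq).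
    apply summable_gauss with 1%R 1%R (ln (Cmod (p ^ 8)) / 2)%R (- (ln (Cmod (p ^ 8)) / 2))%R 0%R.
    - lra.
    - intros n. rewrite !Cmod_mult, Cmod_m1_powz, Cmod_powz, Cmod_R by (apply Hq).
      rewrite !Rmult_1_l, IZR_tri, exp_plus.
      apply Rmult_le_compat; try (left; apply exp_pos); try apply Rabs_pos.
      + right. f_equal. field.
      + assert (K := exp_ineq1_le (Rabs (IZR n))). lra. }
  (* After the shift the frequency is pi i (2n - 1). Its linear part gives Jacobi's series for the
     cube, its constant part the triple product at 1, which is 0. *)
  rewrite (tsum_ext _ (fun n => (- (2 * PI * Ci * p)) * ((-1) ^^ n * (p ^ 8) ^^ tri n * IZR n)
     + PI * Ci * p * ((-1) ^^ n * (p ^ 8) ^^ tri n * 1 ^^ n))).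
  - rewrite tsum_plus, !tsum_scal, T, J by auto using summable_scal. ring.
  - intros n. rewrite Cmult_0_r, Cexp_0, Cpowz_1_l, odd_freq_eq, Cpowz_pow by auto.
    unfold odd_coef.
    replace ((2 * (n + -1) + 1) ^ 2)%Z with (Z.of_nat 8 * tri n + 1)%Z
      by (assert (H := tri_double n); lia).
    rewrite !Cpowz_add, Cpowz_1, plus_IZR, RtoC_plus by (auto; apply Cm1_nz).
    replace ((-1) ^^ (-1)) with (RtoC (-1)).
    + ring.
    + simpl. rewrite Cmult_1_r. field.
Qed.

(** The remaining product is the square of (-q)_oo (q^(1/2))_oo (-q^(1/2))_oo, which is 1 by Euler's
    identity. *)
Lemma th_prod_0 (p : C) : qdisc p ->
  th2 p 0 * th3 p 0 * th4 p 0 = 2 * p * poch_inf (p ^ 8) (p ^ 8) ^ 3.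
Proof.
  intros Hp. assert (Hq := qdisc_pow8 p Hp). assert (Hp0 := proj1 Hp).
  rewrite th2_prod, th3_prod, th4_prod, !Cmult_0_r, Cexp_0, !Cmult_1_r by auto.
  unfold theta.
  assert (Hp4 := Cpow_nz p 4 Hp0).
  replace (p ^ 8 / (p ^ 4)) with (p ^ 4) by (field; auto).
  replace (p ^ 8 / (- p ^ 4)) with (- p ^ 4) by (field; auto).
  replace (p ^ 8 / (- (1))) with (- p ^ 8) by field.
  rewrite (poch_inf_step (p ^ 8) (- (1))) by auto.
  replace (p ^ 8 * - (1)) with (- p ^ 8) by ring.
  assert (E1 := poch_inf_square (p ^ 8) (p ^ 4) Hq).
  assert (E2 := poch_euler_odd (p ^ 8) Hq).
  replace ((p ^ 4) ^ 2) with (p ^ 8) in E1 by ring.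
  set (A := poch_inf (p ^ 8) (p ^ 4)) in *. set (B := poch_inf (p ^ 8) (- p ^ 4)) in *.
  set (D := poch_inf (p ^ 8) (- p ^ 8)) in *. set (Q := poch_inf (p ^ 8) (p ^ 8)).
  rewrite <- E1 in E2.
  transitivity (2 * p * Q ^ 3 * (D * (A * B)) ^ 2); [field|]. rewrite E2. ring.
Qed.

(** Jacobi's derivative formula. It fixes the constants in all three Wronskian identities. *)
Lemma dth1_0_prod (p : C) : qdisc p -> dth1 p 0 = PI * Ci * (th2 p 0 * th3 p 0 * th4 p 0).
Proof. intros Hp. rewrite dth1_0, th_prod_0 by auto. ring. Qed.

Lemma th234_0_nz (p : C) : qdisc p -> th2 p 0 <> 0 /\ th3 p 0 <> 0 /\ th4 p 0 <> 0.
Proof.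
  intros Hp. assert (H := th_prod_0 p Hp).
  assert (K : th2 p 0 * th3 p 0 * th4 p 0 <> 0).
  { rewrite H. apply Cmult_neq_0; [apply Cmult_neq_0|].
    - intros E. apply RtoC_inj in E. lra.
    - apply Hp.
    - apply Cpow_nz, poch_inf_q_nz, qdisc_pow8, Hp. }
  repeat split; intros E; apply K; rewrite E; ring.
Qed.

(** * Wronskians of the theta functions *)

(** The identity a^2 + b^2 = ((a + b)^2 + (a - b)^2) / 2 separates the frequency index [N] from D =
    2n - N. *)
Lemma quad_split1 (p : C) (n N : Z) : p <> 0 ->
  odd_coef p n * even_coef p (N - n)
  = p ^^ (2 * (N * (N + 1)) + 1) * p ^^ (2 * ((2 * n - N) * (2 * n - N + 1))).
Proof.
  intros Hp. unfold odd_coef, even_coef. rewrite <- !Cpowz_add by auto. f_equal. ring.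
Qed.

Lemma summable_powz_quad (p : C) (f g : Z -> C) (B : R) : qdisc p ->
  (forall n, Cmod (f n) <= 1)%R -> (forall n, Cmod (g n) <= B * exp (Rabs (IZR n)))%R ->
  forall k l : Z, (0 < k)%Z ->
  summable (fun n => f n * (g n * p ^^ (k * (n * n) + l * n))).
Proof.
  intros Hp Hf Hg k l Hk. assert (Hl := ln_qdisc p Hp). apply IZR_lt in Hk.
  apply summable_gauss with B 1%R (IZR k * ln (Cmod p))%R (IZR l * ln (Cmod p))%R 0%R.
  - nra.
  - intros n. rewrite !Cmod_mult, Cmod_powz by apply Hp.
    assert (B0 := Cmod_ge_0 (g n)). assert (F0 := Cmod_ge_0 (f n)).
    apply Rle_trans with (1 * (B * exp (Rabs (IZR n))
      * exp (IZR (k * (n * n) + l * n) * ln (Cmod p))))%R.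
    + apply Rmult_le_compat; auto.
      * apply Rmult_le_pos; auto. left; apply exp_pos.
      * apply Rmult_le_compat_r; auto. left; apply exp_pos.
    + rewrite Rmult_1_l, Rmult_assoc, <- exp_plus. right. do 2 f_equal.
      rewrite plus_IZR, !mult_IZR. ring.
Qed.

Lemma Cmod_lin_le (a b : R) (n : Z) :
  (Cmod (RtoC a * IZR n + RtoC b) <= (Rabs a + Rabs b) * exp (Rabs (IZR n)))%R.
Proof.
  eapply Rle_trans; [apply Cmod_triangle|]. rewrite Cmod_mult, !Cmod_R.
  assert (K := exp_ineq1_le (Rabs (IZR n))). assert (A := Rabs_pos a).
  assert (B := Rabs_pos b). assert (N0 := Rabs_pos (IZR n)).
  assert (Rabs a * Rabs (IZR n) <= Rabs a * exp (Rabs (IZR n)))%R by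
    (apply Rmult_le_compat_l; lra).
  assert (Rabs b * 1 <= Rabs b * exp (Rabs (IZR n)))%R by
    (apply Rmult_le_compat_l; lra). lra.
Qed.

Lemma Cmod_1_exp (n : Z) : (Cmod 1 <= 1 * exp (Rabs (IZR n)))%R.
Proof.
  rewrite Cmod_1. assert (K := exp_ineq1_le (Rabs (IZR n))).
  assert (N0 := Rabs_pos (IZR n)). lra.
Qed.

Lemma Cexp_odd_freq_half (n : Z) (w : C) :
  Cexp (odd_freq n * (w + 1 / 2)) = Ci * (-1) ^^ n * Cexp (odd_freq n * w).
Proof.
  rewrite Cmult_plus_distr_l, Cexp_plus.
  replace (Cexp (odd_freq n * (1 / 2))) with (Ci * (-1) ^^ n); [ring|].
  transitivity (Cexp (PI * Ci / 2 + IZR n * (PI * Ci))).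
  - rewrite Cexp_plus, Cexp_PI2, Cexp_Zmult, Cexp_PI. reflexivity.
  - f_equal. rewrite odd_freq_eq. field.
Qed.

Lemma Cexp_even_freq_half (n : Z) (w : C) :
  Cexp (even_freq n * (w + 1 / 2)) = (-1) ^^ n * Cexp (even_freq n * w).
Proof.
  rewrite Cmult_plus_distr_l, Cexp_plus.
  replace (Cexp (even_freq n * (1 / 2))) with ((-1) ^^ n); [ring|].
  transitivity (Cexp (IZR n * (PI * Ci))).
  - rewrite Cexp_Zmult, Cexp_PI. reflexivity.
  - f_equal. rewrite even_freq_eq. field.
Qed.

Lemma th1_half (p w : C) : qdisc p -> th1 p (w + 1 / 2) = Ci * th2 p w.
Proof.
  intros Hp. unfold th1, th2, expsum.
  rewrite <- tsum_scal by apply rapid_summable, rapid_th2, Hp.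
  apply tsum_ext. intros n. rewrite Cexp_odd_freq_half.
  transitivity (((-1) ^^ n * (-1) ^^ n) * (Ci * (odd_coef p n * Cexp (odd_freq n * w)))); [ring|].
  rewrite m1_powz_sq. ring.
Qed.

Lemma th2_half (p w : C) : qdisc p -> th2 p (w + 1 / 2) = Ci * th1 p w.
Proof.
  intros Hp. unfold th1, th2, expsum.
  rewrite <- tsum_scal by apply rapid_summable, rapid_th1, Hp.
  apply tsum_ext. intros n. rewrite Cexp_odd_freq_half. ring.
Qed.

Lemma th3_half (p w : C) : th3 p (w + 1 / 2) = th4 p w.
Proof.
  unfold th3, th4, expsum. apply tsum_ext. intros n. rewrite Cexp_even_freq_half. ring.
Qed.

Lemma th4_half (p w : C) : th4 p (w + 1 / 2) = th3 p w.
Proof.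
  unfold th3, th4, expsum. apply tsum_ext. intros n. rewrite Cexp_even_freq_half.
  transitivity (((-1) ^^ n * (-1) ^^ n) * (even_coef p n * Cexp (even_freq n * w))); [ring|].
  rewrite m1_powz_sq. ring.
Qed.

Lemma dth2_half (p w : C) : qdisc p -> dth2 p (w + 1 / 2) = Ci * dth1 p w.
Proof.
  intros Hp. unfold dth1, dth2, expsum.
  rewrite <- tsum_scal by apply (rapid_summable _ _ w (rapid_lam _ _ (rapid_th1 p Hp))).
  apply tsum_ext. intros n. rewrite Cexp_odd_freq_half. ring.
Qed.

Lemma Cmod_1_le (n : Z) : (Cmod 1 <= 1)%R.
Proof. rewrite Cmod_1. lra. Qed.

(** What is left of the coefficient of a Wronskian ([tri_lin]) and of a product ([tri_gauss]) once
    the factor in [N] is removed: odd and even, respectively, under D -> -1 - D. *)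
Definition tri_lin (p : C) (D : Z) : C := (2 * IZR D + 1) * p ^^ (2 * (D * (D + 1))).
Definition tri_gauss (p : C) (D : Z) : C := p ^^ (2 * (D * (D + 1))).

Lemma tri_lin_summable (p : C) : qdisc p -> summable (tri_lin p).
Proof.
  intros Hp.
  apply summable_ext with (2 := summable_powz_quad p (fun _ => 1)
    (fun n => RtoC 2 * IZR n + RtoC 1) _ Hp Cmod_1_le
    (Cmod_lin_le 2 1) 2 2 ltac:(lia)).
  intros n. unfold tri_lin. rewrite Cmult_1_l. do 2 f_equal. ring.
Qed.

Lemma tri_gauss_summable (p : C) : qdisc p -> summable (tri_gauss p).
Proof.
  intros Hp.
  apply summable_ext with (2 := summable_powz_quad p (fun _ => 1) (fun n => 1) _ Hp
    Cmod_1_le Cmod_1_exp 2 2 ltac:(lia)).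
  intros n. unfold tri_gauss. rewrite !Cmult_1_l. f_equal. ring.
Qed.

Lemma tri_lin_refl (p : C) (D : Z) : tri_lin p (- 1 - D) = (-1) * tri_lin p D.
Proof.
  unfold tri_lin. rewrite minus_IZR, RtoC_minus.
  replace (2 * ((-1 - D) * (-1 - D + 1)))%Z with (2 * (D * (D + 1)))%Z by ring. ring.
Qed.

Lemma tri_gauss_refl (p : C) (D : Z) : tri_gauss p (- 1 - D) = 1 * tri_gauss p D.
Proof. unfold tri_gauss. rewrite Cmult_1_l. f_equal. ring. Qed.

Lemma m1_powz_sub (n N : Z) : (-1) ^^ (N - n) = (-1) ^^ N * (-1) ^^ n.
Proof.
  unfold Z.sub. rewrite Cpowz_add, Cpowz_m1_opp by apply Cm1_nz. reflexivity.
Qed.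

Lemma freq_odd_even (n N : Z) : odd_freq n + even_freq (N - n) = odd_freq N.
Proof. rewrite !odd_freq_eq, even_freq_eq, minus_IZR, RtoC_minus. ring. Qed.

Lemma freq_odd_even_minus (n N : Z) :
  odd_freq n - even_freq (N - n) = PI * Ci * (2 * RtoC (IZR (2 * n - N)) + 1).
Proof.
  rewrite !odd_freq_eq, even_freq_eq, !minus_IZR, !RtoC_minus, mult_IZR, RtoC_mult. ring.
Qed.

(** The convolutions of both sides depend on [N] through the same power of p, so the sides are
    proportional. At 0, where [th1] vanishes, the derivative formula gives the constant. *)
Lemma wronskian_14 (p w : C) : qdisc p ->
  dth1 p w * th4 p w - th1 p w * dth4 p w = PI * Ci * th4 p 0 ^ 2 * (th2 p w * th3 p w).
Proof.
  intros Hp. assert (Hp0 := proj1 Hp).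
  destruct (th234_0_nz p Hp) as [N2 [N3 N4]].
  assert (V : forall N, tsum (fun n => odd_coef p n * even_coef p (N - n))
    = p ^^ (2 * (N * (N + 1)) + 1) * tsum (fun n => tri_gauss p (2 * n))).
  { intros N.
    rewrite (tsum_ext _ (fun n => p ^^ (2 * (N * (N + 1)) + 1) * tri_gauss p (2 * n - N)))
      by (intros; apply quad_split1; auto).
    rewrite (parity_sum _ 1) by auto using tri_gauss_summable, tri_gauss_refl.
    destruct (Z.even N); ring. }
  assert (W : forall N, tsum (fun n => (-1) ^^ n * odd_coef p n
      * ((-1) ^^ (N - n) * even_coef p (N - n)) * (odd_freq n - even_freq (N - n)))
    = PI * Ci * p ^^ (2 * (N * (N + 1)) + 1) * tsum (fun n => tri_lin p (2 * n))).
  { intros N.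
    rewrite (tsum_ext _ (fun n => (PI * Ci * (-1) ^^ N * p ^^ (2 * (N * (N + 1)) + 1))
        * tri_lin p (2 * n - N))).
    - rewrite (parity_sum _ (-1)) by auto using tri_lin_summable, tri_lin_refl.
      (* The sign (-1)^N of the coefficients cancels the sign that the odd function [tri_lin]
         contributes for odd [N]. *)
      rewrite m1_powz_parity. destruct (Z.even N); ring.
    - intros n. rewrite freq_odd_even_minus, m1_powz_sub.
      transitivity (((-1) ^^ n * (-1) ^^ n) * (-1) ^^ N * (odd_coef p n * even_coef p (N - n))
        * (PI * Ci * (2 * RtoC (IZR (2 * n - N)) + 1))); [ring|].
      rewrite m1_powz_sq, quad_split1 by auto. unfold tri_lin. ring. }
  apply (wron_const (fun n => (-1) ^^ n * odd_coef p n) odd_freq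
    (fun n => (-1) ^^ n * even_coef p n) even_freq
    (odd_coef p) odd_freq (even_coef p) even_freq odd_freq
    (PI * Ci * tsum (fun n => tri_lin p (2 * n))) (tsum (fun n => tri_gauss p (2 * n)))
    (PI * Ci * th4 p 0 ^ 2) 0);
    auto using rapid_th1, rapid_th2, rapid_th3, rapid_th4, freq_odd_even.
  - intros N. rewrite W, V. ring.
  - intros E N. rewrite V, E. ring.
  - apply Cmult_neq_0; auto.
  - change (dth1 p 0 * th4 p 0 - th1 p 0 * dth4 p 0
      = PI * Ci * th4 p 0 ^ 2 * (th2 p 0 * th3 p 0)).
    rewrite dth1_0_prod, th1_0 by auto. ring.
Qed.

Lemma Ci_nz : Ci <> 0.
Proof. apply Cmod_gt_0. rewrite Cmod_Ci. lra. Qed.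

(** As for [th1] and [th4], but evaluated at 1/2: there [th2] vanishes, while the right side does
    not. *)
Lemma wronskian_24 (p w : C) : qdisc p ->
  dth2 p w * th4 p w - th2 p w * dth4 p w = PI * Ci * th3 p 0 ^ 2 * (th1 p w * th3 p w).
Proof.
  intros Hp. assert (Hp0 := proj1 Hp).
  destruct (th234_0_nz p Hp) as [N2 [N3 N4]].
  assert (V : forall N, tsum (fun n => (-1) ^^ n * odd_coef p n * even_coef p (N - n))
    = p ^^ (2 * (N * (N + 1)) + 1) * (-1) ^^ (N / 2)
      * tsum (fun n => (-1) ^^ n * tri_gauss p (2 * n))).
  { intros N.
    rewrite (tsum_ext _ (fun n => p ^^ (2 * (N * (N + 1)) + 1)
      * ((-1) ^^ n * tri_gauss p (2 * n - N)))).
    - rewrite (parity_sum_alt _ 1) by auto using tri_gauss_summable, tri_gauss_refl.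
      destruct (Z.even N); ring.
    - intros n. rewrite <- Cmult_assoc, quad_split1 by auto. unfold tri_gauss. ring. }
  assert (W : forall N, tsum (fun n => odd_coef p n
      * ((-1) ^^ (N - n) * even_coef p (N - n)) * (odd_freq n - even_freq (N - n)))
    = PI * Ci * p ^^ (2 * (N * (N + 1)) + 1) * (-1) ^^ (N / 2)
      * tsum (fun n => (-1) ^^ n * tri_lin p (2 * n))).
  { intros N.
    rewrite (tsum_ext _ (fun n => (PI * Ci * (-1) ^^ N * p ^^ (2 * (N * (N + 1)) + 1))
        * ((-1) ^^ n * tri_lin p (2 * n - N)))).
    - rewrite (parity_sum_alt _ (-1)) by auto using tri_lin_summable, tri_lin_refl.
      rewrite (m1_powz_parity N). destruct (Z.even N); ring.
    - intros n. rewrite freq_odd_even_minus, m1_powz_sub.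
      transitivity ((-1) ^^ n * (-1) ^^ N * (odd_coef p n * even_coef p (N - n))
        * (PI * Ci * (2 * RtoC (IZR (2 * n - N)) + 1))); [ring|].
      rewrite quad_split1 by auto. unfold tri_lin. ring. }
  apply (wron_const (odd_coef p) odd_freq
    (fun n => (-1) ^^ n * even_coef p n) even_freq
    (fun n => (-1) ^^ n * odd_coef p n) odd_freq (even_coef p) even_freq odd_freq
    (PI * Ci * tsum (fun n => (-1) ^^ n * tri_lin p (2 * n)))
    (tsum (fun n => (-1) ^^ n * tri_gauss p (2 * n)))
    (PI * Ci * th3 p 0 ^ 2) (0 + 1 / 2));
    auto using rapid_th1, rapid_th2, rapid_th3, rapid_th4, freq_odd_even.
  - intros N. rewrite W, V. ring.
  - intros E N. rewrite V, E. ring.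
  - change (th1 p (0 + 1 / 2) * th3 p (0 + 1 / 2) <> 0). rewrite th1_half, th3_half by auto.
    repeat apply Cmult_neq_0; auto using Ci_nz.
  - change (dth2 p (0 + 1 / 2) * th4 p (0 + 1 / 2) - th2 p (0 + 1 / 2) * dth4 p (0 + 1 / 2)
      = PI * Ci * th3 p 0 ^ 2 * (th1 p (0 + 1 / 2) * th3 p (0 + 1 / 2))).
    rewrite dth2_half, th4_half, th2_half, th1_half, th3_half, dth1_0_prod, th1_0 by auto. ring.
Qed.

(** The hypothesis Cexp (PI * Ci * w) = p ^ 2 = q^(1/4) places [w] at the half-period tau/2 without
    mentioning tau. *)
Lemma Cexp_odd_freq_tau (p w : C) (n : Z) : Cexp (PI * Ci * w) = p ^ 2 -> p <> 0 ->
  Cexp (odd_freq n * w) = p ^^ (2 * (2 * n + 1)).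
Proof.
  intros H Hp. rewrite Cpowz_mul, Cpowz_2, <- H, <- Cexp_Zmult by auto. f_equal.
  unfold odd_freq. ring.
Qed.

Lemma Cexp_even_freq_tau (p w : C) (n : Z) : Cexp (PI * Ci * w) = p ^ 2 -> p <> 0 ->
  Cexp (even_freq n * w) = p ^^ (2 * (2 * n)).
Proof.
  intros H Hp. rewrite Cpowz_mul, Cpowz_2, <- H, <- Cexp_Zmult by auto. f_equal.
  unfold even_freq. ring.
Qed.

Lemma expsum_0 (c lam : Z -> C) : expsum c lam 0 = tsum c.
Proof.
  unfold expsum. apply tsum_ext. intros n. rewrite Cmult_0_r, Cexp_0. ring.
Qed.

(** Completing the square: translation by tau/2 exchanges even and odd coefficients, hence [th4]
    with [th1] and [th3] with [th2]. *)
Lemma quad_even_tau (p : C) (n : Z) : p <> 0 ->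
  even_coef p n * p ^^ (2 * (2 * n)) = / p * odd_coef p n.
Proof.
  intros Hp. unfold even_coef, odd_coef.
  replace ((2 * n + 1) ^ 2)%Z with ((2 * n) ^ 2 + 2 * (2 * n) + 1)%Z by ring.
  rewrite !Cpowz_add, Cpowz_1 by auto. field. auto.
Qed.

Lemma quad_odd_tau (p : C) (n : Z) : p <> 0 ->
  odd_coef p (n - 1) * p ^^ (2 * (2 * (n - 1) + 1)) = / p * even_coef p n.
Proof.
  intros Hp. unfold even_coef, odd_coef.
  replace ((2 * n) ^ 2)%Z with ((2 * (n - 1) + 1) ^ 2 + 2 * (2 * (n - 1) + 1) + 1)%Z by ring.
  rewrite !Cpowz_add, Cpowz_1 by auto. field. auto.
Qed.

Lemma th3_tau (p w : C) : qdisc p -> Cexp (PI * Ci * w) = p ^ 2 -> th3 p w = / p * th2 p 0.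
Proof.
  intros Hp H. assert (Hp0 := proj1 Hp). unfold th3, th2. rewrite expsum_0. unfold expsum.
  rewrite <- tsum_scal by apply (rapid_coef_summable _ _ (rapid_th2 p Hp)).
  apply tsum_ext. intros n. rewrite (Cexp_even_freq_tau p) by auto. apply quad_even_tau; auto.
Qed.

Lemma th4_tau (p w : C) : qdisc p -> Cexp (PI * Ci * w) = p ^ 2 -> th4 p w = 0.
Proof.
  intros Hp H. assert (Hp0 := proj1 Hp). transitivity (/ p * th1 p 0).
  - unfold th4, th1. rewrite expsum_0. unfold expsum.
    rewrite <- tsum_scal by apply (rapid_coef_summable _ _ (rapid_th1 p Hp)).
    apply tsum_ext. intros n.
    rewrite (Cexp_even_freq_tau p), <- Cmult_assoc, quad_even_tau by auto. ring.
  - rewrite th1_0 by auto. ring.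
Qed.

Lemma dth4_tau (p w : C) : qdisc p -> Cexp (PI * Ci * w) = p ^ 2 ->
  dth4 p w = / p * dth1 p 0.
Proof.
  intros Hp H. assert (Hp0 := proj1 Hp).
  transitivity (/ p * (dth1 p 0 - PI * Ci * th1 p 0)); [|rewrite th1_0 by auto; ring].
  assert (S1 := rapid_coef_summable _ _ (rapid_th1 p Hp)).
  assert (S2 := rapid_coef_summable _ _ (rapid_lam _ _ (rapid_th1 p Hp))). cbv beta in S2.
  unfold dth4, dth1, th1. rewrite !expsum_0. unfold expsum.
  rewrite <- (tsum_scal (PI * Ci)), <- tsum_minus, <- tsum_scal
    by auto using summable_minus, summable_scal.
  apply tsum_ext. intros n.
  rewrite (Cexp_even_freq_tau p) by auto.
  transitivity ((-1) ^^ n * even_freq n * (even_coef p n * p ^^ (2 * (2 * n)))); [ring|].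
  rewrite quad_even_tau, even_freq_eq, odd_freq_eq by auto. ring.
Qed.

Lemma th1_tau (p w : C) : qdisc p -> Cexp (PI * Ci * w) = p ^ 2 -> th1 p w = - / p * th4 p 0.
Proof.
  intros Hp H. assert (Hp0 := proj1 Hp). unfold th1, th4. rewrite expsum_0. unfold expsum.
  rewrite <- tsum_scal by apply (rapid_coef_summable _ _ (rapid_th4 p Hp)).
  rewrite <- (tsum_Z_shift (fun n => (-1) ^^ n * odd_coef p n * Cexp (odd_freq n * w)) (-1))
    by apply (rapid_summable _ _ w (rapid_th1 p Hp)).
  apply tsum_ext. intros n. rewrite (Cexp_odd_freq_tau p), <- Cmult_assoc by auto.
  replace (n + -1)%Z with (n - 1)%Z by ring. rewrite quad_odd_tau by auto.
  unfold Z.sub. rewrite Cpowz_add, Cpowz_m1_opp, Cpowz_1 by apply Cm1_nz. ring.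
Qed.

Lemma th2_tau (p w : C) : qdisc p -> Cexp (PI * Ci * w) = p ^ 2 -> th2 p w = / p * th3 p 0.
Proof.
  intros Hp H. assert (Hp0 := proj1 Hp). unfold th2, th3. rewrite expsum_0. unfold expsum.
  rewrite <- tsum_scal by apply (rapid_coef_summable _ _ (rapid_th3 p Hp)).
  rewrite <- (tsum_Z_shift (fun n => odd_coef p n * Cexp (odd_freq n * w)) (-1))
    by apply (rapid_summable _ _ w (rapid_th2 p Hp)).
  apply tsum_ext. intros n. rewrite (Cexp_odd_freq_tau p) by auto.
  replace (n + -1)%Z with (n - 1)%Z by ring. apply quad_odd_tau; auto.
Qed.

Lemma rapid_shift (c lam : Z -> C) (k : Z) : rapid c lam ->
  rapid (fun n => c (n + k)%Z) (fun n => lam (n + k)%Z).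
Proof.
  intros H B. apply (summable_inj (fun n => n + k)%Z
    (fun n => c n * RtoC (exp (B * Cmod (lam n))))); auto. intros; lia.
Qed.

(** The product [th1] [th2] vanishes at 0 and at 1/2, so the constant is read off at tau/2, a zero
    of [th4]. Here coefficients with even [N] vanish on both sides by antisymmetry, and those with
    odd [N] share the factor [cN]. *)
Lemma wronskian_34 (p w w0 : C) : qdisc p -> Cexp (PI * Ci * w0) = p ^ 2 ->
  dth3 p w * th4 p w - th3 p w * dth4 p w = PI * Ci * th2 p 0 ^ 2 * (th1 p w * th2 p w).
Proof.
  intros Hp Hw0. assert (Hp0 := proj1 Hp).
  destruct (th234_0_nz p Hp) as [N2 [N3 N4]].
  set (F := fun D : Z => 2 * RtoC (IZR D) * p ^^ (2 * (D * D))).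
  set (G := fun D : Z => p ^^ (2 * (D * D))).
  assert (SF : summable F).
  { apply summable_ext with (2 := summable_powz_quad p (fun _ => 1)
      (fun n => RtoC 2 * IZR n + RtoC 0) _ Hp Cmod_1_le
      (Cmod_lin_le 2 0) 2 0 ltac:(lia)).
    intros n. unfold F. rewrite Cmult_1_l, Cplus_0_r. do 2 f_equal. ring. }
  assert (SG : summable G).
  { apply summable_ext with (2 := summable_powz_quad p (fun _ => 1) (fun n => 1) _ Hp
      Cmod_1_le Cmod_1_exp 2 0 ltac:(lia)).
    intros n. unfold G. rewrite !Cmult_1_l. f_equal. ring. }
  assert (SF' : forall N, summable (fun n => (-1) ^^ n * F (2 * n - N)%Z))
    by (intros; apply (summable_sign (fun n => n)), summable_affine; auto).
  assert (SG' : forall N, summable (fun n => (-1) ^^ n * G (2 * n - N)%Z))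
    by (intros; apply (summable_sign (fun n => n)), summable_affine; auto).
  set (A := tsum (fun n => (-1) ^^ n * F (2 * n - -1)%Z)).
  set (B := tsum (fun n => (-1) ^^ n * G (2 * n - 0)%Z)).
  set (cN := fun N => if Z.even N then RtoC 0 else (-1) ^^ (N / 2) * p ^^ (2 * (N * N))).
  assert (half : forall k, ((2 * k + 1) / 2 = k)%Z).
  { intros k. rewrite Z.mul_comm, Z.div_add_l by lia.
    replace (1 / 2)%Z with 0%Z by reflexivity. ring. }
  assert (V : forall N, tsum (fun n => (-1) ^^ n * odd_coef p n * odd_coef p (N - n + -1)%Z)
     = cN N * B).
  { intros N.
    rewrite (tsum_ext _ (fun n => p ^^ (2 * (N * N)) * ((-1) ^^ n * G (2 * n - (N - 1))%Z))).
    2:{ intros n. unfold odd_coef, G.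
        transitivity ((-1) ^^ n * (p ^^ ((2 * n + 1) ^ 2) * p ^^ ((2 * (N - n + -1) + 1) ^ 2)));
          [ring|].
        rewrite <- Cpowz_add by auto.
        replace ((2 * n + 1) ^ 2 + (2 * (N - n + -1) + 1) ^ 2)%Z
          with (2 * (N * N) + 2 * ((2 * n - (N - 1)) * (2 * n - (N - 1))))%Z by ring.
        rewrite Cpowz_add by auto. ring. }
    rewrite tsum_scal by auto. unfold cN. destruct (Z.even N) eqn:EN.
    - apply Z.even_spec in EN. destruct EN as [k ->].
      rewrite (tsum_antisym _ (2 * k - 1) (SG' _)); [ring|].
      intros n.
      replace (G (2 * (2 * k - 1 - n) - (2 * k - 1))%Z) with (G (2 * n - (2 * k - 1))%Z)
        by (unfold G; f_equal; ring).
      replace (2 * k - 1 - n)%Z with (2 * (k - 1) + (1 - n))%Z by ring.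
      rewrite Cpowz_add, Cpowz_m1_even, m1_powz_sub, Cpowz_1 by apply Cm1_nz. ring.
    - assert (Ho : Z.odd N = true) by (rewrite <- Z.negb_even, EN; reflexivity).
      apply Z.odd_spec in Ho. destruct Ho as [k ->]. rewrite half.
      unfold B. rewrite <- (tsum_Z_shift (fun n => (-1) ^^ n * G (2 * n - 0)%Z) (- k)),
        <- !tsum_scal by (auto; apply (summable_inj (fun n => n + - k)%Z
           (fun n => (-1) ^^ n * G (2 * n - 0)%Z)); auto; intros; lia).
      apply tsum_ext. intros n.
      rewrite Cpowz_add, Cpowz_m1_opp by apply Cm1_nz.
      replace (2 * n - (2 * k + 1 - 1))%Z with (2 * (n + - k) - 0)%Z by ring.
      match goal with |- ?a * (?b * ?c) = ?s * _ * (_ * ?s * _) =>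
        transitivity ((s * s) * (a * (b * c))); [rewrite m1_powz_sq; ring|ring] end. }
  assert (W : forall N, tsum (fun n => even_coef p n * ((-1) ^^ (N - n) * even_coef p (N - n))
       * (even_freq n - even_freq (N - n))) = PI * Ci * A * cN N).
  { intros N.
    rewrite (tsum_ext _ (fun n => (PI * Ci * (-1) ^^ N * p ^^ (2 * (N * N)))
       * ((-1) ^^ n * F (2 * n - N)%Z))).
    2:{ intros n. rewrite m1_powz_sub, !even_freq_eq. unfold even_coef, F.
        transitivity ((-1) ^^ N * (-1) ^^ n * (p ^^ ((2 * n) ^ 2) * p ^^ ((2 * (N - n)) ^ 2))
          * (PI * Ci * (2 * IZR n) - PI * Ci * (2 * IZR (N - n)))); [ring|].
        rewrite <- (Cpowz_add p) by auto.
        replace ((2 * n) ^ 2 + (2 * (N - n)) ^ 2)%Z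
          with (2 * (N * N) + 2 * ((2 * n - N) * (2 * n - N)))%Z by ring.
        rewrite (Cpowz_add p), !minus_IZR, !RtoC_minus, mult_IZR, RtoC_mult by auto. ring. }
    rewrite tsum_scal by auto. unfold cN. destruct (Z.even N) eqn:EN.
    - apply Z.even_spec in EN. destruct EN as [k ->].
      rewrite (tsum_antisym _ (2 * k) (SF' _)); [ring|].
      intros n. rewrite m1_powz_sub, Cpowz_m1_even. unfold F.
      replace (2 * (2 * k - n) - 2 * k)%Z with (- (2 * n - 2 * k))%Z by ring.
      rewrite opp_IZR, RtoC_opp.
      replace (- (2 * n - 2 * k) * - (2 * n - 2 * k))%Z
        with ((2 * n - 2 * k) * (2 * n - 2 * k))%Z by ring. ring.
    - assert (Ho : Z.odd N = true) by (rewrite <- Z.negb_even, EN; reflexivity).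
      apply Z.odd_spec in Ho. destruct Ho as [k ->]. rewrite half.
      unfold A. rewrite <- (tsum_Z_shift (fun n => (-1) ^^ n * F (2 * n - -1)%Z) (- (k + 1))).
      2: auto.
      assert (S0 : summable (fun n => (-1) ^^ (n + - (k + 1)) * F (2 * (n + - (k + 1)) - -1)%Z)).
      { apply (summable_inj (fun n => n + - (k + 1))%Z
           (fun n => (-1) ^^ n * F (2 * n - -1)%Z)); auto; intros; lia. }
      rewrite (tsum_ext (fun i => (-1) ^^ i * F (2 * i - (2 * k + 1))%Z)
        (fun n => (-1) ^^ (k + 1) * ((-1) ^^ (n + - (k + 1)) * F (2 * (n + - (k + 1)) - -1)%Z))).
      + rewrite tsum_scal by auto.
        rewrite !(Cpowz_add (-1)), Cpowz_m1_even, Cpowz_1 by apply Cm1_nz. ring.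
      + intros n. rewrite (Cpowz_add (-1) n), Cpowz_m1_opp by apply Cm1_nz.
        replace (2 * (n + - (k + 1)) - -1)%Z with (2 * n - (2 * k + 1))%Z by ring.
        match goal with |- _ = ?s * (?b * ?s * ?c) =>
          transitivity ((s * s) * (b * c)); [rewrite m1_powz_sq; ring|ring] end. }
  (* The index of [th2] is moved by one so that the odd frequencies of indices n and N - n - 1 add
     up to the even frequency of index N. *)
  assert (T2 : forall v, expsum (fun n => odd_coef p (n + -1)) (fun n => odd_freq (n + -1)) v
     = th2 p v).
  { intros v. unfold th2, expsum.
    apply (tsum_Z_shift (fun n => odd_coef p n * Cexp (odd_freq n * v)) (-1)).
    apply (rapid_summable _ _ v (rapid_th2 p Hp)). }
  rewrite <- (T2 w).
  apply (wron_const (even_coef p) even_freq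
    (fun n => (-1) ^^ n * even_coef p n) even_freq
    (fun n => (-1) ^^ n * odd_coef p n) odd_freq
    (fun n => odd_coef p (n + -1)) (fun n => odd_freq (n + -1))
    even_freq (PI * Ci * A) B
    (PI * Ci * th2 p 0 ^ 2) w0);
    auto using rapid_th1, rapid_th2, rapid_th3, rapid_th4.
  - apply (rapid_shift (odd_coef p) odd_freq), rapid_th2, Hp.
  - intros n N. rewrite !even_freq_eq, minus_IZR, RtoC_minus. ring.
  - intros n N. rewrite !odd_freq_eq, even_freq_eq, plus_IZR, minus_IZR, RtoC_plus, RtoC_minus.
    ring.
  - intros N. rewrite W, V. ring.
  - intros E N. rewrite V, E. ring.
  - rewrite T2. change (th1 p w0 * th2 p w0 <> 0). rewrite (th1_tau p w0), (th2_tau p w0) by auto.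
    assert (Hi := Cinv_nz p Hp0). repeat apply Cmult_neq_0; auto using Copp_nz.
  - rewrite T2. change (dth3 p w0 * th4 p w0 - th3 p w0 * dth4 p w0
      = PI * Ci * th2 p 0 ^ 2 * (th1 p w0 * th2 p w0)).
    rewrite (th4_tau p w0), (th3_tau p w0), (dth4_tau p w0), (th1_tau p w0), (th2_tau p w0),
      dth1_0_prod by auto. ring.
Qed.

(** * Uniqueness for Jacobi's differential system *)

Lemma Re_minus_mult (a b l : C) (r : R) :
  (Re (a - b - l * RtoC r) = Re a - Re b - Re l * r)%R.
Proof. destruct a, b, l; unfold Re; simpl; ring. Qed.

Lemma Im_minus_mult (a b l : C) (r : R) :
  (Im (a - b - l * RtoC r) = Im a - Im b - Im l * r)%R.
Proof. destruct a, b, l; unfold Im; simpl; ring. Qed.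

Lemma derivable_from_bound (F : R -> R) (t L : R) :
  (forall eps : R, (0 < eps)%R -> exists delta : R, (0 < delta)%R /\
     forall h, (Rabs h < delta)%R -> (Rabs (F (t + h) - F t - L * h) <= eps * Rabs h)%R) ->
  is_derive F t L.
Proof.
  intros H. apply is_derive_Reals. intros eps He.
  destruct (H (eps / 2)%R) as [d [Hd K]]; [lra|]. exists (mkposreal d Hd).
  intros h Hh0 Hh. simpl in Hh. specialize (K h Hh).
  assert (Hp := Rabs_pos_lt h Hh0).
  replace ((F (t + h) - F t) / h - L)%R with ((F (t + h) - F t - L * h) / h)%R by (field; auto).
  unfold Rdiv. rewrite Rabs_mult, Rabs_inv.
  apply Rmult_lt_reg_r with (Rabs h); auto.
  rewrite Rmult_assoc, Rinv_l, Rmult_1_r by lra. nra.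
Qed.

Lemma rder_comp (f : C -> C) (b v l : C) (t : R) :
  cder f (b + t * v) l -> rder (fun t : R => f (b + t * v)) t (l * v).
Proof.
  intros H.
  assert (X : forall eps : R, (0 < eps)%R -> exists delta : R, (0 < delta)%R /\
     forall h : R, (Rabs h < delta)%R ->
     (Cmod (f (b + (t + h)%R * v)%C - f (b + t * v)%C - (l * v) * h) <= eps * Rabs h)%R).
  { intros eps He. assert (Hv := Cmod_ge_0 v).
    destruct (H (eps / (Cmod v + 1))%R) as [d [Hd K]]; [apply Rdiv_lt_0_compat; lra|].
    exists (d / (Cmod v + 1))%R. split; [apply Rdiv_lt_0_compat; lra|].
    intros h Hh. specialize (K (h * v)).
    assert (Hp := Rabs_pos h).
    assert (B : (Cmod (h * v) <= (Cmod v + 1) * Rabs h)%R) by (rewrite Cmod_mult, Cmod_R; nra).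
    assert (B2 : ((Cmod v + 1) * Rabs h < d)%R).
    { apply Rmult_lt_compat_l with (r := (Cmod v + 1)%R) in Hh; [|lra].
      replace ((Cmod v + 1) * (d / (Cmod v + 1)))%R with d in Hh by (field; lra). auto. }
    specialize (K ltac:(lra)).
    replace (b + t * v + h * v) with (b + (t + h)%R * v) in K by (rewrite RtoC_plus; ring).
    replace (l * (h * v)) with (l * v * h) in K by ring.
    eapply Rle_trans; [exact K|].
    apply Rle_trans with (eps / (Cmod v + 1) * ((Cmod v + 1) * Rabs h))%R.
    - apply Rmult_le_compat_l; auto. left. apply Rdiv_lt_0_compat; lra.
    - right. field. lra. }
  split; apply derivable_from_bound; intros eps He; destruct (X eps He) as [d [Hd K]];
    exists d; split; auto; intros h Hh; specialize (K h Hh).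
  - rewrite <- Re_minus_mult by auto. eapply Rle_trans; [apply re_le_Cmod|exact K].
  - rewrite <- Im_minus_mult by auto. eapply Rle_trans; [apply im_le_Cmod|exact K].
Qed.

Lemma rder_minus (G H : R -> C) (t : R) (a b : C) :
  rder G t a -> rder H t b -> rder (fun t => G t - H t) t (a - b).
Proof.
  intros [G1 G2] [H1 H2]. split.
  - apply (is_derive_minus (fun t => Re (G t)) (fun t => Re (H t)) t _ _ G1 H1).
  - apply (is_derive_minus (fun t => Im (G t)) (fun t => Im (H t)) t _ _ G2 H2).
Qed.

(** Unlike the modulus, its square is differentiable at 0 as well, which the energy estimate
    requires. *)
Definition sqn (z : C) : R := (Re z * Re z + Im z * Im z)%R.

Lemma sqn_Cmod (z : C) : sqn z = (Cmod z * Cmod z)%R.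
Proof.
  assert (H := Cmod2_alt z). simpl in H. unfold sqn. lra.
Qed.

Lemma is_derive_sqn (G : R -> C) (t : R) (a : C) : rder G t a ->
  is_derive (fun t => sqn (G t)) t (2 * (Re (G t) * Re a + Im (G t) * Im a))%R.
Proof.
  intros [G1 G2]. unfold sqn.
  assert (M1 := is_derive_mult (fun t => Re (G t)) (fun t => Re (G t)) t _ _ G1 G1 Rmult_comm).
  assert (M2 := is_derive_mult (fun t => Im (G t)) (fun t => Im (G t)) t _ _ G2 G2 Rmult_comm).
  assert (M := is_derive_plus _ _ t _ _ M1 M2).
  match type of M with is_derive _ _ ?l =>
    replace (2 * (Re (G t) * Re a + Im (G t) * Im a))%R with l end.
  - exact M.
  - unfold plus, mult; simpl. ring.
Qed.

Lemma dot_le (a b : C) : (Re a * Re b + Im a * Im b <= Cmod a * Cmod b)%R.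
Proof.
  assert (H : (Re a * Re b + Im a * Im b = Re (a * Cconj b))%R)
    by (destruct a, b; unfold Re, Im; simpl; ring).
  rewrite H, <- (Cmod_conj b), <- Cmod_mult.
  eapply Rle_trans; [apply Rle_abs|apply re_le_Cmod].
Qed.

Lemma gronwall (F dF : R -> R) (K : R) :
  (forall t, (0 <= t <= 1)%R -> is_derive F t (dF t) /\ (dF t <= K * F t)%R) ->
  F 0%R = 0%R -> (F 1%R <= 0)%R.
Proof.
  intros H H0.
  set (G := fun t => (F t * exp (- K * t))%R).
  assert (DG : forall t, (0 <= t <= 1)%R ->
     is_derive G t ((dF t - K * F t) * exp (- K * t))%R).
  { intros t Ht. destruct (H t Ht) as [D _]. unfold G.
    assert (E : is_derive (fun t => exp (- K * t)) t (- K * exp (- K * t))%R)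
      by (auto_derive; auto; ring).
    assert (M := is_derive_mult F (fun t => exp (- K * t)) t _ _ D E Rmult_comm).
    match type of M with is_derive _ _ ?l =>
      replace ((dF t - K * F t) * exp (- K * t))%R with l; [exact M|] end.
    unfold plus, mult; simpl. ring. }
  destruct (MVT_gen G 0 1 (fun t => (dF t - K * F t) * exp (- K * t))%R) as [c [Hc E]].
  - intros t. rewrite Rmin_left, Rmax_right by lra. intros Ht. apply DG. lra.
  - intros t. rewrite Rmin_left, Rmax_right by lra. intros Ht.
    apply continuity_pt_filterlim, (ex_derive_continuous G). eexists. apply DG. lra.
  - rewrite Rmin_left, Rmax_right in Hc by lra. destruct (H c Hc) as [_ L].
    unfold G in E. rewrite H0, Rmult_0_l in E.
    assert (P1 := exp_pos (- K * 1)). assert (P2 := exp_pos (- K * c)).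
    assert (Q : (F 1 * exp (- K * 1) <= 0)%R) by nra. nra.
Qed.

Lemma rder_bounded (G dG : R -> C) :
  (forall t, (0 <= t <= 1)%R -> rder G t (dG t)) ->
  exists M, (0 <= M)%R /\ forall t, (0 <= t <= 1)%R -> (Cmod (G t) <= M)%R.
Proof.
  intros H.
  destruct (continuity_ab_maj (fun t => sqn (G t)) 0 1) as [m [Hm _]]; [lra| |].
  - intros t Ht. apply continuity_pt_filterlim, (ex_derive_continuous (fun t => sqn (G t))).
    eexists. apply is_derive_sqn, H, Ht.
  (* From x^2 <= s follows x <= 1 + s, which spares a square root. *)
  - exists (1 + sqn (G m))%R.
    assert (P : forall z, (0 <= sqn z)%R) by (intros; rewrite sqn_Cmod; apply Rle_0_sqr).
    split; [specialize (P (G m)); lra|].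
    intros t Ht. specialize (Hm t Ht). rewrite (sqn_Cmod (G t)) in Hm.
    specialize (P (G m)). assert (C0 := Cmod_ge_0 (G t)). nra.
Qed.

Lemma jacobi_ode_cder (k : C) (s c d : C -> C) (z : C) : jacobi_ode k s c d z <->
  cder s z (c z * d z) /\ cder c z (- (s z * d z)) /\ cder d z (- (k ^ 2 * (s z * c z))).
Proof. unfold jacobi_ode. rewrite !is_derive_cder. tauto. Qed.

Definition eq3 (s1 c1 d1 s2 c2 d2 : C -> C) (z : C) : Prop :=
  s1 z = s2 z /\ c1 z = c2 z /\ d1 z = d2 z.

(** Gronwall's inequality for the sum of the squared moduli of the three differences, along a
    segment where both triples are regular, hence bounded. *)
Lemma jacobi_segment (k : C) (s1 c1 d1 s2 c2 d2 : C -> C) (b e : C) :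
  (forall t, (0 <= t <= 1)%R -> jacobi_ode k s1 c1 d1 (b + t * (e - b)) /\
     jacobi_ode k s2 c2 d2 (b + t * (e - b))) ->
  eq3 s1 c1 d1 s2 c2 d2 b -> eq3 s1 c1 d1 s2 c2 d2 e.
Proof.
  intros H [Es [Ec Ed]]. set (v := e - b) in *. set (g := fun t : R => b + t * v).
  assert (O : forall s c d : C -> C, (forall t, (0 <= t <= 1)%R -> jacobi_ode k s c d (g t)) ->
    (forall t, (0 <= t <= 1)%R -> rder (fun t => s (g t)) t (c (g t) * d (g t) * v)) /\
    (forall t, (0 <= t <= 1)%R -> rder (fun t => c (g t)) t (- (s (g t) * d (g t)) * v)) /\
    (forall t, (0 <= t <= 1)%R -> rder (fun t => d (g t)) t (- (k ^ 2 * (s (g t) * c (g t))) * v))).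
  { intros s c d Hs.
    assert (X := fun t Ht => proj1 (jacobi_ode_cder k s c d (g t)) (Hs t Ht)).
    split; [|split]; intros t Ht; destruct (X t Ht) as [X1 [X2 X3]].
    - apply (rder_comp s b v _ t X1).
    - apply (rder_comp c b v _ t X2).
    - apply (rder_comp d b v _ t X3). }
  destruct (O s1 c1 d1 (fun t Ht => proj1 (H t Ht))) as [A1 [A2 A3]].
  destruct (O s2 c2 d2 (fun t Ht => proj2 (H t Ht))) as [B1 [B2 B3]]. clear O.
  destruct (rder_bounded _ _ A1) as [m1 [P1 M1]].
  destruct (rder_bounded _ _ A2) as [m2 [P2 M2]].
  destruct (rder_bounded _ _ A3) as [m3 [P3 M3]].
  destruct (rder_bounded _ _ B1) as [m4 [P4 M4]].
  destruct (rder_bounded _ _ B2) as [m5 [P5 M5]].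
  destruct (rder_bounded _ _ B3) as [m6 [P6 M6]].
  set (m := (m1 + m2 + m3 + m4 + m5 + m6)%R).
  assert (Hk := Cmod_ge_0 (k ^ 2)). assert (Hv := Cmod_ge_0 v).
  set (L := ((1 + Cmod (k ^ 2)) * m * Cmod v)%R).
  assert (Pm : (0 <= m)%R) by (unfold m; lra).
  assert (PL : (0 <= L)%R) by (unfold L; apply Rmult_le_pos; auto; apply Rmult_le_pos; lra).
  set (Ds := fun t => s1 (g t) - s2 (g t)). set (Dc := fun t => c1 (g t) - c2 (g t)).
  set (Dd := fun t => d1 (g t) - d2 (g t)).
  set (F := fun t => (sqn (Ds t) + (sqn (Dc t) + sqn (Dd t)))%R).
  set (ds := fun t => c1 (g t) * d1 (g t) * v - c2 (g t) * d2 (g t) * v).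
  set (dc := fun t => - (s1 (g t) * d1 (g t)) * v - - (s2 (g t) * d2 (g t)) * v).
  set (dd := fun t => - (k ^ 2 * (s1 (g t) * c1 (g t))) * v - - (k ^ 2 * (s2 (g t) * c2 (g t))) * v).
  set (dF := fun t => (2 * (Re (Ds t) * Re (ds t) + Im (Ds t) * Im (ds t))
     + (2 * (Re (Dc t) * Re (dc t) + Im (Dc t) * Im (dc t))
     + 2 * (Re (Dd t) * Re (dd t) + Im (Dd t) * Im (dd t))))%R).
  (* The right sides of the system are constants 1, -1, -k^2 times products, and x1 y1 - x2 y2 = (x1
     - x2) y1 + x2 (y1 - y2) makes them Lipschitz on bounded sets. *)
  assert (Bd : forall x1 y1 x2 y2 a : C, (Cmod y1 <= m)%R -> (Cmod x2 <= m)%R ->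
     (Cmod a <= 1 + Cmod (k ^ 2))%R ->
     (Cmod (a * (x1 * y1) * v - a * (x2 * y2) * v) <= L * (Cmod (x1 - x2) + Cmod (y1 - y2)))%R).
  { intros x1 y1 x2 y2 a Hy Hx Ha.
    replace (a * (x1 * y1) * v - a * (x2 * y2) * v)
      with (a * v * ((x1 - x2) * y1 + x2 * (y1 - y2))) by ring.
    rewrite Cmod_mult, (Cmod_mult a v).
    assert (T := Cmod_triangle ((x1 - x2) * y1) (x2 * (y1 - y2))).
    rewrite !Cmod_mult in T.
    assert (Q1 := Cmod_ge_0 (x1 - x2)). assert (Q2 := Cmod_ge_0 (y1 - y2)).
    assert (Q3 := Cmod_ge_0 a).
    apply Rle_trans with ((1 + Cmod (k ^ 2)) * Cmod v * (m * (Cmod (x1 - x2) + Cmod (y1 - y2))))%R.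
    - apply Rmult_le_compat; [apply Rmult_le_pos; auto|apply Cmod_ge_0| |].
      + apply Rmult_le_compat_r; auto.
      + eapply Rle_trans; [exact T|]. nra.
    - unfold L. right. ring. }
  assert (Z : (F 1 <= 0)%R).
  { apply (gronwall F dF (6 * L)%R).
    - intros t Ht. split.
      + apply (is_derive_plus (fun t => sqn (Ds t)) (fun t => sqn (Dc t) + sqn (Dd t))%R).
        * apply is_derive_sqn. apply rder_minus; auto.
        * apply (is_derive_plus (fun t => sqn (Dc t)) (fun t => sqn (Dd t))%R);
          apply is_derive_sqn, rder_minus; auto.
      + specialize (M1 t Ht). specialize (M2 t Ht). specialize (M3 t Ht).
        specialize (M4 t Ht). specialize (M5 t Ht). specialize (M6 t Ht). cbv beta in *.
        assert (K1 : (Cmod (ds t) <= L * (Cmod (Dc t) + Cmod (Dd t)))%R).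
        { replace (ds t) with (1 * (c1 (g t) * d1 (g t)) * v - 1 * (c2 (g t) * d2 (g t)) * v)
            by (unfold ds; ring).
          apply Bd; try (unfold m; lra). rewrite Cmod_1. lra. }
        assert (K2 : (Cmod (dc t) <= L * (Cmod (Ds t) + Cmod (Dd t)))%R).
        { replace (dc t) with (- (1) * (s1 (g t) * d1 (g t)) * v - - (1) * (s2 (g t) * d2 (g t)) * v)
            by (unfold dc; ring).
          apply Bd; try (unfold m; lra). rewrite Cmod_m1. lra. }
        assert (K3 : (Cmod (dd t) <= L * (Cmod (Ds t) + Cmod (Dc t)))%R).
        { replace (dd t) with (- k ^ 2 * (s1 (g t) * c1 (g t)) * v - - k ^ 2 * (s2 (g t) * c2 (g t)) * v)
            by (unfold dd; ring).
          apply Bd; try (unfold m; lra). rewrite Cmod_opp. lra. }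
        assert (T1 := dot_le (Ds t) (ds t)). assert (T2 := dot_le (Dc t) (dc t)).
        assert (T3 := dot_le (Dd t) (dd t)).
        unfold dF, F. rewrite !sqn_Cmod.
        set (x := Cmod (Ds t)) in *. set (y := Cmod (Dc t)) in *. set (z := Cmod (Dd t)) in *.
        assert (x0 : (0 <= x)%R) by apply Cmod_ge_0. assert (y0 : (0 <= y)%R) by apply Cmod_ge_0.
        assert (z0 : (0 <= z)%R) by apply Cmod_ge_0.
        assert (U1 : (x * Cmod (ds t) <= x * (L * (y + z)))%R) by (apply Rmult_le_compat_l; auto).
        assert (U2 : (y * Cmod (dc t) <= y * (L * (x + z)))%R) by (apply Rmult_le_compat_l; auto).
        assert (U3 : (z * Cmod (dd t) <= z * (L * (x + y)))%R) by (apply Rmult_le_compat_l; auto).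
        assert (V : (2 * (x * (y + z) + y * (x + z) + z * (x + y)) <= 6 * (x * x + (y * y + z * z)))%R).
        { assert (0 <= (x - y) * (x - y))%R by apply Rle_0_sqr.
          assert (0 <= (y - z) * (y - z))%R by apply Rle_0_sqr.
          assert (0 <= (x - z) * (x - z))%R by apply Rle_0_sqr.
          assert (0 <= x * x)%R by nra. assert (0 <= y * y)%R by nra. assert (0 <= z * z)%R by nra.
          nra. }
        apply Rmult_le_compat_l with (r := L) in V; auto. lra.
    - unfold F, Ds, Dc, Dd, g. rewrite Cmult_0_l, Cplus_0_r, Es, Ec, Ed.
      rewrite !sqn_Cmod.
      match goal with |- (Cmod (?a - ?a) * _ + (Cmod (?b - ?b) * _ + Cmod (?c - ?c) * _))%R = _ =>
        replace (a - a) with (RtoC 0) by ring; replace (b - b) with (RtoC 0) by ring;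
        replace (c - c) with (RtoC 0) by ring end.
      rewrite Cmod_0. ring. }
  assert (N : forall w, (0 <= sqn w)%R) by (intros; rewrite sqn_Cmod; apply Rle_0_sqr).
  assert (N1 := N (Ds 1%R)). assert (N2 := N (Dc 1%R)). assert (N3 := N (Dd 1%R)).
  unfold F in Z.
  assert (R : forall w, sqn w = 0%R -> w = 0).
  { intros w Hw. rewrite sqn_Cmod in Hw. apply Cmod_eq_0. apply Rsqr_0_uniq. exact Hw. }
  assert (G1 : g 1%R = e) by (unfold g, v; ring).
  assert (R1 := R (Ds 1%R) ltac:(lra)). assert (R2 := R (Dc 1%R) ltac:(lra)).
  assert (R3 := R (Dd 1%R) ltac:(lra)). unfold Ds, Dc, Dd in *. rewrite G1 in *.
  assert (Q : forall a b : C, a - b = 0 -> a = b).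
  { intros x y E. replace x with (x - y + y) by ring. rewrite E. ring. }
  repeat split; apply Q; auto.
Qed.

(** * Continuation of the equality of two solutions across poles *)

Lemma locally'_Cmod (z : C) (P : C -> Prop) :
  locally' z P <->
  exists delta : R, (0 < delta)%R /\
    forall w : C, w <> z -> (Cmod (w - z) < delta)%R -> P w.
Proof.
  unfold locally', within. rewrite locally_Cmod'. split; intros [d [Hd H]]; exists d; split; auto.
Qed.

Lemma jacobi_pole_blowup (s : C -> C) (z : C) (M : R) :
  filterlim (fun w => Cmod (s w)) (locally' z) (Rbar_locally p_infty) ->
  exists delta : R, (0 < delta)%R /\
    forall w : C, w <> z -> (Cmod (w - z) < delta)%R -> (M < Cmod (s w))%R.
Proof.
  intros H. apply locally'_Cmod. apply (H (fun x => (M < x)%R)). exists M. auto.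
Qed.

(** Near a regular point sn is bounded, whereas a pole there would produce arbitrarily large values
    at points just beside it. *)
Lemma jacobi_regular_near (k : C) (s c d : C -> C) (z : C) :
  is_jacobi k s c d -> jacobi_ode k s c d z ->
  exists delta : R, (0 < delta)%R /\
    forall w : C, (Cmod (w - z) < delta)%R -> jacobi_ode k s c d w.
Proof.
  intros [_ [_ [_ H]]] Hz. apply jacobi_ode_cder in Hz. destruct Hz as [Hs _].
  destruct (ccont_bound s z (cder_ccont _ _ _ Hs)) as [dl [M [Hd [HM K]]]].
  exists dl. split; auto. intros w Hw. destruct (H w) as [R|[_ [_ L]]]; auto. exfalso.
  destruct (jacobi_pole_blowup s w M L) as [e [He B]].
  set (r := (Rmin e (dl - Cmod (w - z)) / 2)%R).
  assert (Hr : (0 < Rmin e (dl - Cmod (w - z)))%R) by (apply Rmin_pos; lra).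
  assert (r1 := Rmin_l e (dl - Cmod (w - z))). assert (r2 := Rmin_r e (dl - Cmod (w - z))).
  assert (Er : Cmod (RtoC r) = r) by (rewrite Cmod_R, Rabs_pos_eq; unfold r; lra).
  assert (X1 : (M < Cmod (s (w + r)%C))%R).
  { apply B.
    - intros E. assert (E' : RtoC r = 0) by (replace (RtoC r) with (w + r - w) by ring; rewrite E; ring).
      apply RtoC_inj in E'. unfold r in E'. lra.
    - replace (w + r - w) with (RtoC r) by ring. rewrite Er. unfold r. lra. }
  assert (X2 : (Cmod (s (w + r)%C) < M)%R).
  { apply K. replace (w + r - z) with (RtoC r + (w - z)) by ring.
    eapply Rle_lt_trans; [apply Cmod_triangle|]. rewrite Er. unfold r. lra. }
  lra.
Qed.

Lemma segment_in_ball (a b e : C) (r : R) (t : R) : (0 <= t <= 1)%R ->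
  (Cmod (b - a) < r)%R -> (Cmod (e - a) < r)%R -> (Cmod (b + t * (e - b) - a) < r)%R.
Proof.
  intros Ht Hb He.
  replace (b + t * (e - b) - a) with ((1 - t)%R * (b - a) + t * (e - a))
    by (rewrite RtoC_minus; ring).
  eapply Rle_lt_trans; [apply Cmod_triangle|].
  rewrite !Cmod_mult, !Cmod_R, !Rabs_pos_eq by lra.
  destruct (Rle_dec t 0).
  - replace t with 0%R by lra. lra.
  - assert (t * Cmod (e - a) < t * r)%R by (apply Rmult_lt_compat_l; lra).
    assert ((1 - t) * Cmod (b - a) <= (1 - t) * r)%R by (apply Rmult_le_compat_l; lra). lra.
Qed.

(** The set of points around which the solutions agree is closed. If [a] is regular for both, a
    segment inside a disc suffices. A pole of one alone contradicts boundedness of the other at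
    nearby points of agreement ([mixed]). At a common pole one moves inside the punctured disc, and
    at [a] itself both triples are 0 by convention. *)
Lemma jacobi_closed (k : C) (s1 c1 d1 s2 c2 d2 : C -> C) (a : C) :
  is_jacobi k s1 c1 d1 -> is_jacobi k s2 c2 d2 ->
  (forall r, (0 < r)%R -> exists b, (Cmod (b - a) < r)%R /\
     exists e, (0 < e)%R /\ forall w, (Cmod (w - b) < e)%R -> eq3 s1 c1 d1 s2 c2 d2 w) ->
  exists e, (0 < e)%R /\ forall w, (Cmod (w - a) < e)%R -> eq3 s1 c1 d1 s2 c2 d2 w.
Proof.
  intros J1 J2 Hcl.
  assert (mixed : forall s1 c1 d1 s2 c2 d2, is_jacobi k s1 c1 d1 ->
    jacobi_ode k s1 c1 d1 a ->
    filterlim (fun w => Cmod (s2 w)) (locally' a) (Rbar_locally p_infty) ->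
    (forall r, (0 < r)%R -> exists b, (Cmod (b - a) < r)%R /\
     exists e, (0 < e)%R /\ forall w, (Cmod (w - b) < e)%R -> eq3 s1 c1 d1 s2 c2 d2 w) ->
    exists e, (0 < e)%R /\ forall w, (Cmod (w - a) < e)%R -> eq3 s1 c1 d1 s2 c2 d2 w).
  { clear. intros s1 c1 d1 s2 c2 d2 J1 R1 L Hcl.
    apply jacobi_ode_cder in R1. destruct R1 as [R1 _].
    destruct (ccont_bound s1 a (cder_ccont _ _ _ R1)) as [dl [M [Hd [HM K]]]].
    destruct (jacobi_pole_blowup s2 a M L) as [e [He B]].
    destruct (Hcl (Rmin dl e) (Rmin_pos _ _ Hd He)) as [b [Hb [r [Hr E]]]].
    destruct (classic (b = a)) as [->|Hne]; [exists r; auto|]. exfalso.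
    assert (b1 := Rlt_le_trans _ _ _ Hb (Rmin_l _ _)).
    assert (b2 := Rlt_le_trans _ _ _ Hb (Rmin_r _ _)).
    specialize (K b b1). specialize (B b Hne b2).
    destruct (E b) as [Es _].
    - replace (b - b) with (RtoC 0) by ring. rewrite Cmod_0. auto.
    - rewrite Es in K. lra. }
  destruct (proj2 (proj2 (proj2 J1)) a) as [R1|[[Z1 [Z2 Z3]] [O1 L1]]];
  destruct (proj2 (proj2 (proj2 J2)) a) as [R2|[[Y1 [Y2 Y3]] [O2 L2]]].
  - destruct (jacobi_regular_near k s1 c1 d1 a J1 R1) as [r1 [Hr1 N1]].
    destruct (jacobi_regular_near k s2 c2 d2 a J2 R2) as [r2 [Hr2 N2]].
    exists (Rmin r1 r2). split; [apply Rmin_pos; auto|].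
    destruct (Hcl (Rmin r1 r2) (Rmin_pos _ _ Hr1 Hr2)) as [b [Hb [r [Hr E]]]].
    assert (Eb : eq3 s1 c1 d1 s2 c2 d2 b).
    { apply E. replace (b - b) with (RtoC 0) by ring. rewrite Cmod_0. auto. }
    intros w Hw. apply (jacobi_segment k _ _ _ _ _ _ b w); auto.
    intros t Ht. assert (S := segment_in_ball a b w _ t Ht Hb Hw).
    split; [apply N1; eapply Rlt_le_trans; [exact S|apply Rmin_l]|
      apply N2; eapply Rlt_le_trans; [exact S|apply Rmin_r]].
  - apply mixed; auto.
  - destruct (mixed s2 c2 d2 s1 c1 d1) as [e [He E]]; auto.
    + intros r Hr. destruct (Hcl r Hr) as [b [Hb [e [He E]]]]. exists b. split; auto.
      exists e. split; auto. intros w Hw. destruct (E w Hw) as [? [? ?]]. repeat split; auto.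
    + exists e. split; auto. intros w Hw. destruct (E w Hw) as [? [? ?]]. repeat split; auto.
  - apply locally'_Cmod in O1, O2. destruct O1 as [r1 [Hr1 N1]]. destruct O2 as [r2 [Hr2 N2]].
    set (r := Rmin r1 r2). assert (Hr : (0 < r)%R) by (apply Rmin_pos; auto).
    assert (r1' : (r <= r1)%R) by apply Rmin_l. assert (r2' : (r <= r2)%R) by apply Rmin_r.
    exists r. split; auto.
    destruct (Hcl r Hr) as [b [Hb [rb [Hrb E]]]].
    assert (Eb : eq3 s1 c1 d1 s2 c2 d2 b).
    { apply E. replace (b - b) with (RtoC 0) by ring. rewrite Cmod_0. auto. }
    assert (seg : forall x y, (Cmod (x - a) < r)%R -> (Cmod (y - a) < r)%R ->
      (forall t, (0 <= t <= 1)%R -> x + t * (y - x) <> a) ->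
      eq3 s1 c1 d1 s2 c2 d2 x -> eq3 s1 c1 d1 s2 c2 d2 y).
    { intros x y Hx Hy Hne Ex. apply (jacobi_segment k _ _ _ _ _ _ x y); auto.
      intros t Ht. assert (S := segment_in_ball a x y _ t Ht Hx Hy). specialize (Hne t Ht).
      split; [apply N1|apply N2]; auto; lra. }
    intros w Hw. destruct (classic (w = a)) as [->|Hwa].
    { repeat split; congruence. }
    destruct (classic (b = a)) as [Eba|Hba].
    + subst b.
      (* Agreement already holds on a disc about [a]; [b'] is a point of that disc on the ray from
         [a] to [w], so the segment from [b'] to [w] misses [a]. *)
      set (b' := a + (Rmin (Cmod (w - a)) rb / (2 * Cmod (w - a)))%R * (w - a)).
      assert (Hwp : (0 < Cmod (w - a))%R).
      { apply Cmod_gt_0. intros K. apply Hwa. replace w with (w - a + a) by ring. rewrite K; ring. }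
      assert (Hmp : (0 < Rmin (Cmod (w - a)) rb)%R) by (apply Rmin_pos; auto).
      assert (m1 := Rmin_l (Cmod (w - a)) rb). assert (m2 := Rmin_r (Cmod (w - a)) rb).
      set (q := (Rmin (Cmod (w - a)) rb / (2 * Cmod (w - a)))%R) in *.
      assert (Hq : (0 < q)%R) by (apply Rdiv_lt_0_compat; lra).
      assert (Eq' : (q * Cmod (w - a) = Rmin (Cmod (w - a)) rb / 2)%R) by (unfold q; field; lra).
      assert (Hq1 : (q < 1)%R) by nra.
      assert (Hb' : (Cmod (b' - a) = q * Cmod (w - a))%R).
      { unfold b'. replace (a + q * (w - a) - a) with (q * (w - a)) by ring.
        rewrite Cmod_mult, Cmod_R, Rabs_pos_eq; lra. }
      apply (seg b' w); auto; [lra| |apply E; lra].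
      intros t Ht K.
      assert (K2 : RtoC (q + t * (1 - q)) * (w - a) = 0).
      { rewrite RtoC_plus, RtoC_mult, RtoC_minus. unfold b' in K.
        transitivity (a + q * (w - a) + t * (w - (a + q * (w - a))) - a); [ring|].
        rewrite K. ring. }
      apply (f_equal Cmod) in K2. rewrite Cmod_mult, Cmod_R, Cmod_0, Rabs_pos_eq in K2 by nra.
      assert (0 < q + t * (1 - q))%R by nra. nra.
    + destruct (classic (exists t, (0 <= t <= 1)%R /\ b + t * (w - b) = a)) as [[t [Ht Et]]|Hn].
      (* The pole lies between [b] and [w]. The detour goes through [b] turned by a right angle
         about [a]; both legs miss [a]. *)
      * set (e := a + Ci * (b - a)).
        assert (Hbp : (0 < Cmod (b - a))%R).
        { apply Cmod_gt_0. intros K. apply Hba. replace b with (b - a + a) by ring. rewrite K; ring. }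
        assert (He : (Cmod (e - a) = Cmod (b - a))%R).
        { unfold e. replace (a + Ci * (b - a) - a) with (Ci * (b - a)) by ring.
          rewrite Cmod_mult, Cmod_Ci. ring. }
        assert (Ht0 : t <> 0%R).
        { intros ->. apply Hba. rewrite <- Et. ring. }
        assert (Hz : forall x y : R, RtoC x + RtoC y * Ci = 0 -> x = 0%R /\ y = 0%R).
        { intros x y K. split.
          - apply (f_equal fst) in K. simpl in K. lra.
          - apply (f_equal snd) in K. simpl in K. lra. }
        assert (Hba0 : b - a <> 0) by (apply Cmod_gt_0; auto).
        assert (Ew : w - a = (- (1 - t) / t)%R * (b - a)).
        { replace (w - a) with ((b + t * (w - b) - a - (1 - t) * (b - a)) / t).
          - rewrite Et. unfold Rdiv. rewrite RtoC_mult, RtoC_opp, RtoC_minus, RtoC_inv by auto. field.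
            intros K. apply RtoC_inj in K. auto.
          - field. intros K. apply RtoC_inj in K. auto. }
        apply (seg e w); auto; [lra| |].
        { intros t' Ht' K.
          assert (K2 : ((RtoC (t' * (- (1 - t) / t)) + RtoC (1 - t') * Ci)) * (b - a) = 0).
          { rewrite RtoC_mult, Cmult_plus_distr_r, <- Cmult_assoc, <- Ew, RtoC_minus.
            transitivity (e + t' * (w - e) - a); [unfold e; ring|]. rewrite K. ring. }
          assert (K3 : RtoC (t' * (- (1 - t) / t)) + RtoC (1 - t') * Ci = 0).
          { apply NNPP. intros Hn. apply (Cmult_neq_0 _ _ Hn Hba0 K2). }
          destruct (Hz _ _ K3) as [K4 K5]. replace t' with 1%R in K4 by lra.
          assert (K6 : (1 - t = 0)%R).
          { apply Rmult_eq_reg_r with (- / t)%R; [lra|].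
            apply Ropp_neq_0_compat, Rinv_neq_0_compat; auto. }
          apply Hwa. replace w with (w - a + a) by ring. rewrite Ew, K6.
          replace (- 0 / t)%R with 0%R by (field; auto). ring. }
        apply (seg b e); auto; [lra|].
        intros t' Ht' K.
        assert (K2 : (RtoC (1 - t') + RtoC t' * Ci) * (b - a) = 0).
        { rewrite RtoC_minus. transitivity (b + t' * (e - b) - a); [unfold e; ring|]. rewrite K. ring. }
        assert (K3 : RtoC (1 - t') + RtoC t' * Ci = 0).
        { apply NNPP. intros Hn. apply (Cmult_neq_0 _ _ Hn Hba0 K2). }
        destruct (Hz _ _ K3). lra.
      * apply (seg b w); auto. intros t Ht K. apply Hn. exists t; auto.
Qed.

(** On the segment from 0 to [z], the set of points around which both solutions agree contains 0, is
    open, and is closed by [jacobi_closed]; the supremum [T] is therefore 1. *)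
Theorem jacobi_unique (k : C) (s1 c1 d1 s2 c2 d2 : C -> C) (z : C) :
  is_jacobi k s1 c1 d1 -> is_jacobi k s2 c2 d2 -> eq3 s1 c1 d1 s2 c2 d2 z.
Proof.
  intros J1 J2.
  set (good := fun a => exists e, (0 < e)%R /\
    forall w, (Cmod (w - a) < e)%R -> eq3 s1 c1 d1 s2 c2 d2 w).
  assert (self : forall a, good a -> eq3 s1 c1 d1 s2 c2 d2 a).
  { intros a [e [He E]]. apply E. replace (a - a) with (RtoC 0) by ring. rewrite Cmod_0. auto. }
  assert (good0 : good 0).
  { destruct J1 as [a1 [a2 [a3 H1]]] eqn:EJ1. destruct J2 as [b1 [b2 [b3 H2]]] eqn:EJ2.
    assert (R1 : jacobi_ode k s1 c1 d1 0).
    { destruct (H1 0) as [R|[[_ [Z _]] _]]; auto. rewrite a2 in Z. destruct (C1_nz Z). }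
    assert (R2 : jacobi_ode k s2 c2 d2 0).
    { destruct (H2 0) as [R|[[_ [Z _]] _]]; auto. rewrite b2 in Z. destruct (C1_nz Z). }
    destruct (jacobi_regular_near k s1 c1 d1 0 J1 R1) as [r1 [Hr1 N1]].
    destruct (jacobi_regular_near k s2 c2 d2 0 J2 R2) as [r2 [Hr2 N2]].
    exists (Rmin r1 r2). split; [apply Rmin_pos; auto|].
    intros w Hw. apply (jacobi_segment k _ _ _ _ _ _ 0 w); [|repeat split; congruence].
    intros t Ht. assert (S := segment_in_ball 0 0 w (Rmin r1 r2) t Ht
      ltac:(replace (0 - 0) with (RtoC 0) by ring; rewrite Cmod_0; apply Rmin_pos; auto) Hw).
    split; [apply N1; eapply Rlt_le_trans; [exact S|apply Rmin_l]|
      apply N2; eapply Rlt_le_trans; [exact S|apply Rmin_r]]. }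
  assert (open : forall a, good a -> exists r, (0 < r)%R /\ forall b, (Cmod (b - a) < r)%R -> good b).
  { intros a [e [He E]]. exists e. split; auto. intros b Hb. exists (e - Cmod (b - a))%R.
    split; [lra|]. intros w Hw. apply E. replace (w - a) with ((w - b) + (b - a)) by ring.
    eapply Rle_lt_trans; [apply Cmod_triangle|]. lra. }
  set (S := fun t : R => (0 <= t <= 1)%R /\ forall s, (0 <= s <= t)%R -> good (s * z)).
  destruct (completeness S) as [T [U L]].
  { exists 1%R. intros t [Ht _]. lra. }
  { exists 0%R. split; [lra|]. intros s Hs. replace s with 0%R by lra. rewrite Cmult_0_l. auto. }
  assert (T0 : (0 <= T)%R).
  { apply U. split; [lra|]. intros s Hs. replace s with 0%R by lra. rewrite Cmult_0_l. auto. }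
  assert (T1 : (T <= 1)%R) by (apply L; intros t [Ht _]; lra).
  assert (below : forall s, (0 <= s < T)%R -> good (s * z)).
  { intros s Hs. apply NNPP. intros Hn. assert (T <= s)%R; [|lra].
    apply L. intros t [Ht Kt]. apply Rnot_lt_le. intros Hlt. apply Hn, Kt. lra. }
  assert (GT : good (T * z)).
  { destruct (Rle_lt_or_eq_dec 0 T T0) as [HT|<-]; [|rewrite Cmult_0_l; auto].
    apply (jacobi_closed k); auto. intros r Hr.
    assert (Hz := Cmod_ge_0 z).
    set (h := Rmin T (r / (Cmod z + 1) / 2)).
    assert (Hh : (0 < h)%R).
    { apply Rmin_pos; auto. apply Rdiv_lt_0_compat; [apply Rdiv_lt_0_compat|]; lra. }
    assert (h1 : (h <= T)%R) by apply Rmin_l.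
    assert (h2 : (h <= r / (Cmod z + 1) / 2)%R) by apply Rmin_r.
    exists ((T - h)%R * z). split.
    - replace ((T - h)%R * z - T * z) with (RtoC (- h) * z)
        by (rewrite RtoC_minus, RtoC_opp; ring).
      rewrite Cmod_mult, Cmod_R, Rabs_Ropp, Rabs_pos_eq by lra.
      apply Rle_lt_trans with (h * (Cmod z + 1))%R; [nra|].
      apply Rmult_le_compat_r with (r := (Cmod z + 1)%R) in h2; [|lra].
      replace (r / (Cmod z + 1) / 2 * (Cmod z + 1))%R with (r / 2)%R in h2 by (field; lra). lra.
    - apply below. lra. }
  destruct (Rle_lt_or_eq_dec T 1 T1) as [HT|HT].
  2:{ apply self. rewrite HT, Cmult_1_l in GT. exact GT. }
  exfalso. destruct (open _ GT) as [r [Hr O]].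
  assert (Hz := Cmod_ge_0 z).
  set (h := Rmin (1 - T) (r / (Cmod z + 1) / 2)).
  assert (Hh : (0 < h)%R).
  { apply Rmin_pos; [lra|]. apply Rdiv_lt_0_compat; [apply Rdiv_lt_0_compat|]; lra. }
  assert (h1 : (h <= 1 - T)%R) by apply Rmin_l.
  assert (h2 : (h <= r / (Cmod z + 1) / 2)%R) by apply Rmin_r.
  assert (T + h <= T)%R; [|lra]. apply U. split; [lra|]. intros s Hs.
  destruct (Rlt_le_dec s T) as [Hlt|Hge]; [apply below; lra|].
  apply O. replace (s * z - T * z) with (RtoC (s - T) * z) by (rewrite RtoC_minus; ring).
  rewrite Cmod_mult, Cmod_R, Rabs_pos_eq by lra.
  apply Rle_lt_trans with (h * (Cmod z + 1))%R; [nra|].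
  apply Rmult_le_compat_r with (r := (Cmod z + 1)%R) in h2; [|lra].
  replace (r / (Cmod z + 1) / 2 * (Cmod z + 1))%R with (r / 2)%R in h2 by (field; lra). lra.
Qed.

(** * Jacobi functions as theta quotients *)

Lemma Cmod_powz_inj (p : C) (a b : Z) : qdisc p -> Cmod (p ^^ a) = Cmod (p ^^ b) -> a = b.
Proof.
  intros Hp H. assert (Hl := ln_qdisc p Hp). rewrite !Cmod_powz in H by apply Hp.
  apply exp_inv in H. apply eq_IZR. nra.
Qed.

Lemma th1_eq_0 (p w : C) : qdisc p -> th1 p w = 0 ->
  exists k : Z, Cexp (2 * PI * Ci * w) = p ^^ (8 * k).
Proof.
  intros Hp H. assert (Hq := qdisc_pow8 p Hp). rewrite th1_prod in H by auto.
  destruct (classic (theta (p ^ 8) (Cexp (2 * PI * Ci * w)) = 0)) as [K|K].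
  - destruct (theta_eq_0 _ _ Hq (Cexp_nz _) K) as [k E]. exists k. rewrite E.
    apply (Cpowz_pow p 8 k), Hp.
  - exfalso. revert H. apply Cmult_neq_0; [apply Cmult_neq_0|]; auto using poch_inf_q_nz.
    apply Copp_nz, Cmult_neq_0; [apply Hp|apply Cinv_nz, Cexp_nz].
Qed.

Lemma th2_eq_0 (p w : C) : qdisc p -> th2 p w = 0 ->
  exists k : Z, - Cexp (2 * PI * Ci * w) = p ^^ (8 * k).
Proof.
  intros Hp H. assert (Hq := qdisc_pow8 p Hp). rewrite th2_prod in H by auto.
  destruct (classic (theta (p ^ 8) (- Cexp (2 * PI * Ci * w)) = 0)) as [K|K].
  - destruct (theta_eq_0 _ _ Hq (Copp_nz _ (Cexp_nz _)) K) as [k E]. exists k. rewrite E.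
    apply (Cpowz_pow p 8 k), Hp.
  - exfalso. revert H. apply Cmult_neq_0; [apply Cmult_neq_0|]; auto using poch_inf_q_nz.
    apply Cmult_neq_0; [apply Hp|apply Cinv_nz, Cexp_nz].
Qed.

Lemma th3_eq_0 (p w : C) : qdisc p -> th3 p w = 0 ->
  exists k : Z, - (p ^ 4 * Cexp (2 * PI * Ci * w)) = p ^^ (8 * k).
Proof.
  intros Hp H. assert (Hq := qdisc_pow8 p Hp). rewrite th3_prod in H by auto.
  assert (Hn : p ^ 4 * Cexp (2 * PI * Ci * w) <> 0)
    by (apply Cmult_neq_0; [apply Cpow_nz, Hp|apply Cexp_nz]).
  destruct (classic (theta (p ^ 8) (- (p ^ 4 * Cexp (2 * PI * Ci * w))) = 0)) as [K|K].
  - destruct (theta_eq_0 _ _ Hq (Copp_nz _ Hn) K) as [k E]. exists k. rewrite E.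
    apply (Cpowz_pow p 8 k), Hp.
  - exfalso. revert H. apply Cmult_neq_0; auto using poch_inf_q_nz.
Qed.

Lemma th4_eq_0 (p w : C) : qdisc p -> th4 p w = 0 ->
  exists k : Z, p ^ 4 * Cexp (2 * PI * Ci * w) = p ^^ (8 * k).
Proof.
  intros Hp H. assert (Hq := qdisc_pow8 p Hp). rewrite th4_prod in H by auto.
  assert (Hn : p ^ 4 * Cexp (2 * PI * Ci * w) <> 0)
    by (apply Cmult_neq_0; [apply Cpow_nz, Hp|apply Cexp_nz]).
  destruct (classic (theta (p ^ 8) (p ^ 4 * Cexp (2 * PI * Ci * w)) = 0)) as [K|K].
  - destruct (theta_eq_0 _ _ Hq Hn K) as [k E]. exists k. rewrite E.
    apply (Cpowz_pow p 8 k), Hp.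
  - exfalso. revert H. apply Cmult_neq_0; auto using poch_inf_q_nz.
Qed.

(** Zeros of [th4] have |exp(2 pi i w)| = |p|^(8k - 4), those of [th1] and [th2] have |p|^(8k), and
    those of [th3] differ from those of [th4] by a sign. *)
Lemma th4_zero_others (p w : C) : qdisc p -> th4 p w = 0 ->
  th1 p w <> 0 /\ th2 p w <> 0 /\ th3 p w <> 0.
Proof.
  intros Hp H. destruct (th4_eq_0 p w Hp H) as [k E]. assert (Hp0 := proj1 Hp).
  change (p ^ 4) with (p ^^ 4) in E.
  repeat split; intros H'.
  - destruct (th1_eq_0 p w Hp H') as [m E']. rewrite E', <- Cpowz_add in E by auto.
    apply (f_equal Cmod) in E. apply Cmod_powz_inj in E; auto. lia.
  - destruct (th2_eq_0 p w Hp H') as [m E'].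
    replace (Cexp (2 * PI * Ci * w)) with (- p ^^ (8 * m)) in E by (rewrite <- E'; ring).
    apply (f_equal Cmod) in E. rewrite Cmod_mult, Cmod_opp, <- Cmod_mult, <- Cpowz_add in E by auto.
    apply Cmod_powz_inj in E; auto. lia.
  - destruct (th3_eq_0 p w Hp H') as [m E']. change (p ^ 4) with (p ^^ 4) in E'.
    rewrite E in E'. assert (K := f_equal Cmod E'). rewrite Cmod_opp in K.
    apply Cmod_powz_inj in K; auto. replace m with k in E' by lia.
    assert (Hz := Cpowz_nz p (8 * k) Hp0). apply Hz.
    replace (p ^^ (8 * k)) with ((p ^^ (8 * k) - - p ^^ (8 * k)) / 2) by field.
    rewrite E'. field.
Qed.

Lemma PI_Ci_nz : PI * Ci <> 0.
Proof. intros E. apply two_pi_i_nz. rewrite <- Cmult_assoc, E. ring. Qed.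

Lemma RtoC_PI_nz : RtoC PI <> 0.
Proof. intros E. apply PI_Ci_nz. rewrite E. ring. Qed.

(** The zeros of [th4] are simple: at a double zero the Wronskian with [th1] would vanish, yet [th2]
    and [th3] do not. *)
Lemma dth4_zero_nz (p w : C) : qdisc p -> th4 p w = 0 -> dth4 p w <> 0.
Proof.
  intros Hp H E. destruct (th4_zero_others p w Hp H) as [H1 [H2 H3]].
  assert (W := wronskian_14 p w Hp). rewrite H, E in W.
  destruct (th234_0_nz p Hp) as [N2 [N3 N4]].
  assert (K : PI * Ci * th4 p 0 ^ 2 * (th2 p w * th3 p w) <> 0).
  { repeat apply Cmult_neq_0; auto using RtoC_PI_nz, Ci_nz, Cpow_nz, C1_nz. }
  apply K. rewrite <- W. ring.
Qed.

Lemma th4_isolated (p w : C) : qdisc p -> exists d : R, (0 < d)%R /\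
  forall v, v <> w -> (Cmod (v - w) < d)%R -> th4 p v <> 0.
Proof.
  intros Hp. assert (D := cder_th4 p w Hp).
  destruct (classic (th4 p w = 0)) as [H|H].
  - assert (N := dth4_zero_nz p w Hp H). apply Cmod_gt_0 in N.
    destruct (D (Cmod (dth4 p w) / 2)%R) as [d [Hd K]]; [lra|].
    exists d. split; auto. intros v Hv Hvd E. specialize (K (v - w) Hvd).
    replace (w + (v - w)) with v in K by ring. rewrite H, E in K.
    replace (0 - 0 - dth4 p w * (v - w)) with (- (dth4 p w * (v - w))) in K by ring.
    rewrite Cmod_opp, Cmod_mult in K.
    assert (0 < Cmod (v - w))%R.
    { apply Cmod_gt_0. intros Z. apply Hv. replace v with (v - w + w) by ring. rewrite Z; ring. }
    nra.
  - destruct (ccont_nz _ _ (cder_ccont _ _ _ D) H) as [d [Hd K]].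
    exists d. split; auto. intros v _ Hv E. specialize (K v Hv). rewrite E, Cmod_0 in K.
    assert (X := Cmod_ge_0 (th4 p w)). lra.
Qed.

Definition period_K (p : C) : C := PI * th3 p 0 ^ 2.
(** The classical theta quotients, with argument scaled by pi theta_3(0)^2 = 2K; the factor [- Ci]
    undoes the factor i contained in [th1]. *)
Definition theta_sn (p z : C) : C :=
  - Ci * (th3 p 0 / th2 p 0) * (th1 p (/ period_K p * z) / th4 p (/ period_K p * z)).
Definition theta_cn (p z : C) : C :=
  th4 p 0 / th2 p 0 * (th2 p (/ period_K p * z) / th4 p (/ period_K p * z)).
Definition theta_dn (p z : C) : C :=
  th4 p 0 / th3 p 0 * (th3 p (/ period_K p * z) / th4 p (/ period_K p * z)).
Definition theta_modulus (p : C) : C := th2 p 0 ^ 2 / th3 p 0 ^ 2.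

Lemma period_K_nz (p : C) : qdisc p -> period_K p <> 0.
Proof.
  intros Hp. destruct (th234_0_nz p Hp) as [N2 [N3 N4]].
  apply Cmult_neq_0; auto using RtoC_PI_nz, Cpow_nz.
Qed.

Lemma theta_jacobi_ode (p w0 z : C) : qdisc p -> Cexp (PI * Ci * w0) = p ^ 2 ->
  th4 p (/ period_K p * z) <> 0 ->
  jacobi_ode (theta_modulus p) (theta_sn p) (theta_cn p) (theta_dn p) z.
Proof.
  intros Hp Hw0 H4. apply jacobi_ode_cder.
  destruct (th234_0_nz p Hp) as [N2 [N3 N4]]. assert (HK := period_K_nz p Hp).
  set (c := / period_K p) in *.
  assert (D1 := cder_scal_arg c _ z _ (cder_th1 p (c * z) Hp)).
  assert (D2 := cder_scal_arg c _ z _ (cder_th2 p (c * z) Hp)).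
  assert (D3 := cder_scal_arg c _ z _ (cder_th3 p (c * z) Hp)).
  assert (D4 := cder_scal_arg c _ z _ (cder_th4 p (c * z) Hp)).
  assert (W1 := wronskian_14 p (c * z) Hp).
  assert (W2 := wronskian_24 p (c * z) Hp).
  assert (W3 := wronskian_34 p (c * z) w0 Hp Hw0).
  assert (Hpi := RtoC_PI_nz).
  assert (Ec : c = / (PI * th3 p 0 ^ 2)) by reflexivity.
  assert (Ci2 : Ci * Ci = -1) by (apply injective_projections; simpl; ring).
  split; [|split].
  - assert (Q := cder_scal (- Ci * (th3 p 0 / th2 p 0)) _ _ _ (cder_quot _ _ z _ _ D1 D4 H4)).
    match type of Q with cder _ _ ?l => replace (theta_cn p z * theta_dn p z) with l end;
      [exact Q|].
    unfold theta_cn, theta_dn. fold c.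
    replace (c * dth1 p (c * z) * th4 p (c * z) - th1 p (c * z) * (c * dth4 p (c * z)))
      with (c * (dth1 p (c * z) * th4 p (c * z) - th1 p (c * z) * dth4 p (c * z))) by ring.
    rewrite W1.
    transitivity (- (Ci * Ci) * (th4 p 0 ^ 2 / (th2 p 0 * th3 p 0)
       * (th2 p (c * z) * th3 p (c * z) / th4 p (c * z) ^ 2))).
    + rewrite Ec at 1. field. auto.
    + rewrite Ci2. field. auto.
  - assert (Q := cder_scal (th4 p 0 / th2 p 0) _ _ _ (cder_quot _ _ z _ _ D2 D4 H4)).
    match type of Q with cder _ _ ?l => replace (- (theta_sn p z * theta_dn p z)) with l end;
      [exact Q|].
    unfold theta_sn, theta_dn. fold c.
    replace (c * dth2 p (c * z) * th4 p (c * z) - th2 p (c * z) * (c * dth4 p (c * z)))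
      with (c * (dth2 p (c * z) * th4 p (c * z) - th2 p (c * z) * dth4 p (c * z))) by ring.
    rewrite W2. rewrite Ec at 1. field. auto.
  - assert (Q := cder_scal (th4 p 0 / th3 p 0) _ _ _ (cder_quot _ _ z _ _ D3 D4 H4)).
    match type of Q with cder _ _ ?l =>
      replace (- (theta_modulus p ^ 2 * (theta_sn p z * theta_cn p z))) with l end;
      [exact Q|].
    unfold theta_sn, theta_cn, theta_modulus. fold c.
    replace (c * dth3 p (c * z) * th4 p (c * z) - th3 p (c * z) * (c * dth4 p (c * z)))
      with (c * (dth3 p (c * z) * th4 p (c * z) - th3 p (c * z) * dth4 p (c * z))) by ring.
    rewrite W3. rewrite Ec at 1. field. auto.
Qed.

(** The totalized inverse gives the theta quotients the value 0 at the zeros of [th4], the value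
    that [is_jacobi] prescribes at poles. *)
Lemma Cinv_0 : / (RtoC 0) = 0.
Proof.
  unfold Cinv. simpl. unfold Rdiv. apply injective_projections; simpl.
  - ring.
  - replace (- 0)%R with 0%R by ring. ring.
Qed.

Lemma Cdiv_0 (z : C) : z / 0 = 0.
Proof. unfold Cdiv. rewrite Cinv_0. ring. Qed.

Lemma theta_is_jacobi (p w0 : C) : qdisc p -> Cexp (PI * Ci * w0) = p ^ 2 ->
  is_jacobi (theta_modulus p) (theta_sn p) (theta_cn p) (theta_dn p).
Proof.
  intros Hp Hw0. destruct (th234_0_nz p Hp) as [N2 [N3 N4]]. assert (HK := period_K_nz p Hp).
  assert (Hc := Cinv_nz _ HK). assert (Hcp := proj1 (Cmod_gt_0 _) Hc).
  split; [|split; [|split]].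
  - unfold theta_sn. rewrite Cmult_0_r, th1_0 by auto. unfold Cdiv. ring.
  - unfold theta_cn. rewrite Cmult_0_r. field. auto.
  - unfold theta_dn. rewrite Cmult_0_r. field. auto.
  - intros z. destruct (classic (th4 p (/ period_K p * z) = 0)) as [H|H].
    2:{ left. apply theta_jacobi_ode with w0; auto. }
    right. set (c := / period_K p) in *.
    split; [|split].
    + unfold theta_sn, theta_cn, theta_dn. fold c. rewrite H, !Cdiv_0, !Cmult_0_r. auto.
    + apply locally'_Cmod. destruct (th4_isolated p (c * z) Hp) as [d [Hd K]].
      exists (d / Cmod c)%R. split; [apply Rdiv_lt_0_compat; auto|].
      intros w Hw Hwd. apply theta_jacobi_ode with w0; auto. fold c. apply K.
      * intros E. apply Hw. replace w with (c * w / c) by (field; auto). rewrite E. field. auto.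
      * replace (c * w - c * z) with (c * (w - z)) by ring. rewrite Cmod_mult.
        apply Rmult_lt_compat_l with (r := Cmod c) in Hwd; auto.
        replace (Cmod c * (d / Cmod c))%R with d in Hwd by (field; lra). auto.
    + intros P [M HM]. apply locally'_Cmod.
      assert (D1 := cder_ccont _ _ _ (cder_scal_arg c _ z _ (cder_th1 p (c * z) Hp))).
      assert (D4 := cder_ccont _ _ _ (cder_scal_arg c _ z _ (cder_th4 p (c * z) Hp))).
      destruct (th4_zero_others p (c * z) Hp H) as [H1 _].
      destruct (ccont_nz _ _ D1 H1) as [d1 [Hd1 K1]].
      set (m := Cmod (th1 p (c * z))) in *. assert (Hm := proj1 (Cmod_gt_0 _) H1). fold m in Hm.
      set (e := Cmod (- Ci * (th3 p 0 / th2 p 0))).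
      assert (He : (0 < e)%R).
      { apply Cmod_gt_0. repeat apply Cmult_neq_0; auto using Copp_nz, Ci_nz, Cinv_nz. }
      assert (HM0 := Rabs_pos M).
      (* With |th1| above m / 2 and |th4| below this threshold, the quotient exceeds |M| + 1. *)
      destruct (D4 (e * m / (2 * (Rabs M + 1)))%R) as [d4 [Hd4 K4]].
      { apply Rdiv_lt_0_compat; [apply Rmult_lt_0_compat|]; lra. }
      destruct (th4_isolated p (c * z) Hp) as [d [Hd K]].
      exists (Rmin d1 (Rmin d4 (d / Cmod c))).
      split; [repeat apply Rmin_pos; auto; apply Rdiv_lt_0_compat; auto|].
      intros w Hw Hwd. apply HM.
      assert (w1 := Rlt_le_trans _ _ _ Hwd (Rmin_l _ _)).
      assert (w2 := Rlt_le_trans _ _ _ Hwd (Rmin_r _ _)).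
      assert (w3 := Rlt_le_trans _ _ _ w2 (Rmin_l _ _)).
      assert (w4 := Rlt_le_trans _ _ _ w2 (Rmin_r _ _)).
      specialize (K1 w w1). specialize (K4 w w3). cbv beta in K4.
      rewrite H in K4. replace (th4 p (c * w) - 0) with (th4 p (c * w)) in K4 by ring.
      assert (Hne : th4 p (c * w) <> 0).
      { apply K.
        * intros E. apply Hw. replace w with (c * w / c) by (field; auto). rewrite E. field. auto.
        * replace (c * w - c * z) with (c * (w - z)) by ring. rewrite Cmod_mult.
          apply Rmult_lt_compat_l with (r := Cmod c) in w4; auto.
          replace (Cmod c * (d / Cmod c))%R with d in w4 by (field; lra). auto. }
      unfold theta_sn. fold c. rewrite Cmod_mult, Cmod_div by auto. fold e.
      apply Cmod_gt_0 in Hne. set (t := Cmod (th4 p (c * w))) in *.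
      apply Rmult_lt_reg_r with t; auto.
      replace (e * (Cmod (th1 p (c * w)) / t) * t)%R with (e * Cmod (th1 p (c * w)))%R
        by (field; lra).
      apply Rle_lt_trans with ((Rabs M + 1) * t)%R.
      * apply Rmult_le_compat_r; [lra|]. assert (X := Rle_abs M). lra.
      * apply Rlt_trans with ((Rabs M + 1) * (e * m / (2 * (Rabs M + 1))))%R.
        -- apply Rmult_lt_compat_l; lra.
        -- replace ((Rabs M + 1) * (e * m / (2 * (Rabs M + 1))))%R with (e * (m / 2))%R
             by (field; lra). apply Rmult_lt_compat_l; auto.
Qed.

Lemma jacobi_sn_theta (p w0 z : C) : qdisc p -> Cexp (PI * Ci * w0) = p ^ 2 ->
  jacobi_sn (theta_modulus p) z = theta_sn p z.
Proof.
  intros Hp Hw0. assert (J := theta_is_jacobi p w0 Hp Hw0).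
  apply (iota_unique (V := C_CompleteNormedModule)).
  - intros y [s [c [d [J' ->]]]]. apply (jacobi_unique _ _ _ _ _ _ _ z J' J).
  - exists (theta_sn p), (theta_cn p), (theta_dn p). auto.
Qed.

Lemma jacobi_cn_theta (p w0 z : C) : qdisc p -> Cexp (PI * Ci * w0) = p ^ 2 ->
  jacobi_cn (theta_modulus p) z = theta_cn p z.
Proof.
  intros Hp Hw0. assert (J := theta_is_jacobi p w0 Hp Hw0).
  apply (iota_unique (V := C_CompleteNormedModule)).
  - intros y [s [c [d [J' ->]]]]. apply (jacobi_unique _ _ _ _ _ _ _ z J' J).
  - exists (theta_sn p), (theta_cn p), (theta_dn p). auto.
Qed.

Lemma jacobi_dn_theta (p w0 z : C) : qdisc p -> Cexp (PI * Ci * w0) = p ^ 2 ->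
  jacobi_dn (theta_modulus p) z = theta_dn p z.
Proof.
  intros Hp Hw0. assert (J := theta_is_jacobi p w0 Hp Hw0).
  apply (iota_unique (V := C_CompleteNormedModule)).
  - intros y [s [c [d [J' ->]]]]. apply (jacobi_unique _ _ _ _ _ _ _ z J' J).
  - exists (theta_sn p), (theta_cn p), (theta_dn p). auto.
Qed.

Lemma mero_value_eq (f g : C -> C) (z : C) (d : R) : (0 < d)%R ->
  (forall w, w <> z -> (Cmod (w - z) < d)%R -> f w = g w) -> ccont g z ->
  mero_value f z = g z.
Proof.
  intros Hd E Hg.
  assert (lim : forall l : C, filterlim f (locally' z) (locally l) <->
    forall eps, (0 < eps)%R -> exists e, (0 < e)%R /\
      forall w, w <> z -> (Cmod (w - z) < e)%R -> (Cmod (f w - l) < eps)%R).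
  { intros l. split.
    - intros H eps He. apply locally'_Cmod. apply (H (fun y => (Cmod (y - l) < eps)%R)).
      apply locally_Cmod'. exists eps. auto.
    - intros H P HP. apply locally_Cmod' in HP. destruct HP as [eps [He HP]].
      apply locally'_Cmod. destruct (H eps He) as [e [He' K]]. exists e. split; auto. }
  assert (L : filterlim f (locally' z) (locally (g z))).
  { apply lim. intros eps He. destruct (Hg eps He) as [e [He' K]].
    exists (Rmin d e). split; [apply Rmin_pos; auto|]. intros w Hw Hwd.
    rewrite E; auto.
    - apply K. eapply Rlt_le_trans; [exact Hwd|apply Rmin_r].
    - eapply Rlt_le_trans; [exact Hwd|apply Rmin_l]. }
  apply (iota_unique (V := C_CompleteNormedModule)); auto.
  intros y Hy. apply Ceq_small. intros eps He.
  destruct (proj1 (lim y) Hy (eps / 2)%R) as [e1 [He1 K1]]; [lra|].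
  destruct (proj1 (lim (g z)) L (eps / 2)%R) as [e2 [He2 K2]]; [lra|].
  set (h := (Rmin e1 e2 / 2)%R). assert (Hm : (0 < Rmin e1 e2)%R) by (apply Rmin_pos; auto).
  assert (m1 := Rmin_l e1 e2). assert (m2 := Rmin_r e1 e2).
  assert (Eh : Cmod (z + RtoC h - z) = h).
  { replace (z + RtoC h - z) with (RtoC h) by ring. rewrite Cmod_R, Rabs_pos_eq; unfold h; lra. }
  assert (Hne : z + RtoC h <> z).
  { intros K. rewrite K in Eh. replace (z - z) with (RtoC 0) in Eh by ring.
    rewrite Cmod_0 in Eh. unfold h in Eh. lra. }
  specialize (K1 _ Hne ltac:(rewrite Eh; unfold h; lra)).
  specialize (K2 _ Hne ltac:(rewrite Eh; unfold h; lra)).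
  replace (y - g z) with ((f (z + RtoC h) - g z) - (f (z + RtoC h) - y)) by ring.
  eapply Rle_lt_trans; [apply Cmod_triangle_sub|]. lra.
Qed.

(** The quotient dn / (sn cn) after cancelling [th4]; it stays regular at the common poles, where
    the original expression is undefined. *)
Definition theta_ratio (p w : C) : C :=
  Ci * (th2 p 0 ^ 2 / th3 p 0 ^ 2) * (th3 p w * th4 p w / (th1 p w * th2 p w)).

Lemma ccont_const (a z : C) : ccont (fun _ => a) z.
Proof.
  intros eps He. exists 1%R. split; [lra|]. intros.
  replace (a - a) with (RtoC 0) by ring. rewrite Cmod_0. auto.
Qed.

Lemma theta_ratio_ccont (p u : C) : qdisc p -> th1 p u <> 0 -> th2 p u <> 0 ->
  ccont (theta_ratio p) u.
Proof.
  intros Hp H1 H2. unfold theta_ratio.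
  apply (ccont_mult (fun _ => Ci * (th2 p 0 ^ 2 / th3 p 0 ^ 2))); [apply ccont_const|].
  apply (ccont_mult (fun w => th3 p w * th4 p w) (fun w => / (th1 p w * th2 p w))).
  - apply ccont_mult; eapply cder_ccont; [apply cder_th3|apply cder_th4]; auto.
  - apply (ccont_inv (fun w => th1 p w * th2 p w)); [|apply Cmult_neq_0; auto].
    apply ccont_mult; eapply cder_ccont; [apply cder_th1|apply cder_th2]; auto.
Qed.

Lemma mero_jacobi (p w0 u : C) : qdisc p -> Cexp (PI * Ci * w0) = p ^ 2 ->
  th1 p u <> 0 -> th2 p u <> 0 ->
  mero_value (fun w => jacobi_dn (theta_modulus p) (period_K p * w)
    / (jacobi_sn (theta_modulus p) (period_K p * w)
       * jacobi_cn (theta_modulus p) (period_K p * w))) u = theta_ratio p u /\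
  mero_value (fun w => 1 / (jacobi_sn (theta_modulus p) (period_K p * w)
       * jacobi_sn (theta_modulus p) (period_K p * (w + 1 / 2)))) u = theta_ratio p u.
Proof.
  intros Hp Hw0 H1 H2. destruct (th234_0_nz p Hp) as [N2 [N3 N4]].
  assert (HK := period_K_nz p Hp).
  assert (EK : forall w, / period_K p * (period_K p * w) = w) by (intros; field; auto).
  assert (Ci2 : Ci * Ci = -1) by (apply injective_projections; simpl; ring).
  assert (HCi := Ci_nz).
  destruct (ccont_nz _ _ (cder_ccont _ _ _ (cder_th1 p u Hp)) H1) as [d1 [Hd1 K1]].
  destruct (ccont_nz _ _ (cder_ccont _ _ _ (cder_th2 p u Hp)) H2) as [d2 [Hd2 K2]].
  destruct (th4_isolated p u Hp) as [d4 [Hd4 K4]].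
  (* As [th3] is the translate of [th4] by 1/2, this keeps [th3] away from 0 near [u], except
     possibly at [u]. *)
  destruct (th4_isolated p (u + 1 / 2) Hp) as [d3 [Hd3 K3]].
  assert (G : forall w, w <> u -> (Cmod (w - u) < Rmin (Rmin d1 d2) (Rmin d3 d4))%R ->
     th1 p w <> 0 /\ th2 p w <> 0 /\ th3 p w <> 0 /\ th4 p w <> 0).
  { intros w Hw Hwd.
    assert (w1 := Rlt_le_trans _ _ _ Hwd (Rmin_l _ _)).
    assert (w2 := Rlt_le_trans _ _ _ Hwd (Rmin_r _ _)).
    assert (wa := Rlt_le_trans _ _ _ w1 (Rmin_l _ _)).
    assert (wb := Rlt_le_trans _ _ _ w1 (Rmin_r _ _)).
    assert (wc := Rlt_le_trans _ _ _ w2 (Rmin_l _ _)).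
    assert (wd := Rlt_le_trans _ _ _ w2 (Rmin_r _ _)).
    specialize (K1 w wa). specialize (K2 w wb). specialize (K4 w Hw wd).
    specialize (K3 (w + 1 / 2)). rewrite th4_half in K3.
    assert (A1 := Cmod_ge_0 (th1 p u)). assert (A2 := Cmod_ge_0 (th2 p u)).
    repeat split; auto.
    - apply Cmod_gt_0. lra.
    - apply Cmod_gt_0. lra.
    - apply K3.
      + intros E. apply Hw. replace w with (w + 1 / 2 - 1 / 2) by ring. rewrite E. ring.
      + replace (w + 1 / 2 - (u + 1 / 2)) with (w - u) by ring. auto. }
  assert (Hdm : (0 < Rmin (Rmin d1 d2) (Rmin d3 d4))%R) by (repeat apply Rmin_pos; auto).
  split; apply (mero_value_eq _ (theta_ratio p) u _ Hdm); auto using theta_ratio_ccont;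
    intros w Hw Hwd; destruct (G w Hw Hwd) as [G1 [G2 [G3 G4]]].
  - rewrite (jacobi_dn_theta p w0), (jacobi_sn_theta p w0), (jacobi_cn_theta p w0) by auto.
    unfold theta_dn, theta_sn, theta_cn, theta_ratio. rewrite !EK.
    transitivity ((- (1) / (Ci * Ci)) * (Ci * (th2 p 0 ^ 2 / th3 p 0 ^ 2) * (th3 p w * th4 p w / (th1 p w * th2 p w)))).
    + field. repeat split; auto.
    + rewrite Ci2. field. repeat split; auto.
  - rewrite !(jacobi_sn_theta p w0) by auto.
    unfold theta_sn, theta_ratio. rewrite !EK, th1_half, th4_half by auto.
    transitivity ((1 / (Ci * Ci)) * (1 / (Ci * Ci))
      * (Ci * (th2 p 0 ^ 2 / th3 p 0 ^ 2) * (th3 p w * th4 p w / (th1 p w * th2 p w)))).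
    + field. repeat split; auto.
    + rewrite Ci2. field. repeat split; auto.
Qed.

(** * Periodization of Laurent polynomials *)

Lemma summable_by_inj {I J : Type} (e : I -> J) (f : J -> C) (M : R) :
  (forall a b, e a = e b -> a = b) -> summable_by f M -> summable_by (fun i => f (e i)) M.
Proof.
  intros He HM G NG. specialize (HM (map e G) (NoDup_map_inj e G He NG)).
  rewrite rsum_map in HM. exact HM.
Qed.

Lemma summable_by_lsum {I J : Type} (f : J -> I -> C) (c : J -> R) (S : R) (l : list J) :
  (forall j, summable_by (f j) (c j * S)) ->
  summable_by (fun i => lsum (fun j => f j i) l) (rsum c l * S).
Proof.
  intros H. induction l as [|a l IH].
  - unfold rsum; simpl. rewrite Rmult_0_l. apply summable_by_0.
  - rewrite rsum_cons, Rmult_plus_distr_r. apply (summable_by_plus (f a)); auto.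
Qed.

(** The absolute double sum is at most the product of the bounds for [s] and for the [B j], so the
    sums may be exchanged; each inner sum then runs over a residue class modulo [d]. *)
Lemma periodize (s : Z -> C) (d : Z) (l : nat -> list Z) (b : nat -> Z -> C) (B : nat -> R) :
  summable s -> d <> 0%Z ->
  (forall j, rsum (fun i => Cmod (b j i)) (l j) <= B j)%R ->
  summable (fun j => RtoC (B j)) ->
  (forall n, summable (fun j => lsum (fun i => b j i * s (d * n + i)%Z) (l j))) /\
  summable (fun n => tsum (fun j => lsum (fun i => b j i * s (d * n + i)%Z) (l j))) /\
  tsum (fun n => tsum (fun j => lsum (fun i => b j i * s (d * n + i)%Z) (l j)))
    = tsum (fun j => lsum (fun i => b j i * tsum (fun n => s (d * n + i)%Z)) (l j)).
Proof.
  intros [S HS] Hd HB [M HM].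
  assert (S0 : (0 <= S)%R) by (apply (HS nil); constructor).
  set (f := fun p : nat * Z => lsum (fun i => b (fst p) i * s (d * snd p + i)%Z) (l (fst p))).
  assert (HSi : forall i, summable_by (fun n => s (d * n + i)%Z) S).
  { intros i. apply (summable_by_inj (fun n => d * n + i)%Z s); auto.
    intros x y E. apply (Z.mul_reg_l _ _ d); auto. lia. }
  assert (Hf : summable f).
  { exists (S * M)%R. apply summable_pair with (fun j => S * B j)%R.
    - intros j. unfold f. simpl.
      assert (K := summable_by_lsum (fun i n => b j i * s (d * n + i)%Z) (fun i => Cmod (b j i)) S (l j)
        (fun i => summable_by_scal (b j i) _ S (HSi i))).
      intros G NG. eapply Rle_trans; [apply (K G NG)|]. rewrite Rmult_comm.
      apply Rmult_le_compat_l; auto.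
    - intros G NG. replace (fun i : nat => Cmod (RtoC (S * B i)))
        with (fun i : nat => S * Cmod (RtoC (B i)))%R.
      + rewrite rsum_scal. apply Rmult_le_compat_l; auto.
      + apply functional_extensionality. intros i.
        rewrite RtoC_mult, Cmod_mult, (Cmod_R S), Rabs_pos_eq; auto. }
  set (g := fun p : Z * nat => f (snd p, fst p)).
  assert (Hg : summable g).
  { apply (summable_inj (fun p : Z * nat => (snd p, fst p)) f); auto.
    intros [x1 x2] [y1 y2] E. simpl in E. congruence. }
  split; [|split].
  - intros n. apply (summable_row g n Hg).
  - apply (summable_rows g Hg).
  - transitivity (tsum (fun n => tsum (fun j => f (j, n)))); [reflexivity|].
    rewrite <- (tsum_swap f Hf). apply tsum_ext. intros j. unfold f. simpl.
    destruct (tsum_lsum (fun i n => b j i * s (d * n + i)%Z) (l j)) as [_ E].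
    + intros i. apply summable_scal. eexists. apply HSi.
    + rewrite E. apply lsum_ext. intros i _. apply tsum_scal. eexists; apply HSi.
Qed.

(** The integers from -m to m, listed by pairs of opposite numbers so that symmetry and telescoping
    are one-step inductions. *)
Fixpoint rng (m : nat) : list Z :=
  match m with
  | O => [0%Z]
  | S k => Z.of_nat (S k) :: (- Z.of_nat (S k))%Z :: rng k
  end.

Lemma rng_bound (m : nat) (i : Z) : List.In i (rng m) -> (Z.abs i <= Z.of_nat m)%Z.
Proof.
  induction m as [|k IH]; intros H.
  - destruct H as [<-|[]]. simpl. lia.
  - cbn [rng] in H. destruct H as [<-|[<-|H]]; try lia. specialize (IH H). lia.
Qed.

Lemma rsum_rng_le (f : Z -> R) (A : R) (m : nat) :
  (forall i, (Z.abs i <= Z.of_nat m)%Z -> (f i <= A)%R) ->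
  (rsum f (rng m) <= (2 * INR m + 1) * A)%R.
Proof.
  intros H. apply Rle_trans with (rsum (fun _ => A) (rng m)).
  - apply rsum_le. intros i Hi. apply H, rng_bound, Hi.
  - clear H. induction m as [|k IH].
    + unfold rsum. simpl. lra.
    + cbn [rng]. rewrite !rsum_cons, S_INR. lra.
Qed.

Lemma lsum_rng_opp (h : Z -> C) (m : nat) :
  lsum (fun i => h (- i)%Z) (rng m) = lsum h (rng m).
Proof.
  induction m as [|k IH]; [reflexivity|]. cbn [rng]. rewrite !lsum_cons, IH, Z.opp_involutive.
  ring.
Qed.

Lemma lsum_rng_odd (h : Z -> C) (m : nat) :
  (forall i, h (- i)%Z = - h i) -> lsum h (rng m) = 0.
Proof.
  intros H. assert (E := lsum_rng_opp h m).
  rewrite (lsum_ext _ (fun i => (-1) * h i)) in E by (intros; rewrite H; ring).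
  rewrite lsum_scal in E.
  replace (lsum h (rng m)) with ((lsum h (rng m) - (-1) * lsum h (rng m)) / 2) by field.
  rewrite E. field.
Qed.

Lemma rng_geom (z : C) (m : nat) : z <> 0 ->
  (1 - z) * lsum (fun i => z ^^ i) (rng m) = z ^^ (- Z.of_nat m) - z ^^ (Z.of_nat m + 1).
Proof.
  intros Hz. induction m as [|k IH].
  - unfold lsum. simpl. ring.
  - cbn [rng]. rewrite !lsum_cons, !Cmult_plus_distr_l, IH.
    replace (Z.of_nat (S k)) with (Z.of_nat k + 1)%Z by lia.
    replace (- Z.of_nat k)%Z with (- (Z.of_nat k + 1) + 1)%Z by ring.
    rewrite (Cpowz_succ z (- (Z.of_nat k + 1))), (Cpowz_succ z (Z.of_nat k + 1)) by auto. ring.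
Qed.

Lemma rng_geom_sgn (z : C) (m : nat) : z <> 0 ->
  (1 - z) * lsum (fun i => RtoC (IZR (Z.sgn i)) * z ^^ i) (rng m)
    = 1 + z - z ^^ (Z.of_nat m + 1) - z ^^ (- Z.of_nat m).
Proof.
  intros Hz. induction m as [|k IH].
  - unfold lsum. simpl. ring.
  - cbn [rng]. rewrite !lsum_cons, !Cmult_plus_distr_l, IH.
    replace (Z.sgn (Z.of_nat (S k))) with 1%Z by lia.
    replace (Z.sgn (- Z.of_nat (S k))) with (-1)%Z by lia.
    replace (Z.of_nat (S k)) with (Z.of_nat k + 1)%Z by lia.
    replace (- Z.of_nat k)%Z with (- (Z.of_nat k + 1) + 1)%Z by ring.
    rewrite (Cpowz_succ z (- (Z.of_nat k + 1))), (Cpowz_succ z (Z.of_nat k + 1)) by auto. ring.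
Qed.

(** Passing from m to m + 1 raises every weight by the sign of i, so this is a sum of instances of
    [rng_geom_sgn], divided once more by 1 - z. *)
Lemma rng_geom_lin (z : C) (m : nat) : z <> 0 ->
  (1 - z) ^ 2 * lsum (fun i => RtoC (IZR (Z.sgn i * (Z.of_nat m + 1 - Z.abs i))) * z ^^ i) (rng m)
    = z ^^ (Z.of_nat m + 2) - z ^^ (- Z.of_nat m) - (INR m + 1) * (z ^ 2 - 1).
Proof.
  intros Hz.
  set (W := fun m : nat => lsum (fun i => RtoC (IZR (Z.sgn i * (Z.of_nat m + 1 - Z.abs i))) * z ^^ i) (rng m)).
  assert (Step : forall k, W (S k) = W k + lsum (fun i => RtoC (IZR (Z.sgn i)) * z ^^ i) (rng (S k))).
  { intros k. unfold W. cbn [rng]. rewrite !lsum_cons.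
    replace (Z.sgn (Z.of_nat (S k)) * (Z.of_nat (S k) + 1 - Z.abs (Z.of_nat (S k))))%Z with 1%Z by lia.
    replace (Z.sgn (- Z.of_nat (S k)) * (Z.of_nat (S k) + 1 - Z.abs (- Z.of_nat (S k))))%Z with (-1)%Z by lia.
    replace (Z.sgn (Z.of_nat (S k))) with 1%Z by lia.
    replace (Z.sgn (- Z.of_nat (S k))) with (-1)%Z by lia.
    rewrite (lsum_ext (fun i => RtoC (IZR (Z.sgn i * (Z.of_nat (S k) + 1 - Z.abs i))) * z ^^ i)
      (fun i => RtoC (IZR (Z.sgn i * (Z.of_nat k + 1 - Z.abs i))) * z ^^ i
         + RtoC (IZR (Z.sgn i)) * z ^^ i)).
    - rewrite lsum_plus. ring.
    - intros i _. rewrite <- Cmult_plus_distr_r, <- RtoC_plus, <- plus_IZR. do 3 f_equal. lia. }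
  change (lsum _ (rng m)) with (W m).
  induction m as [|k IH].
  - unfold W, lsum. simpl. ring.
  - rewrite Step, Cmult_plus_distr_l, IH.
    replace ((1 - z) ^ 2 * lsum (fun i => RtoC (IZR (Z.sgn i)) * z ^^ i) (rng (S k)))
      with ((1 - z) * ((1 - z) * lsum (fun i => RtoC (IZR (Z.sgn i)) * z ^^ i) (rng (S k)))) by ring.
    rewrite rng_geom_sgn, S_INR, RtoC_plus by auto.
    replace (Z.of_nat (S k)) with (Z.of_nat k + 1)%Z by lia.
    replace (- Z.of_nat k)%Z with (- (Z.of_nat k + 1) + 1)%Z by ring.
    replace (Z.of_nat k + 1 + 2)%Z with (Z.of_nat k + 2 + 1)%Z by ring.
    replace (Z.of_nat k + 1 + 1)%Z with (Z.of_nat k + 2)%Z by ring.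
    rewrite (Cpowz_succ z (- (Z.of_nat k + 1))), (Cpowz_succ z (Z.of_nat k + 2)) by auto. ring.
Qed.

(** With r = exp(-L), two factors exp(-jL/4) absorb the two polynomial factors, and exp(-jL/2)
    remains for the geometric series. The constant [K] bounds (j + 1) exp(-jL/4). *)
Lemma summable_poly_geom (r : R) : (0 < r < 1)%R ->
  summable (fun j : nat => RtoC ((INR j + 1) * (INR j + 1) * r ^ j)).
Proof.
  intros Hr. set (L := (- ln r)%R).
  assert (HL : (0 < L)%R) by (unfold L; assert (ln r < 0)%R by (rewrite <- ln_1; apply ln_increasing; lra); lra).
  set (K := (1 + 4 / L)%R). assert (HK : (1 <= K)%R).
  { unfold K. assert (0 < 4 / L)%R by (apply Rdiv_lt_0_compat; lra). lra. }
  apply geom_summable_nat with (K * K)%R (exp (- (L / 2))).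
  - split; [left; apply exp_pos|]. rewrite <- exp_0. apply exp_increasing. lra.
  - intros n. assert (Hn := pos_INR n).
    rewrite Cmod_R, Rabs_pos_eq.
    2:{ apply Rmult_le_pos; [nra|apply pow_le; lra]. }
    assert (E : (r ^ n = exp (- (INR n * L)))%R).
    { rewrite <- (exp_ln r) at 1 by lra. rewrite exp_nat_pow. f_equal. unfold L. ring. }
    rewrite E, exp_nat_pow.
    replace (- (INR n * L))%R with (- (INR n * L / 4) + (- (INR n * L / 4) + INR n * - (L / 2)))%R by field.
    rewrite !exp_plus.
    assert (A : ((INR n + 1) * exp (- (INR n * L / 4)) <= K)%R).
    { assert (X := exp_ineq1_le (INR n * L / 4)). assert (P := exp_pos (INR n * L / 4)).
      rewrite exp_Ropp. apply Rmult_le_reg_r with (exp (INR n * L / 4)); auto.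
      rewrite Rmult_assoc, Rinv_l, Rmult_1_r by lra.
      apply Rle_trans with (K * (1 + INR n * L / 4))%R; [|apply Rmult_le_compat_l; lra].
      unfold K. replace ((1 + 4 / L) * (1 + INR n * L / 4))%R
        with (1 + INR n + INR n * L / 4 + 4 / L)%R by (field; lra).
      assert (0 < 4 / L)%R by (apply Rdiv_lt_0_compat; lra). nra. }
    assert (A0 : (0 <= (INR n + 1) * exp (- (INR n * L / 4)))%R)
      by (apply Rmult_le_pos; [lra|left; apply exp_pos]).
    replace ((INR n + 1) * (INR n + 1) * (exp (- (INR n * L / 4)) *
      (exp (- (INR n * L / 4)) * exp (INR n * - (L / 2)))))%R
      with (((INR n + 1) * exp (- (INR n * L / 4))) * ((INR n + 1) * exp (- (INR n * L / 4)))
         * exp (INR n * - (L / 2)))%R by ring.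
    apply Rmult_le_compat_r; [left; apply exp_pos|]. apply Rmult_le_compat; auto.
Qed.

Lemma tri_opp (n : Z) : tri (- n) = tri (n + 1).
Proof. assert (H := tri_double (- n)). assert (H' := tri_double (n + 1)). lia. Qed.

Lemma m1_powz_succ (n : Z) : (-1) ^^ (n + 1) = - (-1) ^^ n.
Proof. rewrite Cpowz_succ by apply Cm1_nz. ring. Qed.

(** Pairing -j with j + 1 produces polynomials divisible by 1 - z, so that the quotient by 1 - z can
    be taken term by term. *)
Lemma tser_fold (q z : C) : qdisc q -> z <> 0 ->
  summable (fun j : nat => (-1) ^^ Z.of_nat j * q ^^ tri (Z.of_nat j + 1)
    * (z ^^ (- Z.of_nat j) - z ^^ (Z.of_nat j + 1))) /\
  tser q z = tsum (fun j : nat => (-1) ^^ Z.of_nat j * q ^^ tri (Z.of_nat j + 1)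
    * (z ^^ (- Z.of_nat j) - z ^^ (Z.of_nat j + 1))).
Proof.
  intros Hq Hz. assert (S := tser_summable q z Hq Hz).
  assert (E : forall j : nat, (-1) ^^ (Z.of_nat j + 1) * q ^^ tri (Z.of_nat j + 1) * z ^^ (Z.of_nat j + 1)
     + (-1) ^^ (- Z.of_nat j) * q ^^ tri (- Z.of_nat j) * z ^^ (- Z.of_nat j)
     = (-1) ^^ Z.of_nat j * q ^^ tri (Z.of_nat j + 1) * (z ^^ (- Z.of_nat j) - z ^^ (Z.of_nat j + 1))).
  { intros j. rewrite m1_powz_succ, Cpowz_m1_opp, tri_opp. ring. }
  split.
  - apply (summable_ext _ _ E). apply summable_plus.
    + apply (summable_inj (fun j : nat => (Z.of_nat j + 1)%Z)
        (fun n => (-1) ^^ n * q ^^ tri n * z ^^ n)); auto. intros; lia.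
    + apply (summable_inj (fun j : nat => (- Z.of_nat j)%Z)
        (fun n => (-1) ^^ n * q ^^ tri n * z ^^ n)); auto. intros; lia.
  - unfold tser. rewrite tsum_Z_fold by auto. apply tsum_ext. exact E.
Qed.

Lemma cube_fold (q : C) : qdisc q ->
  tsum (fun j : nat => (-1) ^^ Z.of_nat j * q ^^ tri (Z.of_nat j + 1) * RtoC (2 * INR j + 1))
    = poch_inf q q ^ 3.
Proof.
  intros Hq. assert (J := jacobi_cube q Hq). assert (Hl := ln_qdisc q Hq).
  assert (S2 : summable (fun n : Z => (-1) ^^ n * q ^^ tri n * IZR n)).
  { apply summable_gauss with 1%R 1%R (ln (Cmod q) / 2)%R (- (ln (Cmod q) / 2))%R 0%R.
    - lra.
    - intros n. rewrite !Cmod_mult, Cmod_m1_powz, Cmod_powz, Cmod_R by (apply Hq).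
      rewrite !Rmult_1_l, IZR_tri, exp_plus.
      apply Rmult_le_compat; try (left; apply exp_pos); try apply Rabs_pos.
      + right. f_equal. field.
      + assert (K := exp_ineq1_le (Rabs (IZR n))). lra. }
  assert (E : forall j : nat, (-1) ^^ (Z.of_nat j + 1) * q ^^ tri (Z.of_nat j + 1) * IZR (Z.of_nat j + 1)
     + (-1) ^^ (- Z.of_nat j) * q ^^ tri (- Z.of_nat j) * IZR (- Z.of_nat j)
     = (-1) * ((-1) ^^ Z.of_nat j * q ^^ tri (Z.of_nat j + 1) * RtoC (2 * INR j + 1))).
  { intros j. rewrite m1_powz_succ, Cpowz_m1_opp, tri_opp, plus_IZR, opp_IZR, <- INR_IZR_INZ.
    rewrite !RtoC_plus, RtoC_opp, RtoC_mult. ring. }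
  rewrite tsum_Z_fold in J by auto. rewrite (tsum_ext _ _ E) in J.
  rewrite tsum_scal in J.
  - match goal with |- ?a = _ => replace a with (- ((-1) * a)) by ring end. rewrite J. ring.
  - assert (S3 : summable (fun j : nat => (-1) ^^ (Z.of_nat j + 1) * q ^^ tri (Z.of_nat j + 1) * IZR (Z.of_nat j + 1)
     + (-1) ^^ (- Z.of_nat j) * q ^^ tri (- Z.of_nat j) * IZR (- Z.of_nat j))).
    { apply summable_plus.
      + apply (summable_inj (fun j : nat => (Z.of_nat j + 1)%Z)
          (fun n => (-1) ^^ n * q ^^ tri n * IZR n)); auto. intros; lia.
      + apply (summable_inj (fun j : nat => (- Z.of_nat j)%Z)
          (fun n => (-1) ^^ n * q ^^ tri n * IZR n)); auto. intros; lia. }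
    apply (summable_scal (-1)) in S3. apply summable_ext with (2 := S3).
    intros j. cbv beta. rewrite E. ring.
Qed.

Lemma lsum_const_1 (m : nat) : lsum (fun i => 1 ^^ i) (rng m) = RtoC (2 * INR m + 1).
Proof.
  induction m as [|k IH].
  - unfold lsum. simpl. rewrite Rmult_0_r, Rplus_0_l. ring.
  - cbn [rng]. rewrite !lsum_cons, IH, !Cpowz_1_l, S_INR, <- !RtoC_plus. f_equal. ring.
Qed.

(** The folded triple product divided by 1 - z; at z = 1, where division fails, the identity is
    Jacobi's formula for the cube. *)
Lemma phi_series (q z : C) : qdisc q -> z <> 0 ->
  poch_inf q q * phi q z
    = tsum (fun j : nat => (-1) ^^ Z.of_nat j * q ^^ tri (Z.of_nat j + 1)
        * lsum (fun i => z ^^ i) (rng j)).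
Proof.
  intros Hq Hz. destruct (classic (z = 1)) as [->|H1].
  - rewrite (tsum_ext _ (fun j : nat => (-1) ^^ Z.of_nat j * q ^^ tri (Z.of_nat j + 1) * RtoC (2 * INR j + 1))).
    + rewrite cube_fold by auto. unfold phi. rewrite Cmult_1_r.
      replace (q / 1) with q by field. ring.
    + intros j. rewrite lsum_const_1. reflexivity.
  - assert (H1' : 1 - z <> 0).
    { intros E. apply H1. replace z with (1 - (1 - z)) by ring. rewrite E. ring. }
    destruct (tser_fold q z Hq Hz) as [S E].
    rewrite (jacobi_triple q z Hq Hz), theta_phi in E by auto.
    transitivity (/ (1 - z) * (poch_inf q q * ((1 - z) * phi q z))); [field; auto|].
    rewrite E, <- tsum_scal by auto. apply tsum_ext. intros j.
    rewrite <- rng_geom by auto. field. auto.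
Qed.

(* Up to the factor [(q^2; q^2)_oo], both sides of the partial fraction
   expansion of [theta (q X) / theta X] come from periodizing [phi]. *)
Lemma phi_periodized (q : C) : qdisc q -> exists c : C, forall X : C, X <> 0 ->
  summable (fun n : Z => (-1) ^^ n * X ^^ n * q ^^ (n * n) * phi (q ^ 2) (X * (q ^ 2) ^^ n)) /\
  tsum (fun n : Z => (-1) ^^ n * X ^^ n * q ^^ (n * n) * phi (q ^ 2) (X * (q ^ 2) ^^ n))
    = c * theta (q ^ 2) (q * X).
Proof.
  intros Hq. assert (Hq2 := qdisc_sq q Hq). assert (Hq0 := proj1 Hq). assert (Hl := ln_qdisc q Hq).
  assert (Hqp := proj1 (Cmod_gt_0 q) Hq0).
  (* Since (n + i)^2 = n^2 + 2ni + i^2, the factors (-1)^i and q^(-i^2) make b j i s(n + i) equal to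
     s(n) times the i-th term of the series at X q^(2n). *)
  set (b := fun (j : nat) (i : Z) => (-1) ^^ Z.of_nat j * (q ^ 2) ^^ tri (Z.of_nat j + 1)
     * ((-1) ^^ i * q ^^ (- (i * i)))).
  set (B := fun j : nat => (2 * ((INR j + 1) * (INR j + 1) * Cmod q ^ j))%R).
  (* For |i| <= j one has j(j + 1) - i^2 >= j, so the growth of q^(-i^2) is compensated and the
     decay is geometric in j. *)
  assert (HB : forall j, (rsum (fun i => Cmod (b j i)) (rng j) <= B j)%R).
  { intros j. assert (Hj := pos_INR j).
    apply Rle_trans with ((2 * INR j + 1) * Cmod q ^ j)%R.
    - apply rsum_rng_le. intros i Hi. unfold b.
      rewrite !Cmod_mult, !Cmod_m1_powz, !Rmult_1_l.
      rewrite (Cpowz_pow q 2) by auto. rewrite <- Cmod_mult, <- Cpowz_add by auto.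
      replace (Cmod q ^ j)%R with (exp (INR j * ln (Cmod q)))
        by (rewrite <- exp_nat_pow, exp_ln; auto).
      rewrite Cmod_powz by auto. apply exp_le_compat.
      rewrite INR_IZR_INZ, !(Rmult_comm _ (ln (Cmod q))).
      apply Rmult_le_compat_neg_l; [lra|]. apply IZR_le.
      assert (T := tri_double (Z.of_nat j + 1)). nia.
    - unfold B. assert (0 <= Cmod q ^ j)%R by (apply pow_le; lra). nra. }
  assert (SB : summable (fun j => RtoC (B j))).
  { assert (K := summable_scal 2 _ (summable_poly_geom (Cmod q) (conj Hqp (proj2 Hq)))).
    apply summable_ext with (2 := K). intros j. unfold B. rewrite (RtoC_mult 2). reflexivity. }
  (* With step 1, every translate of [s] has the same sum; the dependence on X factors out, and the
     coefficients alone form the constant. *)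
  exists (tsum (fun j => lsum (fun i => b j i) (rng j))).
  intros X HX.
  set (s := fun N : Z => (-1) ^^ N * X ^^ N * q ^^ (N * N)).
  assert (Hs : forall N, s N = (-1) ^^ N * (q ^ 2) ^^ tri N * (q * X) ^^ N).
  { intros N. unfold s. rewrite (Cpowz_pow q 2) by auto. rewrite (Cpowz_mult_l q X) by auto.
    replace (N * N)%Z with (Z.of_nat 2 * tri N + N)%Z by (assert (T := tri_double N); lia).
    rewrite (Cpowz_add q) by auto. ring. }
  assert (HqX : q * X <> 0) by (apply Cmult_neq_0; auto).
  assert (Ss : summable s).
  { apply summable_ext with (2 := tser_summable (q ^ 2) (q * X) Hq2 HqX). intros; symmetry; apply Hs. }
  assert (Vs : tsum s = poch_inf (q ^ 2) (q ^ 2) * theta (q ^ 2) (q * X)).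
  { rewrite <- jacobi_triple by auto. unfold tser. apply tsum_ext, Hs. }
  assert (Hnz := poch_inf_q_nz (q ^ 2) Hq2). set (Q := poch_inf (q ^ 2) (q ^ 2)) in *.
  destruct (periodize s 1 rng b B Ss ltac:(lia) HB SB) as [P1 [P2 P3]].
  assert (E : forall n : Z, tsum (fun j => lsum (fun i => b j i * s (1 * n + i)%Z) (rng j))
     = Q * ((-1) ^^ n * X ^^ n * q ^^ (n * n) * phi (q ^ 2) (X * (q ^ 2) ^^ n))).
  { intros n. assert (Hz : X * (q ^ 2) ^^ n <> 0) by (apply Cmult_neq_0; auto; apply Cpowz_nz, Hq2).
    assert (Ht : forall j : nat, lsum (fun i => b j i * s (1 * n + i)%Z) (rng j)
      = ((-1) ^^ n * X ^^ n * q ^^ (n * n)) * ((-1) ^^ Z.of_nat j * (q ^ 2) ^^ tri (Z.of_nat j + 1)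
         * lsum (fun i => (X * (q ^ 2) ^^ n) ^^ i) (rng j))).
    { intros j. rewrite <- !lsum_scal. apply lsum_ext. intros i _. unfold b, s.
      rewrite (Cpowz_mult_l X) by (auto; apply Cpowz_nz, Hq2). rewrite (Cpowz_pow q 2 n), <- Cpowz_mul by auto.
      replace ((1 * n + i) * (1 * n + i))%Z with (n * n + Z.of_nat 2 * n * i + i * i)%Z by ring.
      replace (1 * n + i)%Z with (n + i)%Z by ring.
      rewrite !Cpowz_add, Cpowz_opp by (auto; apply Cm1_nz).
      assert (Hii := Cpowz_nz q (i * i) Hq0).
      transitivity (((-1) ^^ i * (-1) ^^ i) * (/ q ^^ (i * i) * q ^^ (i * i)) *
        ((-1) ^^ n * X ^^ n * q ^^ (n * n) * ((-1) ^^ Z.of_nat j * (q ^ 2) ^^ tri (Z.of_nat j + 1)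
         * (X ^^ i * q ^^ (Z.of_nat 2 * n * i))))); [ring|].
      rewrite m1_powz_sq, Cinv_l by auto. ring. }
    rewrite (tsum_ext _ _ Ht).
    assert (Sn := P1 n). apply (summable_ext _ _ Ht) in Sn.
    assert (Ha : (-1) ^^ n * X ^^ n * q ^^ (n * n) <> 0).
    { repeat apply Cmult_neq_0; apply Cpowz_nz; auto using Cm1_nz. }
    set (a := (-1) ^^ n * X ^^ n * q ^^ (n * n)) in *.
    assert (Sn' : summable (fun j : nat => (-1) ^^ Z.of_nat j * (q ^ 2) ^^ tri (Z.of_nat j + 1)
         * lsum (fun i => (X * (q ^ 2) ^^ n) ^^ i) (rng j))).
    { apply (summable_scal (/ a)) in Sn. apply summable_ext with (2 := Sn).
      intros j. cbv beta. field. auto. }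
    rewrite tsum_scal, <- phi_series by auto. fold Q. ring. }
  split.
  - apply (summable_ext _ _ E), (summable_scal (/ Q)) in P2.
    apply summable_ext with (2 := P2). intros n. cbv beta. field. auto.
  - rewrite (tsum_ext _ _ E) in P3.
    assert (S0 : summable (fun n : Z => (-1) ^^ n * X ^^ n * q ^^ (n * n) * phi (q ^ 2) (X * (q ^ 2) ^^ n))).
    { apply (summable_ext _ _ E), (summable_scal (/ Q)) in P2.
      apply summable_ext with (2 := P2). intros n. cbv beta. field. auto. }
    rewrite tsum_scal in P3 by auto.
    match goal with |- ?t = _ => transitivity (/ Q * (Q * t)); [field; auto|] end.
    rewrite P3.
    rewrite (tsum_ext _ (fun j => tsum s * lsum (fun i => b j i) (rng j))).
    + rewrite tsum_scal.
      * rewrite Vs. field. auto.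
      * apply summable_le with (2 := SB). intros j. rewrite (Cmod_R (B j)).
        eapply Rle_trans; [apply Cmod_lsum|]. eapply Rle_trans; [apply HB|apply Rle_abs].
    + intros j. rewrite <- lsum_scal. apply lsum_ext. intros i _.
      rewrite Cmult_comm. f_equal. rewrite <- (tsum_Z_shift s i) by auto.
      apply tsum_ext. intros n. f_equal. ring.
Qed.

Lemma one_minus_nz (z : C) : z <> 1 -> 1 - z <> 0.
Proof. intros H E. apply H. replace z with (1 - (1 - z)) by ring. rewrite E. ring. Qed.

Lemma not_int_power_shift (q X : C) (n : Z) : qdisc q -> ~ is_int_power q X ->
  1 - X * q ^^ n <> 0.
Proof.
  intros Hq H. assert (Hq0 := proj1 Hq). apply one_minus_nz. intros E. apply H. exists (- n)%Z.
  rewrite Cpowz_opp by auto. assert (Hn := Cpowz_nz q n Hq0).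
  transitivity (X * q ^^ n / q ^^ n); [field; auto|]. rewrite E. field. auto.
Qed.

Lemma phi_pow_0 (q : C) (n : Z) : qdisc q -> n <> 0%Z -> phi q (q ^^ n) = 0.
Proof.
  intros Hq Hn. assert (Hq0 := proj1 Hq).
  assert (H := theta_shift q 1 n Hq C1_nz). rewrite theta_1, Cmult_1_r, Cmult_0_r in H by auto.
  rewrite theta_phi in H by auto. apply NNPP. intros K. revert H. apply Cmult_neq_0; auto.
  apply one_minus_nz. intros E. apply Hn. apply (Cmod_powz_inj q); auto.
  rewrite E. reflexivity.
Qed.

Lemma theta_root_nz (q : C) : qdisc q -> theta (q ^ 2) q <> 0.
Proof.
  intros Hq. apply theta_nz; [apply qdisc_sq; auto|apply Hq|].
  intros [k E]. rewrite (Cpowz_pow q 2) in E by apply Hq.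
  assert (E' : q ^^ 1 = q ^^ (Z.of_nat 2 * k)) by (rewrite Cpowz_1; auto).
  apply (f_equal Cmod), Cmod_powz_inj in E'; auto. lia.
Qed.

Lemma tsum_single (f : Z -> C) : (forall n, n <> 0%Z -> f n = 0) -> tsum f = f 0%Z.
Proof.
  intros H. apply tsum_eq.
  replace (f 0%Z) with (f 0%Z + 0) by ring.
  apply is_usum_split with (fun n => n = 0%Z) (fun n => n <> 0%Z).
  - intros i. split; [intros ->; auto|]. intros K. apply NNPP, K.
  - apply (is_usum_reindex (fun _ : unit => 0%Z) (fun _ => True)).
    + intros [] [] _; reflexivity.
    + intros j. split; [intros ->; exists tt; auto|intros [_ [_ ->]]; auto].
    + assert (K : summable (fun _ : unit => f 0%Z)).
      { exists (Cmod (f 0%Z)). intros G NG.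
        eapply Rle_trans; [apply (rsum_incl _ G [tt]); auto|].
        - intros; apply Cmod_ge_0.
        - intros [] _; left; reflexivity.
        - unfold rsum; simpl. lra. }
      apply summable_has_sum in K. rewrite tsum_unit in K. exact K.
  - intros eps. exists nil. split; [constructor|]. intros G NG AG _.
    fold (lsum f G). replace (lsum f G) with (RtoC 0).
    + replace (0 - 0) with (RtoC 0) by ring. rewrite Cmod_0. apply cond_pos.
    + rewrite (lsum_ext f (fun i => 0 * f i)).
      * rewrite lsum_scal. ring.
      * intros i Hi. rewrite Forall_forall in AG. rewrite (H i (AG i Hi)). ring.
Qed.

(** A case of Kronecker's formula: quasi-periodicity turns the n-th term of [phi_periodized] into
    theta(X) times a partial fraction. *)
Lemma kronecker (q X : C) : qdisc q -> X <> 0 -> ~ is_int_power (q ^ 2) X ->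
  summable (fun n : Z => q ^^ n / (1 - X * (q ^ 2) ^^ n)) /\
  tsum (fun n : Z => q ^^ n / (1 - X * (q ^ 2) ^^ n))
    = poch_inf (q ^ 2) (q ^ 2) ^ 2 * theta (q ^ 2) (q * X)
      / (theta (q ^ 2) X * theta (q ^ 2) q).
Proof.
  intros Hq HX HnX. assert (Hq2 := qdisc_sq q Hq). assert (Hq0 := proj1 Hq).
  assert (Hq20 := proj1 Hq2).
  destruct (phi_periodized q Hq) as [c Hc].
  (* At X = 1 only n = 0 survives, because [phi] vanishes at the nontrivial powers of its base; this
     identifies the constant. *)
  assert (Ec : poch_inf (q ^ 2) (q ^ 2) ^ 2 = c * theta (q ^ 2) q).
  { destruct (Hc 1 C1_nz) as [_ E]. rewrite Cmult_1_r in E. rewrite <- E, tsum_single.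
    - simpl. unfold phi. rewrite !Cmult_1_r. replace (q * q / 1) with (q * q) by field. ring.
    - intros n Hn. rewrite Cmult_1_l, phi_pow_0 by auto. ring. }
  assert (Ht := theta_root_nz q Hq). assert (HtX := theta_nz _ _ Hq2 HX HnX).
  destruct (Hc X HX) as [S E].
  assert (T : forall n : Z, (-1) ^^ n * X ^^ n * q ^^ (n * n) * phi (q ^ 2) (X * (q ^ 2) ^^ n)
     = theta (q ^ 2) X * (q ^^ n / (1 - X * (q ^ 2) ^^ n))).
  { intros n. assert (Hd := not_int_power_shift (q ^ 2) X n Hq2 HnX).
    assert (Sh := theta_shift (q ^ 2) X n Hq2 HX). rewrite Cmult_comm in Sh.
    rewrite theta_phi in Sh by auto.
    rewrite !Cpowz_opp in Sh by auto.
    assert (HXn := Cpowz_nz X n HX). assert (Htn := Cpowz_nz (q ^ 2) (tri n) Hq20).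
    assert (En : q ^^ (n * n) = (q ^ 2) ^^ tri n * q ^^ n).
    { rewrite (Cpowz_pow q 2), <- Cpowz_add by auto. f_equal. assert (K := tri_double n). lia. }
    rewrite En.
    transitivity ((-1) ^^ n * X ^^ n * ((q ^ 2) ^^ tri n * q ^^ n)
      * (((1 - X * (q ^ 2) ^^ n) * phi (q ^ 2) (X * (q ^ 2) ^^ n)) / (1 - X * (q ^ 2) ^^ n)));
      [field; auto|].
    rewrite Sh.
    transitivity (((-1) ^^ n * (-1) ^^ n) * (theta (q ^ 2) X * (q ^^ n / (1 - X * (q ^ 2) ^^ n))));
      [field; auto|]. rewrite m1_powz_sq. ring. }
  assert (S' : summable (fun n : Z => q ^^ n / (1 - X * (q ^ 2) ^^ n))).
  { apply (summable_ext _ _ T), (summable_scal (/ theta (q ^ 2) X)) in S.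
    apply summable_ext with (2 := S). intros n. cbv beta.
    assert (Hd := not_int_power_shift (q ^ 2) X n Hq2 HnX). field. auto. }
  split; auto. rewrite (tsum_ext _ _ T), tsum_scal in E by auto.
  match goal with |- ?t = _ =>
    transitivity (theta (q ^ 2) X * t / theta (q ^ 2) X); [field; auto|] end.
  rewrite E, Ec. field. auto.
Qed.

(** * Antisymmetric quotients for base q and the partial fractions of (ii) *)

Lemma poch_even_fold (q z : C) : qdisc q -> z <> 0 ->
  summable (fun j : nat => q ^^ tri (Z.of_nat j + 1) * (z ^^ (- Z.of_nat j) + z ^^ (Z.of_nat j + 1))) /\
  poch_inf q q * theta q (- z)
    = tsum (fun j : nat => q ^^ tri (Z.of_nat j + 1) * (z ^^ (- Z.of_nat j) + z ^^ (Z.of_nat j + 1))).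
Proof.
  intros Hq Hz. destruct (tser_fold q (- z) Hq (Copp_nz z Hz)) as [S E].
  assert (T : forall j : nat, (-1) ^^ Z.of_nat j * q ^^ tri (Z.of_nat j + 1)
       * ((- z) ^^ (- Z.of_nat j) - (- z) ^^ (Z.of_nat j + 1))
     = q ^^ tri (Z.of_nat j + 1) * (z ^^ (- Z.of_nat j) + z ^^ (Z.of_nat j + 1))).
  { intros j. rewrite !m1_mult_powz, Cpowz_m1_opp, m1_powz_succ by auto.
    transitivity (((-1) ^^ Z.of_nat j * (-1) ^^ Z.of_nat j) *
      (q ^^ tri (Z.of_nat j + 1) * (z ^^ (- Z.of_nat j) + z ^^ (Z.of_nat j + 1)))); [ring|].
    rewrite m1_powz_sq. ring. }
  split; [apply (summable_ext _ _ T S)|].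
  rewrite <- jacobi_triple by (auto using Copp_nz). rewrite E. apply tsum_ext, T.
Qed.

Lemma theta_m1 (q : C) : qdisc q -> theta q (- (1)) = 2 * poch_inf q (- q) ^ 2.
Proof.
  intros Hq. unfold theta. rewrite (poch_inf_step q (- (1))) by auto.
  replace (q * - (1)) with (- q) by ring. replace (q / (- (1))) with (- q) by field. ring.
Qed.

(** Gauss's product for the sum over triangular numbers, obtained from the folded triple product at
    -1. *)
Lemma poch_mq_fold (q : C) : qdisc q ->
  summable (fun j : nat => q ^^ tri (Z.of_nat j + 1)) /\
  poch_inf q q * poch_inf q (- q) ^ 2 = tsum (fun j : nat => q ^^ tri (Z.of_nat j + 1)).
Proof.
  intros Hq. destruct (poch_even_fold q 1 Hq C1_nz) as [S E].
  assert (T : forall j : nat, q ^^ tri (Z.of_nat j + 1) * (1 ^^ (- Z.of_nat j) + 1 ^^ (Z.of_nat j + 1))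
     = 2 * q ^^ tri (Z.of_nat j + 1)) by (intros j; rewrite !Cpowz_1_l; ring).
  assert (S' : summable (fun j : nat => q ^^ tri (Z.of_nat j + 1))).
  { apply (summable_ext _ _ T), (summable_scal (/ 2)) in S.
    apply summable_ext with (2 := S). intros j. cbv beta. field. }
  split; auto. rewrite theta_m1, (tsum_ext _ _ T), tsum_scal in E by auto.
  transitivity (poch_inf q q * (2 * poch_inf q (- q) ^ 2) / 2); [field|]. rewrite E. field.
Qed.

(** The subtracted multiple of 1 + z makes the numerator vanish at z = 1, since theta(-1) = 2
    (-q)_oo^2. After division the coefficients are signs, antisymmetric under z -> 1/z. *)
Lemma odd_quotient_series (q z : C) : qdisc q -> z <> 0 -> z <> 1 ->
  tsum (fun j : nat => q ^^ tri (Z.of_nat j + 1) * lsum (fun i => RtoC (IZR (Z.sgn i)) * z ^^ i) (rng j))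
    = - (poch_inf q q * (theta q (- z) - poch_inf q (- q) ^ 2 * (1 + z)) / (1 - z)).
Proof.
  intros Hq Hz H1. assert (Hd := one_minus_nz z H1).
  destruct (poch_even_fold q z Hq Hz) as [S1 E1]. destruct (poch_mq_fold q Hq) as [S2 E2].
  rewrite (tsum_ext _ (fun j : nat => / (1 - z) * ((1 + z) * q ^^ tri (Z.of_nat j + 1)
     - q ^^ tri (Z.of_nat j + 1) * (z ^^ (- Z.of_nat j) + z ^^ (Z.of_nat j + 1))))).
  - rewrite tsum_scal, tsum_minus, tsum_scal, <- E1, <- E2
      by auto using summable_minus, summable_scal. field. auto.
  - intros j. transitivity (/ (1 - z) * (q ^^ tri (Z.of_nat j + 1)
      * ((1 - z) * lsum (fun i => RtoC (IZR (Z.sgn i)) * z ^^ i) (rng j)))); [field; auto|].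
    rewrite rng_geom_sgn by auto. ring.
Qed.

Lemma summable_geom_B (r : C) : qdisc r ->
  summable (fun j : nat => RtoC (2 * ((INR j + 1) * (INR j + 1) * Cmod r ^ j))).
Proof.
  intros Hr. assert (Hrp := proj1 (Cmod_gt_0 r) (proj1 Hr)).
  assert (K := summable_scal 2 _ (summable_poly_geom (Cmod r) (conj Hrp (proj2 Hr)))).
  apply summable_ext with (2 := K). intros j. cbv beta. rewrite (RtoC_mult 2). reflexivity.
Qed.

Lemma Cmod_sgn_le (i : Z) : (Cmod (RtoC (IZR (Z.sgn i))) <= 1)%R.
Proof. rewrite Cmod_R. destruct i; simpl; rewrite ?Rabs_R0, ?Rabs_R1, ?Rabs_m1; lra. Qed.

(** Periodization with step 2: i and -i lie in the same class modulo 2, so the antisymmetric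
    coefficients cancel and the total is exactly 0. The root r of q keeps the exponents N^2 of s(N)
    = X^N r^(N^2) integral. *)
Lemma appell_even (r X : C) : qdisc r -> X <> 0 -> ~ is_int_power ((r ^ 2) ^ 2) X ->
  let q := r ^ 2 in
  theta q (- X) * tsum (fun n : Z => q ^^ n / (1 - X * (q ^ 2) ^^ n))
    = poch_inf q (- q) ^ 2
      * tsum (fun n : Z => (1 + X * (q ^ 2) ^^ n) / (1 - X * (q ^ 2) ^^ n) * X ^^ (2 * n) * q ^^ (2 * n ^ 2)).
Proof.
  intros Hr HX HnX q. assert (Hq := qdisc_sq r Hr). fold q in Hq.
  assert (Hq2 := qdisc_sq q Hq). assert (Hr0 := proj1 Hr). assert (Hq0 := proj1 Hq).
  assert (Hq20 := proj1 Hq2). assert (Hl := ln_qdisc r Hr).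
  assert (Hrp := proj1 (Cmod_gt_0 r) Hr0).
  set (b := fun (j : nat) (i : Z) => q ^^ tri (Z.of_nat j + 1) * (RtoC (IZR (Z.sgn i)) * r ^^ (- (i * i)))).
  set (B := fun j : nat => (2 * ((INR j + 1) * (INR j + 1) * Cmod r ^ j))%R).
  assert (HB : forall j, (rsum (fun i => Cmod (b j i)) (rng j) <= B j)%R).
  { intros j. assert (Hj := pos_INR j).
    apply Rle_trans with ((2 * INR j + 1) * Cmod r ^ j)%R.
    - apply rsum_rng_le. intros i Hi. unfold b, q.
      rewrite (Cpowz_pow r 2) by auto.
      replace (r ^^ (Z.of_nat 2 * tri (Z.of_nat j + 1)) * (RtoC (IZR (Z.sgn i)) * r ^^ (- (i * i))))
        with (RtoC (IZR (Z.sgn i)) * r ^^ (Z.of_nat 2 * tri (Z.of_nat j + 1) + - (i * i)))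
        by (rewrite (Cpowz_add r) by auto; ring).
      rewrite Cmod_mult. rewrite <- (Rmult_1_l (Cmod r ^ j)).
      apply Rmult_le_compat; try apply Cmod_ge_0; [apply Cmod_sgn_le|].
      replace (Cmod r ^ j)%R with (exp (INR j * ln (Cmod r)))
        by (rewrite <- exp_nat_pow, exp_ln; auto).
      rewrite Cmod_powz by auto. apply exp_le_compat.
      rewrite INR_IZR_INZ, !(Rmult_comm _ (ln (Cmod r))).
      apply Rmult_le_compat_neg_l; [lra|]. apply IZR_le.
      assert (T := tri_double (Z.of_nat j + 1)). nia.
    - unfold B. assert (0 <= Cmod r ^ j)%R by (apply pow_le; lra). nra. }
  set (s := fun N : Z => X ^^ N * r ^^ (N * N)).
  assert (Ss : summable s).
  { apply summable_gauss with 1%R 0%R (ln (Cmod r)) (ln (Cmod X)) 0%R; auto.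
    intros N. unfold s. rewrite Cmod_mult, !Cmod_powz, <- exp_plus, mult_IZR by auto.
    rewrite Rmult_1_l. right. f_equal. ring. }
  destruct (periodize s 2 rng b B Ss ltac:(lia) HB (summable_geom_B r Hr)) as [P1 [P2 P3]].
  assert (Z0 : tsum (fun j : nat => lsum (fun i => b j i * tsum (fun n => s (2 * n + i)%Z)) (rng j)) = 0).
  { rewrite (tsum_ext _ (fun _ => 0)); [apply tsum_0|]. intros j. apply lsum_rng_odd. intros i.
    replace (tsum (fun n => s (2 * n + - i)%Z)) with (tsum (fun n => s (2 * n + i)%Z)).
    - unfold b. rewrite Z.sgn_opp, opp_IZR, RtoC_opp.
      replace (- i * - i)%Z with (i * i)%Z by ring. ring.
    - rewrite <- (tsum_Z_shift (fun n => s (2 * n + - i)%Z) i).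
      + apply tsum_ext. intros n. f_equal. ring.
      + apply (summable_inj (fun n => 2 * n + - i)%Z s); auto. intros; lia. }
  rewrite Z0 in P3.
  assert (Hn1 : forall n, X * (q ^ 2) ^^ n <> 1).
  { intros n E. apply (not_int_power_shift (q ^ 2) X n Hq2 HnX). rewrite E. ring. }
  assert (Hzn : forall n, X * (q ^ 2) ^^ n <> 0) by (intros; apply Cmult_neq_0; auto; apply Cpowz_nz; auto).
  assert (Hnz := poch_inf_q_nz q Hq).
  destruct (kronecker q X Hq HX HnX) as [SN _].
  assert (E : forall n : Z, tsum (fun j => lsum (fun i => b j i * s (2 * n + i)%Z) (rng j))
     = - poch_inf q q * (theta q (- X) * (q ^^ n / (1 - X * (q ^ 2) ^^ n))
        - poch_inf q (- q) ^ 2 * ((1 + X * (q ^ 2) ^^ n) / (1 - X * (q ^ 2) ^^ n) * X ^^ (2 * n) * q ^^ (2 * n ^ 2)))).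
  { intros n. set (a := X ^^ (2 * n) * q ^^ (2 * n ^ 2)).
    assert (Ha : a <> 0) by (apply Cmult_neq_0; apply Cpowz_nz; auto).
    set (z := X * (q ^ 2) ^^ n).
    assert (Ht : forall j : nat, lsum (fun i => b j i * s (2 * n + i)%Z) (rng j)
      = a * (q ^^ tri (Z.of_nat j + 1) * lsum (fun i => RtoC (IZR (Z.sgn i)) * z ^^ i) (rng j))).
    { intros j. rewrite <- !lsum_scal. apply lsum_ext. intros i _. unfold b, s, a, z.
      rewrite (Cpowz_mult_l X) by (auto; apply Cpowz_nz, Hq2).
      rewrite (Cpowz_pow q 2 n), <- Cpowz_mul by auto.
      unfold q. rewrite !(Cpowz_pow r 2) by auto.
      replace ((2 * n + i) * (2 * n + i))%Z with (Z.of_nat 2 * (2 * n ^ 2) + Z.of_nat 2 * (Z.of_nat 2 * n * i) + i * i)%Z by ring.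
      rewrite (Cpowz_add X), !(Cpowz_add r), Cpowz_opp by auto.
      assert (Hii := Cpowz_nz r (i * i) Hr0). field. auto. }
    rewrite (tsum_ext _ _ Ht).
    assert (Sn := P1 n). apply (summable_ext _ _ Ht) in Sn.
    assert (Sn' : summable (fun j : nat => q ^^ tri (Z.of_nat j + 1)
         * lsum (fun i => RtoC (IZR (Z.sgn i)) * z ^^ i) (rng j))).
    { apply (summable_scal (/ a)) in Sn. apply summable_ext with (2 := Sn).
      intros j. cbv beta. field. auto. }
    rewrite tsum_scal, odd_quotient_series by (auto; apply Hzn || apply Hn1).
    assert (Hd := one_minus_nz z (Hn1 n)).
    assert (Sh : a * theta q (- z) = theta q (- X) * q ^^ n).
    { unfold z, a. replace (- (X * (q ^ 2) ^^ n)) with (q ^^ (2 * n) * - X)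
        by (rewrite (Cpowz_pow q 2 n) by auto; simpl Z.of_nat; ring).
      rewrite theta_shift, Cpowz_m1_even by auto using Copp_nz.
      rewrite m1_mult_powz, Cpowz_m1_opp, Cpowz_m1_even, !Cpowz_opp by auto.
      replace (q ^^ (2 * n ^ 2)) with (q ^^ tri (2 * n) * q ^^ n).
      2:{ rewrite <- Cpowz_add by auto. f_equal. assert (K := tri_double (2 * n)). lia. }
      assert (K1 := Cpowz_nz X (2 * n) HX). assert (K2 := Cpowz_nz q (tri (2 * n)) Hq0).
      field. auto. }
    replace (theta q (- X) * (q ^^ n / (1 - z))) with (a * theta q (- z) / (1 - z))
      by (rewrite Sh; field; auto).
    unfold a. field. auto. }
  rewrite (tsum_ext _ _ E) in P3. apply (summable_ext _ _ E) in P2.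
  set (f := fun n : Z => q ^^ n / (1 - X * (q ^ 2) ^^ n)) in *.
  set (g := fun n : Z => (1 + X * (q ^ 2) ^^ n) / (1 - X * (q ^ 2) ^^ n) * X ^^ (2 * n) * q ^^ (2 * n ^ 2)) in *.
  assert (Hmq : poch_inf q (- q) <> 0).
  { intros K. assert (K' := poch_euler_odd q Hq). rewrite K, Cmult_0_l in K'.
    symmetry in K'. apply (C1_nz K'). }
  assert (Sg : summable g).
  { assert (S1 := summable_minus _ _ (summable_scal (theta q (- X)) f SN)
      (summable_scal (- / poch_inf q q) _ P2)). cbv beta in S1.
    apply (summable_scal (/ poch_inf q (- q) ^ 2)) in S1.
    apply summable_ext with (2 := S1). intros n. cbv beta. fold (f n) (g n). field. auto. }
  change (tsum (fun n => - poch_inf q q * (theta q (- X) * f n - poch_inf q (- q) ^ 2 * g n)) = 0) in P3.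
  rewrite tsum_scal, tsum_minus, !tsum_scal in P3 by auto using summable_minus, summable_scal.
  match goal with |- ?u = ?v =>
    transitivity (v + (- / poch_inf q q) * (- poch_inf q q * (u - v))); [field; auto|] end.
  rewrite P3. ring.
Qed.

(** In product form, [th1] [th2] and [th3] [th4] are theta functions of x^2 with base q^2. Their
    quotient is the one of [kronecker], and [appell_even] turns it into the stated series. *)
Lemma part2_sum (p u : C) : qdisc p ->
  let q := p ^ 8 in let x := Cexp (2 * PI * Ci * u) in
  ~ is_int_power q x -> ~ is_int_power q (- x) -> ~ is_int_power q (- x ^ 2) ->
  - (th2 p 0 / 2) * (th3 p u * th4 p u / (th1 p u * th2 p u))
  = / p * (x / (poch_inf q q * theta q (- x ^ 2)))
    * tsum (fun n : Z => (1 + x ^ 2 * q ^^ (2 * n)) / (1 - x ^ 2 * q ^^ (2 * n))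
         * x ^^ (4 * n) * q ^^ (2 * n ^ 2)).
Proof.
  intros Hp q x Hx Hmx Hmx2. assert (Hq := qdisc_pow8 p Hp). fold q in Hq.
  assert (Hp0 := proj1 Hp). assert (Hq0 := proj1 Hq). assert (Hq2 := qdisc_sq q Hq).
  assert (Hx0 : x <> 0) by apply Cexp_nz. assert (Hx20 := Cpow_nz x 2 Hx0).
  set (r := p ^ 4). assert (Hr : qdisc r).
  { unfold r. replace (p ^ 4) with ((p ^ 2) ^ 2) by ring. apply qdisc_sq, qdisc_sq, Hp. }
  assert (Eq : r ^ 2 = q) by (unfold r, q; ring).
  set (xi := Cexp (PI * Ci * u)). assert (Hxi : xi <> 0) by apply Cexp_nz.
  assert (Exi : xi ^ 2 = x).
  { unfold xi, x. simpl. rewrite Cmult_1_r, <- Cexp_plus. f_equal. ring. }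
  assert (Htx := theta_nz q x Hq Hx0 Hx). assert (Htmx := theta_nz q (- x) Hq (Copp_nz _ Hx0) Hmx).
  assert (Htmx2 := theta_nz q (- x ^ 2) Hq (Copp_nz _ Hx20) Hmx2).
  assert (Sq : theta q x * theta q (- x) = theta (q ^ 2) (x ^ 2)).
  { unfold theta. replace (q / (- x)) with (- (q / x)) by (field; auto).
    transitivity ((poch_inf q x * poch_inf q (- x)) * (poch_inf q (q / x) * poch_inf q (- (q / x)))); [ring|].
    rewrite !poch_inf_square by auto. do 2 f_equal. field. auto. }
  assert (HnX : ~ is_int_power (q ^ 2) (x ^ 2)).
  { intros [k E]. rewrite (Cpowz_pow q 2) in E by auto.
    assert (F : (x - q ^^ k) * (x + q ^^ k) = 0).
    { transitivity (x ^ 2 - q ^^ k * q ^^ k); [ring|]. rewrite E, <- Cpowz_add by auto.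
      replace (k + k)%Z with (Z.of_nat 2 * k)%Z by lia. ring. }
    destruct (classic (x - q ^^ k = 0)) as [K|K].
    - apply Hx. exists k. transitivity (x - q ^^ k + q ^^ k); [ring|]. rewrite K. ring.
    - destruct (classic (x + q ^^ k = 0)) as [K'|K']; [|apply (Cmult_neq_0 _ _ K K' F)].
      apply Hmx. exists k. transitivity (- (x + q ^^ k) + q ^^ k); [ring|]. rewrite K'. ring. }
  assert (HtX := theta_nz _ _ Hq2 Hx20 HnX).
  assert (Hroot := theta_root_nz q Hq).
  destruct (kronecker q (x ^ 2) Hq Hx20 HnX) as [_ Kr].
  assert (Ap := appell_even r (x ^ 2) Hr Hx20). rewrite Eq in Ap. specialize (Ap HnX).
  cbv zeta in Ap. rewrite Kr in Ap.
  rewrite (tsum_ext _ (fun n : Z => (1 + x ^ 2 * q ^^ (2 * n)) / (1 - x ^ 2 * q ^^ (2 * n))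
         * x ^^ (4 * n) * q ^^ (2 * n ^ 2))) in Ap.
  2:{ intros n. rewrite (Cpowz_pow q 2), (Cpowz_pow x 2) by auto.
      replace (Z.of_nat 2 * n)%Z with (2 * n)%Z by lia.
      replace (Z.of_nat 2 * (2 * n))%Z with (4 * n)%Z by lia. reflexivity. }
  assert (Eul := poch_euler_odd q Hq). assert (Sqq := poch_inf_square q q Hq).
  assert (Hnz := poch_inf_q_nz q Hq).
  assert (Troot : theta (q ^ 2) q = poch_inf (q ^ 2) q ^ 2).
  { unfold theta. replace (q ^ 2 / q) with q by (field; auto). ring. }
  assert (Hmq : poch_inf q (- q) <> 0).
  { intros K. rewrite K, Cmult_0_l in Eul. symmetry in Eul. apply (C1_nz Eul). }
  rewrite th1_prod, !th2_prod, th3_prod, th4_prod by auto. fold q x xi.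
  rewrite !Cmult_0_r, Cexp_0, theta_m1 by auto.
  assert (S34 : theta q (- (p ^ 4 * x)) * theta q (p ^ 4 * x) = theta (q ^ 2) (q * x ^ 2)).
  { assert (Hpx : p ^ 4 * x <> 0) by (apply Cmult_neq_0; auto; apply Cpow_nz; auto).
    unfold theta. replace (q / (- (p ^ 4 * x))) with (- (q / (p ^ 4 * x))) by (field; split; auto).
    transitivity ((poch_inf q (p ^ 4 * x) * poch_inf q (- (p ^ 4 * x)))
      * (poch_inf q (q / (p ^ 4 * x)) * poch_inf q (- (q / (p ^ 4 * x))))); [ring|].
    rewrite !poch_inf_square by auto. f_equal; f_equal; unfold q; [ring|field; auto]. }
  clear Kr.
  match type of Ap with _ = _ * ?g => set (G := g) in * end. set (A := poch_inf q q) in *. set (D := poch_inf q (- q)) in *.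
  set (V := poch_inf (q ^ 2) q) in *. rewrite <- Sqq, Troot in Ap. rewrite Troot in Hroot.
  assert (HV : V <> 0) by (intros K; apply Hroot; rewrite K; ring).
  transitivity (/ p * x * A * D ^ 2
     * (theta q (- (p ^ 4 * x)) * theta q (p ^ 4 * x)) / (theta q x * theta q (- x))).
  { rewrite <- Exi at 5. field. repeat split; auto. }
  rewrite S34, Sq.
  assert (EG : G = theta q (- x ^ 2) * ((A * D) ^ 2 * theta (q ^ 2) (q * x ^ 2) / (theta (q ^ 2) (x ^ 2) * V ^ 2)) / D ^ 2).
  { transitivity (D ^ 2 * G / D ^ 2); [field; auto|]. rewrite <- Ap. reflexivity. }
  rewrite EG.
  (* The inserted factor is 1 by Euler's identity D V = 1; it reconciles the constants in base q
     with those in base q^2. *)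
  transitivity (/ p * x * A * D ^ 2 * (1 / (D * V) ^ 2) * theta (q ^ 2) (q * x ^ 2) / theta (q ^ 2) (x ^ 2)).
  - rewrite Eul. field. auto.
  - field. repeat split; auto.
Qed.

(** * Summability of the Appell-type series, and the partial fractions of (i) *)

Lemma list_pos_lower {I : Type} (f : I -> R) (l : list I) :
  exists c : R, (0 < c)%R /\ forall i, List.In i l -> (0 < f i)%R -> (c <= f i)%R.
Proof.
  induction l as [|a l [c [Hc K]]].
  - exists 1%R. split; [lra|]. intros i [].
  - destruct (Rlt_le_dec 0 (f a)) as [Ha|Ha].
    + exists (Rmin c (f a)). split; [apply Rmin_pos; auto|].
      intros i [->|Hi] Hp; [apply Rmin_r|]. eapply Rle_trans; [apply Rmin_l|auto].
    + exists c. split; auto. intros i [->|Hi] Hp; [lra|auto].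
Qed.

(** For |n| > N, |x q^n| is at most 1/e or at least e, hence far from 1; the finitely many remaining
    denominators are nonzero and have a positive minimum. *)
Lemma inv_bounded (q x : C) : qdisc q -> x <> 0 -> ~ is_int_power q x ->
  exists M : R, (0 < M)%R /\ forall n : Z, (Cmod (/ (1 - x * q ^^ n)) <= M)%R.
Proof.
  intros Hq Hx Hnx. assert (Hl := ln_qdisc q Hq). assert (Hq0 := proj1 Hq).
  assert (Hxp := proj1 (Cmod_gt_0 x) Hx).
  set (lx := ln (Cmod x)). set (lq := (- ln (Cmod q))%R). assert (Hlq : (0 < lq)%R) by (unfold lq; lra).
  destruct (archimed ((Rabs lx + 1) / lq)) as [Hup _].
  set (N := Z.to_nat (up ((Rabs lx + 1) / lq))).
  assert (Hlx := Rabs_pos lx).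
  assert (HN : (Rabs lx + 1 <= INR N * lq)%R).
  { assert (A : ((Rabs lx + 1) / lq <= INR N)%R).
    { unfold N. rewrite INR_IZR_INZ, Z2Nat.id; [lra|].
      apply le_IZR. assert (0 <= (Rabs lx + 1) / lq)%R by (apply Rdiv_le_0_compat; lra). lra. }
    apply Rmult_le_compat_r with (r := lq) in A; [|lra].
    replace ((Rabs lx + 1) / lq * lq)%R with (Rabs lx + 1)%R in A by (field; lra). auto. }
  destruct (list_pos_lower (fun n : Z => Cmod (1 - x * q ^^ n)) (rng N)) as [c [Hc K]].
  assert (E : forall n, Cmod (x * q ^^ n) = exp (lx - IZR n * lq)).
  { intros n. rewrite Cmod_mult, Cmod_powz by auto. rewrite <- (exp_ln (Cmod x)) at 1 by auto.
    rewrite <- exp_plus. f_equal. unfold lq, lx. ring. }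
  assert (Hin : forall m i, (Z.abs i <= Z.of_nat m)%Z -> List.In i (rng m)).
  { induction m as [|m IH]; intros i Hi; cbn [rng].
    - left. lia.
    - destruct (Z.eq_dec i (Z.of_nat (S m))); [left; auto|].
      destruct (Z.eq_dec i (- Z.of_nat (S m))); [right; left; auto|].
      right; right. apply IH. lia. }
  assert (e1 : (exp (-1) <= / 2)%R).
  { replace (-1)%R with (- (1))%R by ring. rewrite exp_Ropp. assert (X := exp_ineq1_le 1). apply Rinv_le_contravar; lra. }
  assert (L : forall n, (Rmin c (1 / 2) <= Cmod (1 - x * q ^^ n))%R).
  { intros n. assert (Hnz := proj1 (Cmod_gt_0 _) (not_int_power_shift q x n Hq Hnx)).
    destruct (Z_le_gt_dec (Z.abs n) (Z.of_nat N)) as [H|H].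
    - eapply Rle_trans; [apply Rmin_l|]. apply K; auto.
    - eapply Rle_trans; [apply Rmin_r|].
      assert (HNn : (INR N <= Rabs (IZR n))%R).
      { rewrite INR_IZR_INZ, <- abs_IZR. apply IZR_le. lia. }
      assert (HA : (Rabs lx + 1 <= Rabs (IZR n) * lq)%R) by nra.
      assert (X1 := Rle_abs lx). assert (X2 := Rle_abs (- lx)). rewrite Rabs_Ropp in X2.
      destruct (Rle_lt_dec 0 (IZR n)) as [Hs|Hs].
      + rewrite (Rabs_pos_eq (IZR n)) in HA by auto.
        assert (T := Cmod_triangle_rev 1 (x * q ^^ n)). rewrite Cmod_1, E in T.
        assert (exp (lx - IZR n * lq) <= exp (-1))%R by (apply exp_le_compat; lra). lra.
      + rewrite (Rabs_left (IZR n)) in HA by auto.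
        assert (T := Cmod_triangle_rev (x * q ^^ n) 1). rewrite Cmod_1, E, Cmod_sym in T.
        assert (Y := exp_ineq1_le (lx - IZR n * lq)). lra. }
  assert (Hm : (0 < Rmin c (1 / 2))%R) by (apply Rmin_pos; lra).
  exists (/ Rmin c (1 / 2))%R. split; [apply Rinv_0_lt_compat; auto|].
  intros n. rewrite Cmod_inv by (apply not_int_power_shift; auto).
  apply Rinv_le_contravar; auto.
Qed.

Lemma gauss4_summable (q x : C) : qdisc q -> x <> 0 ->
  summable (fun n : Z => x ^^ (4 * n) * q ^^ (2 * n ^ 2)).
Proof.
  intros Hq Hx. assert (Hl := ln_qdisc q Hq).
  apply summable_gauss with 1%R 0%R (2 * ln (Cmod q))%R (4 * ln (Cmod x))%R 0%R; [lra|].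
  intros n. rewrite Cmod_mult, !Cmod_powz, <- exp_plus by (auto; apply Hq).
  rewrite Rmult_1_l. right. f_equal. replace (2 * n ^ 2)%Z with (2 * (n * n))%Z by ring.
  rewrite !mult_IZR. ring.
Qed.

Lemma summable_bounded_mult {I : Type} (f g : I -> C) (M : R) :
  summable f -> (forall i, Cmod (g i) <= M)%R -> summable (fun i => g i * f i).
Proof.
  intros Hf Hg. apply summable_le with (2 := summable_scal (RtoC (Rmax M 0)) f Hf).
  intros i. rewrite !Cmod_mult, Cmod_R, (Rabs_pos_eq (Rmax M 0)) by apply Rmax_r.
  apply Rmult_le_compat_r; [apply Cmod_ge_0|]. eapply Rle_trans; [apply Hg|apply Rmax_l].
Qed.

Definition appell (q x : C) (n : Z) : C :=
  (1 + x * q ^^ n) / (1 - x * q ^^ n) * (x ^^ (4 * n) * q ^^ (2 * n ^ 2)).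

Lemma appell_summable (q x : C) : qdisc q -> x <> 0 -> ~ is_int_power q x ->
  summable (appell q x).
Proof.
  intros Hq Hx Hnx. destruct (inv_bounded q x Hq Hx Hnx) as [M [HM K]].
  apply (summable_bounded_mult (fun n : Z => x ^^ (4 * n) * q ^^ (2 * n ^ 2))
    (fun n => (1 + x * q ^^ n) / (1 - x * q ^^ n)) (2 * M + 1)%R); [apply gauss4_summable; auto|].
  intros n. specialize (K n). assert (Hd := not_int_power_shift q x n Hq Hnx).
  replace ((1 + x * q ^^ n) / (1 - x * q ^^ n)) with (2 * / (1 - x * q ^^ n) - 1) by (field; auto).
  eapply Rle_trans; [apply Cmod_triangle_sub|]. rewrite Cmod_mult, Cmod_1, Cmod_R, Rabs_pos_eq; lra.
Qed.

(** The numerator is (1 - z^2) times the difference of [phi] at z^2 and at 1, so it has a double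
    zero at 1; Jacobi's formula for the cube supplies the subtracted value. The argument z^2 is why
    the exponents reach 2j. *)
Lemma double_quotient_series (q z : C) : qdisc q -> z <> 0 -> z <> 1 ->
  tsum (fun j : nat => (-1) ^^ Z.of_nat j * q ^^ tri (Z.of_nat j + 1)
     * lsum (fun i => RtoC (IZR (Z.sgn i * (Z.of_nat (2 * j) + 1 - Z.abs i))) * z ^^ i) (rng (2 * j)))
    = - (poch_inf q q * (theta q (z ^ 2) - poch_inf q q ^ 2 * (1 - z ^ 2)) / (1 - z) ^ 2).
Proof.
  intros Hq Hz H1. assert (Hd := one_minus_nz z H1). assert (Hz2 := Cpow_nz z 2 Hz).
  destruct (tser_fold q (z ^ 2) Hq Hz2) as [S1 E1].
  rewrite jacobi_triple in E1 by auto.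
  assert (E2 := cube_fold q Hq).
  assert (S2 : summable (fun j : nat => (-1) ^^ Z.of_nat j * q ^^ tri (Z.of_nat j + 1) * RtoC (2 * INR j + 1))).
  { assert (B := summable_poly_geom (Cmod q) (conj (proj1 (Cmod_gt_0 q) (proj1 Hq)) (proj2 Hq))).
    apply summable_le with (2 := summable_scal 2 _ B). intros j.
    assert (Hj := pos_INR j). assert (Hqp := Cmod_ge_0 q).
    rewrite !Cmod_mult, Cmod_m1_powz, Rmult_1_l, !Cmod_R.
    assert (P : (0 <= Cmod q ^ j)%R) by (apply pow_le; auto).
    rewrite !Rabs_pos_eq; try lra; [|apply Rmult_le_pos; auto; nra].
    assert (A : (Cmod (q ^^ tri (Z.of_nat j + 1)) <= Cmod q ^ j)%R).
    { assert (Hqp' := proj1 (Cmod_gt_0 q) (proj1 Hq)). assert (Hl := ln_qdisc q Hq).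
      replace (Cmod q ^ j)%R with (exp (INR j * ln (Cmod q)))
        by (rewrite <- exp_nat_pow, exp_ln; auto).
      rewrite Cmod_powz by apply Hq. apply exp_le_compat.
      rewrite INR_IZR_INZ, !(Rmult_comm _ (ln (Cmod q))).
      apply Rmult_le_compat_neg_l; [lra|]. apply IZR_le.
      assert (T := tri_double (Z.of_nat j + 1)). nia. }
    apply Rle_trans with (Cmod q ^ j * (2 * INR j + 1))%R; [apply Rmult_le_compat_r; lra|nra]. }
  rewrite (tsum_ext _ (fun j : nat => / (1 - z) ^ 2 *
     ((1 - z ^ 2) * ((-1) ^^ Z.of_nat j * q ^^ tri (Z.of_nat j + 1) * RtoC (2 * INR j + 1))
      - (-1) ^^ Z.of_nat j * q ^^ tri (Z.of_nat j + 1)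
         * ((z ^ 2) ^^ (- Z.of_nat j) - (z ^ 2) ^^ (Z.of_nat j + 1))))).
  - rewrite tsum_scal, tsum_minus, tsum_scal, <- E1, E2
      by auto using summable_minus, summable_scal. field. auto.
  - intros j. transitivity (/ (1 - z) ^ 2 * ((-1) ^^ Z.of_nat j * q ^^ tri (Z.of_nat j + 1)
      * ((1 - z) ^ 2 * lsum (fun i => RtoC (IZR (Z.sgn i * (Z.of_nat (2 * j) + 1 - Z.abs i))) * z ^^ i) (rng (2 * j)))));
      [field; auto|].
    rewrite rng_geom_lin by auto. rewrite !(Cpowz_pow z 2) by auto.
    replace (Z.of_nat 2 * - Z.of_nat j)%Z with (- Z.of_nat (2 * j))%Z by lia.
    replace (Z.of_nat 2 * (Z.of_nat j + 1))%Z with (Z.of_nat (2 * j) + 2)%Z by lia.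
    replace (RtoC (INR (2 * j)) + 1) with (RtoC (2 * INR j + 1)).
    + ring.
    + rewrite mult_INR, RtoC_plus. simpl (INR 2). do 2 f_equal.
Qed.

(** The nontrivial Dirichlet character modulo 4. *)
Definition chi4 (i : Z) : C :=
  match (i mod 4)%Z with 1%Z => 1 | 3%Z => RtoC (-1) | _ => 0 end.

Lemma Cmod_chi4 (i : Z) : (Cmod (chi4 i) <= 1)%R.
Proof.
  unfold chi4. destruct (i mod 4)%Z as [|[[?|?|]|?|]|?];
  rewrite ?Cmod_0, ?Cmod_1, ?Cmod_R, ?Rabs_m1, ?Rabs_R0, ?Rabs_R1; lra.
Qed.

(** Only the class of [i] modulo 4 matters. The classes 0 and 2 are their own opposites, and 1 and 3
    are exchanged by negation. *)
Lemma residue_sums (s : Z -> C) (i : Z) : summable s ->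
  let Z_ := fun i => tsum (fun n => s (4 * n + i)%Z) in
  Z_ i - Z_ (- i)%Z = chi4 i * (Z_ 1%Z - Z_ (-1)%Z).
Proof.
  intros Hs Z_.
  assert (Sh : forall i k, Z_ (4 * k + i)%Z = Z_ i).
  { intros j k. unfold Z_. rewrite <- (tsum_Z_shift (fun n => s (4 * n + j)%Z) k).
    - apply tsum_ext. intros n. f_equal. ring.
    - apply (summable_inj (fun n => 4 * n + j)%Z s); auto. intros; lia. }
  assert (D := Z_div_mod_eq_full i 4). assert (M := Z.mod_pos_bound i 4 ltac:(lia)).
  unfold chi4. set (r := (i mod 4)%Z) in *. set (k := (i / 4)%Z) in *.
  assert (H : r = 0%Z \/ r = 1%Z \/ r = 2%Z \/ r = 3%Z) by lia.
  destruct H as [H|[H|[H|H]]]; rewrite H in *; rewrite D.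
  - rewrite Sh. replace (- (4 * k + 0))%Z with (4 * (- k) + 0)%Z by ring. rewrite Sh. ring.
  - rewrite Sh. replace (- (4 * k + 1))%Z with (4 * (- k) + -1)%Z by ring. rewrite Sh. ring.
  - rewrite Sh. replace (- (4 * k + 2))%Z with (4 * (- k - 1) + 2)%Z by ring. rewrite Sh. ring.
  - replace (4 * k + 3)%Z with (4 * (k + 1) + -1)%Z by ring. rewrite Sh.
    replace (- (4 * (k + 1) + -1))%Z with (4 * (- k - 1) + 1)%Z by ring. rewrite Sh. ring.
Qed.

(** In the triple product for x^2, even and odd indices give the classes -1 and 1 modulo 4, because
    8 tri(2n) + 1 = (4n - 1)^2 and 8 tri(2n + 1) + 1 = (4n + 1)^2. *)
Lemma theta_sq_residues (p x : C) : qdisc p -> x <> 0 ->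
  let s := fun N : Z => x ^^ N * p ^^ (N * N) in
  summable s /\
  tsum (fun n => s (4 * n + 1)%Z) - tsum (fun n => s (4 * n + -1)%Z)
    = - (p / x) * (poch_inf (p ^ 8) (p ^ 8) * theta (p ^ 8) (x ^ 2)).
Proof.
  intros Hp Hx s. assert (Hq := qdisc_pow8 p Hp). assert (Hp0 := proj1 Hp).
  assert (Hl := ln_qdisc p Hp). assert (Hx2 := Cpow_nz x 2 Hx).
  assert (Ss : summable s).
  { apply summable_gauss with 1%R 0%R (ln (Cmod p)) (ln (Cmod x)) 0%R; auto.
    intros N. unfold s. rewrite Cmod_mult, !Cmod_powz, <- exp_plus, mult_IZR by auto.
    rewrite Rmult_1_l. right. f_equal. ring. }
  split; auto.
  assert (S := tser_summable (p ^ 8) (x ^ 2) Hq Hx2).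
  rewrite <- jacobi_triple by auto. unfold tser.
  rewrite (tsum_split (fun n : Z => (2 * n)%Z) (fun n : Z => (2 * n + 1)%Z)
    (fun n : Z => (-1) ^^ n * (p ^ 8) ^^ tri n * (x ^ 2) ^^ n)); auto; try (intros; lia).
  2:{ intros k. split.
      - intros [i E] [j E']. lia.
      - intros H. destruct (Z.Even_or_Odd k) as [[i E]|[i E]]; [exists i; auto|].
        exfalso. apply H. exists i; auto. }
  assert (S1 : summable (fun n => s (4 * n + 1)%Z)) by (apply (summable_inj (fun n => 4 * n + 1)%Z s); auto; intros; lia).
  assert (S2 : summable (fun n => s (4 * n + -1)%Z)) by (apply (summable_inj (fun n => 4 * n + -1)%Z s); auto; intros; lia).
  cbv beta.
  rewrite (tsum_ext (fun i => (-1) ^^ (2 * i) * (p ^ 8) ^^ tri (2 * i) * (x ^ 2) ^^ (2 * i))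
    (fun n => x / p * s (4 * n + -1)%Z)).
  rewrite (tsum_ext (fun i => (-1) ^^ (2 * i + 1) * (p ^ 8) ^^ tri (2 * i + 1) * (x ^ 2) ^^ (2 * i + 1))
    (fun n => - (x / p) * s (4 * n + 1)%Z)).
  - rewrite !tsum_scal by auto. field. auto.
  - intros n. rewrite m1_powz_succ, Cpowz_m1_even. unfold s.
    rewrite (Cpowz_pow p 8), (Cpowz_pow x 2) by auto.
    replace (Z.of_nat 2 * (2 * n + 1))%Z with (4 * n + 1 + 1)%Z by lia.
    replace ((4 * n + 1) * (4 * n + 1))%Z with (Z.of_nat 8 * tri (2 * n + 1) + 1)%Z
      by (assert (T := tri_double (2 * n + 1)); lia).
    rewrite (Cpowz_succ x), (Cpowz_succ p) by auto. field. auto.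
  - intros n. rewrite Cpowz_m1_even. unfold s.
    rewrite (Cpowz_pow p 8), (Cpowz_pow x 2) by auto.
    replace (Z.of_nat 2 * (2 * n))%Z with (4 * n + -1 + 1)%Z by lia.
    replace ((4 * n + -1) * (4 * n + -1))%Z with (Z.of_nat 8 * tri (2 * n) + 1)%Z
      by (assert (T := tri_double (2 * n)); lia).
    rewrite (Cpowz_succ x), (Cpowz_succ p) by auto. field. auto.
Qed.

(* [theta (x^2)] times the difference of the two sides is the periodization of
   a series in [z^i - z^-i]; all these periodizations are multiples of
   [theta (x^2) / x], whence the constant. *)
Lemma appell_wp (p : C) : qdisc p -> let q := p ^ 8 in
  exists c : C, forall x : C, x <> 0 -> ~ is_int_power q x -> ~ is_int_power q (x ^ 2) ->
  summable (fun n : Z => x * q ^^ n / (1 - x * q ^^ n) ^ 2) /\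
  tsum (fun n : Z => x * q ^^ n / (1 - x * q ^^ n) ^ 2)
    = poch_inf q q ^ 2 * x * tsum (appell q x) / theta q (x ^ 2) + c.
Proof.
  intros Hp q. assert (Hq := qdisc_pow8 p Hp). fold q in Hq. assert (Hp0 := proj1 Hp).
  assert (Hq0 := proj1 Hq). assert (Hl := ln_qdisc p Hp). assert (Hpp := proj1 (Cmod_gt_0 p) Hp0).
  (* From (4n + i)^2 = 16 n^2 + 8ni + i^2 and q = p^8, the factor p^(-i^2) turns s(4n + i) into the
     weight x^(4n) q^(2n^2) times (x q^n)^i. *)
  set (b := fun (j : nat) (i : Z) => (-1) ^^ Z.of_nat j * q ^^ tri (Z.of_nat j + 1)
    * (RtoC (IZR (Z.sgn i * (Z.of_nat (2 * j) + 1 - Z.abs i))) * p ^^ (- (i * i)))).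
  set (B := fun j : nat => (8 * ((INR j + 1) * (INR j + 1) * Cmod p ^ j))%R).
  set (l := fun j : nat => rng (2 * j)).
  (* For |i| <= 2j one has 4j(j + 1) - i^2 >= 4j, and the integer weights are at most 2j + 1 in
     absolute value. *)
  assert (HB : forall j, (rsum (fun i => Cmod (b j i)) (l j) <= B j)%R).
  { intros j. assert (Hj := pos_INR j). unfold l.
    apply Rle_trans with ((2 * INR (2 * j) + 1) * ((2 * INR j + 1) * Cmod p ^ j))%R.
    - apply rsum_rng_le. intros i Hi. unfold b, q.
      rewrite (Cpowz_pow p 8) by auto.
      set (w := RtoC (IZR (Z.sgn i * (Z.of_nat (2 * j) + 1 - Z.abs i)))).
      replace ((-1) ^^ Z.of_nat j * p ^^ (Z.of_nat 8 * tri (Z.of_nat j + 1)) * (w * p ^^ (- (i * i))))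
        with ((-1) ^^ Z.of_nat j * (w * p ^^ (Z.of_nat 8 * tri (Z.of_nat j + 1) + - (i * i))))
        by (rewrite (Cpowz_add p) by auto; ring).
      rewrite Cmod_sign_mult, Cmod_mult.
      apply Rmult_le_compat; try apply Cmod_ge_0.
      + unfold w. rewrite Cmod_R, <- abs_IZR.
        replace (2 * INR j + 1)%R with (IZR (2 * Z.of_nat j + 1))
          by (rewrite plus_IZR, mult_IZR, <- INR_IZR_INZ; reflexivity).
        apply IZR_le. rewrite Z.abs_mul.
        assert (Hsg : (Z.abs (Z.sgn i) <= 1)%Z) by (destruct i; simpl; lia).
        assert (Hab : (0 <= Z.abs (Z.of_nat (2 * j) + 1 - Z.abs i) <= 2 * Z.of_nat j + 1)%Z) by lia.
        assert (Hs0 := Z.abs_nonneg (Z.sgn i)). nia.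
      + replace (Cmod p ^ j)%R with (exp (INR j * ln (Cmod p)))
          by (rewrite <- exp_nat_pow, exp_ln; auto).
        rewrite Cmod_powz by auto. apply exp_le_compat.
        rewrite INR_IZR_INZ, !(Rmult_comm _ (ln (Cmod p))).
        apply Rmult_le_compat_neg_l; [lra|]. apply IZR_le.
        assert (T := tri_double (Z.of_nat j + 1)). nia.
    - unfold B. rewrite mult_INR. simpl (INR 2).
      assert (0 <= Cmod p ^ j)%R by (apply pow_le; lra). nra. }
  assert (SB : summable (fun j => RtoC (B j))).
  { assert (K := summable_scal 8 _ (summable_poly_geom (Cmod p) (conj Hpp (proj2 Hp)))).
    apply summable_ext with (2 := K). intros j. unfold B. rewrite (RtoC_mult 8). reflexivity. }
  set (kap := tsum (fun j => lsum (fun i => b j i * chi4 i / 2) (l j))).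
  (* The periodized total is D kap with D = -(p / x) (q)_oo theta(x^2); dividing by -((q)_oo / x)
     theta(x^2) leaves p kap, free of x. *)
  exists (p * kap).
  intros x Hx Hnx Hnx2. assert (Hx2 := Cpow_nz x 2 Hx).
  assert (Ht := theta_nz q (x ^ 2) Hq Hx2 Hnx2). assert (HQ := poch_inf_q_nz q Hq).
  destruct (theta_sq_residues p x Hp Hx) as [Ss Er]. fold q in Er.
  set (s := fun N : Z => x ^^ N * p ^^ (N * N)) in *.
  destruct (periodize s 4 l b B Ss ltac:(lia) HB SB) as [P1 [P2 P3]].
  set (D := tsum (fun n => s (4 * n + 1)%Z) - tsum (fun n => s (4 * n + -1)%Z)) in *.
  assert (K : tsum (fun j => lsum (fun i => b j i * tsum (fun n => s (4 * n + i)%Z)) (l j)) = D * kap).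
  { unfold kap. rewrite <- tsum_scal.
    - apply tsum_ext. intros j. unfold l.
      set (h := fun i => b j i * tsum (fun n => s (4 * n + i)%Z)).
      change (lsum (fun i => b j i * tsum (fun n => s (4 * n + i)%Z)) (rng (2 * j))) with (lsum h (rng (2 * j))).
      (* The coefficients are odd in i, so averaging over i and -i brings out differences of
         opposite residue classes. *)
      transitivity ((/ 2) * (lsum h (rng (2 * j)) + lsum (fun i => h (- i)%Z) (rng (2 * j)))).
      { rewrite lsum_rng_opp. field. }
      rewrite <- lsum_plus, <- !lsum_scal. apply lsum_ext. intros i _. unfold h.
      replace (b j (- i)%Z) with (- b j i).
      2:{ unfold b. rewrite Z.sgn_opp, Z.abs_opp.
          replace (- i * - i)%Z with (i * i)%Z by ring.
          replace (- Z.sgn i * (Z.of_nat (2 * j) + 1 - Z.abs i))%Z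
            with (- (Z.sgn i * (Z.of_nat (2 * j) + 1 - Z.abs i)))%Z by ring.
          rewrite opp_IZR, RtoC_opp. ring. }
      transitivity (/ 2 * b j i * (tsum (fun n => s (4 * n + i)%Z) - tsum (fun n => s (4 * n + - i)%Z))); [ring|].
      assert (R := residue_sums s i Ss). cbv zeta in R. rewrite R. fold D. field.
    - apply summable_le with (2 := SB). intros j. rewrite (Cmod_R (B j)).
      eapply Rle_trans; [apply Cmod_lsum|]. eapply Rle_trans; [|apply Rle_abs].
      eapply Rle_trans; [|apply HB]. apply rsum_le. intros i _.
      unfold Cdiv. rewrite !Cmod_mult. assert (C1 := Cmod_chi4 i). assert (C2 := Cmod_ge_0 (b j i)).
      assert (C3 := Cmod_ge_0 (chi4 i)).
      replace (Cmod (/ 2)) with (/ 2)%R.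
      + nra.
      + rewrite Cmod_inv by (intros E; apply RtoC_inj in E; lra). rewrite Cmod_R, Rabs_pos_eq; lra. }
  change (D = - (p / x) * (poch_inf q q * theta q (x ^ 2))) in Er.
  rewrite K, Er in P3.
  set (Pn := fun n : Z => x * q ^^ n / (1 - x * q ^^ n) ^ 2) in *.
  assert (Hn1 : forall n, x * q ^^ n <> 1).
  { intros n E. apply (not_int_power_shift q x n Hq Hnx). rewrite E. ring. }
  assert (Hzn : forall n, x * q ^^ n <> 0) by (intros; apply Cmult_neq_0; auto; apply Cpowz_nz; auto).
  assert (E : forall n : Z, tsum (fun j => lsum (fun i => b j i * s (4 * n + i)%Z) (l j))
     = - (poch_inf q q / x) * (theta q (x ^ 2) * Pn n - poch_inf q q ^ 2 * x * appell q x n)).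
  { intros n. set (a := x ^^ (4 * n) * q ^^ (2 * n ^ 2)).
    assert (Ha : a <> 0) by (apply Cmult_neq_0; apply Cpowz_nz; auto).
    set (z := x * q ^^ n).
    assert (Hterm : forall j : nat, lsum (fun i => b j i * s (4 * n + i)%Z) (l j)
      = a * ((-1) ^^ Z.of_nat j * q ^^ tri (Z.of_nat j + 1)
         * lsum (fun i => RtoC (IZR (Z.sgn i * (Z.of_nat (2 * j) + 1 - Z.abs i))) * z ^^ i) (rng (2 * j)))).
    { intros j. unfold l. rewrite <- !lsum_scal. apply lsum_ext. intros i _. unfold b, s, a, z.
      rewrite (Cpowz_mult_l x) by (auto; apply Cpowz_nz; auto).
      rewrite <- Cpowz_mul by auto. unfold q. rewrite !(Cpowz_pow p 8) by auto.
      replace ((4 * n + i) * (4 * n + i))%Z with (Z.of_nat 8 * (2 * n ^ 2) + Z.of_nat 8 * (n * i) + i * i)%Z by ring.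
      rewrite (Cpowz_add x), !(Cpowz_add p), Cpowz_opp by auto.
      assert (Hii := Cpowz_nz p (i * i) Hp0). field. auto. }
    rewrite (tsum_ext _ _ Hterm).
    assert (Sn := P1 n). apply (summable_ext _ _ Hterm) in Sn.
    assert (Sn' : summable (fun j : nat => (-1) ^^ Z.of_nat j * q ^^ tri (Z.of_nat j + 1)
         * lsum (fun i => RtoC (IZR (Z.sgn i * (Z.of_nat (2 * j) + 1 - Z.abs i))) * z ^^ i) (rng (2 * j)))).
    { apply (summable_scal (/ a)) in Sn. apply summable_ext with (2 := Sn).
      intros j. cbv beta. field. auto. }
    rewrite tsum_scal, double_quotient_series by (auto; apply Hzn || apply Hn1).
    assert (Hd := one_minus_nz z (Hn1 n)).
    (* The weight is, up to q^n, the multiplier of [theta] under x^2 -> q^(2n) x^2; hence theta(x^2)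
       can be factored out of every term. *)
    assert (Sh : a * theta q (z ^ 2) = theta q (x ^ 2) * q ^^ n).
    { unfold z, a. replace ((x * q ^^ n) ^ 2) with (q ^^ (2 * n) * x ^ 2)
        by (replace (2 * n)%Z with (n + n)%Z by ring; rewrite Cpowz_add by auto; ring).
      rewrite theta_shift, Cpowz_m1_even by auto.
      replace (q ^^ (2 * n ^ 2)) with (q ^^ tri (2 * n) * q ^^ n).
      2:{ rewrite <- Cpowz_add by auto. f_equal. assert (T := tri_double (2 * n)). lia. }
      rewrite !Cpowz_opp, (Cpowz_pow x 2) by auto.
      replace (Z.of_nat 2 * (2 * n))%Z with (4 * n)%Z by lia.
      assert (K1 := Cpowz_nz x (4 * n) Hx). assert (K2 := Cpowz_nz q (tri (2 * n)) Hq0).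
      field. auto. }
    unfold Pn, appell. fold a z.
    replace (theta q (x ^ 2) * (z / (1 - z) ^ 2)) with (x * (a * theta q (z ^ 2)) / (1 - z) ^ 2)
      by (rewrite Sh; unfold z; field; auto).
    field. auto. }
  rewrite (tsum_ext _ _ E) in P3. apply (summable_ext _ _ E) in P2.
  assert (SL := appell_summable q x Hq Hx Hnx).
  assert (SP : summable Pn).
  { assert (S1 := summable_plus _ _ (summable_scal (poch_inf q q ^ 2 * x) _ SL)
      (summable_scal (- (x / poch_inf q q)) _ P2)). cbv beta in S1.
    apply (summable_scal (/ theta q (x ^ 2))) in S1.
    apply summable_ext with (2 := S1). intros n. cbv beta. field. auto. }
  split; auto.
  rewrite tsum_scal, tsum_minus, !tsum_scal in P3 by auto using summable_minus, summable_scal.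
  set (TP := tsum Pn) in *. set (TL := tsum (appell q x)) in *.
  transitivity ((poch_inf q q ^ 2 * x * TL
    - x / poch_inf q q * (- (poch_inf q q / x) * (theta q (x ^ 2) * TP - poch_inf q q ^ 2 * x * TL)))
    / theta q (x ^ 2)); [field; auto|].
  rewrite P3. field. auto.
Qed.

(** * The Weierstrass function as a sum of squared cosecants *)

Lemma rsum_Z_le (f : nat -> R) (S : R) : (forall k, 0 <= f k)%R ->
  (forall N, rsum f (seq 0 N) <= S)%R ->
  forall G : list Z, NoDup G -> (rsum (fun n => f (Z.abs_nat n)) G <= 2 * S)%R.
Proof.
  intros Hf HS G NG.
  assert (X : exists N : nat, forall n, List.In n G -> (Z.abs_nat n < N)%nat).
  { clear. induction G as [|a G [N IH]].
    - exists O. intros n [].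
    - exists (Nat.max N (Datatypes.S (Z.abs_nat a))). intros n [E|E].
      + subst. lia.
      + specialize (IH n E). lia. }
  destruct X as [N HN].
  apply Rle_trans with (rsum (fun i : Z => f (Z.abs_nat i))
    (map Z.of_nat (seq 0 N) ++ map (fun k => - Z.of_nat k)%Z (seq 0 N))).
  - apply rsum_incl; auto.
    intros n Hn. specialize (HN n Hn). apply in_or_app.
    destruct (Z_le_gt_dec 0 n).
    + left. apply in_map_iff. exists (Z.abs_nat n). split; [lia|]. apply in_seq. lia.
    + right. apply in_map_iff. exists (Z.abs_nat n). split; [lia|]. apply in_seq. lia.
  - rewrite rsum_app, !rsum_map.
    replace (fun i : nat => f (Z.abs_nat (Z.of_nat i))) with f.
    2:{ apply functional_extensionality. intros; f_equal; lia. }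
    replace (fun i : nat => f (Z.abs_nat (- Z.of_nat i))) with f.
    2:{ apply functional_extensionality. intros; f_equal; lia. }
    specialize (HS N). lra.
Qed.

(** Telescoping: for t >= 1, 1/t^2 is at most 2 (1/t - 1/(t + 1)). *)
Lemma inv_sq_seq (A : R) (N : nat) : (1 <= A)%R ->
  (rsum (fun k => / ((A + INR k) * (A + INR k))) (seq 0 N) <= 2 * (/ A - / (A + INR N)))%R.
Proof.
  intros HA. induction N as [|N IH].
  - unfold rsum; simpl. rewrite Rplus_0_r. lra.
  - rewrite seq_S, rsum_app, S_INR. unfold rsum at 2. simpl. assert (HN := pos_INR N).
    apply Rle_trans with (2 * (/ A - / (A + INR N)) + 2 * (/ (A + INR N) - / (A + (INR N + 1))))%R; [|lra].
    apply Rplus_le_compat; auto. rewrite Rplus_0_r.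
    replace (2 * (/ (A + INR N) - / (A + (INR N + 1))))%R
      with (2 / ((A + INR N) * (A + (INR N + 1))))%R by (field; lra).
    apply Rmult_le_reg_r with ((A + INR N) * (A + INR N) * (A + (INR N + 1)))%R.
    + repeat apply Rmult_lt_0_compat; lra.
    + replace (/ ((A + INR N) * (A + INR N)) * ((A + INR N) * (A + INR N) * (A + (INR N + 1))))%R
        with (A + (INR N + 1))%R by (field; lra).
      replace (2 / ((A + INR N) * (A + (INR N + 1))) * ((A + INR N) * (A + INR N) * (A + (INR N + 1))))%R
        with (2 * (A + INR N))%R by (field; lra). lra.
Qed.

(** That the bound decays like 1/A matters: it makes the rows of the lattice sum summable in
    turn. *)
Lemma inv_sq_summable_by (A : R) : (1 <= A)%R ->
  summable_by (fun n : Z => RtoC (/ ((A + Rabs (IZR n)) * (A + Rabs (IZR n))))) (4 * / A).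
Proof.
  intros HA G NG.
  replace (fun n : Z => Cmod (RtoC (/ ((A + Rabs (IZR n)) * (A + Rabs (IZR n))))))
    with (fun n : Z => (fun k => / ((A + INR k) * (A + INR k)))%R (Z.abs_nat n)).
  - replace (4 * / A)%R with (2 * (2 * / A))%R by ring. apply (rsum_Z_le (fun k => / ((A + INR k) * (A + INR k)))%R); auto.
    + intros k. assert (Hk := pos_INR k). left. apply Rinv_0_lt_compat. nra.
    + intros N. eapply Rle_trans; [apply inv_sq_seq; auto|]. assert (HN := pos_INR N).
      assert (0 < / (A + INR N))%R by (apply Rinv_0_lt_compat; lra). lra.
  - apply functional_extensionality. intros n. assert (Hn := Rabs_pos (IZR n)).
    rewrite abs_nat_IZR, Cmod_R. symmetry. apply Rabs_pos_eq. left. apply Rinv_0_lt_compat. nra.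
Qed.

Lemma summable_by_le {I : Type} (f g : I -> C) (K M : R) : (0 <= K)%R ->
  (forall i, Cmod (f i) <= K * Cmod (g i))%R -> summable_by g M -> summable_by f (K * M).
Proof.
  intros HK H HM G NG. eapply Rle_trans; [apply rsum_le; intros; apply H|].
  rewrite rsum_scal. apply Rmult_le_compat_l; auto.
Qed.

(** The imaginary part of m + n tau controls n, and then m is controlled too, so |m + n tau| grows
    linearly in |m| + |n|. This settles all points with |m| + |n| large against |u|; the finitely
    many others have a minimal positive distance to u. *)
Lemma lattice_lower (tau u : C) : (0 < Im tau)%R ->
  exists c : R, (0 < c)%R /\ forall m n : Z, u - (IZR m + IZR n * tau) <> 0 ->
    (c * (1 + Rabs (IZR n) + Rabs (IZR m)) <= Cmod (u - (RtoC (IZR m) + RtoC (IZR n) * tau)))%R.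
Proof.
  intros Ht. set (T := Im tau) in *. assert (Htau := Cmod_ge_0 tau).
  set (K := (1 + (1 + Cmod tau) / T)%R).
  assert (HKp : (0 <= (1 + Cmod tau) / T)%R) by (apply Rdiv_le_0_compat; lra).
  assert (HK : (1 <= K)%R) by (unfold K; lra).
  assert (D : forall m n : Z, (Rabs (IZR n) + Rabs (IZR m) <= K * Cmod (RtoC (IZR m) + RtoC (IZR n) * tau))%R).
  { intros m n. set (w := RtoC (IZR m) + RtoC (IZR n) * tau).
    assert (H1 : (Rabs (IZR n) * T <= Cmod w)%R).
    { rewrite <- (Rabs_pos_eq T) by lra. rewrite <- Rabs_mult.
      replace (IZR n * T)%R with (Im w) by (unfold w, T; destruct tau; unfold Im; simpl; ring).
      apply im_le_Cmod. }
    assert (H2 : (Rabs (IZR m) <= Cmod w + Rabs (IZR n) * Cmod tau)%R).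
    { rewrite <- (Cmod_R (IZR m)), <- (Cmod_R (IZR n)), <- Cmod_mult.
      replace (RtoC (IZR m)) with (w - RtoC (IZR n) * tau) by (unfold w; ring).
      apply Cmod_triangle_sub. }
    assert (H3 : (Rabs (IZR n) <= Cmod w / T)%R).
    { apply Rmult_le_reg_r with T; auto. unfold Rdiv. rewrite Rmult_assoc, Rinv_l, Rmult_1_r; lra. }
    unfold K. replace ((1 + (1 + Cmod tau) / T) * Cmod w)%R
      with (Cmod w / T * (1 + Cmod tau) + Cmod w)%R by (field; lra).
    assert (Rabs (IZR n) * (1 + Cmod tau) <= Cmod w / T * (1 + Cmod tau))%R
      by (apply Rmult_le_compat_r; lra). lra. }
  assert (Hu := Cmod_ge_0 u).
  destruct (archimed (2 * K * Cmod u + 1)) as [Hup _].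
  set (N := Z.to_nat (up (2 * K * Cmod u + 1))).
  assert (HN : (2 * K * Cmod u + 1 <= INR N)%R).
  { unfold N. rewrite INR_IZR_INZ, Z2Nat.id; [lra|]. apply le_IZR.
    assert (0 <= K * Cmod u)%R by (apply Rmult_le_pos; lra). lra. }
  destruct (list_pos_lower (fun p : Z * Z => Cmod (u - (RtoC (IZR (fst p)) + RtoC (IZR (snd p)) * tau)))
    (list_prod (rng N) (rng N))) as [c [Hc L]].
  assert (Hin : forall m i, (Z.abs i <= Z.of_nat m)%Z -> List.In i (rng m)).
  { induction m as [|m IH]; intros i Hi; cbn [rng].
    - left. lia.
    - destruct (Z.eq_dec i (Z.of_nat (S m))); [left; auto|].
      destruct (Z.eq_dec i (- Z.of_nat (S m))); [right; left; auto|].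
      right; right. apply IH. lia. }
  assert (HNp := pos_INR N).
  exists (Rmin (c / (1 + 2 * INR N)) (/ (4 * K))). split.
  { apply Rmin_pos; [apply Rdiv_lt_0_compat; lra|apply Rinv_0_lt_compat; lra]. }
  intros m n Hne. apply Cmod_gt_0 in Hne.
  assert (Pm := Rabs_pos (IZR m)). assert (Pn := Rabs_pos (IZR n)).
  set (w := RtoC (IZR m) + RtoC (IZR n) * tau) in *.
  destruct (Rle_lt_dec (Rabs (IZR n) + Rabs (IZR m)) (INR N)) as [H|H].
  - apply Rle_trans with (c / (1 + 2 * INR N) * (1 + Rabs (IZR n) + Rabs (IZR m)))%R.
    + apply Rmult_le_compat_r; [lra|apply Rmin_l].
    + apply Rle_trans with c.
      * apply Rle_trans with (c / (1 + 2 * INR N) * (1 + 2 * INR N))%R.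
        -- apply Rmult_le_compat_l; [left; apply Rdiv_lt_0_compat; lra|lra].
        -- right. field. lra.
      * apply (L (m, n)); auto. apply in_prod; apply Hin, le_IZR; rewrite abs_IZR, <- INR_IZR_INZ; lra.
  - apply Rle_trans with (/ (4 * K) * (1 + Rabs (IZR n) + Rabs (IZR m)))%R.
    + apply Rmult_le_compat_r; [lra|apply Rmin_r].
    + specialize (D m n). fold w in D.
      assert (T1 := Cmod_triangle_rev w u). rewrite Cmod_sym in T1.
      apply Rmult_le_reg_l with (4 * K)%R; [lra|].
      rewrite <- Rmult_assoc, Rinv_r, Rmult_1_l by lra.
      assert (K * (Cmod w - Cmod u) <= K * Cmod (u - w))%R by (apply Rmult_le_compat_l; lra).
      lra.
Qed.

Lemma inv_sq_diff_bound (a b : C) (c d s : R) : (0 < c)%R -> (0 < s)%R ->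
  (c * s <= Cmod a)%R -> (c * s <= Cmod b)%R -> (Cmod (a - b) <= d)%R ->
  (Cmod (1 / a ^ 2 - 1 / b ^ 2) <= 2 * d / (c * c * c) * / (s * s * s))%R.
Proof.
  intros Hc Hs Ha Hb Hd. assert (Hcs : (0 < c * s)%R) by nra.
  assert (Ha0 : a <> 0) by (apply Cmod_gt_0; lra). assert (Hb0 : b <> 0) by (apply Cmod_gt_0; lra).
  replace (1 / a ^ 2 - 1 / b ^ 2) with (- (a - b) * (/ a * / b * / b + / a * / a * / b)) by (field; auto).
  rewrite Cmod_mult, Cmod_opp.
  assert (Ia : (Cmod (/ a) <= / (c * s))%R) by (rewrite Cmod_inv by auto; apply Rinv_le_contravar; auto).
  assert (Ib : (Cmod (/ b) <= / (c * s))%R) by (rewrite Cmod_inv by auto; apply Rinv_le_contravar; auto).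
  assert (Pa := Cmod_ge_0 (/ a)). assert (Pb := Cmod_ge_0 (/ b)). assert (Pd := Cmod_ge_0 (a - b)).
  set (e := (/ (c * s))%R) in *.
  assert (X : forall x y z : R, (0 <= x <= e)%R -> (0 <= y <= e)%R -> (0 <= z <= e)%R -> (x * y * z <= e * e * e)%R).
  { intros x y z Hx Hy Hz. apply Rmult_le_compat; try lra; [nra|]. apply Rmult_le_compat; lra. }
  apply Rle_trans with (d * (e * e * e + e * e * e))%R.
  - apply Rmult_le_compat; auto; [apply Cmod_ge_0|].
    eapply Rle_trans; [apply Cmod_triangle|]. rewrite !Cmod_mult.
    apply Rplus_le_compat; apply X; lra.
  - unfold e. right. field. split; lra.
Qed.

(* (pi / sin (pi u))^2 *)
Definition csc2 (u : C) : C :=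
  - (4 * PI ^ 2) * Cexp (2 * PI * Ci * u) / (1 - Cexp (2 * PI * Ci * u)) ^ 2.

Definition not_integer (u : C) : Prop := forall m : Z, u <> IZR m.

Lemma Cexp_not_1 (u : C) : not_integer u -> 1 - Cexp (2 * PI * Ci * u) <> 0.
Proof.
  intros H. apply one_minus_nz. intros E. destruct (Cexp_eq_1 _ E) as [n Hn].
  apply (H n). assert (K := two_pi_i_nz).
  transitivity (2 * PI * Ci * u / (2 * PI * Ci)).
  - field. repeat split; auto using Ci_nz, RtoC_PI_nz.
  - rewrite Hn. field. repeat split; auto using Ci_nz, RtoC_PI_nz.
Qed.

Lemma inv_sq_int_summable (u : C) : summable (fun m : Z => 1 / (u - IZR m) ^ 2).
Proof.
  (* The row n = 0 of the lattice of Gaussian integers. A term with u = m is 0, as 1 / 0 = 0. *)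
  destruct (lattice_lower Ci u ltac:(simpl; lra)) as [c [Hc L]].
  assert (S := inv_sq_summable_by 1 (Rle_refl 1)).
  exists (/ (c * c) * (4 * / 1))%R. apply summable_by_le with (3 := S).
  - left. apply Rinv_0_lt_compat. nra.
  - intros m. assert (Pm := Rabs_pos (IZR m)).
    rewrite Cmod_R, Rabs_pos_eq by (left; apply Rinv_0_lt_compat; nra).
    destruct (classic (u - IZR m = 0)) as [E|E].
    + rewrite E. replace (0 ^ 2) with (RtoC 0) by (simpl; ring). rewrite Cdiv_0, Cmod_0.
      apply Rmult_le_pos; left; apply Rinv_0_lt_compat; nra.
    + specialize (L m 0%Z). rewrite Cmult_0_l, Cplus_0_r, Rabs_R0, Rplus_0_r in L. specialize (L E).
      rewrite <- Rinv_mult.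
      rewrite Cmod_div, Cmod_1, Cmod_pow by (apply Cpow_nz; auto).
      unfold Rdiv. rewrite Rmult_1_l. apply Rinv_le_contravar.
      * assert (0 < c * c)%R by nra. nra.
      * simpl. rewrite Rmult_1_r.
        replace (c * c * ((1 + Rabs (IZR m)) * (1 + Rabs (IZR m))))%R
          with ((c * (1 + Rabs (IZR m))) * (c * (1 + Rabs (IZR m))))%R by ring.
        assert (0 <= c * (1 + Rabs (IZR m)))%R by nra.
        apply Rmult_le_compat; auto.
Qed.

Definition herg (u : C) : C := tsum (fun m : Z => 1 / (u - IZR m) ^ 2) - csc2 u.

Lemma Cexp_shift_int (u : C) (n : Z) :
  Cexp (2 * PI * Ci * (u + IZR n)) = Cexp (2 * PI * Ci * u).
Proof.
  rewrite Cmult_plus_distr_l, Cexp_plus.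
  replace (2 * PI * Ci * IZR n) with (IZR n * (2 * PI * Ci)) by ring.
  rewrite Cexp_Zmult, Cexp_2PI, Cpowz_1_l. ring.
Qed.

Lemma herg_period (u : C) (n : Z) : herg (u + IZR n) = herg u.
Proof.
  unfold herg, csc2. rewrite Cexp_shift_int. f_equal.
  rewrite <- (tsum_Z_shift (fun m => 1 / (u + IZR n - IZR m) ^ 2) n) by apply inv_sq_int_summable.
  apply tsum_ext. intros m. do 2 f_equal. rewrite plus_IZR, RtoC_plus. ring.
Qed.

(* Herglotz' trick: a bounded function with this duplication formula vanishes. *)
Lemma herg_half (u : C) : not_integer u ->
  4 * herg u = herg (u / 2) + herg ((u + 1) / 2).
Proof.
  intros Hu. assert (S := inv_sq_int_summable u).
  assert (two : RtoC 2 <> 0) by (intros E; apply RtoC_inj in E; lra).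
  assert (Hne : forall m : Z, u - IZR m <> 0).
  { intros m E. apply (Hu m). replace u with (u - IZR m + IZR m) by ring. rewrite E. ring. }
  assert (E1 : tsum (fun m : Z => 1 / (u / 2 - IZR m) ^ 2)
     = 4 * tsum (fun m : Z => 1 / (u - IZR (2 * m)) ^ 2)).
  { rewrite <- tsum_scal.
    - apply tsum_ext. intros m. assert (K := Hne (2 * m)%Z).
      replace (u / 2 - IZR m) with ((u - IZR (2 * m)) / 2)
        by (rewrite mult_IZR, RtoC_mult; field). field. auto.
    - apply (summable_inj (fun m => 2 * m)%Z (fun m => 1 / (u - IZR m) ^ 2)); auto. intros; lia. }
  assert (E2 : tsum (fun m : Z => 1 / ((u + 1) / 2 - IZR m) ^ 2)
     = 4 * tsum (fun m : Z => 1 / (u - IZR (2 * m - 1)) ^ 2)).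
  { rewrite <- tsum_scal.
    - apply tsum_ext. intros m. assert (K := Hne (2 * m - 1)%Z).
      replace ((u + 1) / 2 - IZR m) with ((u - IZR (2 * m - 1)) / 2)
        by (rewrite minus_IZR, mult_IZR, RtoC_minus, RtoC_mult; field). field. auto.
    - apply (summable_inj (fun m => 2 * m - 1)%Z (fun m => 1 / (u - IZR m) ^ 2)); auto. intros; lia. }
  assert (E3 : tsum (fun m : Z => 1 / (u - IZR m) ^ 2)
     = tsum (fun m : Z => 1 / (u - IZR (2 * m)) ^ 2) + tsum (fun m : Z => 1 / (u - IZR (2 * m - 1)) ^ 2)).
  { apply (tsum_split (fun m => 2 * m)%Z (fun m => 2 * m - 1)%Z (fun m : Z => 1 / (u - IZR m) ^ 2)); auto; try (intros; lia).
    intros k. split.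
    - intros [i E] [j E']. lia.
    - intros H. destruct (Z.Even_or_Odd k) as [[i E]|[i E]]; [exists i; auto|].
      exfalso. apply H. exists (i + 1)%Z. lia. }
  unfold herg. rewrite E1, E2, E3.
  assert (E4 : 4 * csc2 u = csc2 (u / 2) + csc2 ((u + 1) / 2)).
  { unfold csc2. assert (N := Cexp_not_1 u Hu). set (y := Cexp (PI * Ci * u)).
    assert (Y1 : Cexp (2 * PI * Ci * u) = y * y).
    { unfold y. rewrite <- Cexp_plus. f_equal. ring. }
    assert (Y2 : Cexp (2 * PI * Ci * (u / 2)) = y) by (unfold y; f_equal; field).
    assert (Y3 : Cexp (2 * PI * Ci * ((u + 1) / 2)) = - y).
    { transitivity (Cexp (PI * Ci * u + PI * Ci)); [f_equal; field|].
      rewrite Cexp_plus, Cexp_PI. fold y. ring. }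
    rewrite Y1 in N. rewrite Y1, Y2, Y3.
    assert (N1 : 1 - y <> 0) by (intros E; apply N; replace (1 - y * y) with ((1 - y) * (1 + y)) by ring; rewrite E; ring).
    assert (N2 : 1 - - y <> 0) by (intros E; apply N; replace (1 - y * y) with ((1 - y) * (1 - - y)) by ring; rewrite E; ring).
    replace (1 - y * y) with ((1 - y) * (1 - - y)) by ring. field. auto. }
  transitivity (4 * tsum (fun m : Z => 1 / (u - IZR (2 * m)) ^ 2) + 4 * tsum (fun m : Z => 1 / (u - IZR (2 * m - 1)) ^ 2) - 4 * csc2 u); [ring|].
  rewrite E4. ring.
Qed.

(** The squared modulus is exactly (e^t - e^(-t))^2 + 4 sin^2 a, and |e^t - e^(-t)| >= |t|. *)
Lemma Csinh_lower (a t : R) :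
  ((2 * t) * (2 * t) / 4 <= sqn (Cexp (- t, a) - Cexp (t, - a)%R) /\
   4 * (sin a * sin a) <= sqn (Cexp (- t, a) - Cexp (t, - a)%R))%R.
Proof.
  assert (E : sqn (Cexp (- t, a)%R - Cexp (t, - a)%R)
    = ((exp t - exp (- t)) * (exp t - exp (- t)) + 4 * (sin a * sin a))%R).
  { unfold sqn, Cexp, Re, Im; simpl. rewrite cos_neg, sin_neg.
    assert (S := sin2_cos2 a). unfold Rsqr in S.
    assert (P : (exp (- t) * exp t = 1)%R) by (rewrite <- exp_plus, Rplus_opp_l; apply exp_0).
    set (A := exp (- t)) in *. set (B := exp t) in *. set (c := cos a) in *. set (s := sin a) in *.
    replace ((A * c + - (B * c)) * (A * c + - (B * c)) + (A * s + - (B * - s)) * (A * s + - (B * - s)))%R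
      with ((A - B) * (A - B) * (s * s + c * c) + 4 * (A * B) * (s * s))%R by ring.
    rewrite S, P. ring. }
  rewrite E. split; [|assert (X := Rle_0_sqr (exp t - exp (- t))); unfold Rsqr in X; lra].
  assert (X1 := exp_ineq1_le t). assert (X2 := exp_ineq1_le (- t)).
  assert (P : (exp (- t) * exp t = 1)%R) by (rewrite <- exp_plus, Rplus_opp_l; apply exp_0).
  assert (P1 := exp_pos t). assert (P2 := exp_pos (- t)).
  assert (K : (t * t <= (exp t - exp (- t)) * (exp t - exp (- t)))%R).
  { destruct (Rle_lt_dec 0 t) as [H|H].
    - assert (exp (- t) <= 1)%R by (rewrite <- exp_0; apply exp_le_compat; lra).
      assert (t <= exp t - exp (- t))%R by lra. apply Rmult_le_compat; lra.
    - assert (exp t <= 1)%R by (rewrite <- exp_0; apply exp_le_compat; lra).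
      assert (- t <= exp (- t) - exp t)%R by lra.
      replace (t * t)%R with ((- t) * (- t))%R by ring.
      replace ((exp t - exp (- t)) * (exp t - exp (- t)))%R
        with ((exp (- t) - exp t) * (exp (- t) - exp t))%R by ring.
      apply Rmult_le_compat; lra. }
  assert (0 <= sin a * sin a)%R by (assert (Y := Rle_0_sqr (sin a)); unfold Rsqr in Y; lra). lra.
Qed.

Lemma csc2_near (u : C) : csc2 u = - (4 * PI ^ 2) / (Cexp (PI * Ci * u) - Cexp (- (PI * Ci * u))) ^ 2.
Proof.
  unfold csc2. set (y := Cexp (PI * Ci * u)). assert (Hy : y <> 0) by apply Cexp_nz.
  assert (Y1 : Cexp (2 * PI * Ci * u) = y * y).
  { unfold y. rewrite <- Cexp_plus. f_equal. ring. }
  rewrite Y1, Cexp_opp. fold y.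
  destruct (classic (1 - y * y = 0)) as [E|E].
  - rewrite E. replace (y - / y) with (- (1 - y * y) / y) by (field; auto). rewrite E.
    replace ((- 0 / y) ^ 2) with (RtoC 0) by (field; auto).
    replace (0 ^ 2) with (RtoC 0) by (simpl; ring). rewrite !Cdiv_0. reflexivity.
  - field. repeat split; auto. intros K. apply E.
    replace (1 - y * y) with (- (y * y - 1)) by ring. rewrite K. ring.
Qed.

(** Near 0 the double poles cancel by a Taylor expansion; elsewhere in the strip the denominator is
    bounded below by [Csinh_lower]. *)
Lemma csc2_pole_bounded : exists M : R, forall u : C, (Rabs (Re u) <= 1 / 2)%R -> u <> 0 ->
  (Cmod (1 / u ^ 2 - csc2 u) <= M)%R.
Proof.
  assert (Hpi := PI_RGT_0). assert (Hpi4 := PI_4).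
  assert (Hs0 : (0 < sin (1 / 16))%R).
  { apply sin_gt_0; [lra|]. assert (X := PI2_1). lra. }
  set (s0 := sin (1 / 16)) in *.
  (* When |v| > 1/8, either |pi Re u| >= 1/16, and the sine bound applies, or |pi Im u| >= 1/16,
     whose square is 1/256. *)
  set (e0 := Rmin (4 * (s0 * s0)) (/ 256)).
  assert (He0 : (0 < e0)%R) by (apply Rmin_pos; [nra|lra]).
  exists (Rmax (80 * PI ^ 2 * 3) (64 * PI ^ 2 + 4 * PI ^ 2 / e0))%R.
  intros u Hre Hu. set (v := PI * Ci * u).
  assert (Hv : v <> 0) by (apply Cmult_neq_0; auto using PI_Ci_nz).
  assert (Hvp := proj1 (Cmod_gt_0 _) Hv).
  assert (Ev : v = (- (PI * Im u), PI * Re u)%R).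
  { unfold v. destruct u; unfold Re, Im; simpl. apply injective_projections; simpl; ring. }
  assert (Ci2 : Ci * Ci = -1) by (apply injective_projections; simpl; ring).
  assert (Eu : 1 / u ^ 2 = - PI ^ 2 / v ^ 2).
  { unfold v. transitivity ((Ci * Ci) * PI ^ 2 / (PI * Ci * u) ^ 2).
    - field. repeat split; auto using Ci_nz, RtoC_PI_nz.
    - rewrite Ci2. field. repeat split; auto using Ci_nz, RtoC_PI_nz. }
  rewrite csc2_near, Eu. fold v. set (E := Cexp v - Cexp (- v)).
  assert (CP : Cmod (RtoC PI ^ 2) = (PI ^ 2)%R).
  { rewrite Cmod_pow, Cmod_R, Rabs_pos_eq; lra. }
  destruct (Rle_lt_dec (Cmod v) (1 / 8)) as [Hsm|Hbig].
  - eapply Rle_trans; [|apply Rmax_l].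
    assert (e3 : (exp (Cmod v) <= 3)%R).
    { apply Rle_trans with (exp 1); [apply exp_le_compat; lra|apply exp_le_3]. }
    assert (T1 := Cexp_taylor3 v). assert (T2 := Cexp_taylor3 (- v)). rewrite Cmod_opp in T2.
    (* The even terms cancel in E = e^v - e^(-v), so E - 2v is cubic in v. With E + 2v = O(v) the
       numerator has order 4, matching v^2 E^2; the constant is 48 times 5. *)
    assert (T : (Cmod (E - 2 * v) <= 16 * (Cmod v ^ 3 * exp (Cmod v)))%R).
    { replace (E - 2 * v) with ((Cexp v - 1 - v - v ^ 2 / 2) - (Cexp (- v) - 1 - - v - (- v) ^ 2 / 2))
        by (unfold E; field).
      eapply Rle_trans; [apply Cmod_triangle_sub|]. lra. }
    set (t := Cmod v) in *.
    assert (T' : (Cmod (E - 2 * v) <= 48 * t ^ 3)%R).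
    { assert (0 <= t ^ 3)%R by (apply pow_le; lra). nra. }
    assert (T'' : (Cmod (E - 2 * v) <= t)%R).
    { eapply Rle_trans; [exact T'|]. simpl. assert (t * t <= 1 / 64)%R by nra. nra. }
    assert (L : (t <= Cmod E)%R).
    { assert (X := Cmod_triangle_rev (2 * v) (2 * v - E)). rewrite (Cmod_sym (2 * v) E) in X.
      replace (2 * v - (2 * v - E)) with E in X by ring.
      rewrite Cmod_mult, Cmod_R, Rabs_pos_eq in X by lra. fold t in X. lra. }
    assert (U : (Cmod (E + 2 * v) <= 5 * t)%R).
    { replace (E + 2 * v) with ((E - 2 * v) + 4 * v) by ring.
      eapply Rle_trans; [apply Cmod_triangle|]. rewrite (Cmod_mult 4), Cmod_R, Rabs_pos_eq by lra.
      fold t. lra. }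
    assert (HE : E <> 0) by (apply Cmod_gt_0; lra).
    replace (- PI ^ 2 / v ^ 2 - - (4 * PI ^ 2) / E ^ 2)
      with (- PI ^ 2 * ((E - 2 * v) * (E + 2 * v)) * (/ v * / v) * (/ E * / E)) by (field; auto).
    rewrite !Cmod_mult, Cmod_opp, CP, !Cmod_inv by auto. fold t.
    apply Rle_trans with (PI ^ 2 * ((48 * t ^ 3) * (5 * t)) * (/ t * / t) * (/ t * / t))%R.
    + assert (I : (/ Cmod E <= / t)%R) by (apply Rinv_le_contravar; auto).
      assert (I0 : (0 < / Cmod E)%R) by (apply Rinv_0_lt_compat; lra).
      assert (It : (0 < / t)%R) by (apply Rinv_0_lt_compat; lra).
      assert (P2 : (0 <= PI ^ 2)%R) by apply pow2_ge_0.
      apply Rmult_le_compat.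
      * apply Rmult_le_pos; [apply Rmult_le_pos; [auto|apply Rmult_le_pos; apply Cmod_ge_0]|nra].
      * nra.
      * apply Rmult_le_compat_r; [nra|]. apply Rmult_le_compat_l; auto.
        apply Rmult_le_compat; auto; apply Cmod_ge_0.
      * apply Rmult_le_compat; lra.
    + right. field. lra.
  - eapply Rle_trans; [|apply Rmax_r].
    eapply Rle_trans; [apply Cmod_triangle_sub|]. apply Rplus_le_compat.
    + rewrite Cmod_div, Cmod_opp, CP, Cmod_pow by (apply Cpow_nz; auto).
      replace (64 * PI ^ 2)%R with (PI ^ 2 * 64)%R by ring. unfold Rdiv.
      apply Rmult_le_compat_l; [apply pow2_ge_0|].
      replace 64%R with (/ (/ 64))%R by field. apply Rinv_le_contravar; [lra|]. simpl. nra.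
    + assert (LE : (e0 <= Cmod E * Cmod E)%R).
      { rewrite <- sqn_Cmod. unfold E. rewrite Ev.
        replace (- ((- (PI * Im u))%R, (PI * Re u)%R)) with ((PI * Im u)%R, (- (PI * Re u))%R)
          by (apply injective_projections; simpl; ring).
        destruct (Csinh_lower (PI * Re u) (PI * Im u)) as [A1 A2].
        destruct (Rle_lt_dec (1 / 16) (Rabs (PI * Re u))) as [Ha|Ha].
        - eapply Rle_trans; [apply Rmin_l|]. eapply Rle_trans; [|exact A2].
          apply Rmult_le_compat_l; [lra|].
          assert (Q : (s0 <= Rabs (sin (PI * Re u)))%R).
          { assert (B : (Rabs (PI * Re u) <= PI / 2)%R).
            { rewrite Rabs_mult, (Rabs_pos_eq PI) by lra. nra. }
            assert (M : (s0 <= sin (Rabs (PI * Re u)))%R) by (apply sin_incr_1; lra).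
            unfold Rabs in M at 1. destruct (Rcase_abs (PI * Re u)).
            - rewrite sin_neg in M. rewrite Rabs_left1; lra.
            - rewrite Rabs_pos_eq; lra. }
          rewrite <- (Rabs_pos_eq (sin (PI * Re u) * sin (PI * Re u))) by apply Rle_0_sqr.
          rewrite Rabs_mult. apply Rmult_le_compat; lra.
        - eapply Rle_trans; [apply Rmin_r|]. eapply Rle_trans; [|exact A1].
          assert (B : (1 / 16 <= Rabs (PI * Im u))%R).
          { assert (X := Cmod_le_Re_Im v). rewrite Ev in X at 2 3. unfold Re at 1, Im at 2 in X. simpl in X.
            rewrite Rabs_Ropp in X. lra. }
          replace (2 * (PI * Im u) * (2 * (PI * Im u)) / 4)%R with ((PI * Im u) * (PI * Im u))%R by field.
          rewrite <- (Rabs_pos_eq ((PI * Im u) * (PI * Im u))) by apply Rle_0_sqr.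
          rewrite Rabs_mult. nra. }
      assert (HE : E <> 0).
      { intros K. rewrite K, Cmod_0 in LE. lra. }
      rewrite Cmod_div, Cmod_opp, Cmod_mult, CP, Cmod_pow, Cmod_R, Rabs_pos_eq by (try apply Cpow_nz; auto; lra).
      unfold Rdiv. apply Rmult_le_compat_l; [assert (X := pow2_ge_0 PI); lra|].
      apply Rinv_le_contravar; auto. simpl. lra.
Qed.

(** By periodicity u may be moved into |Re u| <= 1/2. There the term m = 0 is paired with the pole
    of [csc2], and the other terms have a uniform majorant. *)
Lemma herg_bounded : exists M : R, forall u : C, not_integer u -> (Cmod (herg u) <= M)%R.
Proof.
  destruct csc2_pole_bounded as [M HM].
  exists (16 * (4 * / 1) + M)%R.
  intros u0 Hu0.
  (* The integer in the interval from Re u0 - 1/2 (excluded) to Re u0 + 1/2 (included). *)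
  set (n := up (Re u0 - 1 / 2)). destruct (archimed (Re u0 - 1 / 2)) as [A1 A2]. fold n in A1, A2.
  set (u := u0 + IZR (- n)).
  assert (Hu : not_integer u).
  { intros m E. apply (Hu0 (m + n)%Z). unfold u in E.
    replace u0 with (u0 + IZR (- n) - IZR (- n)) by ring. rewrite E, opp_IZR, plus_IZR, RtoC_opp, RtoC_plus. ring. }
  assert (Hre : (Rabs (Re u) <= 1 / 2)%R).
  { unfold u. rewrite opp_IZR. destruct u0 as [a b]. unfold Re in *; simpl in *. apply Rabs_le. lra. }
  rewrite <- (herg_period u0 (- n)). fold u.
  assert (Hu00 : u <> 0) by (apply (Hu 0%Z)).
  specialize (HM u Hre Hu00). unfold herg.
  assert (S := inv_sq_int_summable u).
  set (g := fun m : Z => if Z.eq_dec m 0 then 1 / u ^ 2 else 0).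
  assert (Sg : summable g).
  { apply summable_le with (2 := S). intros m. unfold g. destruct (Z.eq_dec m 0) as [->|].
    - right. do 3 f_equal. ring.
    - rewrite Cmod_0. apply Cmod_ge_0. }
  assert (Tg : tsum g = 1 / u ^ 2).
  { rewrite tsum_single; [reflexivity|]. intros m Hm. unfold g. destruct (Z.eq_dec m 0); tauto. }
  set (f := fun m : Z => 1 / (u - IZR m) ^ 2) in *.
  replace (tsum f - csc2 u) with (tsum (fun m => f m - g m) + (1 / u ^ 2 - csc2 u)).
  2:{ rewrite tsum_minus, Tg by auto. ring. }
  eapply Rle_trans; [apply Cmod_triangle|]. apply Rplus_le_compat; auto.
  apply tsum_bound. apply summable_by_le with (3 := inv_sq_summable_by 1 (Rle_refl 1)); [lra|].
  intros m. assert (Pm := Rabs_pos (IZR m)).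
  rewrite Cmod_R, Rabs_pos_eq by (left; apply Rinv_0_lt_compat; nra).
  unfold f, g. destruct (Z.eq_dec m 0) as [->|Hm].
  - replace (1 / (u - 0) ^ 2 - 1 / u ^ 2) with (RtoC 0).
    + rewrite Cmod_0. apply Rmult_le_pos; [lra|]. left; apply Rinv_0_lt_compat; nra.
    + replace (u - 0) with u by ring. ring.
  - replace (1 / (u - IZR m) ^ 2 - 0) with (1 / (u - IZR m) ^ 2) by ring.
    assert (Hm1 : (1 <= Rabs (IZR m))%R) by (rewrite <- abs_IZR; apply IZR_le; lia).
    (* For |m| >= 1, |m| - 1/2 is at least (1 + |m|) / 4, whence the factor 16. *)
    assert (L : (Rabs (IZR m) - 1 / 2 <= Cmod (u - IZR m))%R).
    { eapply Rle_trans; [|apply re_le_Cmod].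
      replace (Re (u - IZR m)) with (Re u - IZR m)%R by (destruct u; unfold Re; simpl; ring).
      assert (X := Rabs_triang_inv (IZR m) (Re u)). rewrite Rabs_minus_sym in X. lra. }
    assert (Hne : u - IZR m <> 0) by (apply Cmod_gt_0; lra).
    rewrite Cmod_div, Cmod_1, Cmod_pow by (apply Cpow_nz; auto).
    unfold Rdiv. rewrite Rmult_1_l.
    replace 16%R with (/ (/ 16))%R by field. rewrite <- Rinv_mult. apply Rinv_le_contravar.
    + apply Rmult_lt_0_compat; nra.
    + simpl. rewrite Rmult_1_r.
      replace (/ 16 * ((1 + Rabs (IZR m)) * (1 + Rabs (IZR m))))%R
        with ((1 + Rabs (IZR m)) / 4 * ((1 + Rabs (IZR m)) / 4))%R by field.
      apply Rmult_le_compat; lra.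
Qed.

(** The duplication formula has 4 on one side and two terms on the other, so every use halves the
    bound [M], which therefore tends to 0. *)
Lemma csc2_series (u : C) : not_integer u ->
  tsum (fun m : Z => 1 / (u - IZR m) ^ 2) = csc2 u.
Proof.
  intros Hu0. destruct herg_bounded as [M HM].
  assert (HM0 : (0 <= M)%R) by (eapply Rle_trans; [apply Cmod_ge_0|apply (HM u Hu0)]).
  assert (two : RtoC 2 <> 0) by (intros E; apply RtoC_inj in E; lra).
  assert (X : forall (k : nat) u, not_integer u -> (Cmod (herg u) <= M * (/ 2) ^ k)%R).
  { clear u Hu0. induction k; intros u Hu.
    - simpl. rewrite Rmult_1_r. auto.
    - assert (H1 : not_integer (u / 2)).
      { intros m E. apply (Hu (2 * m)%Z). replace u with (2 * (u / 2)) by (field; auto).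
        rewrite E, mult_IZR, RtoC_mult. reflexivity. }
      assert (H2 : not_integer ((u + 1) / 2)).
      { intros m E. apply (Hu (2 * m - 1)%Z). replace u with (2 * ((u + 1) / 2) - 1) by (field; auto).
        rewrite E, minus_IZR, mult_IZR, RtoC_minus, RtoC_mult. reflexivity. }
      assert (A1 := IHk _ H1). assert (A2 := IHk _ H2).
      assert (E := herg_half u Hu). apply (f_equal Cmod) in E.
      rewrite Cmod_mult, Cmod_R, Rabs_pos_eq in E by lra.
      assert (T := Cmod_triangle (herg (u / 2)) (herg ((u + 1) / 2))).
      simpl. set (y := (M * (/ 2) ^ k)%R) in *.
      replace (M * (/ 2 * (/ 2) ^ k))%R with (y / 2)%R by (unfold y; field). lra. }
  assert (H0 : herg u = 0).
  { apply Ceq_small. intros eps He. replace (herg u - 0) with (herg u) by ring.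
    destruct (pow_small (/ 2) (eps / (M + 1))) as [N HN]; [lra|apply Rdiv_lt_0_compat; lra|].
    specialize (HN N (le_n N)). specialize (X N u Hu0).
    apply Rmult_lt_compat_l with (r := (M + 1)%R) in HN; [|lra].
    replace ((M + 1) * (eps / (M + 1)))%R with eps in HN by (field; lra).
    assert (0 <= (/ 2) ^ N)%R by (apply pow_le; lra). nra. }
  unfold herg in H0. transitivity (tsum (fun m : Z => 1 / (u - IZR m) ^ 2) - csc2 u + csc2 u); [ring|].
  rewrite H0. ring.
Qed.

(** The coefficient of tau comes first, so that the rows of the double sum run over the integers m
    and are evaluated by [csc2_series]. *)
Definition lat (tau : C) (p : Z * Z) : C := IZR (snd p) + IZR (fst p) * tau.

Lemma lat_inj (tau : C) (p r : Z * Z) : (0 < Im tau)%R -> lat tau p = lat tau r -> p = r.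
Proof.
  intros Ht E. destruct p as [n m], r as [n' m']. unfold lat in E; simpl in E.
  assert (EI := f_equal Im E). assert (ER := f_equal Re E).
  destruct tau as [a b]; unfold Re, Im in *; simpl in *.
  assert (X : ((IZR n - IZR n') * b = 0)%R) by lra.
  apply Rmult_integral in X. destruct X as [X|X]; [|lra].
  assert (IZR n = IZR n') by lra. assert (n = n') by (apply eq_IZR; auto). subst n'.
  f_equal. apply eq_IZR. lra.
Qed.

Lemma lat_eq_0 (tau : C) (p : Z * Z) : (0 < Im tau)%R -> lat tau p = 0 -> p = (0%Z, 0%Z).
Proof.
  intros Ht E. apply (lat_inj tau); auto. rewrite E. unfold lat; simpl. ring.
Qed.

(* Since [1 / 0 = 0], the term at [(0, 0)] is the isolated [1 / u ^ 2] of the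
   Weierstrass function. *)
Definition wp_term (tau u : C) (p : Z * Z) : C := 1 / (u - lat tau p) ^ 2 - 1 / lat tau p ^ 2.

(** The difference of inverse squares decays like the cube of |m| + |n| + 1. One of the three
    factors is weakened to 1 + |n|, which leaves inverse squares to sum along a row. *)
Lemma wp_term_bound (tau u : C) : (0 < Im tau)%R -> (forall p, u - lat tau p <> 0) ->
  exists K : R, (0 <= K)%R /\ forall n m : Z,
    (Cmod (wp_term tau u (n, m)) <= K * (/ (1 + Rabs (IZR n)) *
       / ((1 + Rabs (IZR n) + Rabs (IZR m)) * (1 + Rabs (IZR n) + Rabs (IZR m)))))%R.
Proof.
  intros Ht Hu. destruct (lattice_lower tau u Ht) as [c1 [H1 L1]].
  destruct (lattice_lower tau 0 Ht) as [c2 [H2 L2]].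
  set (c := Rmin c1 c2). assert (Hc : (0 < c)%R) by (apply Rmin_pos; auto).
  set (K0 := (2 * Cmod u / (c * c * c))%R).
  assert (HK0 : (0 <= K0)%R).
  { apply Rdiv_le_0_compat; [assert (X := Cmod_ge_0 u); lra|]. repeat apply Rmult_lt_0_compat; auto. }
  exists (Rmax K0 (Cmod (1 / u ^ 2))). split; [eapply Rle_trans; [exact HK0|apply Rmax_l]|].
  intros n m. assert (Pn := Rabs_pos (IZR n)). assert (Pm := Rabs_pos (IZR m)).
  set (s := (1 + Rabs (IZR n) + Rabs (IZR m))%R).
  assert (Hs : (1 <= s)%R) by (unfold s; lra).
  destruct (classic ((n, m) = (0%Z, 0%Z))) as [E|E].
  - injection E as -> ->. unfold s. rewrite Rabs_R0, !Rplus_0_r, !Rmult_1_r, Rinv_1, !Rmult_1_r.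
    eapply Rle_trans; [|apply Rmax_r]. right. f_equal. unfold wp_term, lat; simpl fst; simpl snd.
    replace (IZR 0 + IZR 0 * tau) with (RtoC 0) by ring.
    replace (0 ^ 2) with (RtoC 0) by (simpl; ring). rewrite Cdiv_0.
    replace (u - 0) with u by ring. ring.
  - apply Rle_trans with (K0 * / (s * s * s))%R.
    + unfold wp_term. assert (Hw : lat tau (n, m) <> 0) by (intros K; apply E, (lat_eq_0 tau); auto).
      replace (lat tau (n, m) ^ 2) with ((0 - lat tau (n, m)) ^ 2) by ring.
      apply inv_sq_diff_bound; auto; [lra| | |].
      * eapply Rle_trans; [|apply (L1 m n); apply (Hu (n, m))]. apply Rmult_le_compat_r; [lra|apply Rmin_l].
      * eapply Rle_trans; [|apply (L2 m n)]. apply Rmult_le_compat_r; [lra|apply Rmin_r].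
        intros K. apply Hw. replace (lat tau (n, m)) with (- (0 - lat tau (n, m))) by ring.
        change (lat tau (n, m)) with (IZR m + IZR n * tau). rewrite K. ring.
      * right. f_equal. ring.
    + apply Rmult_le_compat; auto.
      * left. apply Rinv_0_lt_compat. repeat apply Rmult_lt_0_compat; lra.
      * apply Rmax_l.
      * rewrite <- Rinv_mult. apply Rinv_le_contravar.
        -- repeat apply Rmult_lt_0_compat; lra.
        -- rewrite Rmult_assoc. apply Rmult_le_compat_r; [nra|unfold s; lra].
Qed.

Lemma wp_term_summable (tau u : C) : (0 < Im tau)%R -> (forall p, u - lat tau p <> 0) ->
  summable (wp_term tau u).
Proof.
  intros Ht Hu. destruct (wp_term_bound tau u Ht Hu) as [K [HK B]].
  eexists. apply summable_pair with (B := fun n => (K * / (1 + Rabs (IZR n)) * (4 * / (1 + Rabs (IZR n))))%R).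
  - intros n. assert (Pn := Rabs_pos (IZR n)).
    assert (HA : (1 <= 1 + Rabs (IZR n))%R) by lra.
    apply summable_by_le with (3 := inv_sq_summable_by _ HA).
    + apply Rmult_le_pos; auto. left. apply Rinv_0_lt_compat. lra.
    + intros m. eapply Rle_trans; [apply B|]. assert (Pm := Rabs_pos (IZR m)).
      rewrite Cmod_R, (Rabs_pos_eq (/ _)) by (left; apply Rinv_0_lt_compat; nra). right. ring.
  - apply summable_by_le with (K := (4 * K)%R) (3 := inv_sq_summable_by 1 (Rle_refl 1)); [lra|].
    intros n. assert (Pn := Rabs_pos (IZR n)). rewrite !Cmod_R, Rinv_mult.
    set (e := (/ (1 + Rabs (IZR n)))%R). assert (0 < e)%R by (apply Rinv_0_lt_compat; lra).
    assert (0 <= K * e)%R by nra. rewrite (Rabs_pos_eq (_ * (4 * _))), Rabs_pos_eq by nra. right. ring.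
Qed.

Lemma weierstrass_p_tsum (tau u : C) : (0 < Im tau)%R -> (forall p, u - lat tau p <> 0) ->
  weierstrass_p tau u = tsum (wp_term tau u).
Proof.
  intros Ht Hu. assert (S := wp_term_summable tau u Ht Hu).
  assert (W : wp_term tau u (0%Z, 0%Z) = 1 / u ^ 2).
  { unfold wp_term, lat; simpl fst; simpl snd.
    replace (IZR 0 + IZR 0 * tau) with (RtoC 0) by ring.
    replace (0 ^ 2) with (RtoC 0) by (simpl; ring). rewrite Cdiv_0.
    replace (u - 0) with u by ring. ring. }
  set (O2 := (0%Z, 0%Z)) in *.
  (* The terms with the origin set to 0: their total is the sum over the nonzero lattice points, and
     the origin contributes 1 / u^2. *)
  set (g := fun p => if excluded_middle_informative (p = O2) then RtoC 0 else wp_term tau u p).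
  assert (Sg : summable g).
  { apply summable_le with (2 := S). intros p. unfold g. destruct excluded_middle_informative; [|right; auto].
    rewrite Cmod_0. apply Cmod_ge_0. }
  assert (Hg : is_usum (fun p => p <> O2) g (tsum g)).
  { apply is_usum_support; [|apply summable_has_sum; auto].
    intros p. unfold g. destruct excluded_middle_informative; auto. }
  assert (ext : forall (A : Z * Z -> Prop) (f h : Z * Z -> C) s, (forall p, A p -> f p = h p) -> is_usum A f s -> is_usum A h s).
  { intros A f h s E H eps. destruct (H eps) as [F [AF KF]]. exists F. split; auto.
    intros G NG AG I. specialize (KF G NG AG I). rewrite Forall_forall in AG.
    replace (map h G) with (map f G); auto. apply map_ext_in. auto. }
  assert (Hw : is_usum (fun p => p <> O2) (wp_term tau u) (tsum g)).
  { apply ext with g; auto. intros p Hp. unfold g. destruct excluded_middle_informative; tauto. }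
  assert (Hs : has_sum (wp_term tau u) (1 / u ^ 2 + tsum g)).
  { apply is_usum_split with (fun p => p = O2) (fun p => p <> O2); auto.
    - intros p. split; [tauto|apply NNPP].
    - apply (is_usum_reindex (fun _ : unit => O2) (fun _ => True)).
      + intros [] [] _; reflexivity.
      + intros j. split; [intros ->; exists tt; auto|intros [_ [_ ->]]; auto].
      + cbv beta. rewrite W. assert (K : summable (fun _ : unit => 1 / u ^ 2)).
        { exists (Cmod (1 / u ^ 2)). intros G NG. destruct G as [|[] [|[] G]].
          - unfold rsum; simpl. apply Cmod_ge_0.
          - unfold rsum; simpl. lra.
          - exfalso. inversion NG; subst; simpl in *; tauto. }
        apply summable_has_sum in K. rewrite tsum_unit in K. exact K. }
  rewrite (tsum_eq _ _ Hs). unfold weierstrass_p. f_equal.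
  apply usum_eq. apply (is_usum_reindex (lat tau) (fun p => p <> O2)).
  - intros a b. apply lat_inj; auto.
  - intros w. split.
    + intros [[m [n E]] Hw0]. exists (n, m). split; auto. intros E'. injection E' as -> ->.
      apply Hw0. rewrite E. ring.
    + intros [[n m] [Hp ->]]. split; [exists m, n; reflexivity|]. intros E. apply Hp, (lat_eq_0 tau); auto.
  - exact Hw.
Qed.

Lemma qpow_Zmult (tau s : C) (n : Z) : qpow tau (IZR n * s) = qpow tau s ^^ n.
Proof. unfold qpow. rewrite <- Cexp_Zmult. f_equal. ring. Qed.

Lemma Cexp_lat (tau u : C) (n m : Z) :
  Cexp (2 * PI * Ci * (u - (IZR m + IZR n * tau))) = Cexp (2 * PI * Ci * u) * qpow tau 1 ^^ (- n).
Proof.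
  rewrite <- qpow_Zmult. unfold qpow. rewrite <- Cexp_plus.
  rewrite <- (Cexp_shift_int _ m). f_equal. rewrite opp_IZR, RtoC_opp. ring.
Qed.

Lemma not_lattice (tau u : C) : ~ is_int_power (qpow tau 1) (Cexp (2 * PI * Ci * u)) ->
  forall p, u - lat tau p <> 0.
Proof.
  intros H [n m] E. apply H. exists n. assert (X := Cexp_lat tau u n m).
  unfold lat in E; simpl in E. rewrite E, Cmult_0_r, Cexp_0 in X.
  assert (Hq : qpow tau 1 <> 0) by apply Cexp_nz. assert (Hn := Cpowz_nz _ n Hq).
  rewrite Cpowz_opp in X by auto.
  transitivity (Cexp (2 * PI * Ci * u) * / qpow tau 1 ^^ n * qpow tau 1 ^^ n); [field; auto|].
  rewrite <- X. ring.
Qed.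

(** In the difference the terms 1 / w^2 cancel before summation. The rest is summed row by row, each
    row being a difference of two convergent sums of inverse squares. *)
Lemma weierstrass_p_diff (tau u v : C) : (0 < Im tau)%R -> (forall p, u - lat tau p <> 0) ->
  (forall p, v - lat tau p <> 0) ->
  weierstrass_p tau u - weierstrass_p tau v
    = tsum (fun n : Z => csc2 (u - IZR n * tau) - csc2 (v - IZR n * tau)).
Proof.
  intros Ht Hu Hv. rewrite !weierstrass_p_tsum by auto.
  assert (Su := wp_term_summable tau u Ht Hu). assert (Sv := wp_term_summable tau v Ht Hv).
  rewrite <- tsum_minus by auto. rewrite tsum_fubini by (apply summable_minus; auto).
  assert (NI : forall w (n : Z), (forall p, w - lat tau p <> 0) -> not_integer (w - IZR n * tau)).
  { intros w n Hw m E. apply (Hw (n, m)). unfold lat; simpl. rewrite <- E. ring. }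
  apply tsum_ext. intros n. rewrite <- !csc2_series by auto.
  rewrite <- tsum_minus by apply inv_sq_int_summable.
  apply tsum_ext. intros m. unfold wp_term, lat; simpl fst; simpl snd.
  replace (u - (IZR m + IZR n * tau)) with (u - IZR n * tau - IZR m) by ring.
  replace (v - (IZR m + IZR n * tau)) with (v - IZR n * tau - IZR m) by ring. ring.
Qed.

Lemma wp_appell (tau u v : C) (p : C) : (0 < Im tau)%R -> qdisc p -> p ^ 8 = qpow tau 1 ->
  let q := qpow tau 1 in let x := Cexp (2 * PI * Ci * u) in let y := Cexp (2 * PI * Ci * v) in
  ~ is_int_power q (x ^ 2) -> ~ is_int_power q (y ^ 2) -> ~ is_int_power q x -> ~ is_int_power q y ->
  weierstrass_p tau u - weierstrass_p tau v
    = - (4 * PI ^ 2) * poch_inf q q ^ 2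
      * (x * tsum (appell q x) / theta q (x ^ 2) - y * tsum (appell q y) / theta q (y ^ 2)).
Proof.
  intros Ht Hp Epq q x y Hx2 Hy2 Hx Hy.
  destruct (appell_wp p Hp) as [c A]. rewrite Epq in A. fold q in A.
  assert (Hx0 : x <> 0) by apply Cexp_nz. assert (Hy0 : y <> 0) by apply Cexp_nz.
  destruct (A x Hx0 Hx Hx2) as [Sx Ex]. destruct (A y Hy0 Hy Hy2) as [Sy Ey].
  rewrite weierstrass_p_diff by (auto; apply not_lattice; auto).
  (* Translation of u by -n tau multiplies x by q^(-n); the reflection n -> -n restores positive
     powers. *)
  rewrite <- (tsum_Z_refl (fun n : Z => csc2 (u - IZR n * tau) - csc2 (v - IZR n * tau)) 0).
  - rewrite (tsum_ext _ (fun n : Z => - (4 * PI ^ 2) * (x * q ^^ n / (1 - x * q ^^ n) ^ 2 - y * q ^^ n / (1 - y * q ^^ n) ^ 2))).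
    + rewrite tsum_scal, tsum_minus, Ex, Ey by auto using summable_minus.
      assert (theta q (x ^ 2) <> 0) by (apply theta_nz; auto using Cpow_nz; unfold q; rewrite <- Epq; apply qdisc_pow8; auto).
      assert (theta q (y ^ 2) <> 0) by (apply theta_nz; auto using Cpow_nz; unfold q; rewrite <- Epq; apply qdisc_pow8; auto).
      field. auto.
    + intros n. unfold csc2.
      assert (X : forall w, Cexp (2 * PI * Ci * (w - IZR (0 - n) * tau)) = Cexp (2 * PI * Ci * w) * q ^^ n).
      { intros w. transitivity (Cexp (2 * PI * Ci * (w - (IZR 0 + IZR (- n) * tau)))).
        - do 2 f_equal. replace (0 - n)%Z with (- n)%Z by ring. ring.
        - rewrite Cexp_lat. do 2 f_equal. ring. }
      rewrite !X. fold x y. unfold Cdiv. ring.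
  - apply (summable_ext (fun n : Z => - (4 * PI ^ 2) * ((fun n => x * q ^^ n / (1 - x * q ^^ n) ^ 2 - y * q ^^ n / (1 - y * q ^^ n) ^ 2) (- n)%Z))).
    + intros n. unfold csc2.
      assert (X : forall w, Cexp (2 * PI * Ci * (w - IZR n * tau)) = Cexp (2 * PI * Ci * w) * q ^^ (- n)).
      { intros w. transitivity (Cexp (2 * PI * Ci * (w - (IZR 0 + IZR n * tau)))).
        - do 2 f_equal. ring.
        - apply Cexp_lat. }
      rewrite !X. fold x y. unfold Cdiv. ring.
    + apply summable_scal. apply (summable_inj (fun n : Z => (- n)%Z) (fun n => x * q ^^ n / (1 - x * q ^^ n) ^ 2 - y * q ^^ n / (1 - y * q ^^ n) ^ 2)); [intros; lia|].
      apply summable_minus; auto.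
Qed.

(** * The bilateral series *)

Lemma poch_inf_nz (q a : C) : qdisc q -> ~ is_int_power q a -> poch_inf q a <> 0.
Proof.
  intros Hq Ha E. destruct (poch_inf_eq_0 q a Hq E) as [n H]. apply Ha. exists (- Z.of_nat n)%Z.
  rewrite Cpowz_opp, Cpowz_nat by apply Hq. assert (Hn := Cpow_nz q n (proj1 Hq)).
  transitivity (a * q ^ n / q ^ n); [field; auto|]. rewrite H. field. auto.
Qed.

Lemma is_int_power_shift (q a : C) (n : Z) : q <> 0 -> is_int_power q (q ^^ n * a) -> is_int_power q a.
Proof.
  intros Hq [k E]. exists (k - n)%Z. assert (Hn := Cpowz_nz q n Hq).
  replace (k - n)%Z with (k + - n)%Z by ring. rewrite Cpowz_add, Cpowz_opp, <- E by auto. field. auto.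
Qed.

(** The products for a and a/q differ by one factor, so an upper and a lower parameter in ratio q
    contribute a single linear fraction in q^n. The nonvanishing statements justify the divisions in
    the bilateral series. *)
Lemma poch_ratio (q a : C) (n : Z) : qdisc q -> ~ is_int_power q a ->
  poch q a n <> 0 /\ poch q (a / q) n <> 0 /\ 1 - a / q <> 0 /\ 1 - a / q * q ^^ n <> 0 /\
  poch q a n = (1 - a / q * q ^^ n) / (1 - a / q) * poch q (a / q) n.
Proof.
  intros Hq Ha. assert (Hq0 := proj1 Hq).
  assert (Ha' : ~ is_int_power q (a / q)).
  { intros [k E]. apply Ha. exists (k + 1)%Z. rewrite Cpowz_succ, <- E by auto. field. auto. }
  assert (N : forall b m, ~ is_int_power q b -> poch_inf q (q ^^ m * b) <> 0).
  { intros b m Hb. apply poch_inf_nz; auto. intros K. apply Hb, (is_int_power_shift q b m Hq0 K). }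
  assert (N1 := poch_inf_nz q a Hq Ha). assert (N2 := poch_inf_nz q (a / q) Hq Ha').
  assert (N3 := N a n Ha). assert (N4 := N (a / q) n Ha').
  assert (D1 := not_int_power_shift q (a / q) 0 Hq Ha'). assert (D2 := not_int_power_shift q (a / q) n Hq Ha').
  replace (a / q * q ^^ 0) with (a / q) in D1 by (simpl; ring).
  unfold poch. repeat split; auto.
  - apply Cmult_neq_0; auto using Cinv_nz.
  - apply Cmult_neq_0; auto using Cinv_nz.
  - rewrite (poch_inf_step q (a / q)), (poch_inf_step q (q ^^ n * (a / q))) by auto.
    rewrite (poch_inf_step q (q ^^ n * (a / q))) in N4 by auto.
    replace (q * (a / q)) with a by (field; auto).
    replace (q * (q ^^ n * (a / q))) with (q ^^ n * a) in * by (field; auto).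
    replace (q ^^ n * (a / q)) with (a / q * q ^^ n) in * by ring.
    set (A := a / q) in *. field. auto.
Qed.

Lemma poch_0 (q : C) (n : Z) : qdisc q -> poch q 0 n = 1.
Proof. intros Hq. unfold poch. rewrite Cmult_0_r, poch_inf_0 by auto. field. Qed.

(** The exponent 4 is s - r in both bilateral series. At index n + 1, 4 tri(n + 1) = 2n^2 + 2n, and
    its linear part cancels against the powers of 1 / q^2. *)
Lemma psi_gauss (q x : C) (n : Z) : q <> 0 -> x <> 0 ->
  ((-1) ^^ (n + 1) * q ^^ ((n + 1) * (n + 1 - 1) / 2)) ^^ 4 * (x ^ 4 / q ^ 2) ^^ (n + 1)
    = x ^ 4 / q ^ 2 * (x ^^ (4 * n) * q ^^ (2 * n ^ 2)).
Proof.
  intros Hq Hx. fold (tri (n + 1)).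
  assert (Hx4 := Cpow_nz x 4 Hx). assert (Hq2 := Cpow_nz q 2 Hq).
  rewrite Cpowz_mult_l, <- !Cpowz_mul by auto using Cpowz_nz, Cm1_nz.
  replace ((n + 1) * 4)%Z with (2 * (2 * (n + 1)))%Z by ring. rewrite Cpowz_m1_even.
  replace (tri (n + 1) * 4)%Z with (2 * n ^ 2 + 2 * n)%Z.
  2:{ assert (T := tri_double (n + 1)). replace (tri (n + 1) * 4)%Z with (2 * (2 * tri (n + 1)))%Z by ring. rewrite T. ring. }
  unfold Cdiv at 1. rewrite Cpowz_mult_l by auto using Cinv_nz.
  assert (I : (/ q ^ 2) ^^ (n + 1) = q ^^ (- (2 * n)) * / q ^ 2).
  { rewrite <- (Cpowz_2 q), <- Cpowz_opp by auto. rewrite <- Cpowz_mul, <- Cpowz_add by auto. f_equal. ring. }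
  rewrite I, (Cpowz_pow x 4) by auto.
  replace (Z.of_nat 4 * (n + 1))%Z with (4 * n + 4)%Z by (simpl Z.of_nat; ring).
  rewrite (Cpowz_add x), (Cpowz_add q), Cpowz_opp by auto.
  assert (Hqn := Cpowz_nz q (2 * n) Hq). change (x ^^ 4) with (x ^ 4). field. auto.
Qed.

Lemma psi_appell (q x : C) : qdisc q -> x <> 0 -> ~ is_int_power q x -> ~ is_int_power q (- x) ->
  (q + x) / (q - x)
   * psi q [- x; x / q] [- x / q; x; RtoC 0; RtoC 0; RtoC 0; RtoC 0] (x ^ 4 / q ^ 2)
  = x ^ 4 / q ^ 2 * tsum (appell q x).
Proof.
  intros Hq Hx Nx Nmx. assert (Hq0 := proj1 Hq).
  assert (S := appell_summable q x Hq Hx Nx).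
  (* The index shift turns (x / q) q^(n+1) into x q^n. What does not depend on n is collected here,
     and the prefactor (q + x) / (q - x) cancels it down to x^4 / q^2. *)
  set (c := (1 - x / q) / (1 - - x / q) * (x ^ 4 / q ^ 2)).
  set (f := fun n : Z => pochs q [- x; x / q] n / pochs q [- x / q; x; RtoC 0; RtoC 0; RtoC 0; RtoC 0] n
    * ((-1) ^^ n * q ^^ (n * (n - 1) / 2)) ^^ 4 * (x ^ 4 / q ^ 2) ^^ n).
  destruct (poch_ratio q x 0 Hq Nx) as [_ [_ [D1 _]]].
  destruct (poch_ratio q (- x) 0 Hq Nmx) as [_ [_ [D2 _]]].
  assert (T : forall n, f (n + 1)%Z = c * appell q x n).
  { intros n. unfold f, appell. rewrite <- Cmult_assoc, psi_gauss by auto.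
    unfold pochs. cbn [map fold_right]. rewrite !poch_0 by auto.
    destruct (poch_ratio q x (n + 1) Hq Nx) as [P1 [P2 [_ [P4 P5]]]].
    destruct (poch_ratio q (- x) (n + 1) Hq Nmx) as [Q1 [Q2 [_ [Q4 Q5]]]].
    rewrite P5, Q5. rewrite P5 in P1. rewrite Q5 in Q1.
    assert (E1 : x / q * q ^^ (n + 1) = x * q ^^ n) by (rewrite Cpowz_succ by auto; field; auto).
    assert (E2 : - x / q * q ^^ (n + 1) = - (x * q ^^ n)) by (rewrite Cpowz_succ by auto; field; auto).
    rewrite E1, E2 in *. set (A := poch q (x / q) (n + 1)) in *. set (B := poch q (- x / q) (n + 1)) in *.
    set (g := x ^^ (4 * n) * q ^^ (2 * n ^ 2)). unfold c.
    set (a := x / q) in *. set (b := - x / q) in *. set (d := x ^ 4 / q ^ 2). set (w := x * q ^^ n) in *.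
    replace (1 + w) with (1 - - w) by ring. field. repeat split; auto. }
  assert (Sf : summable f).
  { apply (summable_ext (fun n => f (n + -1 + 1)%Z)); [intros n; f_equal; ring|].
    apply (summable_ext (fun n => c * appell q x (n + -1)%Z)); [intros n; symmetry; apply T|].
    apply summable_scal, (summable_inj (fun n => n + -1)%Z (appell q x)); auto. intros; lia. }
  assert (E : psi q [- x; x / q] [- x / q; x; RtoC 0; RtoC 0; RtoC 0; RtoC 0] (x ^ 4 / q ^ 2) = c * tsum (appell q x)).
  { change (tsum f = c * tsum (appell q x)). rewrite <- (tsum_Z_shift f 1), <- tsum_scal by auto.
    apply tsum_ext, T. }
  rewrite E. unfold c.
  assert (q - x <> 0) by (intros K; apply D1; replace (1 - x / q) with ((q - x) / q) by (field; auto); rewrite K; unfold Cdiv; ring).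
  assert (q + x <> 0) by (intros K; apply D2; replace (1 - - x / q) with ((q + x) / q) by (field; auto); rewrite K; unfold Cdiv; ring).
  replace (1 - x / q) with ((q - x) / q) by (field; auto).
  replace (1 - - x / q) with ((q + x) / q) by (field; auto). field. auto.
Qed.

Definition appell2 (q x : C) (n : Z) : C :=
  (1 + x ^ 2 * q ^^ (2 * n)) / (1 - x ^ 2 * q ^^ (2 * n)) * x ^^ (4 * n) * q ^^ (2 * n ^ 2).

Lemma not_int_power_sq (q x : C) : qdisc q -> ~ is_int_power q x -> ~ is_int_power q (- x) ->
  ~ is_int_power (q ^ 2) (x ^ 2).
Proof.
  intros Hq Nx Nmx [k E]. rewrite (Cpowz_pow q 2) in E by apply Hq.
  replace (Z.of_nat 2 * k)%Z with (k * 2)%Z in E by (simpl Z.of_nat; ring).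
  rewrite Cpowz_mul, Cpowz_2 in E by apply Hq.
  destruct (classic (x - q ^^ k = 0)) as [K|K].
  - apply Nx. exists k. replace x with (x - q ^^ k + q ^^ k) by ring. rewrite K. ring.
  - apply Nmx. exists k. apply NNPP. intros K'. apply (Cmult_neq_0 (x - q ^^ k) (x + q ^^ k)); auto.
    + intros K2. apply K'. replace (- x) with (q ^^ k - (x + q ^^ k)) by ring. rewrite K2. ring.
    + transitivity (x ^ 2 - (q ^^ k) ^ 2); [ring|]. rewrite E. ring.
Qed.

Lemma sq_inv_bounded (q x : C) : qdisc q -> x <> 0 -> ~ is_int_power (q ^ 2) (x ^ 2) ->
  exists M : R, (0 < M)%R /\ forall n : Z, 1 - x ^ 2 * q ^^ (2 * n) <> 0 /\
    (Cmod (/ (1 - x ^ 2 * q ^^ (2 * n))) <= M)%R.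
Proof.
  intros Hq Hx N. assert (Hq2 := qdisc_sq q Hq). assert (Hx2 := Cpow_nz x 2 Hx).
  destruct (inv_bounded (q ^ 2) (x ^ 2) Hq2 Hx2 N) as [M [HM K]].
  exists M. split; auto. intros n. specialize (K n).
  assert (D := not_int_power_shift (q ^ 2) (x ^ 2) n Hq2 N).
  rewrite (Cpowz_pow q 2) in * by apply Hq. auto.
Qed.

Lemma appell2_summable (q x : C) : qdisc q -> x <> 0 -> ~ is_int_power (q ^ 2) (x ^ 2) ->
  summable (appell2 q x).
Proof.
  intros Hq Hx N. destruct (sq_inv_bounded q x Hq Hx N) as [M [HM K]].
  apply (summable_ext (fun n => (1 + x ^ 2 * q ^^ (2 * n)) / (1 - x ^ 2 * q ^^ (2 * n)) * (x ^^ (4 * n) * q ^^ (2 * n ^ 2)))).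
  { intros n. unfold appell2. ring. }
  apply (summable_bounded_mult (fun n : Z => x ^^ (4 * n) * q ^^ (2 * n ^ 2))
    (fun n => (1 + x ^ 2 * q ^^ (2 * n)) / (1 - x ^ 2 * q ^^ (2 * n))) (2 * M + 1)%R); [apply gauss4_summable; auto|].
  intros n. destruct (K n) as [Hd B].
  replace ((1 + x ^ 2 * q ^^ (2 * n)) / (1 - x ^ 2 * q ^^ (2 * n))) with (2 * / (1 - x ^ 2 * q ^^ (2 * n)) - 1) by (field; auto).
  eapply Rle_trans; [apply Cmod_triangle_sub|]. rewrite Cmod_mult, Cmod_1, Cmod_R, Rabs_pos_eq; lra.
Qed.

Lemma psi_appell2 (q x : C) : qdisc q -> x <> 0 -> ~ is_int_power q x -> ~ is_int_power q (- x) ->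
  ~ is_int_power q (- x ^ 2) ->
  (q ^ 2 + x ^ 2) / (q ^ 2 - x ^ 2)
   * psi q [Ci * x; - Ci * x; x / q; - x / q]
       [Ci * x / q; - Ci * x / q; x; - x; RtoC 0; RtoC 0; RtoC 0; RtoC 0] (x ^ 4 / q ^ 2)
  = x ^ 4 / q ^ 2 * tsum (appell2 q x).
Proof.
  intros Hq Hx Nx Nmx Nmx2. assert (Hq0 := proj1 Hq).
  assert (Ci2 : Ci * Ci = -1) by (apply injective_projections; simpl; ring).
  (* If a square root z of -x^2, such as i x or -i x, were q^k, then -x^2 would be q^(2k). *)
  assert (Nsq : forall z, z * z = - x ^ 2 -> ~ is_int_power q z).
  { intros z Hz [k E]. apply Nmx2. exists (k + k)%Z. rewrite Cpowz_add, <- Hz, E by auto. reflexivity. }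
  assert (Ni : ~ is_int_power q (Ci * x)).
  { apply Nsq. transitivity (Ci * Ci * (x * x)); [ring|]. rewrite Ci2. ring. }
  assert (Nmi : ~ is_int_power q (- Ci * x)).
  { apply Nsq. transitivity (Ci * Ci * (x * x)); [ring|]. rewrite Ci2. ring. }
  assert (S := appell2_summable q x Hq Hx (not_int_power_sq q x Hq Nx Nmx)).
  set (c := (1 - (x / q) ^ 2) / (1 + (x / q) ^ 2) * (x ^ 4 / q ^ 2)).
  set (f := fun n : Z => pochs q [Ci * x; - Ci * x; x / q; - x / q] n
    / pochs q [Ci * x / q; - Ci * x / q; x; - x; RtoC 0; RtoC 0; RtoC 0; RtoC 0] n
    * ((-1) ^^ n * q ^^ (n * (n - 1) / 2)) ^^ 4 * (x ^ 4 / q ^ 2) ^^ n).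
  assert (R : forall w, (1 - w) * (1 - - w) = 1 - w ^ 2) by (intros; ring).
  assert (Ri : forall w, (1 - Ci * w) * (1 - - (Ci * w)) = 1 + w ^ 2).
  { intros w. transitivity (1 - Ci * Ci * w ^ 2); [ring|]. rewrite Ci2. ring. }
  destruct (poch_ratio q x 0 Hq Nx) as [_ [_ [D1 _]]].
  destruct (poch_ratio q (- x) 0 Hq Nmx) as [_ [_ [D2 _]]].
  destruct (poch_ratio q (Ci * x) 0 Hq Ni) as [_ [_ [D3 _]]].
  destruct (poch_ratio q (- Ci * x) 0 Hq Nmi) as [_ [_ [D4 _]]].
  replace (- x / q) with (- (x / q)) in D2 by (field; auto).
  replace (Ci * x / q) with (Ci * (x / q)) in D3 by (field; auto).
  replace (- Ci * x / q) with (- (Ci * (x / q))) in D4 by (field; auto).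
  assert (D12 := Cmult_neq_0 _ _ D1 D2). rewrite R in D12.
  assert (D34 := Cmult_neq_0 _ _ D3 D4). rewrite Ri in D34.
  assert (T : forall n, f (n + 1)%Z = c * appell2 q x n).
  { intros n. unfold f, appell2. rewrite <- Cmult_assoc, psi_gauss by auto.
    unfold pochs. cbn [map fold_right]. rewrite !poch_0 by auto.
    destruct (poch_ratio q x (n + 1) Hq Nx) as [A1 [A2 [_ [A4 A5]]]].
    destruct (poch_ratio q (- x) (n + 1) Hq Nmx) as [B1 [B2 [_ [B4 B5]]]].
    destruct (poch_ratio q (Ci * x) (n + 1) Hq Ni) as [G1 [G2 [_ [G4 G5]]]].
    destruct (poch_ratio q (- Ci * x) (n + 1) Hq Nmi) as [H1 [H2 [_ [H4 H5]]]].
    set (w := x * q ^^ n).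
    assert (E1 : x / q * q ^^ (n + 1) = w) by (unfold w; rewrite Cpowz_succ by auto; field; auto).
    assert (E2 : - x / q * q ^^ (n + 1) = - w) by (unfold w; rewrite Cpowz_succ by auto; field; auto).
    assert (E3 : Ci * x / q * q ^^ (n + 1) = Ci * w) by (unfold w; rewrite Cpowz_succ by auto; field; auto).
    assert (E4 : - Ci * x / q * q ^^ (n + 1) = - (Ci * w)) by (unfold w; rewrite Cpowz_succ by auto; field; auto).
    assert (W : x ^ 2 * q ^^ (2 * n) = w ^ 2).
    { unfold w. replace (2 * n)%Z with (n + n)%Z by ring. rewrite Cpowz_add by auto. ring. }
    rewrite W. rewrite E1 in A4, A5. rewrite E2 in B4, B5. rewrite E3 in G4, G5. rewrite E4 in H4, H5.
    rewrite A5, B5, G5, H5.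
    assert (D5 := Cmult_neq_0 _ _ A4 B4). rewrite R in D5.
    set (A := poch q (x / q) (n + 1)) in *. set (B := poch q (- x / q) (n + 1)) in *.
    set (G := poch q (Ci * x / q) (n + 1)) in *. set (H := poch q (- Ci * x / q) (n + 1)) in *.
    replace (- x / q) with (- (x / q)) by (field; auto).
    replace (Ci * x / q) with (Ci * (x / q)) by (field; auto).
    replace (- Ci * x / q) with (- (Ci * (x / q))) by (field; auto).
    unfold c. rewrite <- (R w), <- (Ri w), <- (R (x / q)), <- (Ri (x / q)).
    rewrite <- (R w) in D5.
    set (a := x / q) in *. set (d := x ^ 4 / q ^ 2).
    set (g1 := x ^^ (4 * n)). set (g2 := q ^^ (2 * n ^ 2)).
    clearbody a d w A B G H g1 g2.
    set (ca := 1 - Ci * a) in *. set (cb := 1 - - (Ci * a)) in *.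
    set (cw := 1 - Ci * w) in *. set (cv := 1 - - (Ci * w)) in *.
    set (aa := 1 - a) in *. set (ab := 1 - - a) in *. set (ww := 1 - w) in *. set (wv := 1 - - w) in *.
    clearbody ca cb cw cv aa ab ww wv. field. repeat split; auto. }
  assert (Sf : summable f).
  { apply (summable_ext (fun n => f (n + -1 + 1)%Z)); [intros n; f_equal; ring|].
    apply (summable_ext (fun n => c * appell2 q x (n + -1)%Z)); [intros n; symmetry; apply T|].
    apply summable_scal, (summable_inj (fun n => n + -1)%Z (appell2 q x)); auto. intros; lia. }
  assert (E : psi q [Ci * x; - Ci * x; x / q; - x / q]
       [Ci * x / q; - Ci * x / q; x; - x; RtoC 0; RtoC 0; RtoC 0; RtoC 0] (x ^ 4 / q ^ 2) = c * tsum (appell2 q x)).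
  { change (tsum f = c * tsum (appell2 q x)). rewrite <- (tsum_Z_shift f 1), <- tsum_scal by auto.
    apply tsum_ext, T. }
  rewrite E. unfold c.
  replace (1 - (x / q) ^ 2) with ((q ^ 2 - x ^ 2) / q ^ 2) in * by (field; auto).
  replace (1 + (x / q) ^ 2) with ((q ^ 2 + x ^ 2) / q ^ 2) in * by (field; auto).
  assert (q ^ 2 - x ^ 2 <> 0) by (intros K; apply D12; rewrite K; unfold Cdiv; ring).
  assert (q ^ 2 + x ^ 2 <> 0) by (intros K; apply D34; rewrite K; unfold Cdiv; ring).
  field. auto.
Qed.

Lemma theta_two_steps (q z : C) : qdisc q -> z <> 0 ->
  theta q (z / q ^ 2) = z ^ 2 / q ^ 3 * theta q z.
Proof.
  intros Hq Hz. assert (Hq0 := proj1 Hq). assert (T := theta_shift q z (-2) Hq Hz).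
  replace (z / q ^ 2) with (q ^^ (-2) * z) by (simpl; field; auto). rewrite T.
  replace ((-1) ^^ (-2)) with (RtoC 1) by (symmetry; apply (Cpowz_m1_even (-1))).
  change (- -2)%Z with 2%Z. change (tri (-2)) with 3%Z. rewrite Cpowz_opp by auto.
  change (z ^^ 2) with (z ^ 2). change (q ^^ 3) with (q ^ 3). field. auto.
Qed.

(** The two halves of the last form of each identity are matched only after n -> -n in the second
    half. *)
Lemma tsum_minus_refl (a b c : Z -> C) : summable a -> summable (fun n => b (- n)%Z) ->
  (forall n, a n - b (- n)%Z = c n) -> tsum (fun n => a n - b n) = tsum c.
Proof.
  intros Sa Sb H.
  assert (Sb' : summable b).
  { apply (summable_ext (fun n => b (- (- n))%Z)); [intros n; f_equal; ring|].
    apply (summable_inj (fun n => (- n)%Z) (fun n => b (- n)%Z)); auto. intros; lia. }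
  rewrite tsum_minus by auto. rewrite <- (tsum_ext (fun n => a n - b (- n)%Z) c H).
  rewrite tsum_minus by auto. f_equal. rewrite <- (tsum_Z_refl b 0) by auto. reflexivity.
Qed.

Lemma appell_squares (q x : C) : qdisc q -> x <> 0 -> ~ is_int_power q x ->
  tsum (fun n => x ^^ (4 * n) * q ^^ (2 * n ^ 2) / (1 - x * q ^^ n) ^ 2
           - x ^^ (- 4 * n) * q ^^ (2 * n ^ 2) / (1 - / x * q ^^ n) ^ 2) = tsum (appell q x).
Proof.
  intros Hq Hx Nx. assert (Hq0 := proj1 Hq). destruct (inv_bounded q x Hq Hx Nx) as [M [HM K]].
  assert (S := gauss4_summable q x Hq Hx).
  assert (D := fun n => not_int_power_shift q x n Hq Nx).
  (* With t = 1 / (1 - x q^n), the reflected denominator has inverse 1 - t, and t^2 - (1 - t)^2 = 2t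
     - 1 = (1 + x q^n) / (1 - x q^n). *)
  assert (B : forall n, x ^^ (- 4 * - n) * q ^^ (2 * (- n) ^ 2) / (1 - / x * q ^^ (- n)) ^ 2
     = (1 - / (1 - x * q ^^ n)) ^ 2 * (x ^^ (4 * n) * q ^^ (2 * n ^ 2))).
  { intros n. replace (-4 * - n)%Z with (4 * n)%Z by ring. replace (2 * (- n) ^ 2)%Z with (2 * n ^ 2)%Z by ring.
    rewrite Cpowz_opp by auto. assert (Hn := Cpowz_nz q n Hq0). specialize (D n).
    set (g := x ^^ (4 * n) * q ^^ (2 * n ^ 2)). set (r := q ^^ n) in *.
    field. repeat split; auto. intros E. apply D. replace (1 - x * r) with (- (x * r - 1)) by ring. rewrite E. ring. }
  apply (tsum_minus_refl (fun n => x ^^ (4 * n) * q ^^ (2 * n ^ 2) / (1 - x * q ^^ n) ^ 2)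
    (fun n => x ^^ (- 4 * n) * q ^^ (2 * n ^ 2) / (1 - / x * q ^^ n) ^ 2)).
  - apply (summable_ext (fun n => (/ (1 - x * q ^^ n)) ^ 2 * (x ^^ (4 * n) * q ^^ (2 * n ^ 2)))).
    + intros n. field. apply D.
    + apply (summable_bounded_mult _ (fun n => (/ (1 - x * q ^^ n)) ^ 2) (M ^ 2)); auto.
      intros n. rewrite Cmod_pow. apply pow_incr. split; [apply Cmod_ge_0|apply K].
  - apply (summable_ext (fun n => (1 - / (1 - x * q ^^ n)) ^ 2 * (x ^^ (4 * n) * q ^^ (2 * n ^ 2)))).
    + intros n. symmetry. apply B.
    + apply (summable_bounded_mult _ (fun n => (1 - / (1 - x * q ^^ n)) ^ 2) ((1 + M) ^ 2)); auto.
      intros n. rewrite Cmod_pow. apply pow_incr. split; [apply Cmod_ge_0|].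
      eapply Rle_trans; [apply Cmod_triangle_sub|]. rewrite Cmod_1. specialize (K n). lra.
  - intros n. cbv beta. rewrite B. unfold appell. field. apply D.
Qed.

(** With t = 1 / (1 - x^2 q^(2n)), reflection gives 1 - t, and t - (1 - t) = 2t - 1. *)
Lemma appell2_split (q x : C) : qdisc q -> x <> 0 -> ~ is_int_power (q ^ 2) (x ^ 2) ->
  tsum (fun n => x ^^ (4 * n) * q ^^ (2 * n ^ 2) / (1 - x ^ 2 * q ^^ (2 * n))
         - x ^^ (- 4 * n) * q ^^ (2 * n ^ 2) / (1 - x ^^ (- 2) * q ^^ (2 * n))) = tsum (appell2 q x).
Proof.
  intros Hq Hx N. assert (Hq0 := proj1 Hq). destruct (sq_inv_bounded q x Hq Hx N) as [M [HM K]].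
  assert (S := gauss4_summable q x Hq Hx). assert (Hx2 := Cpow_nz x 2 Hx).
  assert (B : forall n, x ^^ (- 4 * - n) * q ^^ (2 * (- n) ^ 2) / (1 - x ^^ (- 2) * q ^^ (2 * - n))
     = (1 - / (1 - x ^ 2 * q ^^ (2 * n))) * (x ^^ (4 * n) * q ^^ (2 * n ^ 2))).
  { intros n. replace (-4 * - n)%Z with (4 * n)%Z by ring. replace (2 * (- n) ^ 2)%Z with (2 * n ^ 2)%Z by ring.
    replace (2 * - n)%Z with (- (2 * n))%Z by ring. change (x ^^ (-2)) with (/ x ^ 2).
    rewrite Cpowz_opp by auto. assert (Hn := Cpowz_nz q (2 * n) Hq0). destruct (K n) as [D _].
    set (g := x ^^ (4 * n) * q ^^ (2 * n ^ 2)). set (r := q ^^ (2 * n)) in *. set (X := x ^ 2) in *.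
    field. repeat split; auto. intros E. apply D. replace (1 - X * r) with (- (X * r - 1)) by ring. rewrite E. ring. }
  apply (tsum_minus_refl (fun n => x ^^ (4 * n) * q ^^ (2 * n ^ 2) / (1 - x ^ 2 * q ^^ (2 * n)))
    (fun n => x ^^ (- 4 * n) * q ^^ (2 * n ^ 2) / (1 - x ^^ (- 2) * q ^^ (2 * n)))).
  - apply (summable_ext (fun n => / (1 - x ^ 2 * q ^^ (2 * n)) * (x ^^ (4 * n) * q ^^ (2 * n ^ 2)))).
    + intros n. unfold Cdiv. ring.
    + apply (summable_bounded_mult _ (fun n => / (1 - x ^ 2 * q ^^ (2 * n))) M); auto. intros n. apply K.
  - apply (summable_ext (fun n => (1 - / (1 - x ^ 2 * q ^^ (2 * n))) * (x ^^ (4 * n) * q ^^ (2 * n ^ 2)))).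
    + intros n. symmetry. apply B.
    + apply (summable_bounded_mult _ (fun n => 1 - / (1 - x ^ 2 * q ^^ (2 * n))) (1 + M)); auto.
      intros n. eapply Rle_trans; [apply Cmod_triangle_sub|]. rewrite Cmod_1. destruct (K n). lra.
  - intros n. cbv beta. rewrite B. unfold appell2. field. apply K.
Qed.

(** * Modulus and period as theta constants *)

Lemma qpow_pow8 (tau s : C) (n : Z) : s = IZR n / 8 -> qpow tau s = qpow tau (1 / 8) ^^ n.
Proof. intros ->. rewrite <- qpow_Zmult. f_equal. field. Qed.

Lemma qdisc_qpow8 (tau : C) : (0 < Im tau)%R -> qdisc (qpow tau (1 / 8)).
Proof.
  intros Ht. split; [apply Cexp_nz|]. unfold qpow. rewrite Cmod_Cexp.
  replace (2 * PI * Ci * tau * (1 / 8)) with ((PI / 4)%R * (Ci * tau))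
    by (rewrite RtoC_div by lra; field).
  rewrite <- exp_0. apply exp_increasing.
  destruct tau as [a b]; unfold Re, Im in *; simpl in *.
  assert (H := PI_RGT_0). assert (0 < PI / 4 * b)%R by (apply Rmult_lt_0_compat; lra). lra.
Qed.

Lemma th2_0_prod (p : C) : qdisc p ->
  th2 p 0 = 2 * p * poch_inf (p ^ 8) (p ^ 8) * poch_inf (p ^ 8) (- p ^ 8) ^ 2.
Proof.
  intros Hp. rewrite th2_prod, !Cmult_0_r, Cexp_0, theta_m1 by auto using qdisc_pow8. field.
Qed.

Lemma th3_0_prod (p : C) : qdisc p ->
  th3 p 0 = poch_inf (p ^ 8) (p ^ 8) * poch_inf (p ^ 8) (- p ^ 4) ^ 2.
Proof.
  intros Hp. assert (Hp0 := proj1 Hp). rewrite th3_prod, !Cmult_0_r, Cexp_0, Cmult_1_r by auto.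
  unfold theta. replace (p ^ 8 / - p ^ 4) with (- p ^ 4) by (field; auto). ring.
Qed.

Lemma elliptic_modulus_theta (tau : C) : (0 < Im tau)%R ->
  elliptic_modulus tau = theta_modulus (qpow tau (1 / 8)).
Proof.
  intros Ht. assert (Hp := qdisc_qpow8 tau Ht). set (p := qpow tau (1 / 8)) in *.
  unfold elliptic_modulus, theta_modulus. destruct (th234_0_nz p Hp) as [_ [N3 _]].
  rewrite th3_0_prod in * by auto. rewrite th2_0_prod by auto.
  rewrite (qpow_pow8 tau 1 8), (qpow_pow8 tau (1 / 4) 2), (qpow_pow8 tau (1 / 2) 4) by field.
  fold p. change (p ^^ 8) with (p ^ 8). change (p ^^ 4) with (p ^ 4). change (p ^^ 2) with (p ^ 2).
  field. repeat split; auto using poch_inf_q_nz, qdisc_pow8.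
  intros E. apply N3. rewrite E. ring.
Qed.

Lemma elliptic_K_theta (tau : C) : (0 < Im tau)%R ->
  2 * elliptic_K tau = period_K (qpow tau (1 / 8)).
Proof.
  intros Ht. assert (Hp := qdisc_qpow8 tau Ht). set (p := qpow tau (1 / 8)) in *.
  unfold elliptic_K, period_K. rewrite th3_0_prod by auto.
  rewrite (qpow_pow8 tau 1 8), (qpow_pow8 tau (1 / 2) 4) by field.
  fold p. change (p ^^ 8) with (p ^ 8). change (p ^^ 4) with (p ^ 4). field.
Qed.

(** At u = 1/2 the first part of the exponent is 2 pi i (n + 1/2), which contributes the constant
    factor -1. *)
Lemma theta11_half (tau : C) : (0 < Im tau)%R ->
  theta11 tau (1 / 2) = - th2 (qpow tau (1 / 8)) 0.
Proof.
  intros Ht. assert (Hp := qdisc_qpow8 tau Ht). unfold th2. rewrite expsum_0.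
  assert (S : summable (odd_coef (qpow tau (1 / 8)))).
  { apply (rapid_coef_summable _ _ (rapid_th2 _ Hp)). }
  transitivity ((-1) * tsum (odd_coef (qpow tau (1 / 8)))); [|ring].
  rewrite <- tsum_scal by auto. apply tsum_ext. intros n. cbv zeta. unfold odd_coef.
  rewrite <- qpow_Zmult. unfold qpow.
  transitivity (Cexp (PI * Ci) * Cexp (IZR n * (2 * PI * Ci))
     * Cexp (2 * PI * Ci * tau * (IZR ((2 * n + 1) ^ 2) * (1 / 8)))).
  - rewrite <- !Cexp_plus. f_equal.
    replace ((2 * n + 1) ^ 2)%Z with ((2 * n + 1) * (2 * n + 1))%Z by ring.
    rewrite mult_IZR, plus_IZR, mult_IZR, RtoC_mult, RtoC_plus, RtoC_mult. field.
  - rewrite Cexp_PI, Cexp_Zmult, Cexp_2PI, Cpowz_1_l. ring.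
Qed.

(** * The two families of identities, assembled from the Appell-type sums and the theta quotients *)

Theorem corollary10 :
  forall tau u v : C, (0 < Im tau)%R ->
  let q := qpow tau 1 in
  let x := Cexp (2 * PI * Ci * u) in
  let y := Cexp (2 * PI * Ci * v) in
  let k := elliptic_modulus tau in
  let K := elliptic_K tau in
  (* (i) *)
  (~ is_int_power q (x ^ 2) -> ~ is_int_power q (y ^ 2) ->
   ~ is_int_power q x -> ~ is_int_power q (- x) ->
   ~ is_int_power q y -> ~ is_int_power q (- y) ->
   weierstrass_p tau u - weierstrass_p tau v
   = - (4 * PI ^ 2 * x / q) * ((q + x) / (q - x))
       * (poch_inf q q ^ 2 / theta q (x ^ 2 / q ^ 2))
       * psi q [- x; x / q] [- x / q; x; RtoC 0; RtoC 0; RtoC 0; RtoC 0]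
           (x ^ 4 / q ^ 2)
     + 4 * PI ^ 2 * y / q * ((q + y) / (q - y))
       * (poch_inf q q ^ 2 / theta q (y ^ 2 / q ^ 2))
       * psi q [- y; y / q] [- y / q; y; RtoC 0; RtoC 0; RtoC 0; RtoC 0]
           (y ^ 4 / q ^ 2)
   /\
   weierstrass_p tau u - weierstrass_p tau v
   = - 4 * PI ^ 2 * poch_inf q q ^ 2
     * sumZ (fun n =>
         (1 + x * q ^^ n) / (1 - x * q ^^ n)
           * (x ^^ (4 * n + 1) * q ^^ (2 * n ^ 2) / theta q (x ^ 2))
         - (1 + y * q ^^ n) / (1 - y * q ^^ n)
           * (y ^^ (4 * n + 1) * q ^^ (2 * n ^ 2) / theta q (y ^ 2)))
   /\
   weierstrass_p tau u - weierstrass_p tau v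
   = - (4 * PI ^ 2 * x * poch_inf q q ^ 2 / theta q (x ^ 2))
       * sumZ (fun n =>
           x ^^ (4 * n) * q ^^ (2 * n ^ 2) / (1 - x * q ^^ n) ^ 2
           - x ^^ (- 4 * n) * q ^^ (2 * n ^ 2) / (1 - / x * q ^^ n) ^ 2)
     + 4 * PI ^ 2 * y * poch_inf q q ^ 2 / theta q (y ^ 2)
       * sumZ (fun n =>
           y ^^ (4 * n) * q ^^ (2 * n ^ 2) / (1 - y * q ^^ n) ^ 2
           - y ^^ (- 4 * n) * q ^^ (2 * n ^ 2) / (1 - / y * q ^^ n) ^ 2))
  /\
  (* (ii) *)
  (~ is_int_power q x -> ~ is_int_power q (- x) -> ~ is_int_power q (- x ^ 2) ->
   let J := mero_value (fun w =>
       jacobi_dn k (2 * K * w)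
       / (jacobi_sn k (2 * K * w) * jacobi_cn k (2 * K * w))) u in
   mero_value (fun w =>
     1 / (jacobi_sn k (2 * K * w) * jacobi_sn k (2 * K * (w + 1 / 2)))) u = J
   /\
   1 / (2 * PI * Ci) * (2 * K / theta11 tau (1 / 2)) * J
   = qpow tau (- 9 / 8) * ((q ^ 2 + x ^ 2) / (q ^ 2 - x ^ 2))
     * (x / (poch_inf q q * theta q (- x ^ 2 / q ^ 2)))
     * psi q [Ci * x; - Ci * x; x / q; - x / q]
         [Ci * x / q; - Ci * x / q; x; - x; RtoC 0; RtoC 0; RtoC 0; RtoC 0]
         (x ^ 4 / q ^ 2)
   /\
   1 / (2 * PI * Ci) * (2 * K / theta11 tau (1 / 2)) * J
   = qpow tau (- 1 / 8) * (x / (poch_inf q q * theta q (- x ^ 2)))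
     * sumZ (fun n =>
         (1 + x ^ 2 * q ^^ (2 * n)) / (1 - x ^ 2 * q ^^ (2 * n))
         * x ^^ (4 * n) * q ^^ (2 * n ^ 2))
   /\
   1 / (2 * PI * Ci) * (2 * K / theta11 tau (1 / 2)) * J
   = qpow tau (- 1 / 8) * (x / (poch_inf q q * theta q (- x ^ 2)))
     * sumZ (fun n =>
         x ^^ (4 * n) * q ^^ (2 * n ^ 2) / (1 - x ^ 2 * q ^^ (2 * n))
         - x ^^ (- 4 * n) * q ^^ (2 * n ^ 2)
           / (1 - x ^^ (- 2) * q ^^ (2 * n)))).
Proof.
  intros tau u v Ht q x y k K.
  assert (Hp := qdisc_qpow8 tau Ht).
  assert (Epq : qpow tau (1 / 8) ^ 8 = qpow tau 1) by (symmetry; apply (qpow_pow8 tau 1 8); field).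
  assert (Hq := qdisc_pow8 _ Hp). rewrite Epq in Hq. fold q in Hq. assert (Hq0 := proj1 Hq).
  assert (Hx : x <> 0) by apply Cexp_nz. assert (Hy : y <> 0) by apply Cexp_nz.
  split.
  - intros Nx2 Ny2 Nx Nmx Ny Nmy.
    assert (W := wp_appell tau u v _ Ht Hp Epq Nx2 Ny2 Nx Ny). fold q x y in W.
    assert (Tx : theta q (x ^ 2) <> 0) by (apply theta_nz; auto using Cpow_nz).
    assert (Ty : theta q (y ^ 2) <> 0) by (apply theta_nz; auto using Cpow_nz).
    assert (Sx := appell_summable q x Hq Hx Nx). assert (Sy := appell_summable q y Hq Hy Ny).
    rewrite W. split; [|split].
    + assert (Px := psi_appell q x Hq Hx Nx Nmx). assert (Py := psi_appell q y Hq Hy Ny Nmy).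
      (* The multiplier x^4 / q^3 of theta(x^2 / q^2) cancels against the factor x^4 / q^2 of
         [psi_appell] and the explicit 1 / q. *)
      rewrite !theta_two_steps by auto using Cpow_nz.
      set (psx := psi q [- x; x / q] _ _) in *. set (psy := psi q [- y; y / q] _ _) in *.
      set (fx := (q + x) / (q - x)) in *. set (fy := (q + y) / (q - y)) in *.
      transitivity (- (4 * PI ^ 2 * x / q) * (poch_inf q q ^ 2 / ((x ^ 2) ^ 2 / q ^ 3 * theta q (x ^ 2))) * (fx * psx)
        + 4 * PI ^ 2 * y / q * (poch_inf q q ^ 2 / ((y ^ 2) ^ 2 / q ^ 3 * theta q (y ^ 2))) * (fy * psy)); [|ring].
      rewrite Px, Py. field. auto.
    + change (@sumZ) with (@tsum Z).
      assert (T : tsum (fun n => (1 + x * q ^^ n) / (1 - x * q ^^ n)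
             * (x ^^ (4 * n + 1) * q ^^ (2 * n ^ 2) / theta q (x ^ 2))
           - (1 + y * q ^^ n) / (1 - y * q ^^ n)
             * (y ^^ (4 * n + 1) * q ^^ (2 * n ^ 2) / theta q (y ^ 2)))
         = x / theta q (x ^ 2) * tsum (appell q x) - y / theta q (y ^ 2) * tsum (appell q y)).
      { rewrite <- !tsum_scal, <- tsum_minus by auto using summable_scal.
        apply tsum_ext. intros n. unfold appell. rewrite !Cpowz_succ by auto. unfold Cdiv. ring. }
      rewrite T. replace (RtoC (-4)) with (- RtoC 4) by (rewrite <- RtoC_opp; reflexivity). field. auto.
    + change (@sumZ) with (@tsum Z). rewrite !appell_squares by auto. field. auto.
  - intros Nx Nmx Nmx2. set (p := qpow tau (1 / 8)) in *.
    (* The point tau/2 is the half-period at which the third Wronskian identity is normalized. *)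
    assert (Hw0 : Cexp (PI * Ci * (tau / 2)) = p ^ 2).
    { transitivity (qpow tau (1 / 4)); [unfold qpow; f_equal; field|].
      apply (qpow_pow8 tau (1 / 4) 2). field. }
    assert (N1 : th1 p u <> 0).
    { intros E. destruct (th1_eq_0 p u Hp E) as [j Ej]. apply Nx. exists j.
      unfold q. rewrite <- Epq, (Cpowz_pow p 8) by apply Hp. exact Ej. }
    assert (N2 : th2 p u <> 0).
    { intros E. destruct (th2_eq_0 p u Hp E) as [j Ej]. apply Nmx. exists j.
      unfold q. rewrite <- Epq, (Cpowz_pow p 8) by apply Hp. exact Ej. }
    destruct (mero_jacobi p (tau / 2) u Hp Hw0 N1 N2) as [M1 M2].
    unfold k, K. rewrite elliptic_modulus_theta, elliptic_K_theta by auto. fold p.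
    cbv zeta. rewrite M1, M2. split; [reflexivity|].
    assert (Nsq := not_int_power_sq q x Hq Nx Nmx).
    assert (T : theta q (- x ^ 2) <> 0) by (apply theta_nz; auto using Cpow_nz, Copp_nz).
    assert (L : 1 / (2 * PI * Ci) * (period_K p / theta11 tau (1 / 2)) * theta_ratio p u
      = qpow tau (- 1 / 8) * (x / (poch_inf q q * theta q (- x ^ 2))) * tsum (appell2 q x)).
    { rewrite theta11_half by auto. fold p.
      transitivity (- (th2 p 0 / 2) * (th3 p u * th4 p u / (th1 p u * th2 p u))).
      - unfold period_K, theta_ratio. destruct (th234_0_nz p Hp) as [T2 [T3 T4]].
        field. repeat split; auto using Ci_nz, RtoC_PI_nz.
      - assert (X := part2_sum p u Hp). rewrite Epq in X. rewrite (X Nx Nmx Nmx2).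
        rewrite (qpow_pow8 tau (- 1 / 8) (-1)) by reflexivity. fold p.
        change (p ^^ (-1)) with (/ p ^ 1). replace (p ^ 1) with p by ring. reflexivity. }
    rewrite L. split; [|split].
    + assert (P := psi_appell2 q x Hq Hx Nx Nmx Nmx2).
      rewrite theta_two_steps by auto using Cpow_nz, Copp_nz.
      rewrite (qpow_pow8 tau (- 1 / 8) (-1)), (qpow_pow8 tau (- 9 / 8) (-9)) by reflexivity. fold p.
      (* q^(-1/8) = q^(-9/8) q: the additional q comes from comparing the multipliers x^4 / q^2 of
         the series and x^4 / q^3 of [theta]. *)
      change (-1)%Z with (-9 + 8)%Z at 1. rewrite Cpowz_add by apply Hp. change (p ^^ 8) with (p ^ 8). rewrite Epq. fold q.
      set (ps := psi q [Ci * x; - Ci * x; x / q; - x / q] _ _) in *.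
      set (f := (q ^ 2 + x ^ 2) / (q ^ 2 - x ^ 2)) in *.
      transitivity (p ^^ (-9) * (x / (poch_inf q q * ((- x ^ 2) ^ 2 / q ^ 3 * theta q (- x ^ 2)))) * (f * ps)); [|ring].
      rewrite P. assert (QQ := poch_inf_q_nz q Hq). field. auto.
    + reflexivity.
    + change (@sumZ) with (@tsum Z). rewrite appell2_split by auto. reflexivity.
Qed.
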